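(* For every involution $y\in\mathcal I_n$, the symmetric function $2^{\mathrm{cyc}(y)}F^{\mathrm O}_y$ is Schur $Q$ positive, i.e. a nonnegative integer linear combination of Schur $Q$-functions $Q_\lambda$ with $\lambda$ a strict partition, where $\mathrm{cyc}(y)$ is the number of 2-cycles of $y$. For every fixed-point-free involution $z\in\mathcal I_n^{\mathrm{fpf}}$, the symmetric function $F^{\mathrm{Sp}}_z$ is Schur $P$ positive, i.e. a nonnegative integer linear combination of Schur $P$-functions $P_\lambda$ with $\lambda$ a strict partition.
   Context: $\mathcal I_n=\{y\in S_n:y^2=1\}$; $\mathcal I_n^{\mathrm{fpf}}$ is the subset of involutions without fixed points (nonempty only for $n$ even). A strict partition is $\lambda_1>\cdots>\lambda_\ell>0$ (possibly empty). **Involution Stanley symmetric functions.** Let $s_i=(i,i+1)$. The Demazure product $\circ$ on $S_n$ is the unique associative product with $w\circ s_i=ws_i$ if $\ell(ws_i)>\ell(w)$ and $w\circ s_i=w$ otherwise ($\ell$ = number of inversions). Put $1^{\mathrm O}_n=1\in S_n$, and for $n$ even $1^{\mathrm{Sp}}_n=(1,2)(3,4)\cdots(n-1,n)$. For $K=\mathrm O$, $z\in\mathcal I_n$, or $K=\mathrm{Sp}$, $z\in\mathcal I^{\mathrm{fpf}}_n$, let $\hat{\mathcal R}^K(z)$ be the set of minimal-length words $a_1\cdots a_\ell$ with $z=s_{a_\ell}\circ\cdots\circ s_{a_1}\circ 1^K_n\circ s_{a_1}\circ\cdots\circ s_{a_\ell}$. In variables $x_i$, $i\in\mathbb Z$,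 $i<0$, define $$F^K_z=\sum_{a\in\hat{\mathcal R}^K(z)}\ \sum x_{i_1}\cdots x_{i_\ell},$$ the inner sum over integer sequences $i_1\le\cdots\le i_\ell\le-1$ with $i_j<i_{j+1}$ whenever $a_j<a_{j+1}$. These are symmetric functions. **Schur $Q$- and $P$-functions** (in the same variables). $Q_d=\sum_{a+b=d}h_ae_b$ for $d\ge0$ ($h_a,e_b$ complete homogeneous and elementary symmetric functions); $Q_\emptyset=1$, $Q_{(a)}=Q_a$, $Q_{(a,b)}=Q_aQ_b+2\sum_{p=1}^{b}(-1)^pQ_{a+p}Q_{b-p}$ for $(a,b)\neq(0,0)$, $Q_{(0,0)}=0$; and $Q_\lambda=\mathrm{pf}(Q_{(\lambda^+_i,\lambda^+_j)})$, where $\lambda^+=\lambda$ if $\ell(\lambda)$ is even and $\lambda^+=(\lambda,0)$ if $\ell(\lambda)$ is odd. $P_\lambda=2^{-\ell(\lambda)}Q_\lambda$. *)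

(* Defs.v *)
From HB Require Import structures.
From mathcomp Require Import all_boot all_order all_fingroup all_algebra.
From mathcomp Require Import finmap multiset.
From mathcomp Require Import boolp.
From mathcomp Require Import zify.

Set Implicit Arguments.
Unset Strict Implicit.
Unset Printing Implicit Defensive.

Import Order.TTheory GRing.Theory Num.Theory.

Local Open Scope ring_scope.

(** * Formal power series in the variables x_i, i a negative integer *)

Definition var := {i : int | i < 0}.

(* The multiset m stands for the product of the x_i, i in m (with
   multiplicity); a series maps each monomial to its coefficient.           *)
Definition monomial := {mset var}%mset.
Definition series := monomial -> rat.

Lemma seriesP (f g : series) : f =1 g -> f = g.
Proof. by move=> fg; apply/funext. Qed.

HB.instance Definition _ := Choice.copy series (monomial -> rat).

Definition series_add (f g : series) : series := fun m => f m + g m.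
Definition series_opp (f : series) : series := fun m => - f m.
Definition series_zero : series := fun _ => 0.
Definition series_one : series := fun m => (m == mset0)%:R.

Lemma series_addA : associative series_add.
Proof. by move=> f g h; apply: seriesP => m; apply: addrA. Qed.
Lemma series_addC : commutative series_add.
Proof. by move=> f g; apply: seriesP => m; apply: addrC. Qed.
Lemma series_add0 : left_id series_zero series_add.
Proof. by move=> f; apply: seriesP => m; apply: add0r. Qed.
Lemma series_addN : left_inverse series_zero series_opp series_add.
Proof. by move=> f; apply: seriesP => m; apply: addNr. Qed.

HB.instance Definition _ :=
  GRing.isZmodule.Build series series_addA series_addC series_add0 series_addN.

Definition mono_divisors (m : monomial) : seq monomial :=
  undup [seq seq_mset (take k s)
        | s <- permutations (enum_mset m), k <- iota 0 (size s).+1].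

Lemma seq_mset_cat (s t : seq var) :
  seq_mset (s ++ t) = (seq_mset s `+` seq_mset t)%mset.
Proof. by apply/msetP => x; rewrite msetE2 !mset_seqE count_cat. Qed.

Lemma mem_mono_divisors (m a : monomial) : (a \in mono_divisors m) = (a `<=` m)%mset.
Proof.
rewrite mem_undup; apply/allpairsPdep/idP => [[s [k [sm _ ->]]]|le_am].
  have -> : m = seq_mset s.
    rewrite -(seq_mset_id m); apply/eq_seq_msetP.
    by rewrite mem_permutations in sm; rewrite perm_sym.
  rewrite -{2}(cat_take_drop k s) seq_mset_cat; apply/msubsetP => x.
  by rewrite msetE2 leq_addr.
exists (enum_mset a ++ enum_mset (m `\` a)%mset), (size (enum_mset a)); split.
- rewrite mem_permutations; apply/eq_seq_msetP.
  by rewrite seq_mset_cat !seq_mset_id msetBDKC.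
- by rewrite mem_iota /= add0n ltnS size_cat leq_addr.
- by rewrite take_size_cat // seq_mset_id.
Qed.

Definition series_mul (f g : series) : series :=
  fun m => \sum_(a <- mono_divisors m) f a * g (m `\` a)%mset.

(* any finite list of monomials containing the divisors of m will do *)
Lemma series_mulE (D : seq monomial) f g m :
    uniq D -> (forall a, (a `<=` m)%mset -> a \in D) ->
  series_mul f g m =
    \sum_(a <- D) \sum_(b <- D | (a `+` b)%mset == m) f a * g b.
Proof.
move=> uD sD; rewrite /series_mul.
rewrite [RHS](bigID (mem (mono_divisors m))) /= [X in _ + X]big1 ?addr0; last first.
  move=> a; rewrite mem_mono_divisors => Na. rewrite big1 // => b /eqP E.
  by case/negP: Na; rewrite -E; apply/msubsetP => x; rewrite msetE2 leq_addr.
rewrite -[RHS]big_filter.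
rewrite [RHS](perm_big (mono_divisors m)); last first.
  apply: uniq_perm; rewrite ?filter_uniq ?undup_uniq // => a.
  rewrite mem_filter; case: (boolP (a \in mono_divisors m)) => //=.
  by rewrite mem_mono_divisors => /sD ->.
apply: eq_big_seq => a; rewrite mem_mono_divisors => le_am.
have Dm : (m `\` a)%mset \in D by apply: sD; apply: msubsetDl.
rewrite -big_filter (perm_big [:: (m `\` a)%mset]) ?big_seq1 //.
apply: uniq_perm; rewrite ?filter_uniq // => b.
rewrite mem_filter inE; apply/andP/eqP => [[/eqP <- _]|->].
  by rewrite msetDKB.
by rewrite msetBDKC ?eqxx.
Qed.

Lemma series_mulC : commutative series_mul.
Proof.
move=> f g; apply: seriesP => m.
have sD a : (a `<=` m)%mset -> a \in mono_divisors m by rewrite mem_mono_divisors.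
rewrite !(series_mulE (D := mono_divisors m)) ?undup_uniq //.
rewrite (exchange_big_dep xpredT) //=; apply: eq_bigr => a _.
by apply: eq_big => b; [rewrite msetDC | rewrite mulrC].
Qed.

Lemma series_mulA : associative series_mul.
Proof.
suff mulA3 f g h m : series_mul f (series_mul g h) m =
    \sum_(a <- mono_divisors m) \sum_(b <- mono_divisors m)
       \sum_(c <- mono_divisors m | (a `+` (b `+` c))%mset == m) f a * (g b * h c).
  move=> f g h; apply: seriesP => m; rewrite mulA3 series_mulC mulA3.
  rewrite [RHS]exchange_big /=; apply: eq_bigr => a _.
  under [RHS]eq_bigr do rewrite big_mkcond; rewrite [RHS]exchange_big /=.
  apply: eq_bigr => b _; rewrite -[RHS]big_mkcond /=.
  apply: eq_big => c; first by rewrite msetDA msetDC.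
  by rewrite mulrA mulrC.
have sD u : (u `<=` m)%mset -> forall a, (a `<=` u)%mset -> a \in mono_divisors m.
  by move=> um a au; rewrite mem_mono_divisors; apply: msubset_trans um.
rewrite (series_mulE (D := mono_divisors m)) ?undup_uniq //; last exact: sD (msubset_refl _).
apply: eq_bigr => a _.
transitivity (\sum_(u <- mono_divisors m | (a `+` u)%mset == m)
   \sum_(b <- mono_divisors m) \sum_(c <- mono_divisors m | (b `+` c)%mset == u)
     f a * (g b * h c)).
  rewrite big_seq_cond [RHS]big_seq_cond; apply: eq_bigr => u /andP[ud _].
  rewrite mem_mono_divisors in ud.
  rewrite (series_mulE (D := mono_divisors m)) ?undup_uniq //; last exact: sD.
  by rewrite mulr_sumr; apply: eq_bigr => b _; rewrite mulr_sumr.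
rewrite exchange_big /=; apply: eq_bigr => b _.
rewrite (exchange_big_dep xpredT) //= [RHS]big_mkcond /=; apply: eq_bigr => c _.
have [E|NE] := eqVneq (a `+` (b `+` c))%mset m.
  rewrite -big_filter (perm_big [:: (b `+` c)%mset]) ?big_seq1 //.
  apply: uniq_perm; rewrite ?filter_uniq ?undup_uniq // => u.
  rewrite mem_filter inE [u == _]eq_sym -andbA.
  have [<-|_] := eqVneq (b `+` c)%mset u; rewrite ?andbF //= E eqxx /=.
  by rewrite mem_mono_divisors -E; apply/msubsetP => x; rewrite [leqRHS]msetE2 leq_addl.
by rewrite big1 // => u /andP[/eqP E /eqP Eu]; rewrite Eu E eqxx in NE.
Qed.

Lemma series_mul1 : left_id series_one series_mul.
Proof.
move=> f; apply: seriesP => m; rewrite /series_mul.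
rewrite (bigD1_seq mset0) ?undup_uniq //= ?mem_mono_divisors ?msub0set //.
rewrite big1 ?addr0 => [|a /negPf Na]; last by rewrite /series_one Na mul0r.
by rewrite /series_one eqxx mul1r msetB0.
Qed.

Lemma series_mulDl : left_distributive series_mul series_add.
Proof.
move=> f g h; apply: seriesP => m; rewrite /series_add /series_mul -big_split /=.
by apply: eq_bigr => a _; rewrite mulrDl.
Qed.

Lemma series_1neq0 : series_one != 0.
Proof.
apply/eqP => /(congr1 (fun f : series => f mset0)) /eqP.
by rewrite /series_one eqxx oner_eq0.
Qed.

HB.instance Definition _ :=
  GRing.Zmodule_isComNzRing.Build series
    series_mulA series_mulC series_mul1 series_mulDl series_1neq0.

Definition series_scale (c : rat) (f : series) : series := fun m => c * f m.

Lemma series_scaleA a b f :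
  series_scale a (series_scale b f) = series_scale (a * b) f.
Proof. by apply: seriesP => m; apply: mulrA. Qed.
Lemma series_scale1 : left_id 1 series_scale.
Proof. by move=> f; apply: seriesP => m; apply: mul1r. Qed.
Lemma series_scaleDr : right_distributive series_scale +%R.
Proof. by move=> a f g; apply: seriesP => m; apply: mulrDr. Qed.
Lemma series_scaleDl f : {morph series_scale^~ f : a b / a + b}.
Proof. by move=> a b; apply: seriesP => m; apply: mulrDl. Qed.

HB.instance Definition _ :=
  GRing.Zmodule_isLmodule.Build rat series
    series_scaleA series_scale1 series_scaleDr series_scaleDl.

(** * Schur Q- and P-functions *)

Definition complete_sym (d : nat) : series := fun m => (size (enum_mset m) == d)%:R.

Definition elementary_sym (d : nat) : series :=
  fun m => ((size (enum_mset m) == d) && uniq (enum_mset m))%:R.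

Definition Qone (d : nat) : series := 
  \sum_(a < d.+1) complete_sym a * elementary_sym (d - a).

Definition Qtwo (a b : nat) : series :=
  if (a == 0)%N && (b == 0)%N then 0
  else Qone a * Qone b
       + (\sum_(1 <= p < b.+1) (-1) ^+ p * Qone (a + p) * Qone (b - p)) *+ 2.

Lemma even_slot_subproof k (i : 'I_k) : (i.*2 < k.*2)%N.
Proof. by rewrite ltn_double. Qed.
Lemma odd_slot_subproof k (i : 'I_k) : (i.*2.+1 < k.*2)%N.
Proof. by rewrite ltn_Sdouble. Qed.
Definition even_slot k (i : 'I_k) := Ordinal (even_slot_subproof i).
Definition odd_slot k (i : 'I_k) := Ordinal (odd_slot_subproof i).

(* A perfect matching {{s 0 < s 1}, {s 2 < s 3}, ...} of 'I_(2k), with its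
   blocks listed by increasing minimum.                                     *)
Definition is_matching k (s : 'S_(k.*2)) : bool :=
  [forall i : 'I_k, (s (even_slot i) < s (odd_slot i))%N] &&
  [forall i : 'I_k, forall j : 'I_k,
     (i < j)%N ==> (s (even_slot i) < s (even_slot j))%N].

Definition pfaffian (R : comNzRingType) k (A : 'M[R]_(k.*2)) : R :=
  \sum_(s : 'S_(k.*2) | is_matching s)
     (-1) ^+ s * \prod_(i < k) A (s (even_slot i)) (s (odd_slot i)).

Definition strict_partition (l : seq nat) : bool :=
  sorted gtn l && all (fun a => 0 < a)%N l.

(* nth pads l with a final 0 when its length is odd *)
Definition schurQ (l : seq nat) : series :=
  pfaffian (\matrix_(i < (uphalf (size l)).*2, j < (uphalf (size l)).*2)
              Qtwo (nth 0 l i)%N (nth 0 l j)%N).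

Definition schurP (l : seq nat) : series := 2%:R ^- size l *: schurQ l.

Definition schurQ_positive (f : series) : Prop :=
  exists (ls : seq (seq nat)) (c : seq nat -> nat),
    all strict_partition ls /\ f = \sum_(l <- ls) (c l)%:R *: schurQ l.

Definition schurP_positive (f : series) : Prop :=
  exists (ls : seq (seq nat)) (c : seq nat -> nat),
    all strict_partition ls /\ f = \sum_(l <- ls) (c l)%:R *: schurP l.

(** * Demazure product on S_n *)

Definition inversions n (w : 'S_n) : nat :=
  #|[set p : 'I_n * 'I_n | (p.1 < p.2)%N && (w p.2 < w p.1)%N]|.

Lemma ord_lo_subproof n (i : 'I_n.-1) : (i < n)%N.
Proof. by apply: leq_trans (ltn_ord i) (leq_pred n). Qed.
Lemma ord_hi_subproof n (i : 'I_n.-1) : (i.+1 < n)%N.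
Proof. by rewrite -ltn_predRL. Qed.
Definition ord_lo n (i : 'I_n.-1) := Ordinal (ord_lo_subproof i).
Definition ord_hi n (i : 'I_n.-1) := Ordinal (ord_hi_subproof i).

(* 'S_n permutes {0, ..., n-1}: the letter i stands for the generator
   usually written s_(i+1).                                                 *)
Definition simple_refl n (i : 'I_n.-1) : 'S_n := tperm (ord_lo i) (ord_hi i).

(* The product of permutations composes from left to right in MathComp and
   from right to left here.                                                 *)
Definition mulR n (w : 'S_n) (i : 'I_n.-1) : 'S_n := (simple_refl i * w)%g.

Definition demazureR n (w : 'S_n) (i : 'I_n.-1) : 'S_n :=
  if (inversions w < inversions (mulR w i))%N then mulR w i else w.

(* u o 1 = u, and u o v = (u o v s_i) o s_i if v s_i is shorter than v *)
Fixpoint demazure_rec n k (u v : 'S_n) : 'S_n :=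
  if k is k'.+1 then
    if [pick i | (inversions (mulR v i) < inversions v)%N] is Some i
    then demazureR (demazure_rec k' u (mulR v i)) i
    else u
  else u.

Definition demazure n (u v : 'S_n) : 'S_n := demazure_rec (inversions v) u v.

Section DemazureTheory.
Context {n : nat}.
Implicit Types (u v w : 'S_n) (i j : 'I_n.-1) (x y : 'I_n).

Definition ascent w i := (w (ord_lo i) < w (ord_hi i))%N.

Lemma ord_lo_neq_hi i : ord_lo i != ord_hi i.
Proof. by rewrite -val_eqE /= neq_ltn ltnSn. Qed.

Lemma mulRK w i : mulR (mulR w i) i = w.
Proof. by rewrite /mulR mulgA tperm2 mul1g. Qed.

Lemma ascent_mulR w i : ascent (mulR w i) i = ~~ ascent w i.
Proof.
rewrite /ascent /mulR !permM tpermL tpermR -leqNgt ltn_neqAle andb_idl // => _.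
by rewrite (inj_eq val_inj) (inj_eq perm_inj) eq_sym ord_lo_neq_hi.
Qed.

(* s_i preserves the order of every pair except {i, i+1} *)
Lemma simple_refl_lt i x y : (x, y) != (ord_lo i, ord_hi i) ->
  (x, y) != (ord_hi i, ord_lo i) -> (simple_refl i x < simple_refl i y)%N = (x < y)%N.
Proof.
rewrite /simple_refl !xpair_eqE -!val_eqE /= => N1 N2.
have E z : tperm (ord_lo i) (ord_hi i) z =
           (if z == i :> nat then i.+1 else if z == i.+1 :> nat then i : nat else z) :> nat.
  by case: tpermP => [->|->|] /=; rewrite ?eqxx // ?(gtn_eqF (ltnSn _)) //
    => /eqP; rewrite -val_eqE /= => /negPf -> /eqP; rewrite -val_eqE /= => /negPf ->.
rewrite !E; move: N1 N2 {E}. move: (nat_of_ord i) (nat_of_ord x) (nat_of_ord y) => I X Y N1 N2.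
by do 4?[case: ifP => /eqP ?]; move: N1 N2; lia.
Qed.

Lemma ascent_lt w i : ascent w i -> (inversions w < inversions (mulR w i))%N.
Proof.
move=> asc; pose sw (p : 'I_n * 'I_n) := (simple_refl i p.1, simple_refl i p.2).
have swK : cancel sw sw by move=> [x y]; rewrite /sw /= !tpermK.
rewrite /inversions -(card_imset _ (can_inj swK)).
apply/proper_card/properP; split; last first.
  exists (ord_lo i, ord_hi i); first by rewrite inE /= ltnSn !permM tpermL tpermR.
  apply/imsetP => -[[x y]]; rewrite inE /= => /andP[xy wyx] [/esym Ex /esym Ey].
  move: xy; rewrite -(tpermK (ord_lo i) (ord_hi i) x) -/(simple_refl i) Ex tpermL.
  rewrite -(tpermK (ord_lo i) (ord_hi i) y) -/(simple_refl i) Ey tpermR /=.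
  by rewrite ltnNge leqnSn.
apply/subsetP => p /imsetP[[x y]]; rewrite inE /= => /andP[xy wyx] ->; rewrite inE.
rewrite /= !permM !tpermK wyx andbT simple_refl_lt //.
  by apply: contraTneq wyx => -[-> ->]; rewrite -leqNgt ltnW.
by apply: contraTneq xy => -[-> ->]; rewrite /= -leqNgt leqnSn.
Qed.

Lemma ltn_inversions w i : (inversions w < inversions (mulR w i))%N = ascent w i.
Proof.
apply/idP/idP => [|/ascent_lt//]; apply: contraTT => Na.
rewrite -leqNgt ltnW // -{2}(mulRK w i) ascent_lt //.
by rewrite ascent_mulR.
Qed.

Lemma gtn_inversions w i : (inversions (mulR w i) < inversions w)%N = ~~ ascent w i.
Proof. by rewrite -{2}(mulRK w i) ltn_inversions ascent_mulR. Qed.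

Lemma demazureRE w i : demazureR w i = if ascent w i then mulR w i else w.
Proof. by rewrite /demazureR ltn_inversions. Qed.

Lemma no_descent w : (forall i, ascent w i) -> w = 1%g.
Proof.
move=> asc.
have inc x y : (x < y)%N -> (w x < w y)%N.
  case: y => y ly; rewrite [X in (_ < X)%N]/=.
  elim: y ly => // y IHy ly; rewrite ltnS => xy.
  have ly' : (y < n)%N by apply: ltnW.
  have li : (y < n.-1)%N by rewrite ltn_predRL.
  have := asc (Ordinal li); rewrite /ascent.
  have -> : ord_lo (Ordinal li) = Ordinal ly' by apply/val_inj.
  have -> : ord_hi (Ordinal li) = Ordinal ly by apply/val_inj.
  move: xy; rewrite leq_eqVlt => /orP[/eqP xy|xy]; last exact/ltn_trans/IHy.
  by rewrite (_ : x = Ordinal ly') //; apply/val_inj.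
have ge x : (x <= w x)%N.
  case: x => x lx; elim: x lx => // x IHx lx.
  by apply: leq_ltn_trans (IHx (ltnW lx)) (inc _ _ _) => /=.
have S : (\sum_x w x = \sum_(x < n) x)%N.
  by rewrite [RHS](reindex_inj (@perm_inj _ w)).
apply/permP => x; rewrite perm1; apply/val_inj/esym/eqP.
have /leqif_sum : forall y : 'I_n, true -> (y <= w y ?= iff (y == w y :> nat))%N.
  by move=> y _; split.
by move=> [_]; rewrite -S eqxx => /esym/forallP/(_ x).
Qed.

Definition demL w i : 'S_n := (demazureR w^-1 i)^-1%g.

Lemma demLE w i :
  demL w i = if ascent w^-1%g i then (w * simple_refl i)%g else w.
Proof.
rewrite /demL demazureRE; case: ifP => _; last by rewrite invgK.
by rewrite /mulR invMg invgK tpermV.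
Qed.

Lemma demLR w i j : demL (demazureR w j) i = demazureR (demL w i) j.
Proof.
pose a := w^-1%g (ord_lo i); pose b := w^-1%g (ord_hi i).
have wa : w a = ord_lo i by rewrite permKV.
have wb : w b = ord_hi i by rewrite permKV.
have [/andP[/eqP Ea /eqP Eb]|N1] := boolP ((a == ord_lo j) && (b == ord_hi j)).
  have A1 : ascent w j by rewrite /ascent -Ea -Eb wa wb /= ltnSn.
  have A2 : ascent w^-1%g i by rewrite /ascent -/a -/b Ea Eb /= ltnSn.
  have E : (mulR w j = w * simple_refl i)%g.
    by rewrite /mulR /simple_refl -Ea -Eb -wa -wb -(tpermJ a b w) conjgE mulKVg.
  rewrite (demazureRE w) A1 demLE (demLE w) A2 -E.
  rewrite demazureRE ascent_mulR A1 /= {1}E /ascent invMg tpermV !permM.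
  by rewrite tpermL tpermR -/a -/b Ea Eb /= ltnNge leqnSn.
have [/andP[/eqP Ea /eqP Eb]|N2] := boolP ((a == ord_hi j) && (b == ord_lo j)).
  have A1 : ascent w j = false by rewrite /ascent -Ea -Eb wa wb /= ltnNge leqnSn.
  have A2 : ascent w^-1%g i = false by rewrite /ascent -/a -/b Ea Eb /= ltnNge leqnSn.
  by rewrite demazureRE A1 demLE A2 demazureRE A1.
have A1 : ascent (mulR w j)^-1%g i = ascent w^-1%g i.
  by rewrite /ascent /mulR invMg tpermV !permM -/(simple_refl j) -/a -/b simple_refl_lt.
have A2 : ascent (w * simple_refl i)%g j = ascent w j.
  rewrite /ascent !permM simple_refl_lt //.
    apply: contra N1; rewrite !xpair_eqE -!wa -!wb !(inj_eq perm_inj).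
    by rewrite ![ord_lo j == _]eq_sym ![ord_hi j == _]eq_sym.
  apply: contra N2; rewrite !xpair_eqE -!wa -!wb !(inj_eq perm_inj) andbC.
  by rewrite ![ord_lo j == _]eq_sym ![ord_hi j == _]eq_sym.
rewrite demLE (demazureRE w) demazureRE demLE.
case B: (ascent w j); case A: (ascent w^-1%g i); rewrite ?A1 ?A2 ?A ?B //.
by rewrite /mulR mulgA.
Qed.

Lemma demL_foldl (a : seq 'I_n.-1) w i :
  demL (foldl (@demazureR n) w a) i = foldl (@demazureR n) (demL w i) a.
Proof. by elim: a w => //= j a IHa w; rewrite IHa demLR. Qed.

Lemma demazure_rec_word k v : (inversions v <= k)%N ->
  exists2 a : seq 'I_n.-1, v = foldl (@demazureR n) 1%g a
    & forall u, demazure_rec k u v = foldl (@demazureR n) u a.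
Proof.
elim: k v => [|k IHk] v le_v.
  exists [::] => //; apply: no_descent => i; apply: contraLR le_v.
  by rewrite -gtn_inversions -ltnNge; apply: leq_trans.
rewrite /=; case: pickP => [i lt_i|Ni].
  have [|a Ea Ra] := IHk (mulR v i); first by rewrite -ltnS (leq_trans lt_i).
  exists (rcons a i) => [|u]; rewrite foldl_rcons ?Ra // -Ea demazureRE.
  by rewrite ascent_mulR -gtn_inversions lt_i mulRK.
exists [::] => //; apply: no_descent => i.
by have := Ni i; rewrite gtn_inversions => /negbFE.
Qed.

Lemma demazure_word v :
  exists2 a : seq 'I_n.-1, v = foldl (@demazureR n) 1%g a
    & forall u, demazure u v = foldl (@demazureR n) u a.
Proof. exact: demazure_rec_word. Qed.

Lemma foldl_demazureR_inj (a b : seq 'I_n.-1) :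
    foldl (@demazureR n) 1%g a = foldl (@demazureR n) 1%g b ->
  forall u, foldl (@demazureR n) u a = foldl (@demazureR n) u b.
Proof.
move=> Eab u; have [c /(canRL invgK) Ec _] := demazure_word u^-1.
have -> : u = foldl demL 1%g c.
  rewrite Ec -[in LHS](invg1 _); elim: c (1%g : 'S_n) {Ec} => [|i c IHc] v /=.
    by rewrite ?invgK.
  by rewrite -IHc /demL invgK.
elim/last_ind: c {Ec} => [|c i IHc] //.
by rewrite foldl_rcons -!demL_foldl IHc.
Qed.

Lemma demazureA : associative (@demazure n).
Proof.
move=> u v w; have [a Ev Ra] := demazure_word v.
have [b Ew Rb] := demazure_word w; have [c Evw Rc] := demazure_word (demazure v w).
rewrite Rc Rb Ra -foldl_cat; apply: foldl_demazureR_inj.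
by rewrite -Evw Rb foldl_cat -Ev.
Qed.

Lemma demazure1 : right_id 1%g (@demazure n).
Proof.
move=> u; have [a Ea ->] := demazure_word 1%g.
by rewrite (@foldl_demazureR_inj a [::]).
Qed.

Lemma demazure_simple w i : demazure w (simple_refl i) =
  if (inversions (mulR w i) > inversions w)%N then mulR w i else w.
Proof.
have [a Ea ->] := demazure_word (simple_refl i).
rewrite (@foldl_demazureR_inj a [:: i]) // -Ea /= demazureRE.
by rewrite /ascent !perm1 /= ltnSn /mulR mulg1.
Qed.

End DemazureTheory.

(** * Involution Stanley symmetric functions *)

(* The set of words of minimal length a_1 ... a_l with
   z = s_(a_l) o ... o s_(a_1) o one o s_(a_1) o ... o s_(a_l).              *)
Definition is_hat_factorization n (one z : 'S_n) (a : seq 'I_n.-1) : bool :=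
  z == foldl (fun w i => demazure (demazure (simple_refl i) w) (simple_refl i)) one a.

Definition is_hat_word n (one z : 'S_n) (a : seq 'I_n.-1) : bool :=
  is_hat_factorization one z a &&
  [forall k : 'I_(size a), forall b : k.-tuple 'I_n.-1,
     ~~ is_hat_factorization one z b].

Definition compatible n (a : seq 'I_n.-1) (i : seq var) : bool :=
  (size a == size i) &&
  sorted (fun p q : 'I_n.-1 * var =>
            (val p.2 <= val q.2) && ((p.1 < q.1)%N ==> (val p.2 < val q.2)))
         (zip a i).

(* The coefficient of m counts the pairs (a, i) with a in the set of hat words,
   i compatible with a, and x_(i_1) ... x_(i_l) = m: then l is the degree of m
   and i is a rearrangement of m (permutations is duplicate-free).          *)
Definition stanley n (one z : 'S_n) : series := fun m =>
  (\sum_(a : (size (enum_mset m)).-tuple 'I_n.-1 | is_hat_word one z a)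
      count (compatible a) (permutations (enum_mset m)))%:R.

Definition one_O n : 'S_n := 1%g.

(* (1,2)(3,4)...(n-1,n), for n even *)
Definition one_Sp n : 'S_n := (\prod_(i < n.-1 | ~~ odd i) simple_refl i)%g.

Definition stanley_O n (y : 'S_n) : series := stanley (one_O n) y.
Definition stanley_Sp n (z : 'S_n) : series := stanley (one_Sp n) z.

Definition involution n (y : 'S_n) : bool := (y ^+ 2 == 1)%g.

Definition fpf_involution n (z : 'S_n) : bool :=
  involution z && [forall x, z x != x].

Definition cyc n (y : 'S_n) : nat := #|[set c in porbits y | #|c| == 2%N]|.

(* Main.v *)
(* Extend an involution of {0, ..., n-1} to an involution z of the integers,
   trivial (respectively matching 2x with 2x+1) outside that range, and let
   F(z) be its symmetric function; in finitely many variables F is computed by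
   passes which strip descents off z.  For every r the signed sum of F over the
   involutions covering z through a transposition (r x) vanishes; this is a
   telescoping identity along a pass.  Applied at the rightmost visible pair of
   z it writes F(z), up to powers of 2, as a nonnegative combination of F at
   smaller involutions, and the recursion stops at Grassmannian involutions,
   which are classified by strict partitions l; write f_l for their functions.
   It remains to see that 2^(size l) f_l = Q_l.  The transition identity gives
   the f_l the Pieri rule for q_1, f_l vanishes in fewer than size l variables,
   and, since products of disjoint arcs are products of the q_d, running the
   recursion on them puts every product of r of the q_d in the span of the f_l
   with at most r rows.  The Q_l satisfy the same Pieri rule, vanish likewise,
   are combinations of products of size l of the q_d, and are independent in r
   variables when restricted to at most r rows.  Removing the last box of l and
   applying the Pieri rule in exactly size l variables then identifies f_l and
   Q_l by induction. *)
From Stdlib Require Import ZArith Lia FunctionalExtensionality.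
From Stdlib Require List Classical.
From mathcomp Require Import ssreflect ssrfun ssrbool.
Set Implicit Arguments.
Unset Strict Implicit.
Unset Printing Implicit Defensive.
Unset Lia Cache.

(** * Covering transformations of involutions of the integers *)

Module IntegerInvolutions.
Local Open Scope Z_scope.

(** Working over the integers leaves room on both sides for the covers that a transition needs. The
    two halves of the theorem share one argument, switched by a boolean [sp]: the covering map [tau]
    is always the one for arbitrary involutions, and in the fixed-point-free case a cover with a
    fixed point contributes zero, because stripping never gets rid of fixed points. The factors 2
    have one source: cutting an arc on adjacent points merges two covers into one, so a new arc on
    two fixed points counts twice; hence the normalisation by 2 to the number of arcs. The Pieri
    rule alone does not identify the functions with Q-functions, since each instance involves
    several unknown functions at once; in exactly as many variables as rows, longer partitions
    disappear and one unknown term is left. This requires a bound on the rows that occur in a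
    product of q's. For ordinary involutions the number of arcs is such a bound; a fixed-point-free
    involution has infinitely many arcs, and the bound becomes the number of arcs to delete before
    the remaining ones lie side by side. *)

Definition sw (a b x : Z) : Z :=
  if x =? a then b else if x =? b then a else x.

Definition cj (t z : Z -> Z) (x : Z) : Z := t (z (t x)).

Definition inv (z : Z -> Z) : Prop := forall x, z (z x) = x.

Definition dsc (z : Z -> Z) (i : Z) : Prop := z (i + 1) < z i.

(** Both points become fixed, whatever their partners: [tau] applies it to the inner ends of two
    different arcs. *)
Definition unarc (z : Z -> Z) (a b : Z) (x : Z) : Z :=
  if x =? a then a else if x =? b then b else z x.

Definition addarc (z : Z -> Z) (a b : Z) (x : Z) : Z :=
  if x =? a then b else if x =? b then a else z x.

(** At a descent this inverts the Demazure conjugation by the transposition (i, i+1). Conjugation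
    would not change an arc joining i and i+1, so that arc is cut into two fixed points. *)
Definition strip (z : Z -> Z) (i : Z) : Z -> Z :=
  if (z i) =? (i + 1) then unarc z i (i + 1) else cj (sw i (i + 1)) z.

(** The Bruhat covering condition for right multiplication of z by the transposition (a, b). *)
Definition rect (z : Z -> Z) (a b : Z) : Prop :=
  [/\ a < b, z a < z b & forall e, a < e < b -> ~ (z a < z e < z b)].

(** The covering transformation of involutions: a substitute for multiplication by (a, b) that stays
    among involutions and, for pairs satisfying [rect], takes the same value at (z a, z b). Usually
    it is a conjugation. Two fixed points are joined, and two arcs lying side by side in which a and
    b are ends of the same kind are replaced by the arc on their outer ends, the inner ends becoming
    fixed. *)
Definition tau (z : Z -> Z) (a b : Z) : Z -> Z :=
  if (z a) =? a then
    if (z b) =? b then addarc z a b else cj (sw a (Z.min b (z b))) z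
  else if (z b) =? b then cj (sw (Z.max a (z a)) b) z
  else if Z.max a (z a) <? Z.min b (z b) then
    if Bool.eqb (Z.ltb a (z a)) (Z.ltb b (z b)) then
      addarc (unarc z (Z.max a (z a)) (Z.min b (z b))) (Z.min a (z a)) (Z.max b (z b))
    else cj (sw a b) z
  else cj (sw a b) z.

Ltac noif t := lazymatch t with context [if _ then _ else _] => fail | _ => idtac end.
Ltac zcase :=
  match goal with
  | |- context [?a =? ?b] => noif a; noif b; case: (Z.eqb_spec a b) => ?
  | |- context [?a <? ?b] => noif a; noif b; case: (Z.ltb_spec a b) => ?
  end.

Lemma swK a b : involutive (sw a b).
Proof. by move=> x; rewrite /sw; repeat zcase; lia. Qed.

Lemma sw_inj a b : injective (sw a b).
Proof. exact: inv_inj (swK a b). Qed.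

Lemma cj_inv t z : involutive t -> inv z -> inv (cj t z).
Proof. by move=> tK zK x; rewrite /cj tK zK tK. Qed.

Lemma cjK t z : involutive t -> cj t (cj t z) = z.
Proof. by move=> tK; apply: functional_extensionality => x; rewrite /cj !tK. Qed.

Lemma inv_eq z x y : inv z -> z x = z y -> x = y.
Proof. by move=> zK e; rewrite -(zK x) e zK. Qed.

Ltac zall := repeat zcase; subst; try lia; try congruence.

Lemma unarc_inv z a b : inv z -> z a = b -> inv (unarc z a b).
Proof.
move=> zK ab x; have ba : z b = a by rewrite -ab zK.
by have hx := zK x; rewrite /unarc; zall.
Qed.

Lemma addarc_inv z a b : inv z -> z a = a -> z b = b -> inv (addarc z a b).
Proof. by move=> zK za zb x; have hx := zK x; rewrite /addarc; zall. Qed.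

Lemma strip_inv z i : inv z -> inv (strip z i).
Proof.
move=> zK; rewrite /strip; zcase; first exact: unarc_inv.
by apply: cj_inv => //; apply: swK.
Qed.

Lemma cj_sw_sym z a b : inv z -> z a <> a -> z b <> b -> z a <> b -> a <> b ->
  cj (sw (z a) (z b)) z = cj (sw a b) z.
Proof.
move=> zK na nb ab nab; have ha := zK a; have hb := zK b.
apply: functional_extensionality => x; have hx := zK x; rewrite /cj.
have [e|n1] := Z.eqb_spec x a; first by subst x; rewrite /sw; zall.
have [e|n2] := Z.eqb_spec x b; first by subst x; rewrite /sw; zall.
have [e|n3] := Z.eqb_spec x (z a); first by subst x; rewrite /sw; zall.
have [e|n4] := Z.eqb_spec x (z b); first by subst x; rewrite /sw; zall.
have n5 : z x <> a by congruence.
have n6 : z x <> b by congruence.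
have n7 : z x <> z a by congruence.
have n8 : z x <> z b by congruence.
have -> : sw (z a) (z b) x = x by rewrite /sw; zall.
have -> : sw a b x = x by rewrite /sw; zall.
by rewrite /sw; zall.
Qed.

Lemma tau_sym z a b : inv z -> rect z a b -> tau z (z a) (z b) = tau z a b.
Proof.
move=> zK [ab zab _]; rewrite /tau !zK.
have nab : z a <> b by move=> e; have := zK a; rewrite e; lia.
have n : a <> b by lia.
rewrite (Z.eqb_sym a) (Z.eqb_sym b).
case: (Z.eqb_spec (z a) a) => [ea|na].
  by rewrite ea Z.min_comm; case: Z.eqb_spec => [->|].
case: (Z.eqb_spec (z b) b) => [eb|nb].
  by rewrite eb Z.max_comm.
rewrite (Z.max_comm (z a)) (Z.min_comm (z b)) (Z.min_comm (z a)) (Z.max_comm (z b)).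
have [lt|le] := Z.ltb_spec; last by rewrite cj_sw_sym.
have -> : Bool.eqb (z a <? a) (z b <? b) = Bool.eqb (a <? z a) (b <? z b).
  by case: (Z.ltb_spec (z a) a); case: (Z.ltb_spec a (z a)); case: (Z.ltb_spec (z b) b); case: (Z.ltb_spec b (z b)) => //=; lia.
by case: ifP => // _; rewrite cj_sw_sym.
Qed.

Lemma rect_sym z a b : inv z -> rect z a b -> rect z (z a) (z b).
Proof.
move=> zK [ab zab h]; split; rewrite ?zK // => e he he'.
by apply: (h (z e)); rewrite ?zK.
Qed.

(** One of (a, b) and (z a, z b) is in this position, where [tau] has only the three outcomes of
    [tau_canon]: a new arc on two fixed points, two arcs fused into one, or a conjugation. *)
Definition canon (z : Z -> Z) (a b : Z) : Prop :=
  [/\ rect z a b, z a <= a & z a = a -> b <= z b].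

Lemma canon_ind z (P : Z -> Z -> Prop) : inv z ->
  (forall a b, rect z a b -> P (z a) (z b) -> P a b) ->
  (forall a b, canon z a b -> P a b) -> forall a b, rect z a b -> P a b.
Proof.
move=> zK Psym Pcan a b ab; have ab' := rect_sym zK ab.
have [e|ne] := Z.eqb_spec (z a) a.
  have [le|lt] := Z.leb_spec b (z b); first by apply: Pcan; split => //; lia.
  by apply: Psym => //; apply: Pcan; split => //; rewrite ?zK; lia.
have [le|lt] := Z.leb_spec (z a) a; first by apply: Pcan; split => //; lia.
by apply: Psym => //; apply: Pcan; split => //; rewrite ?zK; lia.
Qed.

Lemma tau_canon z a b : inv z -> canon z a b ->
  [\/ [/\ z a = a, z b = b & tau z a b = addarc z a b],
      [/\ z a < a < z b, z b < b & tau z a b = addarc (unarc z a (z b)) (z a) b] |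
      [/\ z a < a \/ b < z b, ~ (z a < a < z b /\ z b < b) & tau z a b = cj (sw a b) z]].
Proof.
move=> zK [[ab zab h] za zb]; have ha := zK a; have hb := zK b.
have nab : z a <> b by move=> e; move: ha; rewrite e; lia.
rewrite /tau; case: Z.eqb_spec => [ea|na].
  case: Z.eqb_spec => [eb|nb]; first by apply: Or31.
  by apply: Or33; split; [lia|lia|]; rewrite Z.min_l //; lia.
case: Z.eqb_spec => [eb|nb].
  by apply: Or33; split; [lia|lia|]; rewrite Z.max_l //; lia.
rewrite (Z.max_l a) // (Z.min_r a) //.
have -> : (a <? z a) = false by apply/Z.ltb_spec0; lia.
case: (Z.ltb_spec b (z b)) => /= hb'.
  by rewrite if_same; apply: Or33; split; [lia|lia|].
rewrite (Z.min_r b) // (Z.max_l b) //.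
case: Z.ltb_spec => h'; first by apply: Or32; split => //; lia.
by apply: Or33; split; [lia|lia|].
Qed.

Ltac inst h xs := idtac.

(* functional relations between the values of z at the points x and y *)
Lemma cj_sw_cj s a b z : involutive s ->
  cj s (cj (sw a b) z) = cj (sw (s a) (s b)) (cj s z).
Proof.
move=> sK; apply: functional_extensionality => x; rewrite /cj.
have sE u v : s u = s v -> u = v by move/(congr1 s); rewrite !sK.
have E y : s (sw a b y) = sw (s a) (s b) (s y).
  rewrite /sw; case: (Z.eqb_spec y a) => [->|na]; first by rewrite Z.eqb_refl.
  case: (Z.eqb_spec (s y) (s a)) => [/sE //|_].
  case: (Z.eqb_spec y b) => [->|nb]; first by rewrite Z.eqb_refl.
  by case: (Z.eqb_spec (s y) (s b)) => [/sE //|_].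
by rewrite E; congr (sw _ _ (s (z _))); apply: sE; rewrite E !sK.
Qed.

Ltac cmp zK u x :=
  let e := fresh "e" in let n := fresh "n" in
  case: (Z.eqb_spec u x) => [e|n];
  [have := f_equal _ e : _ = _ | idtac].

(* right multiplication by s = (i i+1) at a descent *)
Lemma rect_mulr w i a b : injective w -> w (i + 1) < w i -> rect w a b ->
  w (sw a b (i + 1)) < w (sw a b i) ->
  rect (fun x => w (sw i (i + 1) x)) (sw i (i + 1) a) (sw i (i + 1) b).
Proof.
move=> wI di [ab wab h] d; have hi := h i; have hj := h (i + 1).
have ni : ~ (a = i /\ b = i + 1) by case=> e1 e2; subst; lia.
split.
- by rewrite /sw; zall.
- by rewrite !swK.
move=> e; rewrite !swK => he; have he' := h (sw i (i + 1) e).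
move: d he he'; rewrite /sw; repeat zcase; subst; lia.
Qed.

Lemma rect_mulr_inv w i a b : injective w -> w (i + 1) < w i -> a < b ->
  ~ (a = i /\ b = i + 1) ->
  rect (fun x => w (sw i (i + 1) x)) (sw i (i + 1) a) (sw i (i + 1) b) ->
  rect w a b /\ w (sw a b (i + 1)) < w (sw a b i).
Proof.
move=> wI di ab ni [ab' wab h]; move: wab; rewrite !swK => wab; split.
  split=> // e he; have := h (sw i (i + 1) e); rewrite !swK.
  by move: ab' he; rewrite /sw; repeat zcase; subst; lia.
have := h i; have := h (i + 1); rewrite !swK.
have wij x y : x = y \/ w x <> w y.
  by have [e|n] := Z.eqb_spec x y; [left|right => /wI].
have := wij i b; have := wij i a; have := wij (i + 1) a; have := wij (i + 1) b.
by move: ab'; rewrite /sw; repeat zcase; subst; lia.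
Qed.

Section Conj.
Variables (z : Z -> Z) (i : Z).
Hypotheses (zK : inv z) (di : dsc z i) (ni : z i <> i + 1).
Let s := sw i (i + 1).
Let v := cj s z.

Let zI : injective z.
Proof. by move=> x y; apply: inv_eq. Qed.

(** Conjugation by s is done in two one-sided steps: right multiplication of z, then, after
    inversion, of s z. The two conditions are the descents at i that [rect_mulr] asks for in these
    steps. *)
Definition dscLR (z : Z -> Z) i a b :=
  z (sw a b (i + 1)) < z (sw a b i) /\
  s (z (sw (z a) (z b) (i + 1))) < s (z (sw (z a) (z b) i)).

Lemma rect_strip a b : rect z a b -> dscLR z i a b -> rect v (s a) (s b).
Proof.
move=> ab [d1 d2].
have sK : involutive s := swK i (i + 1).
have r1 := rect_mulr zI di ab d1.
have sI : injective (fun x => s (z x)) by move=> x y /(inv_inj sK) /zI.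
have d' : s (z (i + 1)) < s (z i).
  move: di ni; rewrite /dsc /s /sw => ? ?.
  have := zK i; have := zK (i + 1); by zall.
have r2 : rect (fun x => s (z x)) (z a) (z b).
  move: r1 => [h1 h2 h3]; rewrite /s in sK *; rewrite !swK in h2; split; rewrite /= ?zK //.
  by move=> e he he'; apply: (h3 (s (z e))); rewrite /= /s ?swK ?zK.
have [h1 h2 h3] := rect_mulr sI d' r2 d2.
split.
- by move: h2; rewrite /= /s !swK !zK.
- by move: h1; rewrite /v /cj /s !swK.
- move=> e; rewrite /v /cj /s !swK => he he'; apply: (h3 (s (z (s e)))); rewrite /= /s ?swK ?zK ?swK //.
Qed.

Lemma rect_strip_inv a b : a < b -> z a < z b -> ~ (a = i /\ b = i + 1) ->
  ~ (z a = i /\ z b = i + 1) -> rect v (s a) (s b) -> rect z a b /\ dscLR z i a b.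
Proof.
move=> ab zab n1 n2 [h1 h2 h3].
have sK : involutive s := swK i (i + 1).
have sI : injective (fun x => s (z x)) by move=> x y /(inv_inj sK) /zI.
have d' : s (z (i + 1)) < s (z i).
  move: di ni; rewrite /dsc /s /sw => ? ?.
  have := zK i; have := zK (i + 1); by zall.
move: h2; rewrite /v /cj /s !swK => h2.
have [|r2 d2] := rect_mulr_inv sI d' zab n2.
  have h1' : sw i (i + 1) a < sw i (i + 1) b := h1.
  split; rewrite /= /s ?swK ?zK //.
  move=> e he he'; apply: (h3 (s (z (s e)))) => //.
  by rewrite /v /cj /s !swK zK swK.
move: r2 => [_ /=]; rewrite !zK => h4 h5.
have [|r1 d1] := rect_mulr_inv zI di ab n1.
  split; rewrite /= /s ?swK // => e he he'.
  by have := h5 (z (s e)); rewrite zK /s !swK => /(_ he'); apply.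
by [].
Qed.
End Conj.

Record generic (z : Z -> Z) (a b u : Z) : Prop := Generic {
  gen_a : u <> a; gen_b : u <> b; gen_za : u <> z a; gen_zb : u <> z b;
  gen_ua : z u <> a; gen_ub : z u <> b; gen_uza : z u <> z a; gen_uzb : z u <> z b }.

Lemma point_cases z a b u : inv z ->
  (u = a /\ z u = z a) \/ (u = b /\ z u = z b) \/ (z a = u /\ z u = a) \/ (z b = u /\ z u = b) \/
  generic z a b u.
Proof.
move=> zK; have ha := zK a; have hb := zK b; have hu := zK u.
have [e|n1] := Z.eqb_spec u a; first by left; subst.
have [e|n2] := Z.eqb_spec u b; first by right; left; subst.
have [e|n3] := Z.eqb_spec u (z a); first by do 2!right; left; split; congruence.
have [e|n4] := Z.eqb_spec u (z b); first by do 3!right; left; split; congruence.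
by do 4!right; split; congruence.
Qed.

Lemma eqbF x y : x <> y -> (x =? y) = false.
Proof. by case: (Z.eqb_spec x y). Qed.

Lemma swN a b x : x <> a -> x <> b -> sw a b x = x.
Proof. by move=> na nb; rewrite /sw !eqbF. Qed.

Lemma tau_generic z a b u : inv z -> canon z a b -> generic z a b u -> tau z a b u = z u.
Proof.
move=> zK ab [*]; have [[ea eb ->]|[l1 l2 ->]|[l1 l2 ->]] := tau_canon zK ab.
- by rewrite /addarc !eqbF.
- by rewrite /addarc /unarc !eqbF.
- by rewrite /cj (swN (x := u)) // swN.
Qed.

Ltac gen_rw := repeat match goal with
  | p : generic _ _ _ _ |- _ =>
     progress rewrite ?(eqbF (gen_a p)) ?(eqbF (gen_b p)) ?(eqbF (gen_za p)) ?(eqbF (gen_zb p))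
      ?(eqbF (gen_ua p)) ?(eqbF (gen_ub p)) ?(eqbF (gen_uza p)) ?(eqbF (gen_uzb p))
      ?(eqbF (not_eq_sym (gen_a p))) ?(eqbF (not_eq_sym (gen_b p))) ?(eqbF (not_eq_sym (gen_za p))) ?(eqbF (not_eq_sym (gen_zb p)))
      ?(eqbF (not_eq_sym (gen_ua p))) ?(eqbF (not_eq_sym (gen_ub p))) ?(eqbF (not_eq_sym (gen_uza p))) ?(eqbF (not_eq_sym (gen_uzb p)))
  end.

Ltac zprune := gen_rw; repeat (zcase; try (exfalso; congruence); try (exfalso; lia); gen_rw).

Section Conj.
Variables (z : Z -> Z) (i : Z).
Hypotheses (zK : inv z) (di : dsc z i) (ni : z i <> i + 1).
Let s := sw i (i + 1).
Let v := cj s z.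

(** The bridge from the one-sided conditions to [tau]. The positions of i and i+1 relative to a, b,
    z a and z b leave finitely many cases, each settled by comparing values; the emptiness of the
    rectangle is applied to i, i+1 and their images. *)
Lemma dsc_tau a b : canon z a b -> (dsc (tau z a b) i <-> dscLR i z i a b).
Proof.
move=> ab; have [[lt zlt h] le1 le2] := ab.
have h1 := zK i; have h2 := zK (i + 1); have h3 := zK a; have h4 := zK b.
have hi := h i; have hj := h (i + 1); have hi' := h (z i); have hj' := h (z (i + 1)); rewrite h1 in hi'; rewrite h2 in hj'; clear h.
have := di; rewrite /dsc => di1; have ni1 : z i = i + 1 -> False := ni.
have T := tau_canon zK ab.
case: (point_cases a b i zK) => [[p1 p2]|[[p1 p2]|[[p1 p2]|[[p1 p2]|p1]]]];
case: (point_cases a b (i + 1) zK) => [[p3 p4]|[[p3 p4]|[[p3 p4]|[[p3 p4]|p3]]]].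
all: try (exfalso; lia).
all: rewrite /dscLR.
all: try (rewrite (tau_generic zK ab p1) (swN (gen_a p1) (gen_b p1)) (swN (gen_za p1) (gen_zb p1))).
all: try (rewrite (tau_generic zK ab p3) (swN (gen_a p3) (gen_b p3)) (swN (gen_za p3) (gen_zb p3))).
all: clear h1 h2.
all: (case: T => [[ea eb E]|[l1 l2 E]|[l1 l2 E]]; rewrite ?E {E}; try (exfalso; lia)).
all: have [ea'|la] : z a = a \/ z a < a by lia.
all: have [eb'|[lb|lb]] : z b = b \/ z b < b \/ b < z b by lia.
all: try (exfalso; lia).
all: try (have hcr : z b <= a by lia); try (have hcr : a <= z b by lia).
all: clear l1 l2 le1 le2 || clear le1 le2; move: hi hj hi' hj'.
all: rewrite /addarc ?/unarc ?/cj /sw; zprune; rewrite ?h3 ?h4; zprune; try lia.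
all: repeat match goal with n : _ <> _ |- _ => clear n end.
all: have nba : z b <> a by (move=> e; move: h4; rewrite e; lia).
all: match goal with p : generic _ _ _ _ |- _ =>
  try (exfalso; case: p; congruence); clear nba; move=> hi hj hi' hj' end.
all: match goal with p : generic _ _ _ _ |- _ =>
  first [ (have := gen_za p; have := gen_zb p; lia) | (have := gen_ua p; have := gen_ub p; lia)
   | (have := gen_za p; have := gen_ub p; lia) ] end.
Qed.
End Conj.

Lemma cj_unarc s z a b : involutive s -> cj s (unarc z a b) = unarc (cj s z) (s a) (s b).
Proof.
move=> sK; apply: functional_extensionality => x; rewrite /cj /unarc.
have E y : (s x =? y) = (x =? s y).
  apply/idP/idP => /Z.eqb_spec; first by move=> <-; rewrite sK Z.eqb_refl.
  by move=> ->; rewrite sK Z.eqb_refl.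
by rewrite !E; do 2!case: ifP => // /Z.eqb_spec.
Qed.

Lemma cj_addarc s z a b : involutive s -> cj s (addarc z a b) = addarc (cj s z) (s a) (s b).
Proof.
move=> sK; apply: functional_extensionality => x; rewrite /cj /addarc.
have E y : (s x =? y) = (x =? s y).
  apply/idP/idP => /Z.eqb_spec; first by move=> <-; rewrite sK Z.eqb_refl.
  by move=> ->; rewrite sK Z.eqb_refl.
by rewrite !E; do 2!case: ifP => // /Z.eqb_spec.
Qed.

Section Conj.
Variables (z : Z -> Z) (i : Z).
Hypotheses (zK : inv z) (di : dsc z i) (ni : z i <> i + 1).
Let s := sw i (i + 1).
Let v := cj s z.

Let sK : involutive s := swK i (i + 1).

Lemma strip_conj : strip z i = v.
Proof. by rewrite /strip; case: Z.eqb_spec. Qed.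

Lemma canon_strip a b : canon z a b -> rect v (s a) (s b) -> canon v (s a) (s b).
Proof.
move=> [[lt zlt h] le1 le2] r; have := di; rewrite /dsc => di1; split => //.
- rewrite /v /cj sK /s; have h1 := zK i; have ha := zK a; rewrite /sw; zall.
- rewrite /v /cj !sK => /(inv_inj sK) e; have := le2 e; rewrite /s; have hb := zK b.
  have h1 := zK i; rewrite /sw; zall.
Qed.

Lemma strip_tau_canon a b : canon z a b -> dsc (tau z a b) i ->
  strip (tau z a b) i = tau v (s a) (s b).
Proof.
move=> ab dt; have [[lt zlt h] le1 le2] := ab.
have := di; rewrite /dsc => di1.
have rv : rect v (s a) (s b).
  by apply: rect_strip => //; apply/(dsc_tau zK di ni ab).
have cv := canon_strip ab rv.
have vK : inv v by apply: cj_inv.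
have hi := zK i; have hj := zK (i + 1); have ha := zK a; have hb := zK b.
have va x : v (s x) = s (z x) by rewrite /v /cj sK.
have [[ea eb E]|[l1 l2 E]|[l1 l2 E]] := tau_canon zK ab; rewrite E.
- have E2 : tau v (s a) (s b) = addarc v (s a) (s b).
    by have := tau_canon vK cv; rewrite !va ea eb; case=> [[]|[l3]|[l3]] //; exfalso; lia.
  have nz : addarc z a b i <> i + 1.
    by clear -ea eb lt ni di1; rewrite /addarc; repeat zcase; move=> e; subst; lia.
  by rewrite E2 /strip (eqbF nz) cj_addarc.
- have nz : addarc (unarc z a (z b)) (z a) b i <> i + 1.
    by clear -l1 l2 ni; rewrite /addarc /unarc; repeat zcase; move=> e; subst; lia.
  have sub x y : x < y -> (x = i /\ y = i + 1 -> False) -> s x < s y.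
    by clear; rewrite /s /sw; repeat zcase; lia.
  have lt1 : s a < s (z b).
    by apply: sub; [lia | case=> e1 e2; move: di1 hb; rewrite e2 -e1; lia].
  have lt2 : s (z b) < s b by apply: sub; [lia | case=> e1 e2; apply: ni; move: hb; rewrite e1; lia].
  have lt3 : s (z a) < s a by apply: sub; [lia | case=> e1 e2; apply: ni; move: ha; rewrite e1; lia].
  have [[l3 _ _]|[_ _ E2]|[_ l3 _]] := tau_canon vK cv.
  - by rewrite va in l3; lia.
  - by rewrite E2 !va /strip (eqbF nz) cj_addarc // cj_unarc.
  - by rewrite !va in l3; lia.
- have nba : z b <> a by (move=> e; move: hb; rewrite e; lia).
  (* In the position a = i+1, z b = i the conjugation makes i and i+1 partners, so stripping cuts an
     arc; on the stripped side the same involution arises by fusing two arcs. In all other positions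
     of this case both sides are conjugations. *)
  have [S2|nS2] : (a = i + 1 /\ z b = i) \/ cj (sw a b) z i <> i + 1.
    have [e2|n2] := Z.eqb_spec (z b) i.
      have [e1|n1] := Z.eqb_spec a (i + 1); first by left.
      right; move: di1 hi hj l1; clear -lt zlt ni n1 e2 ha hb le1.
      by rewrite /cj /sw; repeat zcase; subst; try lia.
    right; move: di1 hi hj l1; clear -lt zlt ni n2 ha hb le1 le2.
    have [e1|n1] := Z.eqb_spec a (i + 1); rewrite /cj /sw; repeat zcase; subst; try lia; try congruence; try (by move=> A B C D e'; rewrite -e' hb in A; lia).
  case: S2 => e1 e2.
  have zi : z i = b by rewrite -e2.
  have lza : z a < i.
    have : z a <> i by move=> e; move: ha; rewrite e zi; lia.
    have : z a <> a by move=> e; have := le2 e; lia.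
    by lia.
  have sa : s a = i by rewrite e1 /s /sw; zall.
  have sb : s b = b by rewrite /s /sw; zall.
  rewrite sa sb in cv *.
  have vi : v i = z a by rewrite -sa va /s swN; lia.
  have vb : v b = i + 1 by rewrite -sb va e2 /s /sw; zall.
  have [[l3 _ _]|[_ _ E2]|[_ l3 _]] := tau_canon vK cv; try by rewrite vi ?vb in l3; lia.
    rewrite E2 vi vb /strip.
    have -> : cj (sw a b) z i = i + 1.
      rewrite /cj (swN (x := i)) ?zi; try lia.
      by rewrite /sw; zall.
    rewrite Z.eqb_refl; apply: functional_extensionality => x.
    rewrite /unarc /addarc.
    case: (Z.eqb_spec x i) => [->|n1]; first by zall.
    case: (Z.eqb_spec x (i + 1)) => [->|n2]; first by zall.
    rewrite /cj /v /cj.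
    case: (Z.eqb_spec x (z a)) => [->|n3].
      rewrite (swN (x := z a)); try lia.
      by rewrite ha /sw; zall.
    case: (Z.eqb_spec x b) => [->|n4].
      have -> : sw a b b = a by rewrite /sw; zall.
      by rewrite swN; lia.
    have hx := zK x.
    rewrite (swN (x := x)) ?e1 //. rewrite /s (swN (x := x)) // swN; first rewrite swN //.
    + by move=> e; apply: n4; rewrite -zi -e.
    + by move=> e; apply: n3; rewrite e1 -e.
    + by move=> e; apply: n3; rewrite e1 -e.
    + by move=> e; apply: n1; rewrite -e2 -e.
have [[l3 l4 _]|[l3 l4 _]|[_ _ E2]] := tau_canon vK cv.
- exfalso; move: l3 l4; rewrite !va => /(inv_inj sK) e3 /(inv_inj sK) e4.
  by lia.
- exfalso; apply: l2; move: l3 l4; rewrite !va.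
  have sub x y : s x < s y -> x < y \/ (x = i + 1 /\ y = i).
    by clear; rewrite /s /sw; repeat zcase; lia.
  case=> /sub h1 /sub h2 /sub h3.
  have k3 : z b < b.
    by case: h3 => // -[e1 e2]; exfalso; apply: ni; rewrite -e2; lia.
  case: h2 => [h2|[e1 e2]]; first by lia.
  exfalso; apply: nS2; rewrite /cj (swN (x := i)); try lia.
  have -> : z i = b by rewrite -e2 hb.
  by rewrite /sw; zall.
by rewrite /strip (eqbF nS2) cj_sw_cj // E2.
Qed.
End Conj.

Lemma tau_inv z a b : inv z -> rect z a b -> inv (tau z a b).
Proof.
move=> zK; move: a b; apply: canon_ind => // [a b ab|a b ab]; first by rewrite tau_sym.
have [[ea eb ->]|[l1 l2 ->]|[_ _ ->]] := tau_canon zK ab.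
- exact: addarc_inv.
- move=> x; have ha := zK a; have hb := zK b; have hx := zK x.
  have [[p _]|[[p _]|[[p _]|[[p _]|p]]]] := point_cases a b x zK; try (by subst x; rewrite /addarc /unarc; zall).
  have E y : generic z a b y -> addarc (unarc z a (z b)) (z a) b y = z y.
    by move=> [*]; rewrite /addarc /unarc !eqbF.
  by rewrite E // E //; case: p => *; split; rewrite ?hx.
- by apply: cj_inv => //; apply: swK.
Qed.

Lemma tau_out z a b u : inv z -> rect z a b -> generic z a b u -> tau z a b u = z u.
Proof.
move=> zK r; move: a b r u; apply: canon_ind => // [a b ab P u g|a b ab u]; last exact: tau_generic.
by rewrite -(tau_sym zK ab) P //; case: g => *; split; rewrite ?zK.
Qed.

Lemma swL a b : sw a b a = b.
Proof. by rewrite /sw Z.eqb_refl. Qed.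

Lemma swR a b : sw a b b = a.
Proof. by rewrite /sw Z.eqb_refl; case: Z.eqb_spec. Qed.

(** Visible pairs, a restricted kind of inversion. The inequality is strict when [sp] holds, so that
    an arc is not visible by itself and the base matching has no visible pair. *)
Definition vis (sp : bool) (z : Z -> Z) i j : Prop :=
  i < j /\ (if sp then z j < Z.min i (z i) else z j <= Z.min i (z i)).

(** * Parent and children of an involution at its last visible pair *)

Section Step.
Variables (sp : bool) (z : Z -> Z) (q r : Z).
Hypotheses (zK : inv z) (fpf : sp -> forall x, z x <> x).
Hypotheses (vqr : vis sp z q r) (maxr : forall j, vis sp z q j -> j <= r)
           (maxq : forall i j, vis sp z i j -> i <= q).
Let p := z r.
Let k := z q.

(** Undoes, at the last visible pair (q, r), the cover that leads to z: [parent_tau] recovers z. An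
    arc joining q and r is cut, otherwise q and r are exchanged. *)
Definition parent : Z -> Z := if z q =? r then unarc z q r else cj (sw q r) z.
Let y := parent.

Let zp : z p = r. Proof. by rewrite /p zK. Qed.
Let zk : z k = q. Proof. by rewrite /k zK. Qed.

(** Maximality of (q, r) leaves an arc (q, r), a fixed point q inside an arc ending at r, two nested
    arcs with right ends q < r, or, without fixed points, two crossing arcs with p < q < r < k. *)
Lemma step_cases : q < r /\
  [\/ [/\ sp = false, k = r & p = q], [/\ sp = false, k = q & p < q],
      p < k < q | [/\ sp = true, p < q & r < k]].
Proof.
have [lt le] := vqr; split=> //; rewrite -/p -/k in le.
have n1 : p = k -> q = r by rewrite /p /k => /(inv_eq zK).
have n2 : k = r -> p = q by rewrite /k /p => <-; rewrite zK.
have n3 : p = q -> k = r by rewrite /k => <-; rewrite zp.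
case E : sp le maxr maxq fpf => /= le mr mq fp.
  have k1 := fp isT q; rewrite -/k in k1.
  have [h|[h|h]] : k < q \/ q < k < r \/ r < k by lia.
  - by apply: Or43; lia.
  - by have := mq k r; rewrite /vis zk -/p; lia.
  - by apply: Or44; split=> //; lia.
have [h|[h|[h|h]]] : k = r \/ k = q \/ k < q \/ (q < k /\ k <> r) by lia.
- by apply: Or41; split=> //; apply: n2.
- by apply: Or42; split=> //; lia.
- by apply: Or43; lia.
have h1 := mr k; rewrite /vis zk -/k in h1; have h2 := mq k r; rewrite /vis zk -/p in h2.
by lia.
Qed.

Lemma mid_lt e : q < e < r -> z e < p.
Proof.
move=> he; have := maxq (i := e) (j := r); rewrite /vis -/p.
have [_ le] := vqr; rewrite -/p -/k in le.
have : z e <> p by rewrite /p => /(inv_eq zK); lia.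
by case: (sp) le => le; lia.
Qed.

Lemma far_gt x : r < x -> x <> k -> Z.min q k < z x.
Proof.
move=> hx n; have := maxr (j := x); rewrite /vis -/k.
have n1 : z x <> q by move=> e; apply: n; rewrite /k -e zK.
have n2 : z x <> k by rewrite /k => /(inv_eq zK); have := vqr; rewrite /vis; lia.
by have := vqr; rewrite /vis; case: (sp); lia.
Qed.

Lemma no_start g : sp = false -> q < g -> z g <= g.
Proof. by move=> e hg; have := maxq (i := g) (j := z g); rewrite /vis e zK; lia. Qed.

Lemma under_k g : r < k -> sp = true -> q < g < k -> z g < q.
Proof.
move=> h e hg; have := maxq (i := g) (j := k); rewrite /vis e zk.
have : z g <> q by move=> e'; have := zK g; rewrite e' -/k; lia.
by lia.
Qed.

Lemma parent_inv : inv y.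
Proof.
rewrite /y /parent; case: Z.eqb_spec => e; first exact: unarc_inv.
by apply: cj_inv => //; apply: swK.
Qed.

Lemma parent_q : y q = p.
Proof.
have [lt C] := step_cases; rewrite /y /parent -/k; case: Z.eqb_spec => e.
  by rewrite /unarc Z.eqb_refl; case: C => [[]|[]||[]]; lia.
rewrite /cj; have -> : sw q r q = r by rewrite /sw; zall.
by rewrite -/p swN //; case: C => [[]|[]||[]]; lia.
Qed.

Lemma parent_r : y r = if k =? q then r else k.
Proof.
have [lt C] := step_cases; rewrite /y /parent -/k; case: Z.eqb_spec => e.
  by rewrite /unarc; zall.
rewrite /cj; have -> : sw q r r = q by rewrite /sw; zall.
by rewrite -/k /sw; zall.
Qed.

Lemma parent_k : k <> q -> k <> r -> y k = r.
Proof.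
move=> n1 n2; rewrite /y /parent (eqbF n2) /cj (swN n1) // zk /sw; zall.
Qed.

Lemma parent_out e : e <> q -> e <> r -> e <> p -> e <> k -> y e = z e.
Proof.
move=> n1 n2 n3 n4; rewrite /y /parent; case: Z.eqb_spec => h; first by rewrite /unarc !eqbF.
rewrite /cj (swN n1 n2) swN // => h'; [apply: n4|apply: n3].
  by rewrite /k -h' zK.
by rewrite /p -h' zK.
Qed.

Lemma parent_mid e : q < e < r -> y e = z e /\ z e < p.
Proof.
move=> he; have h := mid_lt he; split=> //.
have [lt C] := step_cases; apply: parent_out; try lia.
  by case: C => [[]|[]||[]]; lia.
move=> e'; have := zk; rewrite -e' => h'; move: h; rewrite h'.
by case: C => [[]|[]||[]]; lia.
Qed.

Lemma parent_rect : rect y q r.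
Proof.
have [lt C] := step_cases; split=> //.
  by rewrite parent_q parent_r; case: Z.eqb_spec; case: C => [[]|[]||[]]; lia.
by move=> e he; rewrite parent_q; have [-> h] := parent_mid he; lia.
Qed.

Lemma parent_tau : tau y q r = z.
Proof.
have [lt C] := step_cases.
have eT a b : a < b -> (a <? b) = true by move=> h; apply/Z.ltb_spec0.
have eF a b : b <= a -> (a <? b) = false by move=> h; apply/Z.ltb_spec0; lia.
have yE : k <> r -> cj (sw q r) y = z.
  by move=> n; rewrite /y /parent (eqbF n) cjK //; apply: swK.
rewrite /tau parent_q parent_r.
case: C => [[_ h1 h2]|[_ h1 h2]|h|[_ h1 h2]].
- rewrite h2 h1 (eqbF (x := r)); last lia.
  rewrite !Z.eqb_refl; apply: functional_extensionality => x.
  have e1 : z q = r by [].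
  have e2 : z r = q by rewrite -e1 zK.
  by rewrite /addarc /y /parent e1 Z.eqb_refl /unarc; zall.
- rewrite h1 !Z.eqb_refl (eqbF (x := p)); last lia.
  by rewrite Z.max_l; last lia; rewrite yE //; lia.
- rewrite (eqbF (x := k)); last lia.
  rewrite !eqbF; try lia.
  by rewrite eF ?yE //; lia.
rewrite (eqbF (x := k)); last lia.
rewrite !eqbF; try lia.
by rewrite eT ?(eF q p) ?(eT r k) ?yE //=; lia.
Qed.

(** Another x would produce a visible pair of z beyond (q, r), so the positive side of the
    transition for the parent at q reduces to z. The exception x = k belongs to crossing arcs: there
    the cover fuses the arcs (p, q) and (r, k) of the parent and leaves q fixed, so it counts
    zero. *)
Lemma parent_pos x : rect y q x -> x = r \/ [/\ sp = true, x = k & r < k].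
Proof.
move=> [lt ylt h]; have [ltr C] := step_cases; rewrite parent_q in ylt.
have [//|n] := Z.eqb_spec x r; first by left.
have [l|l] : x < r \/ r < x by lia.
  have [e h'] : y x = z x /\ z x < p by apply: parent_mid; lia.
  by exfalso; lia.
have hr := h r; rewrite parent_q parent_r in hr.
have [e|nk] := Z.eqb_spec x k.
  by right; split=> //; [case: C => [[_ h1 _]|[_ h1 _]|h1|[]//]; exfalso; lia | lia].
have nq : x <> q by lia.
have np : x <> p by case: C => [[]|[]||[]]; lia.
have yx : y x = z x by apply: parent_out.
have hf := far_gt l nk.
have nzr : z x <> r by move=> e; apply: np; rewrite /p -e zK.
rewrite yx in hr ylt.
have zx := zK x.
exfalso; case: C => [[e h1 h2]|[e h1 h2]|h1|[e h1 h2]].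
- rewrite (eqbF (x := k)) in hr; last lia.
  by have := no_start (g := z x) e; rewrite zx; lia.
- rewrite h1 Z.eqb_refl in hr.
  by have := no_start (g := z x) e; rewrite zx; lia.
- by rewrite (eqbF (x := k)) in hr; lia.
rewrite (eqbF (x := k)) in hr; last lia.
have nzk : z x <> k by rewrite /k => /(inv_eq zK); lia.
have [l1|l1] : z x < k \/ k < z x by lia.
  by have := under_k (g := z x) h2 e; rewrite zx; lia.
by lia.
Qed.

Lemma parent_pos_fixed : sp = true -> r < k -> tau y q k q = q.
Proof.
move=> e h; have [ltr C] := step_cases.
have {}C : p < q by case: C => [[]|[]||[]]; lia.
rewrite /tau parent_q parent_k; try lia.
rewrite !eqbF; try lia.
have -> : Z.max q p <? Z.min k r = true by apply/Z.ltb_spec0; lia.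
have -> : q <? p = false by apply/Z.ltb_spec0; lia.
have -> : k <? r = false by apply/Z.ltb_spec0; lia.
by rewrite /= /addarc /unarc; zall.
Qed.

Section Child.
Variable x : Z.
Hypotheses (xq : x < q) (rx : rect y x q).
Let w := tau y x q.
Let i := y x.

Lemma child_lt : i < p.
Proof. by case: rx => _; rewrite parent_q. Qed.

Lemma child_out e : q < e -> w e = y e.
Proof.
move=> he; have h := child_lt; have [lt C] := step_cases.
have pq : p <= q by case: C => [[]|[]||[]]; lia.
have yK := parent_inv; have yq := parent_q.
apply: tau_out => //; split; rewrite ?yq -/i; try lia.
- by move=> e'; have := yK e; rewrite e' -/i; lia.
- by move=> e'; have := yK e; rewrite e' yq; lia.
- by move=> /(inv_eq yK); lia.
move=> e'; have h2 : e = q by apply: (inv_eq yK); rewrite e' yq.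
by lia.
Qed.

Lemma child_q : w q < p.
Proof.
have h := child_lt; have [lt C] := step_cases.
have pq : p <= q by case: C => [[]|[]||[]]; lia.
have yK := parent_inv; have yq := parent_q; have yp : y p = q by rewrite -yq yK.
have yi : y i = x by rewrite /i yK.
rewrite /w /tau yq -/i.
case: Z.eqb_spec => e1; case: Z.eqb_spec => e2.
- rewrite /addarc (eqbF (x := q) (y := x)) ?Z.eqb_refl; lia.
- rewrite Z.min_r; last lia.
  by rewrite /cj (@swN x p q) ?yq /sw ?(eqbF (x := p) (y := x)) ?Z.eqb_refl; lia.
- have [l|l] : i < x \/ x < i by lia.
    by rewrite Z.max_l; [|lia]; rewrite /cj; rewrite swR -/i swN; lia.
  by rewrite Z.max_r; [|lia]; rewrite /cj; rewrite swR yi swN; lia.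
have cjq : cj (sw x q) y q < p.
  by rewrite /cj; rewrite swR -/i swN; lia.
case: Z.ltb_spec => l; last by [].
case: ifP => // _.
rewrite /addarc /unarc (eqbF (x := q) (y := Z.min x i)) ?(Z.max_l q) ?Z.eqb_refl; lia.
Qed.

(** With [child_maxq], the last visible pair of a child precedes (q, r) lexicographically, which
    makes the recursion stop. Right of q the child agrees with the parent, and its value at q has
    dropped below p. *)
Lemma child_maxr j : vis sp w q j -> j < r.
Proof.
move=> [lt le]; have h := child_q; have [ltr C] := step_cases.
rewrite child_out // in le.
have {}le : y j < p by move: le; case: (sp); lia.
have [//|[e|l]] : j < r \/ j = r \/ r < j by lia.
  by move: le; rewrite e parent_r; case: Z.eqb_spec; case: C => [[]|[]||[]]; lia.
have [e|nk] := Z.eqb_spec j k.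
  by move: le; rewrite e parent_k; case: C => [[]|[]||[]]; lia.
have hf := far_gt l nk; move: le; rewrite parent_out //; try lia.
  by case: C => [[]|[]||[]]; lia.
by case: C => [[]|[]||[]]; lia.
Qed.

Lemma child_maxq e j : vis sp w e j -> e <= q.
Proof.
move=> v; have [//|he] := Z.le_gt_cases e q; exfalso; move: v => [lt].
have [ltr C] := step_cases; have pq : p <= q by case: C => [[]|[]||[]]; lia.
rewrite !child_out; try lia; move=> {}v.
have le : y j <= Z.min e (y e) by move: v; case: (sp); lia.
have zj := zK j; have ze := zK e.
have [j1|[j1|j1]] : j < r \/ j = r \/ r < j by lia.
- have [y1 l1] : y j = z j /\ z j < p by apply: parent_mid; lia.
  have [y2 l2] : y e = z e /\ z e < p by apply: parent_mid; lia.
  by rewrite y1 y2 in v; have := maxq (conj lt v); lia.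
- have [y2 l2] : y e = z e /\ z e < p by apply: parent_mid; lia.
  by move: le; rewrite j1 parent_r y2; case: Z.eqb_spec; case: C => [[]|[]||[]]; lia.
have [jk|nk] := Z.eqb_spec j k.
  have h1 : r < k by lia.
  have h2 : sp = true by case: C => [[_ h2 _]|[_ h2 _]|h2|[]//]; exfalso; lia.
  move: v le; rewrite h2 jk parent_k; try lia; move=> v _.
  have ye : y e = z e by apply: parent_out; lia.
  by have := under_k (g := e) h1 h2; lia.
have hf := far_gt j1 nk; have yj : y j = z j by apply: parent_out; lia.
rewrite yj in v le.
have [e1|ne1] := Z.eqb_spec e r.
  move: v le; rewrite e1 parent_r => v le.
  case: C => [[h h1 h2]|[h h1 h2]|h1|[h h1 h2]].
  - rewrite (eqbF (x := k)) in le; last lia.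
    have n : z j <> r by move=> e'; move: zj; rewrite e' -/p; lia.
    by have := no_start (g := z j) h; rewrite zj; lia.
  - rewrite h1 Z.eqb_refl in le.
    have n : z j <> r by move=> e'; move: zj; rewrite e' -/p; lia.
    by have := no_start (g := z j) h; rewrite zj; lia.
  - by rewrite (eqbF (x := k)) in le; lia.
  have n : z j <> r by move=> e'; move: zj; rewrite e' -/p; lia.
  by have := under_k (g := z j) h2 h; rewrite zj; lia.
have [ek|nek] := Z.eqb_spec e k.
  have h1 : q < k by lia.
  have [h2 h3] : sp = true /\ r < k by case: C => [[_ h2 _]|[_ h2 _]|h2|[]//]; exfalso; lia.
  move: v le; rewrite ek parent_k; try lia; move=> v le.
  have n : z j <> r by move=> e'; move: zj; rewrite e' -/p; lia.
  by have := under_k (g := z j) h3 h2; rewrite zj; lia.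
have ye : y e = z e by apply: parent_out; lia.
by rewrite ye in v; have := maxq (conj lt v); lia.
Qed.
End Child.
End Step.

(** * Covers before and after stripping a letter *)

Section Conj.
Variables (z : Z -> Z) (i : Z).
Hypotheses (zK : inv z) (di : dsc z i) (ni : z i <> i + 1).
Let s := sw i (i + 1).
Let v := cj s z.

Lemma tau_strip_conj a b : rect z a b ->
  (dsc (tau z a b) i <-> rect v (s a) (s b)) /\
  (dsc (tau z a b) i -> strip (tau z a b) i = tau v (s a) (s b)).
Proof.
have vK : inv v by apply: cj_inv => //; apply: swK.
have vs x : s (z x) = v (s x) by rewrite /v /cj /s swK.
move: a b; apply: canon_ind => // [a b ab [P1 P2]|a b ab].
  rewrite (tau_sym zK ab) !vs in P1 P2.
  have E : rect v (s a) (s b) <-> rect v (v (s a)) (v (s b)).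
    by split=> [/(rect_sym vK)//|/(rect_sym vK)]; rewrite !vK.
  split=> [|d]; first by rewrite E.
  by rewrite P2 // tau_sym //; apply/E/P1.
have [r _ _] := ab; have di1 := di; rewrite /dsc in di1.
split=> [|d]; last exact: strip_tau_canon.
rewrite (dsc_tau zK di ni ab); split=> [|r'].
  exact: rect_strip.
have [lt zlt _] := r; have := @rect_strip_inv _ i zK di ni a b lt zlt.
case=> //.
- by case=> e1 e2; subst a b; lia.
- by case=> e1 e2; move: lt; rewrite -(zK a) -(zK b) e1 e2; lia.
Qed.

(** Besides the covers inherited from z, the stripped involution has, up to symmetry, only the cover
    through the adjacent transposition. That one leads back to z and causes the correction term in
    [gterm_conj]. *)
Lemma rect_conj_special a b : rect v (s a) (s b) ->
  [\/ rect z a b, s a = i /\ s b = i + 1 | s (z a) = i /\ s (z b) = i + 1].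
Proof.
move=> r; have vs x : v (s x) = s (z x) by rewrite /v /cj /s swK.
have sub x y : s x < s y -> x < y \/ (s x = i /\ s y = i + 1).
  by rewrite /s /sw; repeat zcase; lia.
have [lt zlt _] := r; rewrite !vs in zlt.
have [{}lt|sp] := sub _ _ lt; last by apply: Or32.
have [{}zlt|sp] := sub _ _ zlt; last by apply: Or33.
apply: Or31; have [] // := @rect_strip_inv _ i zK di ni a b lt zlt.
- by case=> e1 e2; move: di zlt; rewrite /dsc e1 e2; lia.
- by case=> e1 e2; move: di lt; rewrite /dsc -(zK a) -(zK b) e1 e2; lia.
Qed.
End Conj.

Section Ascent.
Variables (z : Z -> Z) (i : Z).
Hypotheses (zK : inv z) (asc : z i < z (i + 1)).

Lemma rect_adjacent : rect z i (i + 1).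
Proof. by split=> //; lia. Qed.

Lemma tau_adjacent : (z i = i -> z (i + 1) = i + 1 -> False) ->
  tau z i (i + 1) = cj (sw i (i + 1)) z.
Proof.
move=> n; have hi := zK i; have hj := zK (i + 1).
have n1 : z (i + 1) <> i by move=> e; move: hj; rewrite e; lia.
rewrite /tau; case: Z.eqb_spec => e1; case: Z.eqb_spec => e2; try (exfalso; exact: n e1 e2).
- by rewrite Z.min_l //; lia.
- by rewrite Z.max_l //; lia.
case: Z.ltb_spec => // l; case: ifP => //.
by case: (Z.ltb_spec i (z i)) => l1; case: (Z.ltb_spec (i + 1) (z (i + 1))) => l2 //= _; exfalso; lia.
Qed.

Lemma strip_tau_adjacent :
  dsc (tau z i (i + 1)) i /\ strip (tau z i (i + 1)) i = z.
Proof.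
have hi := zK i; have hj := zK (i + 1).
have [[e1 e2]|n] : (z i = i /\ z (i + 1) = i + 1) \/ (z i = i -> z (i + 1) = i + 1 -> False) by lia.
  have -> : tau z i (i + 1) = addarc z i (i + 1) by rewrite /tau !(proj2 (Z.eqb_eq _ _)).
  split; first by rewrite /dsc /addarc; zall.
  rewrite /strip {1}/addarc Z.eqb_refl Z.eqb_refl.
  by apply: functional_extensionality => x; rewrite /unarc /addarc; zall.
rewrite (tau_adjacent n).
split.
  rewrite /dsc /cj; have -> : sw i (i + 1) (i + 1) = i by rewrite /sw; zall.
  have -> : sw i (i + 1) i = i + 1 by rewrite /sw; zall.
  by rewrite /sw; repeat zcase; lia.
rewrite /strip; have -> : (cj (sw i (i + 1)) z i =? i + 1) = false; last by rewrite cjK //; apply: swK.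
apply: eqbF; rewrite /cj; have -> : sw i (i + 1) i = i + 1 by rewrite /sw; zall.
move=> e; have : z (i + 1) = i by move: e; rewrite /sw; repeat zcase; lia.
by move=> e'; move: hj; rewrite e'; lia.
Qed.

(** So [Dop] at an ascent of z sees a single cover up to symmetry, and by [strip_tau_adjacent] that
    cover strips back to z: another source of the terms [H z] in the transition identities. *)
Lemma dsc_tau_adjacent a b : rect z a b -> dsc (tau z a b) i ->
  (a = i /\ b = i + 1) \/ (z a = i /\ z b = i + 1).
Proof.
move: a b; apply: canon_ind => // [a b ab P d|a b ab].
  by rewrite (tau_sym zK ab) !zK in P; case: (P d) => ?; [right|left].
have [[lt zlt h] le1 le2] := ab.
have h1 := zK i; have h2 := zK (i + 1); have h3 := zK a; have h4 := zK b.
have hi := h i; have hj := h (i + 1); have hi' := h (z i); have hj' := h (z (i + 1)); rewrite h1 in hi'; rewrite h2 in hj'; clear h.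
rewrite /dsc; have T := tau_canon zK ab; have asc1 := asc.
case: (point_cases a b i zK) => [[p1 p2]|[[p1 p2]|[[p1 p2]|[[p1 p2]|p1]]]];
case: (point_cases a b (i + 1) zK) => [[p3 p4]|[[p3 p4]|[[p3 p4]|[[p3 p4]|p3]]]].
all: try (exfalso; lia).
all: try (by left; lia). all: try (by right; lia).
all: try (rewrite (tau_generic zK ab p1)).
all: try (rewrite (tau_generic zK ab p3)).
all: try (by move=> ?; exfalso; lia).
all: clear h1 h2.
all: (case: T => [[ea eb E]|[l1 l2 E]|[l1 l2 E]]; rewrite ?E {E}; try (exfalso; lia)).
all: have [ea'|la] : z a = a \/ z a < a by lia.
all: have [eb'|[lb|lb]] : z b = b \/ z b < b \/ b < z b by lia.
all: try (exfalso; lia).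
all: clear l2 le1 le2 || clear le1 le2; move: hi hj hi' hj'.
all: rewrite /addarc ?/unarc ?/cj /sw; zprune; rewrite ?h3 ?h4; zprune; try (by move=> *; exfalso; lia).
all: try (by move=> *; left; split; lia); try (by move=> *; right; split; lia).
all: repeat match goal with n : _ <> _ |- _ => clear n end.
all: match goal with p : generic _ _ _ _ |- _ =>
  move=> hi hj hi' hj' hd; exfalso; have nba : z b <> a by (move=> e; move: h4; rewrite e; lia); try (exfalso; congruence); clear nba;
  first [ (have := gen_b p; lia) | (have := gen_ua p; have := gen_uza p; lia) | (have := gen_ub p; have := gen_uzb p; lia) | (have := gen_za p; have := gen_zb p; lia) | (have := gen_ua p; have := gen_ub p; lia)
   | (have := gen_za p; have := gen_ub p; lia) | (have := gen_a p; have := gen_b p; lia) | (have := gen_uza p; have := gen_uzb p; lia) | idtac ] end.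
by [].
Qed.
End Ascent.

(** * Cutting an arc that joins i and i+1 *)

Section Removal.
Variables (z : Z -> Z) (i : Z).
Hypotheses (zK : inv z) (zi : z i = i + 1).
Let v := unarc z i (i + 1).

Let zj : z (i + 1) = i.
Proof. by rewrite -zi zK. Qed.
Let vi : v i = i.
Proof. by rewrite /v /unarc Z.eqb_refl. Qed.
Let vj : v (i + 1) = i + 1.
Proof. by rewrite /v /unarc; zall. Qed.
Let ve e : e <> i -> e <> i + 1 -> v e = z e.
Proof. by move=> n1 n2; rewrite /v /unarc !eqbF. Qed.
Let zn e : e <> i -> e <> i + 1 -> z e <> i /\ z e <> i + 1.
Proof. by move=> n1 n2; split=> h; have := zK e; rewrite h ?zi ?zj; lia. Qed.

Lemma strip_removal : strip z i = v.
Proof. by rewrite /strip zi Z.eqb_refl. Qed.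

Lemma rect_removal a b : a <> i -> a <> i + 1 -> b <> i -> b <> i + 1 ->
  rect z a b <-> rect v a b.
Proof.
move=> a1 a2 b1 b2; have [na na'] := zn a1 a2; have [nb nb'] := zn b1 b2.
rewrite /rect (ve a1 a2) (ve b1 b2); split=> -[lt zlt h]; split=> // e he.
  have [e1|n1] := Z.eqb_spec e i; first by rewrite e1 in he *; rewrite vi; have := h i; rewrite zi; lia.
  have [e1|n2] := Z.eqb_spec e (i + 1); first by rewrite e1 in he *; rewrite vj; have := h (i + 1); rewrite zj; lia.
  by rewrite ve // => k; apply: (h e he k).
have [e1|n1] := Z.eqb_spec e i; first by rewrite e1 in he *; rewrite zi; have := h i; rewrite vi; lia.
have [e1|n2] := Z.eqb_spec e (i + 1); first by rewrite e1 in he *; rewrite zj; have := h (i + 1); rewrite vj; lia.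
by rewrite -(ve n1 n2); apply: h.
Qed.

Lemma tau_removal a b : a <> i -> a <> i + 1 -> b <> i -> b <> i + 1 ->
  tau z a b i = i + 1 /\ unarc (tau z a b) i (i + 1) = tau v a b.
Proof.
move=> a1 a2 b1 b2; have [na na'] := zn a1 a2; have [nb nb'] := zn b1 b2.
have cu (u : Z -> Z) p q : p <> i -> p <> i + 1 -> q <> i -> q <> i + 1 ->
    cj (sw p q) u i = sw p q (u i) /\ unarc (cj (sw p q) u) i (i + 1) = cj (sw p q) (unarc u i (i + 1)).
  move=> p1 p2 q1 q2; split; first by rewrite /cj (swN (x := i)) //; lia.
  by rewrite cj_unarc ?(@swN p q i) ?(@swN p q (i+1)) //; try lia; apply: swK.
have au (u : Z -> Z) p q : p <> i -> p <> i + 1 -> q <> i -> q <> i + 1 ->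
    addarc u p q i = u i /\ unarc (addarc u p q) i (i + 1) = addarc (unarc u i (i + 1)) p q.
  move=> p1 p2 q1 q2; split; first by rewrite /addarc !eqbF //; lia.
  by apply: functional_extensionality => x; rewrite /unarc /addarc; zall.
have uu (u : Z -> Z) p q : p <> i -> p <> i + 1 -> q <> i -> q <> i + 1 ->
    unarc u p q i = u i /\ unarc (unarc u p q) i (i + 1) = unarc (unarc u i (i + 1)) p q.
  move=> p1 p2 q1 q2; split; first by rewrite /unarc !eqbF //; lia.
  by apply: functional_extensionality => x; rewrite /unarc; zall.
have swi p q : p <> i -> p <> i + 1 -> q <> i -> q <> i + 1 -> sw p q (i + 1) = i + 1.
  by move=> *; rewrite swN //; lia.
have mn p q c : p <> c -> q <> c -> Z.min p q <> c by lia.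
have mx p q c : p <> c -> q <> c -> Z.max p q <> c by lia.
have ha := ve a1 a2; have hb := ve b1 b2; rewrite /tau ha hb.
have C p q : p <> i -> p <> i + 1 -> q <> i -> q <> i + 1 ->
    cj (sw p q) z i = i + 1 /\ unarc (cj (sw p q) z) i (i + 1) = cj (sw p q) v.
  by move=> p1 p2 q1 q2; have [-> ->] := cu z _ _ p1 p2 q1 q2; rewrite zi swi.
have A p q : p <> i -> p <> i + 1 -> q <> i -> q <> i + 1 ->
    addarc z p q i = i + 1 /\ unarc (addarc z p q) i (i + 1) = addarc v p q.
  by move=> p1 p2 q1 q2; have [-> ->] := au z _ _ p1 p2 q1 q2; rewrite zi.
case: Z.eqb_spec => e1; case: Z.eqb_spec => e2; try (by apply: A); try (by apply: C; auto).
case: Z.ltb_spec => l; last by apply: C.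
case: ifP => _; last by apply: C.
have [|||| -> ->] := au (unarc z (Z.max a (z a)) (Z.min b (z b))) (Z.min a (z a)) (Z.max b (z b)); auto.
by have [|||| -> ->] := uu z (Z.max a (z a)) (Z.min b (z b)); auto.
Qed.

Lemma rect_removal_left r : r <> i -> r <> i + 1 ->
  [/\ rect z r i <-> rect v r i, rect z r (i + 1) <-> rect v r i & ~ rect v r (i + 1)].
Proof.
move=> n1 n2; have [m1 m2] := zn n1 n2; rewrite /rect (ve n1 n2) vi vj zi zj.
split.
- split=> -[lt zlt h]; split; try lia; move=> e he.
    by rewrite ve; [have := h e he; lia|lia|lia].
  have [k1 k2] : z e <> i /\ z e <> i + 1 by apply: zn; lia.
  by have := h e he; rewrite ve; lia.
- split=> -[lt zlt h]; split; try lia; move=> e he.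
    by rewrite ve; [apply: h; lia|lia|lia].
  have [e1|n] := Z.eqb_spec e i; first by rewrite e1 zi; lia.
  have [k1 k2] : z e <> i /\ z e <> i + 1 by apply: zn; lia.
  by have := h e; rewrite ve; lia.
by move=> [lt zlt h]; apply: (h i); [lia | rewrite vi; lia].
Qed.

Lemma rect_removal_right r : r <> i -> r <> i + 1 ->
  [/\ rect z i r <-> rect v (i + 1) r, rect z (i + 1) r <-> rect v (i + 1) r & ~ rect v i r].
Proof.
move=> n1 n2; have [m1 m2] := zn n1 n2; rewrite /rect (ve n1 n2) vi vj zi zj.
split.
- split=> -[lt zlt h]; split; try lia; move=> e he.
    by rewrite ve; [apply: h; lia|lia|lia].
  have [e1|n] := Z.eqb_spec e (i + 1); first by rewrite e1 zj; lia.
  have [k1 k2] : z e <> i /\ z e <> i + 1 by apply: zn; lia.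
  by have := h e; rewrite ve; lia.
- split=> -[lt zlt h]; split; try lia; move=> e he.
    by rewrite ve; [have := h e he; lia|lia|lia].
  have [k1 k2] : z e <> i /\ z e <> i + 1 by apply: zn; lia.
  by have := h e he; rewrite ve; lia.
by move=> [lt zlt h]; apply: (h (i + 1)); [lia | rewrite vj; lia].
Qed.

Let zr r x : x <> r -> x <> z r -> z x <> r.
Proof. by move=> n1 n2 e; apply: n2; rewrite -e zK. Qed.

(** The two covers of z coincide and strip to a single cover of v, in which r and i are both fixed:
    this is the origin of the weight 2. *)
Lemma removal_fixed_left r : r < i -> z r = r ->
  [/\ tau z r (i + 1) = tau z r i, dsc (tau z r i) i & strip (tau z r i) i = tau v r i].
Proof.
move=> lt e; rewrite /tau (ve (e := r)) ?e ?Z.eqb_refl ?vi ?Z.eqb_refl ?zi ?zj; try lia.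
rewrite !eqbF; try lia.
rewrite (Z.min_l i) ?(Z.min_r (i + 1)); try lia.
have ti : cj (sw r i) z i = i by rewrite /cj /sw; zall.
split=> //; first by rewrite /dsc ti /cj (swN (x := i + 1)) ?zj /sw; zall.
rewrite /strip ti eqbF; last by lia.
apply: functional_extensionality => x; rewrite /addarc.
have [->|x1] := Z.eqb_spec x r; first by rewrite /cj /v /addarc /unarc /sw; zall.
have [->|x2] := Z.eqb_spec x i; first by rewrite /cj /v /addarc /unarc /sw; zall.
have [->|x3] := Z.eqb_spec x (i + 1).
  by rewrite vj; clear ti; rewrite /cj /v /addarc /unarc /sw; zall.
have [k1 k2] := zn x2 x3; have k3 : z x <> r by apply: zr; rewrite ?e.
by rewrite ve // /cj (swN (x := x)) // (@swN _ _ x) // (@swN _ _ (z x)) // swN.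
Qed.

(** Here r is not fixed, so the cover of v has weight 1; accordingly only one of the two covers of z
    has a descent to strip. *)
Lemma removal_right_end r : z r < r -> r < i ->
  [/\ ~ dsc (tau z r i) i, dsc (tau z r (i + 1)) i & strip (tau z r (i + 1)) i = tau v r i].
Proof.
move=> lt1 lt2; rewrite /tau (ve (e := r)) ?vi ?zi ?zj; try lia.
rewrite Z.eqb_refl !(@eqbF (z r) r) ?(@eqbF (i + 1) i) ?(@eqbF i (i + 1)); try lia.
rewrite (Z.min_l i) ?(Z.min_r (i + 1)) ?(Z.max_l r) ?(Z.max_l (i + 1)) ?(Z.min_r r); try lia.
have -> : (r <? i) = true by apply/Z.ltb_spec0.
have -> : (r <? z r) = false by apply/Z.ltb_spec0; lia.
have -> : (i <? i + 1) = true by apply/Z.ltb_spec0; lia.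
have -> : (i + 1 <? i) = false by apply/Z.ltb_spec0; lia.
rewrite /=; have hr := zK r.
have ti : addarc (unarc z r i) (z r) (i + 1) i = i by rewrite /addarc /unarc; zall.
split.
- by rewrite /dsc /cj (@swN _ _ (i + 1)) ?zj /sw; zall.
- by rewrite /dsc ti /addarc; zall.
rewrite /strip ti eqbF; last by lia.
apply: functional_extensionality => x.
have [->|x1] := Z.eqb_spec x r.
  by rewrite /cj /v /addarc /unarc /sw; zall.
have [->|x2] := Z.eqb_spec x i.
  by rewrite /cj /v /addarc /unarc /sw; zall.
have [->|x3] := Z.eqb_spec x (i + 1).
  by rewrite /cj /v /addarc /unarc /sw; zall.
have [->|x4] := Z.eqb_spec x (z r).
  by rewrite /cj (@swN _ _ (z r)) ?(@swN _ _ (z r)) ?ve /addarc ?Z.eqb_refl ?hr /sw; zall.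
have [k1 k2] := zn x2 x3; have k3 : z x <> r by apply: zr.
rewrite /cj (swN (x := x)) // (@swN _ _ x) // ve // (@swN _ _ (z x)) //.
by rewrite /addarc /unarc !eqbF // swN.
Qed.

Lemma removal_fixed_right r : i + 1 < r -> z r = r ->
  [/\ tau z i r = tau z (i + 1) r, dsc (tau z i r) i & strip (tau z i r) i = tau v (i + 1) r].
Proof.
move=> lt e; rewrite /tau (ve (e := r)) ?e ?Z.eqb_refl ?vj ?Z.eqb_refl ?zi ?zj; try lia.
rewrite !eqbF; try lia.
rewrite (Z.max_r i) ?(Z.max_l (i + 1)); try lia.
have tj : cj (sw (i + 1) r) z (i + 1) = i + 1 by rewrite /cj /sw; zall.
have ti : cj (sw (i + 1) r) z i = r by rewrite /cj (@swN _ _ i) ?zi /sw; zall.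
split=> //; first by rewrite /dsc ti tj; lia.
rewrite /strip ti eqbF; last by lia.
apply: functional_extensionality => x; rewrite /addarc.
have [->|x2] := Z.eqb_spec x (i + 1); first by rewrite /cj /v /addarc /unarc /sw; zall.
have [->|x1] := Z.eqb_spec x r; first by rewrite /cj /v /addarc /unarc /sw; zall.
have [->|x3] := Z.eqb_spec x i.
  by rewrite vi; clear ti tj; rewrite /cj /v /addarc /unarc /sw; zall.
have [k1 k2] := zn x3 x2; have k3 : z x <> r by apply: zr; rewrite ?e.
by rewrite ve // /cj (swN (x := x)) // (@swN _ _ x) // (@swN _ _ (z x)) // swN.
Qed.

Lemma removal_left_end r : i + 1 < r -> r < z r ->
  [/\ ~ dsc (tau z (i + 1) r) i, dsc (tau z i r) i & strip (tau z i r) i = tau v (i + 1) r].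
Proof.
move=> lt1 lt2; rewrite /tau (ve (e := r)) ?vj ?zi ?zj; try lia.
rewrite Z.eqb_refl !(@eqbF (z r) r) ?(@eqbF (i + 1) i) ?(@eqbF i (i + 1)); try lia.
rewrite (Z.max_r i) ?(Z.max_l (i + 1)) ?(Z.min_l r) ?(Z.max_r r) ?(Z.min_l i); try lia.
have -> : (i + 1 <? r) = true by apply/Z.ltb_spec0.
have -> : (r <? z r) = true by apply/Z.ltb_spec0; lia.
have -> : (i <? i + 1) = true by apply/Z.ltb_spec0; lia.
have -> : (i + 1 <? i) = false by apply/Z.ltb_spec0; lia.
rewrite /=; have hr := zK r.
have ti : addarc (unarc z (i + 1) r) i (z r) i = z r by rewrite /addarc /unarc; zall.
have tj : addarc (unarc z (i + 1) r) i (z r) (i + 1) = i + 1 by rewrite /addarc /unarc; zall.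
split.
- by rewrite /dsc /cj (@swN _ _ i) ?zi /sw; zall.
- by rewrite /dsc ti tj; lia.
rewrite /strip ti eqbF; last by lia.
apply: functional_extensionality => x.
have [->|x1] := Z.eqb_spec x r.
  by rewrite /cj /v /addarc /unarc /sw; zall.
have [->|x2] := Z.eqb_spec x i.
  by rewrite /cj /v /addarc /unarc /sw; zall.
have [->|x3] := Z.eqb_spec x (i + 1).
  by rewrite /cj /v /addarc /unarc /sw; zall.
have [->|x4] := Z.eqb_spec x (z r).
  by rewrite /cj (@swN _ _ (z r)) ?(@swN _ _ (z r)) ?ve /addarc ?Z.eqb_refl ?hr /sw; zall.
have [k1 k2] := zn x2 x3; have k3 : z x <> r by apply: zr.
rewrite /cj (swN (x := x)) // (@swN _ _ x) // ve // (@swN _ _ (z x)) //.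
by rewrite /addarc /unarc !eqbF // swN.
Qed.
End Removal.

(** The shape of the negative side kept along the recursion. For ordinary involutions no arc has
    both ends negative; without fixed points such an arc spans only points whose partner is
    nonnegative. This lets the nonnegative side determine a Grassmannian involution. *)
Definition prefix (sp : bool) (z : Z -> Z) : Prop :=
  if sp then forall e u, e < z e -> z e < 0 -> e < u < z e -> 0 <= z u
  else forall e, e < 0 -> e <= z e.

(** * The shape of the negative side along the recursion *)

Section Step.
Variables (sp : bool) (z : Z -> Z) (q r : Z).
Hypotheses (zK : inv z) (fpf : sp -> forall x, z x <> x).
Hypotheses (vqr : vis sp z q r) (maxr : forall j, vis sp z q j -> j <= r)
           (maxq : forall i j, vis sp z i j -> i <= q).
Hypothesis (q0 : 0 <= q).
Let p := z r.
Let k := z q.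
Let y := parent z q r.

Let zp : z p = r. Proof. by rewrite /p zK. Qed.
Let zk : z k = q. Proof. by rewrite /k zK. Qed.
Let C := step_cases zK fpf vqr maxr maxq.
Let yq : y q = p. Proof. exact: parent_q zK fpf vqr maxr maxq. Qed.
Let yr : y r = if k =? q then r else k. Proof. exact: parent_r zK fpf vqr maxr maxq. Qed.
Let yk : k <> q -> k <> r -> y k = r. Proof. exact: parent_k zK. Qed.
Let yo e : e <> q -> e <> r -> e <> p -> e <> k -> y e = z e. Proof. exact: (@parent_out z q r zK e). Qed.
Let yK : inv y. Proof. exact: parent_inv. Qed.
Let yp : y p = q. Proof. by rewrite -yq yK. Qed.

Lemma parent_prefix : prefix sp z -> prefix sp y.
Proof.
have [lt C'] := C; rewrite /prefix; case E : sp C' => C' h.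
  move=> e u l1 l2 l3.
  have {}C' : p < k < q \/ (p < q /\ r < k).
    by case: C' => [[]//|[]//|h0|[_ h1 h2]]; [left|right].
  have kq : k <> q by lia.
  have kr : k <> r by lia.
  have ep : e <> p by move=> e1; move: l2; rewrite e1 yp; lia.
  have ek : e <> k by move=> e1; move: l2; rewrite e1 yk //; lia.
  have ye : y e = z e by apply: yo; lia.
  rewrite ye in l1 l2 l3; have hu := h _ _ l1 l2 l3.
  have [->|n1] := Z.eqb_spec u p; first by rewrite yp.
  have [->|n2] := Z.eqb_spec u k; first by rewrite yk //; lia.
  by rewrite yo; lia.
move=> e he; have [e1|n1] := Z.eqb_spec e p; first by rewrite e1 yp; case: C' => [[]|[]||[]]; lia.
have [e1|n2] := Z.eqb_spec e k; first by rewrite e1 yk; case: C' => [[]|[]||[]]; lia.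
by rewrite yo; try lia; apply: h.
Qed.

Variable x : Z.
Hypotheses (xq : x < q) (rx : rect y x q).
Let w := tau y x q.
Let i := y x.
Let yi : y i = x. Proof. by rewrite /i yK. Qed.
Let ip : i < p. Proof. by case: rx => _; rewrite yq. Qed.
Let pq : p <= q. Proof. by have [_ [[]|[]||[]]] := C; lia. Qed.

(** Sorted by whether x and q are fixed in the parent and whether two arcs are fused. Fusing leaves
    x and p fixed, so a fixed-point-free child arises by conjugation. *)
Lemma child_form :
  [\/ [/\ i = x, p = q & w = addarc y x q] \/ [/\ i = x, p < q & w = cj (sw x p) y],
      [/\ i <> x, p = q & w = cj (sw (Z.max x i) q) y],
      [/\ i < x < p, p < q & w = addarc (unarc y x p) i q] |
      [/\ i <> x, p < q, p < x \/ x < i < p & w = cj (sw x q) y]].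
Proof.
have eT a b : a < b -> (a <? b) = true by move=> h; apply/Z.ltb_spec0.
have eF a b : b <= a -> (a <? b) = false by move=> h; apply/Z.ltb_spec0; lia.
have xp : x <> p by move=> e; move: ip; rewrite /i e yp; lia.
rewrite /w /tau yq -/i.
case: Z.eqb_spec => e1; case: Z.eqb_spec => e2.
- by apply: Or41; left.
- by apply: Or41; right; rewrite Z.min_r; [split=> //; lia | lia].
- by apply: Or42.
case: Z.ltb_spec => l; last by apply: Or44; split=> //; lia.
rewrite (eF q p) //; have [l1|l1] : x < i \/ i < x by lia.
  by rewrite eT //; apply: Or44; split=> //; lia.
rewrite eF /=; last lia.
by apply: Or43; rewrite (Z.max_l x) ?(Z.min_r q) ?(Z.min_r x) ?(Z.max_l q); try lia; split=> //; lia.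
Qed.

Lemma child_gen e : e <> x -> e <> q -> e <> i -> e <> p -> w e = y e.
Proof.
move=> n1 n2 n3 n4; apply: tau_out => //; split; rewrite ?yq //.
- by move=> e'; apply: n3; rewrite /i -e' yK.
- by move=> e'; apply: n4; rewrite -yq -e' yK.
- by move=> e'; apply: n1; apply: (inv_eq yK).
- by move=> e'; apply: n2; apply: (inv_eq yK); rewrite e' yq.
Qed.

(* values on the four moved points in the only case without new fixed points *)
Lemma child_vals : i <> x -> p < q -> p < x \/ x < i < p -> w = cj (sw x q) y ->
  [/\ w x = p, w p = x, w i = q & w q = i].
Proof.
move=> n1 lt l ->; rewrite /cj swL swR yq -/i.
have n2 : x <> p by lia.
have n3 : q <> i by lia.
rewrite (@swN x q i) ?(@swN x q p) ?yi ?yp ?swL ?swR; try lia.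
by split.
Qed.

Lemma child_prefix : prefix sp z -> (sp -> forall e, w e <> e) -> prefix sp w.
Proof.
move=> /parent_prefix h wf; have F := child_form.
have [ltr C'] := C.
move: h wf; rewrite /prefix; case E : sp => h wf; last first.
  move=> e he; have [e1|n1] := Z.eqb_spec e x.
    move: he; rewrite e1 => he; have hx := h _ he; rewrite -/i in hx.
    case: F => [[[f1 f2 ->]|[f1 f2 ->]]|[f1 f2 ->]|[f1 f2 ->]|[f1 f2 f3 f4]].
    - by rewrite /addarc Z.eqb_refl; lia.
    - by rewrite /cj swL yp swN; lia.
    - rewrite Z.max_r; last lia.
      by rewrite /cj (@swN _ _ x) -/i ?swL; lia.
    - by lia.
    by have [-> _ _ _] := child_vals f1 f2 f3 f4; lia.
  have [e1|n2] := Z.eqb_spec e i.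
    move: he; rewrite e1 => he; have hi := h _ he; rewrite yi in hi.
    case: F => [[[f1 f2 ->]|[f1 f2 ->]]|[f1 f2 ->]|[f1 f2 ->]|[f1 f2 f3 f4]]; try lia.
    - rewrite Z.max_l; last lia.
      by rewrite /cj (@swN _ _ i) ?yi ?swL; lia.
    - by rewrite /addarc Z.eqb_refl; lia.
    by have [_ _ -> _] := child_vals f1 f2 f3 f4; lia.
  have [e1|n3] := Z.eqb_spec e p; last by rewrite child_gen //; try lia; apply: h.
  move: he; rewrite e1 => he.
  have hi : i <= x by rewrite -yi; apply: h; lia.
  case: F => [[[f1 f2 ->]|[f1 f2 ->]]|[f1 f2 ->]|[f1 f2 ->]|[f1 f2 f3 f4]]; try lia.
  - by rewrite /cj swR -/i f1 swL; lia.
  - by rewrite /addarc (@eqbF p i) ?(@eqbF p q) /unarc; try lia; rewrite (@eqbF p x) ?Z.eqb_refl; lia.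
  by have [_ -> _ _] := child_vals f1 f2 f3 f4; lia.
have {}C' : p < k < q \/ (p < q /\ r < k).
  by rewrite E in C'; case: C' => [[]//|[]//|h0|[_ h1 h2]]; [left|right].
have kq : k <> q by lia.
have yf e : y e <> e.
  have kr : k <> r by lia.
  have pltq : p < q by lia.
  have [->|n1] := Z.eqb_spec e q; first by rewrite yq; lia.
  have [->|n2] := Z.eqb_spec e r; first by rewrite yr (eqbF kq).
  have [->|n3] := Z.eqb_spec e p; first by rewrite yp; lia.
  have [->|n4] := Z.eqb_spec e k; first by rewrite yk //; lia.
  by rewrite yo //; apply: fpf; rewrite E.
have ix := yf x; rewrite -/i in ix.
have [f2 f3 f4] : [/\ p < q, p < x \/ x < i < p & w = cj (sw x q) y].
  have yqq := yf q; rewrite yq in yqq.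
  case: F => [[[f1 f2 f4]|[f1 f2 f4]]|[f1 f2 f4]|[f1 f2 f4]|[f1 f2 f3 f4]] //.
  exfalso; apply: (wf isT p).
  by rewrite f4 /addarc (@eqbF p i) ?(@eqbF p q) /unarc; try lia; rewrite (@eqbF p x) ?Z.eqb_refl; lia.
have [wx wp wi wq] := child_vals ix f2 f3 f4.
have R2 u : i < u < p -> ~ (x < y u < q).
  by move=> hu; have [_ _ R] := rect_sym yK rx; have := R u; rewrite -/i yi yq yp; apply.
have ynum u v : y u = v -> y v = u by move=> <-; rewrite yK.
move=> e u l1 l2 l3.
have wu : 0 <= y u -> u <> x -> u <> p -> 0 <= w u.
  move=> h0 n1 n2; have [->|n3] := Z.eqb_spec u i; first by rewrite wi.
  have [e2|n4] := Z.eqb_spec u q; last by rewrite child_gen.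
  by move: l3 l2; rewrite e2; lia.
have hi := h i; rewrite yi in hi; have hx := h x; rewrite -/i in hx.
have yu := yK u; have ye := yK e.
have [e1|n1] := Z.eqb_spec e i; first by move: l2; rewrite e1 wi; lia.
have [e1|n2] := Z.eqb_spec e q; first by move: l2 l1; rewrite e1; lia.
have [e1|n3] := Z.eqb_spec e x.
  rewrite e1 wx in l1 l2 l3; case: f3 => f3; first by lia.
  have [l|l] : u < i \/ i <= u by lia.
    by apply: wu; try lia; apply: hx; lia.
  have [->|n4] := Z.eqb_spec u i; first by rewrite wi.
  apply: wu; try lia.
  have [//|neg] := Z.le_gt_cases 0 (y u); exfalso.
  have r2 := R2 u; have n5 : y u <> x by move=> e'; apply: n4; rewrite /i -e' yK.
  have := h (y u) i; rewrite yu yi; lia.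
have [e1|n4] := Z.eqb_spec e p.
  rewrite e1 wp in l1 l2 l3; have h1 : 0 <= y u by apply: hi; lia.
  by apply: wu; lia.
rewrite child_gen // in l1 l2 l3.
have h1 := h _ _ l1 l2 l3.
have [e1|m1] := Z.eqb_spec u x; first by rewrite e1 wx; move: h1; rewrite e1 -/i; lia.
have [e1|m2] := Z.eqb_spec u p; last exact: wu.
rewrite e1 wp; rewrite e1 in l3.
have [//|neg] := Z.le_gt_cases 0 x; exfalso.
have r2 := R2 e; case: f3 => f3.
  have [l|l] : e < i \/ i < e by lia.
    by have := h e i; rewrite yi; lia.
  by have := h i e; rewrite yi; lia.
have [l|[l|l]] : e < x \/ x < e < i \/ i < e by lia.
- by have := h e x; rewrite -/i; lia.
- by have := h x e; rewrite -/i; lia.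
by lia.
Qed.

End Step.

(** * The row bound for fixed-point-free involutions *)

Section Rows.
Import List Classical.

Record chained (z : Z -> Z) (E : Z -> bool) : Prop := Chained {
  ch_cl : forall x, E x -> E (z x);
  ch_cons : forall x u, E x -> x < u < z x -> E u -> False }.

Definition small (E : Z -> bool) (d : nat) := exists S : list Z,
  (forall x, E x = false -> In x S) /\ (length S <= 2 * d)%nat.

(* deleting at most [d] arcs leaves pairwise disjoint arcs *)
Definition rows (z : Z -> Z) (d : nat) := exists E, chained z E /\ small E d.

(** Trades the kept point a for a deleted point b, so that rerouting arcs does not raise the number
    of deleted points. *)
Definition mv (E : Z -> bool) (a b : Z) (x : Z) : bool := if x =? a then false else if x =? b then true else E x.

Lemma mv_small E a b d : small E d -> E b = false -> small (mv E a b) d.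
Proof.
move=> [S [h1 h2]] hb; exists (a :: remove Z.eq_dec b S); split; last first.
  by have := remove_length_lt Z.eq_dec S b (h1 _ hb); rewrite /=; lia.
move=> x; rewrite /mv; case: Z.eqb_spec => [-> _|na]; first by left.
case: Z.eqb_spec => // nb hx; right; apply: in_in_remove => //; exact: h1.
Qed.

Section Step.
Variables (z : Z -> Z) (q r : Z).
Hypotheses (zK : inv z) (fpf : forall x, z x <> x).
Hypotheses (vqr : vis true z q r) (maxr : forall j, vis true z q j -> j <= r)
           (maxq : forall i j, vis true z i j -> i <= q).
Let p := z r.
Let k := z q.
Let y := parent z q r.

Let zp : z p = r. Proof. by rewrite /p zK. Qed.
Let zk : z k = q. Proof. by rewrite /k zK. Qed.
Let yK : inv y. Proof. exact: parent_inv. Qed.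
Let fpf' : true -> forall x, z x <> x. Proof. by []. Qed.
Let C : [/\ q < r, p < q & p < k < q \/ r < k].
Proof.
have [lt C] := step_cases zK fpf' vqr maxr maxq.
case: C => [[//]|[//]|h|[_ h1 h2]]; last by split=> //; right.
by split=> //; [lia | left].
Qed.
Let yq : y q = p. Proof. exact: parent_q zK fpf' vqr maxr maxq. Qed.
Let yr : y r = k.
Proof. by rewrite /y (parent_r zK fpf' vqr maxr maxq) -/k eqbF //; case: C; lia. Qed.
Let yk : y k = r. Proof. by rewrite -yr yK. Qed.
Let yp : y p = q. Proof. by rewrite -yq yK. Qed.
Let yo e : e <> q -> e <> r -> e <> p -> e <> k -> y e = z e. Proof. exact: (@parent_out z q r zK e). Qed.
Let M1 u : q < u < r -> z u < p. Proof. exact: (mid_lt zK vqr maxq). Qed.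
Let M2 u : r < k -> q < u < k -> z u < q. Proof. by move=> h; apply: (under_k zK maxq h). Qed.
Let zo e : e <> q -> e <> r -> e <> p -> e <> k -> [/\ z e <> q, z e <> r, z e <> p & z e <> k].
Proof.
move=> n1 n2 n3 n4; have h := zK e; split=> e'; move: h; rewrite e'; [exact: not_eq_sym|exact: not_eq_sym| |].
  by rewrite zp; exact: not_eq_sym.
by rewrite zk; exact: not_eq_sym.
Qed.

(** What a kept set must satisfy at the parent in order to serve every child: p and q are deleted,
    and no kept arc spans them both. *)
Record mid (E : Z -> bool) : Prop := Mid {
  mid_ch : chained y E; mid_p : E p = false; mid_q : E q = false;
  mid_over : forall u, E u -> u < p -> q < y u -> False }.

(** In z the arcs {p, r} and {k, q} are nested or cross, so at most one is kept. If {p, r} is kept,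
    k takes the place of p; if {k, q} is kept, r takes the place of q; either way the arc {k, r} of
    the parent is now kept. If neither is kept, a kept arc spanning p and q, if there is one, is
    given up for {k, r}. *)
Lemma rows_mid d : rows z d -> exists E, mid E /\ small E d.
Proof.
move=> [E [[cl co] sm]]; have [ltr pq kk] := C.
have cl' x : E (z x) -> E x by move=> /cl; rewrite zK.
have Epr : E p = E r by apply/idP/idP => [/cl|/cl]; rewrite ?zp.
have Eqk : E q = E k by apply/idP/idP => [/cl|/cl]; rewrite ?zk.
have co2 x u : E (z x) -> z x < u < x -> E u -> False by have := co (z x) u; rewrite zK.
have npq : E p -> E q -> False.
  move=> h1 h2; case: kk => kk; last by apply: (co p q) => //; rewrite zp; lia.
  by apply: (co p k); rewrite ?zp -?Eqk //; lia.
have gen (E' : Z -> bool) : (forall x, E' x -> [\/ x = k, x = r | [/\ E x, x <> p, x <> q, x <> k & x <> r]]) ->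
   E' k = E' r ->
   (E' k -> forall x, E x -> E' x -> x <> p -> x <> q -> x <> k -> x <> r -> x < z x -> (x < k < z x) \/ (x < r < z x) -> False) ->
   (E' k -> forall x, E x -> E' x -> x <> p -> x <> q -> x <> k -> x <> r -> (k < x < r) \/ (r < x < k) -> False) ->
   (forall x, E x -> E' x -> x <> p -> x <> q -> x <> k -> x <> r -> E' (z x)) ->
   (forall x, E x -> E' x -> x < p -> q < z x -> x <> k -> x <> r -> False) -> mid E'.
  move=> h1 h2 h3 h4 h5 h6.
  have hp : E' p = false.
    by apply/negP => /h1 [||[]] //; case: kk; lia.
  have hq : E' q = false.
    by apply/negP => /h1 [||[]] //; case: kk; lia.
  split=> //.
  - split.
      move=> x hx; have [e|e|[e1 e2 e3 e4 e5]] := h1 _ hx.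
      + by rewrite e yk -h2 -e.
      + by rewrite e yr h2 -e.
      + by rewrite yo //; apply: h5.
    move=> x u hx hu hu'.
    have [e|e|[e1 e2 e3 e4 e5]] := h1 _ hx; have [f|f|[f1 f2 f3 f4 f5]] := h1 _ hu'.
    + by lia.
    + by move: hu; rewrite e f yk; lia.
    + by apply: (h4 _ u) => //; rewrite -?e //; move: hu; rewrite e yk; lia.
    + by move: hu; rewrite e f yr; lia.
    + by lia.
    + by apply: (h4 _ u) => //; rewrite ?h2 -?e //; move: hu; rewrite e yr; lia.
    + by rewrite yo // in hu; apply: (h3 _ x) => //; rewrite -?f //; lia.
    + by rewrite yo // in hu; apply: (h3 _ x) => //; rewrite ?h2 -?f //; lia.
    + by rewrite yo // in hu; apply: (co x u).
  move=> u hu l1 l2; have [e|e|[e1 e2 e3 e4 e5]] := h1 _ hu; try (by move: l1; case: kk; lia).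
  by rewrite yo // in l2; apply: (h6 u).
have mvE a b x : mv E a b x -> x = b \/ (E x /\ x <> a).
  by rewrite /mv; case: Z.eqb_spec => // n; case: Z.eqb_spec => [->|m h]; [left|right].
have mvI a b x : E x -> x <> a -> mv E a b x.
  by move=> h n; rewrite /mv (eqbF n); case: Z.eqb_spec.
have mvb a b : a <> b -> mv E a b b by move=> n; rewrite /mv eqbF ?Z.eqb_refl //; apply: not_eq_sym.
case Ep : (E p).
  have Er : E r by rewrite -Epr.
  have Eq' : E q = false by apply/negP => /(npq Ep).
  exists (mv E p k); split; last by apply: mv_small => //; rewrite -Eqk.
  apply: gen.
  - move=> x /mvE [->|[h1 h2]]; first by apply: Or31.
    have [e|n1] := Z.eqb_spec x k; first by apply: Or31.
    have [e|n2] := Z.eqb_spec x r; first by apply: Or32.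
    by apply: Or33; split=> // e; move: h1; rewrite e Eq'.
  - by rewrite mvb ?mvI //; case: kk; lia.
  - move=> _ x h1 _ n1 n2 n3 n4 lt [l|l]; last exact: (co x r).
    case: kk => kk.
      have [l1|l1] : x < p \/ p < x by lia.
        by apply: (co x p) => //; lia.
      by apply: (co p x) => //; rewrite zp; lia.
    have [l1|l1] : x < r \/ r < x by lia.
      by apply: (co x r) => //; lia.
    by have := @M2 x kk; lia.
  - move=> _ x h1 _ n1 n2 n3 n4 [l|l]; first by apply: (co p x) => //; rewrite zp; lia.
    have m := @M2 x; have zx := zo n2 n4 n1 n3; have h2 := cl _ h1; case: zx => z1 z2 z3 z4.
    have [l1|l1] : z x < p \/ p < z x by lia.
      by apply: (co2 x p) => //; lia.
    by apply: (co p (z x)) => //; rewrite zp; lia.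
  - move=> x h1 _ n1 n2 n3 n4; have [z1 z2 z3 z4] := zo n2 n4 n1 n3.
    by apply: mvI => //; apply: cl.
  - by move=> x h1 _ l1 l2 n1 n2; apply: (co x p) => //; lia.
case Eq' : (E q).
  have Ek : E k by rewrite -Eqk.
  exists (mv E q r); split; last by apply: mv_small => //; rewrite -Epr.
  apply: gen.
  - move=> x /mvE [->|[h1 h2]]; first by apply: Or32.
    have [e|n1] := Z.eqb_spec x k; first by apply: Or31.
    have [e|n2] := Z.eqb_spec x r; first by apply: Or32.
    by apply: Or33; split=> // e; move: h1; rewrite e Ep.
  - by rewrite mvb ?mvI //; case: kk; lia.
  - move=> _ x h1 _ n1 n2 n3 n4 lt [l|l]; first exact: (co x k).
    have m := @M1 x.
    have [l1|l1] : x < q \/ q < x by lia.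
      case: kk => kk; last by apply: (co x q) => //; lia.
      have [l2|l2] : x < k \/ k < x by lia.
        by apply: (co x k) => //; lia.
      by apply: (co k x) => //; rewrite zk; lia.
    by lia.
  - move=> _ x h1 _ n1 n2 n3 n4 [l|l]; last by apply: (co q x) => //; rewrite -/k; lia.
    have m := @M1 x.
    have [l2|l2] : x < q \/ q < x by lia.
      by apply: (co k x) => //; rewrite zk; lia.
    by apply: (co2 x k) => //; [exact: cl | lia].
  - move=> x h1 _ n1 n2 n3 n4; have [z1 z2 z3 z4] := zo n2 n4 n1 n3.
    by apply: mvI => //; apply: cl.
  - by move=> x h1 _ l1 l2 n1 n2; apply: (co x q) => //; lia.
have Er : E r = false by rewrite -Epr.
have Ek : E k = false by rewrite -Eqk.
have nE x : E x -> [/\ x <> p, x <> q, x <> k & x <> r].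
  by move=> h; split=> e; move: h; rewrite e ?Ep ?Eq' ?Er ?Ek.
have [[e [He l1 l2]]|no] := classic (exists e, [/\ E e, e < p & q < z e]); last first.
  exists E; split=> //; apply: gen => //; rewrite ?Ek ?Er //.
  - by move=> x hx; have [n1 n2 n3 n4] := nE _ hx; apply: Or33; split.
  - by move=> x h1 _ *; apply: cl.
  - by move=> x h1 _ m1 m2 _ _; apply: no; exists x.
pose f := z e; rewrite -/f in l2.
have Hf : E f by apply: cl.
have [ne1 ne2 ne3 ne4] := nE _ He; have [nf1 nf2 nf3 nf4] := nE _ Hf.
have zf : z f = e by rewrite /f zK.
exists (mv (mv E e k) f r); split; last first.
  apply: mv_small; first exact: mv_small.
  by rewrite /mv eqbF ?(eqbF (x := r) (y := k)) //; case: kk; lia.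
have hE x : mv (mv E e k) f r x -> [\/ x = k, x = r | [/\ E x, x <> e & x <> f]].
  rewrite /mv; case: Z.eqb_spec => // n1; case: Z.eqb_spec => // n2; first by move=> _; apply: Or32.
  case: Z.eqb_spec => // n3; case: Z.eqb_spec => // n4; first by move=> _; apply: Or31.
  by move=> h; apply: Or33.
have hE2 x : E x -> mv (mv E e k) f r x -> x <> e /\ x <> f.
  move=> h /hE [e1|e1|[]] //; by move: h; rewrite e1 ?Ek ?Er.
have trapped x : E x -> x <> e -> x <> f -> (x < e /\ z x < e) \/ (f < x /\ f < z x).
  move=> hx n1 n2; have hzx := cl _ hx.
  have m1 : z x <> e by move=> h; apply: n2; rewrite -zf in h; exact: (inv_eq zK).
  have m2 : z x <> f by move=> h; apply: n1; exact: (inv_eq zK).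
  have o1 := co e x He; have o2 := co e (z x) He; rewrite -/f in o1 o2.
  have o3 := co x e hx; have o4 := co2 x e hzx.
  have c1 : ~ (e < x < f) by move=> h; exact: o1.
  have c2 : ~ (e < z x < f) by move=> h; exact: o2.
  have c3 : ~ (x < e < z x) by move=> h; exact: o3.
  have c4 : ~ (z x < e < x) by move=> h; exact: o4.
  by lia.
apply: gen.
- move=> x /hE [->|->|[h1 h2 h3]]; [exact: Or31|exact: Or32|].
  by have [n1 n2 n3 n4] := nE _ h1; apply: Or33; split.
- rewrite /mv Z.eqb_refl !(@eqbF k f) ?(@eqbF k e) ?(@eqbF r f) ?Z.eqb_refl; try exact: not_eq_sym.
  by rewrite eqbF //; case: kk; lia.
- move=> _ x h1 /(hE2 _ h1) [m1 m2] n1 n2 n3 n4 lt l.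
  by have t := trapped x h1 m1 m2; have := @M1 x; have := @M2 x; case: kk; lia.
- move=> _ x h1 /(hE2 _ h1) [m1 m2] n1 n2 n3 n4 l.
  by have t := trapped x h1 m1 m2; have := @M1 x; have := @M2 x; case: kk; lia.
- move=> x h1 /(hE2 _ h1) [m1 m2] n1 n2 n3 n4; have [z1 z2 z3 z4] := zo n2 n4 n1 n3.
  rewrite /mv !eqbF //; first exact: cl.
  + by move=> h; apply: m2; rewrite -zf in h; exact: (inv_eq zK).
  + by move=> h; apply: m1; exact: (inv_eq zK).
- move=> x h1 /(hE2 _ h1) [m1 m2] k1 k2 n1 n2.
  by have t := trapped x h1 m1 m2; lia.
Qed.

Variable x : Z.
Hypotheses (xq : x < q) (rx : rect y x q).
Let w := tau y x q.
Let i := y x.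
Hypothesis wf : forall e, w e <> e.

Let yf e : y e <> e.
Proof.
have [ltr pq kk] := C.
have [->|n1] := Z.eqb_spec e q; first by rewrite yq; lia.
have [->|n2] := Z.eqb_spec e r; first by rewrite yr; case: kk; lia.
have [->|n3] := Z.eqb_spec e p; first by rewrite yp; lia.
have [->|n4] := Z.eqb_spec e k; first by rewrite yk; case: kk; lia.
by rewrite yo.
Qed.

(** A fixed-point-free child has the arcs {x, p} and {i, q} in place of {x, i} and {p, q}. If {x, i}
    was kept, trading i for p keeps {x, p}; otherwise the kept set stays as it is. *)
Lemma child_rows d : rows z d -> rows w d.
Proof.
move=> /rows_mid [E [[[cl co] Ep Eq' ov] sm]]; have [ltr pq kk] := C.
have ix := yf (e := x); rewrite -/i in ix.
have yi : y i = x by rewrite /i yK.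
have ip : i < p by case: rx => _; rewrite yq.
have F := child_form zK fpf' vqr maxr maxq rx.
have [f2 f3 f4] : [/\ p < q, p < x \/ x < i < p & w = cj (sw x q) y].
  case: F => [[[f1 f2 f4]|[f1 f2 f4]]|[f1 f2 f4]|[f1 f2 f4]|[f1 f2 f3 f4]] //; try (by exfalso; rewrite -/p in f2; lia); try by [].
  exfalso; apply: (wf (e := p)); rewrite /w f4 /addarc.
  by rewrite (@eqbF p (y x)) ?(@eqbF p q) /unarc -/i -/p ?(@eqbF p x) ?Z.eqb_refl //; lia.
have [wx wp wi wq] : [/\ w x = p, w p = x, w i = q & w q = i] := child_vals zK fpf' vqr maxr maxq xq rx ix f2 f3 f4.
have wg e : e <> x -> e <> q -> e <> i -> e <> p -> w e = y e.
  exact: (child_gen zK fpf' vqr maxr maxq rx).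
have R2 u : i < u < p -> ~ (x < y u < q).
  by move=> hu; have [_ _ R] := rect_sym yK rx; have := R u; rewrite -/i yi yq yp; apply.
have co2 u v : E (y u) -> y u < v < u -> E v -> False by have := co (y u) v; rewrite yK.
have Eix : E i = E x by apply/idP/idP => [/cl|/cl]; rewrite ?yi.
have yn e : e <> x -> e <> q -> e <> i -> e <> p -> [/\ y e <> x, y e <> q, y e <> i & y e <> p].
  move=> n1 n2 n3 n4; have h := yK e; split=> e'; move: h; rewrite e' ?yi ?yp ?yq -/i; exact: not_eq_sym.
case Ei : (E i); last first.
  have Ex : E x = false by rewrite -Eix.
  have nE u : E u -> [/\ u <> x, u <> q, u <> i & u <> p].
    by move=> h; split=> e; move: h; rewrite e ?Ep ?Eq' ?Ei ?Ex.
  exists E; split=> //; split=> [u hu|u v hu].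
    by have [n1 n2 n3 n4] := nE _ hu; rewrite wg //; apply: cl.
  by have [n1 n2 n3 n4] := nE _ hu; rewrite wg //; apply: co.
have Ex : E x by rewrite -Eix.
exists (mv E i p); split; last exact: mv_small.
have xp : x <> p by case: f3; lia.
have hE u : mv E i p u -> u = p \/ (E u /\ [/\ u <> i, u <> q & u <> p]).
  rewrite /mv; case: Z.eqb_spec => // n1; case: Z.eqb_spec => // n2; first by left.
  by move=> h; right; split=> //; split=> // e; move: h; rewrite e Eq'.
split.
  move=> u /hE [->|[hu [n1 n2 n3]]].
    by rewrite wp /mv (eqbF xp) eqbF //; apply: not_eq_sym.
  have [->|n4] := Z.eqb_spec u x; first by rewrite wx /mv Z.eqb_refl eqbF //; lia.
  by have [m1 m2 m3 m4] := yn _ n4 n2 n1 n3; rewrite wg // /mv !eqbF //; apply: cl.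
move=> u v /hE [->|[hu [n1 n2 n3]]] + /hE.
  rewrite wp => l [e|[hv [m1 m2 m3]]]; first by lia.
  by case: f3 => f3; [apply: (co i v); rewrite ?yi //; lia | lia].
have [eu|n4] := Z.eqb_spec u x.
  rewrite eu wx => l [e|[hv [m1 m2 m3]]]; first by lia.
  case: f3 => f3; first by lia.
  have [l1|l1] : v < i \/ i < v by lia.
    by apply: (co x v) => //; rewrite -/i; lia.
  have n5 : v <> x by lia.
  have [k1 k2 k3 k4] := yn _ n5 m2 m1 m3; have r2 := R2 v.
  have [l2|l2] : y v < x \/ q < y v by lia.
    by apply: (co2 v x) => //; [exact: cl | lia].
  by apply: (ov v) => //; lia.
rewrite wg // => l [e|[hv [m1 m2 m3]]]; last exact: (co u v).
rewrite e in l; have [k1 k2 k3 k4] := yn _ n4 n2 n1 n3; have r2 := R2 u.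
have [l1|l1] : u < i \/ i < u by lia.
  by apply: (co u i) => //; lia.
case: f3 => f3; first by apply: (co i u); rewrite ?yi //; lia.
by apply: (ov u) => //; lia.
Qed.
End Step.

End Rows.
End IntegerInvolutions.

Require Import Defs.
From mathcomp Require Import all_boot all_order all_fingroup all_algebra.
From mathcomp Require Import finmap multiset boolp zify ssrZ ring.
Import Order.TTheory GRing.Theory Num.Theory.
Import IntegerInvolutions.
Delimit Scope Z_scope with Zs.

(** * Transition equations *)

Section TransitionEquations.
Local Open Scope ring_scope.

Lemma eqZE (x y : Z) : (x == y) = (x =? y)%Zs.
Proof. by apply/eqP/idP => /Z.eqb_eq. Qed.

(** Two fixed points weigh 2 because cutting an arc merges two covers into one; see
    [gterm_removal_left]. *)
Definition wt (z : Z -> Z) a b : nat := if (z a == a) && (z b == b) then 2 else 1.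

Section Ops.
Variables (V : zmodType).
Implicit Types (H : (Z -> Z) -> V) (z : Z -> Z) (i a b r : Z) (W : seq Z).

Definition gterm z a b H : V := if `[<rect z a b>] then H (tau z a b) *+ wt z a b else 0.

Definition Dop i H z : V := if (z (i + 1)%Zs <? z i)%Zs then H (strip z i) else 0.

(** The signed sum over the covers through r, positive when r is the left point of the pair and
    negative when it is the right one, with the other point in the window W. *)
Definition Top W H z r : V := \sum_(x <- W) (gterm z r x H - gterm z x r H).

Lemma gtermN z a b H : ~ rect z a b -> gterm z a b H = 0.
Proof. by rewrite /gterm; case: asboolP. Qed.

Lemma gtermT z a b H : rect z a b -> gterm z a b H = H (tau z a b) *+ wt z a b.
Proof. by rewrite /gterm; case: asboolP. Qed.

Lemma gterm_sym z a b H : inv z -> gterm z (z a) (z b) H = gterm z a b H.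
Proof.
move=> zK; have [r|n] := pselect (rect z a b).
  rewrite !gtermT ?tau_sym //; last exact: rect_sym.
  by rewrite /wt !zK ![_ == z _]eq_sym.
rewrite !gtermN // => r; apply: n; by have := rect_sym zK r; rewrite !zK.
Qed.

Lemma DopT i H z : dsc z i -> Dop i H z = H (strip z i).
Proof. by rewrite /Dop /dsc => /Z.ltb_spec0 ->. Qed.

Lemma DopN i H z : ~ dsc z i -> Dop i H z = 0.
Proof. by rewrite /Dop /dsc => /Z.ltb_spec0/negbTE ->. Qed.

Lemma gterm_asc z i a b H : inv z -> (z i < z (i + 1))%Zs ->
  gterm z a b (Dop i H) =
  H z *+ (((a == i) && (b == (i + 1)%Zs)) + ((z a == i) && (z b == (i + 1)%Zs))).
Proof.
move=> zK asc; have [d e] := strip_tau_adjacent zK asc.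
have [[-> ->]|n1] := pselect (a = i /\ b = (i + 1)%Zs).
  rewrite gtermT; last exact: rect_adjacent.
  by rewrite DopT // e !eqxx /wt; case: ifP.
have [[ea eb]|n2] := pselect (z a = i /\ z b = (i + 1)%Zs).
  rewrite -gterm_sym // ea eb gtermT; last exact: rect_adjacent.
  rewrite DopT // e !eqxx /=; have -> : (a == i) && (b == (i + 1)%Zs) = false.
    by apply/negP => /andP[/eqP h1 /eqP h2]; apply: n1.
  have -> : wt z i (i + 1) = 1%N; last by [].
  rewrite /wt; case: ifP => // /andP[/eqP h1 /eqP h2]; case: n1.
  by split; [rewrite -[a]zK ea h1 | rewrite -[b]zK eb h2].
have -> : (a == i) && (b == (i + 1)%Zs) = false.
  by apply/negP => /andP[/eqP h1 /eqP h2]; apply: n1.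
have -> : (z a == i) && (z b == (i + 1)%Zs) = false.
  by apply/negP => /andP[/eqP h1 /eqP h2]; apply: n2.
have [r|/gtermN//] := pselect (rect z a b).
rewrite gtermT // DopN ?mul0rn // => d'.
by case: (dsc_tau_adjacent zK asc r d').
Qed.

(** Covers of z with a descent at i correspond to covers of the stripped involution, except the
    adjacent one, which returns z; the multiple of [H z] accounts for it. *)
Lemma gterm_conj z i a b H (s := sw i (i + 1)) : inv z -> dsc z i -> z i <> (i + 1)%Zs ->
  gterm z a b (Dop i H) + H z *+ (((s a == i) && (s b == (i + 1)%Zs)) +
     ((s (z a) == i) && (s (z b) == (i + 1)%Zs))) = gterm (cj s z) (s a) (s b) H.
Proof.
move=> zK di ni; have vK : inv (cj s z) by apply: cj_inv => //; apply: swK.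
have vs x : cj s z (s x) = s (z x) by rewrite /cj /s swK.
have [ei ej] : s i = (i + 1)%Zs /\ s (i + 1)%Zs = i by rewrite /s /sw; split; zall.
have di1 := di; rewrite /dsc in di1.
have nj : z (i + 1)%Zs <> i by move=> e; apply: ni; have := zK (i + 1)%Zs; rewrite e.
have vi : cj s z i = s (z (i + 1)%Zs) by rewrite /cj ei.
have vj : cj s z (i + 1)%Zs = s (z i) by rewrite /cj ej.
have vasc : (cj s z i < cj s z (i + 1))%Zs.
  by rewrite vi vj /s /sw; repeat zcase; lia.
have nfix : cj s z i = i -> cj s z (i + 1)%Zs = (i + 1)%Zs -> False.
  rewrite vi vj => /(congr1 s) h1 /(congr1 s); move: h1.
  by rewrite /s !swK -/s ei ej; lia.
have tv : tau (cj s z) i (i + 1) = z.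
  by rewrite tau_adjacent // cjK //; apply: swK.
have w1 : wt (cj s z) i (i + 1) = 1%N.
  by rewrite /wt; case: ifP => // /andP[/eqP h1 /eqP h2]; case: nfix.
have gv : gterm (cj s z) i (i + 1) H = H z.
  by rewrite gtermT ?tv ?w1 //; apply: rect_adjacent.
have norect x y : s x = i -> s y = (i + 1)%Zs -> ~ rect z x y.
  move=> /(congr1 s) h1 /(congr1 s); move: h1; rewrite /s !swK -/s ei ej => -> -> [lt _ _]; lia.
have [[ea eb]|n1] := pselect (s a = i /\ s b = (i + 1)%Zs).
  rewrite gtermN; last exact: norect.
  rewrite ea eb gv !eqxx add0r.
  suff -> : (s (z a) == i) && (s (z b) == (i + 1)%Zs) = false by [].
  by apply/negP => /andP[/eqP h1 /eqP h2]; apply: nfix; [have := vs a; rewrite ea h1 | have := vs b; rewrite eb h2].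
have [[ea eb]|n2] := pselect (s (z a) = i /\ s (z b) = (i + 1)%Zs).
  rewrite -gterm_sym // gtermN; last exact: norect.
  rewrite -[RHS]gterm_sym // !vs ea eb gv !eqxx add0r.
  suff -> : (s a == i) && (s b == (i + 1)%Zs) = false by [].
  by apply/negP => /andP[/eqP h1 /eqP h2]; apply: n1.
have -> : (s a == i) && (s b == (i + 1)%Zs) = false.
  by apply/negP => /andP[/eqP h1 /eqP h2]; apply: n1.
have -> : (s (z a) == i) && (s (z b) == (i + 1)%Zs) = false.
  by apply/negP => /andP[/eqP h1 /eqP h2]; apply: n2.
rewrite addr0; have [r|n] := pselect (rect (cj s z) (s a) (s b)).
  have [r'|//|//] := rect_conj_special zK di ni r.
  have [h1 h2] := tau_strip_conj zK di ni r'; have d := h1.2 r.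
  rewrite !gtermT // DopT // h2 // /wt !vs !(inj_eq (inv_inj (swK _ _))) //.
rewrite [RHS]gtermN //; have [r'|/gtermN//] := pselect (rect z a b).
have [h1 h2] := tau_strip_conj zK di ni r'.
by rewrite gtermT // DopN ?mul0rn // => /h1.
Qed.
End Ops.

Section Ops.
Variables (V : zmodType).
Implicit Types (H : (Z -> Z) -> V) (z : Z -> Z) (i a b r : Z) (W : seq Z).

Lemma wt1 z a b : z b <> b -> wt z a b = 1%N.
Proof. by move=> n; rewrite /wt; case: ifP => // /andP[_ /eqP]. Qed.

Lemma wt1l z a b : z a <> a -> wt z a b = 1%N.
Proof. by move=> n; rewrite /wt; case: ifP => // /andP[/eqP]. Qed.

Section Removal.
Variables (z : Z -> Z) (i : Z) (H : (Z -> Z) -> V).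
Hypotheses (zK : inv z) (zi : z i = (i + 1)%Zs).
Let v := unarc z i (i + 1).

Let zj : z (i + 1)%Zs = i.
Proof. by rewrite -zi zK. Qed.
Let vK : inv v.
Proof. exact: unarc_inv. Qed.
Let vi : v i = i.
Proof. by rewrite /v /unarc Z.eqb_refl. Qed.
Let vj : v (i + 1)%Zs = (i + 1)%Zs.
Proof. by rewrite /v /unarc; zall. Qed.
Let ve e : e <> i -> e <> (i + 1)%Zs -> v e = z e.
Proof. by move=> n1 n2; rewrite /v /unarc !eqbF. Qed.
Let zn e : e <> i -> e <> (i + 1)%Zs -> z e <> i /\ z e <> (i + 1)%Zs.
Proof. by move=> n1 n2; split=> h; have := zK e; rewrite h ?zi ?zj; lia. Qed.

Let wi r : wt z r i = 1%N. Proof. by apply: wt1; rewrite zi; lia. Qed.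
Let wj r : wt z r (i + 1) = 1%N. Proof. by apply: wt1; rewrite zj; lia. Qed.
Let wi' r : wt z i r = 1%N. Proof. by apply: wt1l; rewrite zi; lia. Qed.
Let wj' r : wt z (i + 1) r = 1%N. Proof. by apply: wt1l; rewrite zj; lia. Qed.

Lemma gterm_removal a b : a <> i -> a <> (i + 1)%Zs -> b <> i -> b <> (i + 1)%Zs ->
  gterm z a b (Dop i H) = gterm v a b H.
Proof.
move=> a1 a2 b1 b2; have R := rect_removal zK zi a1 a2 b1 b2.
have [h1 h2] := tau_removal zK zi a1 a2 b1 b2.
have [r|n] := pselect (rect z a b); last by rewrite !gtermN // => /R.
have tK := tau_inv zK r.
rewrite !gtermT ?DopT //; last exact/R.
  by rewrite /strip h1 Z.eqb_refl h2 /wt !ve.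
by have := tK i; rewrite h1 /dsc => ->; lia.
Qed.

Lemma gterm_removal_left r : r <> i -> r <> (i + 1)%Zs ->
  gterm z r i (Dop i H) + gterm z r (i + 1) (Dop i H) = gterm v r i H + gterm v r (i + 1) H.
Proof.
move=> n1 n2; have [R1 R2 R3] := rect_removal_left zK zi n1 n2.
rewrite (gtermN _ R3) addr0.
have [rv|n] := pselect (rect v r i); last first.
  by rewrite !gtermN ?addr0 // => [/R2|/R1].
have r1 := R1.2 rv; have r2 := R2.2 rv.
have [lt zlt _] := r1.
have [lt2 zlt2 _] := r2; rewrite zj in zlt2.
rewrite !gtermT // wi wj !mulr1n.
have [e|[l|l]] : z r = r \/ (z r < r)%Zs \/ (r < z r)%Zs by lia.
- have [-> d s] := removal_fixed_left zK zi lt e.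
  by rewrite DopT // s /wt ve // e vi !eqxx.
- have [d1 d2 s] := removal_right_end zK zi l lt.
  by rewrite DopN // DopT // s wt1l ?ve //; [rewrite add0r | lia].
have zrr : (z (z r) < z r)%Zs by rewrite zK.
have [d1 d2 s] := removal_right_end zK zi zrr zlt2.
rewrite -(tau_sym zK r1) -(tau_sym zK r2) -(tau_sym vK rv) zi zj vi ve //.
by rewrite DopT // DopN // s wt1l ?ve ?addr0 //; lia.
Qed.

Lemma gterm_removal_right r : r <> i -> r <> (i + 1)%Zs ->
  gterm z i r (Dop i H) + gterm z (i + 1) r (Dop i H) = gterm v i r H + gterm v (i + 1) r H.
Proof.
move=> n1 n2; have [R1 R2 R3] := rect_removal_right zK zi n1 n2.
rewrite (gtermN _ R3) add0r.
have [rv|n] := pselect (rect v (i + 1) r); last first.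
  by rewrite !gtermN ?addr0 // => [/R2|/R1].
have r1 := R1.2 rv; have r2 := R2.2 rv.
have [lt zlt _] := r1; rewrite zi in zlt.
have [lt2 zlt2 _] := r2; rewrite zj in zlt2.
rewrite !gtermT // wi' wj' !mulr1n.
have [e|[l|l]] : z r = r \/ (r < z r)%Zs \/ (z r < r)%Zs by lia.
- have [<- d s] := removal_fixed_right zK zi lt2 e.
  by rewrite DopT // s /wt (ve (e := r)) // e vj !eqxx.
- have [d1 d2 s] := removal_left_end zK zi lt2 l.
  by rewrite DopT // DopN // s wt1 ?ve //; [rewrite addr0 | lia].
have zrr : (z r < z (z r))%Zs by rewrite zK.
have [d1 d2 s] := removal_left_end zK zi zlt zrr.
rewrite -(tau_sym zK r1) -(tau_sym zK r2) -(tau_sym vK rv) zi zj vj ve //.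
by rewrite DopN // DopT // s wt1 ?ve ?add0r //; lia.
Qed.
End Removal.
End Ops.

(** Follows the two ends of an arc through the strips: once the arc is cut, they go on as two fixed
    points. The transition identity is proved for the sum over both members. *)
Definition paired (z : Z -> Z) r r' := z r = r' \/ (z r = r /\ z r' = r').

Section Ops.
Variables (V : zmodType) (W : seq Z).
Hypothesis uW : uniq W.
Implicit Types (H : (Z -> Z) -> V) (z : Z -> Z) (i a b r : Z).

Lemma sum_ind (c : Z) : c \in W -> (\sum_(x <- W) (x == c) = 1)%N.
Proof.
move=> cW; rewrite (bigD1_seq c) //= eqxx big1 ?addn0 // => x /negbTE ->; by [].
Qed.

Lemma sum_ind_and (P : bool) (c : Z) : c \in W -> (\sum_(x <- W) (P && (x == c)) = P)%N.
Proof. by case: P => /= cW; [exact: sum_ind | rewrite big1]. Qed.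

Lemma sum_split2 (F : Z -> V) i j : i \in W -> j \in W -> j != i ->
  \sum_(x <- W) F x = F i + F j + \sum_(x <- W | (x != i) && (x != j)) F x.
Proof.
move=> iW jW ji; rewrite (bigD1_seq i) //= -addrA; congr (_ + _).
rewrite big_mkcond (bigD1_seq j) //= ji; congr (_ + _).
by rewrite -big_mkcondr; apply: eq_bigl => x; rewrite andbC.
Qed.

Section Local.
Variables (z : Z -> Z) (i : Z) (H : (Z -> Z) -> V).
Hypotheses (zK : inv z) (iW : i \in W) (jW : (i + 1)%Zs \in W) (zW : forall x, x \in W -> z x \in W).
Let s := sw i (i + 1).

Let zeq x y : (z x == y) = (x == z y).
Proof. by apply/eqP/eqP => [<-|->]; rewrite zK. Qed.

Let sumR r c d : d \in W -> (\sum_(x <- W) (((r == c) && (x == d)) + ((z r == c) && (z x == d))) = (r == c) + (z r == c))%N.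
Proof.
move=> dW; rewrite big_split /= sum_ind_and //; congr (_ + _)%N.
by under eq_bigr => x _ do rewrite [z x == _]zeq; rewrite sum_ind_and // zW.
Qed.

Let sumL r c d : d \in W -> (\sum_(x <- W) (((x == d) && (r == c)) + ((z x == d) && (z r == c))) = (r == c) + (z r == c))%N.
Proof. by move=> dW; rewrite -(sumR _ _ dW); apply: eq_bigr => x _; congr (_ + _)%N; rewrite andbC. Qed.

Lemma Top_asc r : (z i < z (i + 1))%Zs ->
  Top W (Dop i H) z r + H z *+ ((r == (i + 1)%Zs) + (z r == (i + 1)%Zs)) = H z *+ ((r == i) + (z r == i)).
Proof.
move=> asc; rewrite /Top sumrB.
under eq_bigr do rewrite gterm_asc //.
under [X in _ - X]eq_bigr do rewrite gterm_asc //.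
by rewrite !sumrMnr sumR // sumL // subrK.
Qed.

Lemma perm_sw : perm_eq (map s W) W.
Proof.
apply: uniq_perm => //; first by rewrite map_inj_uniq //; apply: inv_inj; apply: swK.
move=> x; apply/mapP/idP => [[y yW ->]|xW].
  by rewrite /s /sw; case: ifP => // _; case: ifP.
exists (s x); last by rewrite /s swK.
by rewrite /s /sw; case: ifP => // _; case: ifP.
Qed.

Lemma Top_conj r : dsc z i -> z i <> (i + 1)%Zs ->
  Top W (Dop i H) z r + H z *+ ((r == (i + 1)%Zs) + (z r == (i + 1)%Zs)) =
  Top W H (strip z i) (s r) + H z *+ ((r == i) + (z r == i)).
Proof.
move=> di ni; rewrite strip_conj // /Top -[in RHS](perm_big _ perm_sw) /= big_map.
have [ei ej] : s i = (i + 1)%Zs /\ s (i + 1)%Zs = i by rewrite /s /sw; split; zall.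
have sE x y : (s x == y) = (x == s y).
  by apply/eqP/eqP => [<-|->]; rewrite /s swK.
pose k1 x := (((r == (i + 1)%Zs) && (x == i)) + ((z r == (i + 1)%Zs) && (z x == i)))%N.
pose k2 x := (((x == (i + 1)%Zs) && (r == i)) + ((z x == (i + 1)%Zs) && (z r == i)))%N.
have E x : gterm z r x (Dop i H) - gterm z x r (Dop i H) + H z *+ k1 x =
    gterm (cj s z) (s r) (s x) H - gterm (cj s z) (s x) (s r) H + H z *+ k2 x.
  rewrite -!gterm_conj // -/s !sE ei ej /k1 /k2.
  by rewrite opprD [in RHS]addrACA -[RHS]addrA subrK.
have S : \sum_(x <- W) (gterm z r x (Dop i H) - gterm z x r (Dop i H) + H z *+ k1 x) =
  \sum_(x <- W) (gterm (cj s z) (s r) (s x) H - gterm (cj s z) (s x) (s r) H + H z *+ k2 x) by apply: eq_bigr.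
by rewrite -(@sumR r (i + 1)%Zs i iW) -(@sumL r i (i + 1)%Zs jW) -!sumrMnr -!big_split /=; exact: S.
Qed.

Lemma Top_removal_out r : z i = (i + 1)%Zs -> r <> i -> r <> (i + 1)%Zs ->
  Top W (Dop i H) z r = Top W H (strip z i) r.
Proof.
move=> zi n1 n2; rewrite strip_removal // /Top.
have ni : (i + 1)%Zs != i by apply/eqP; lia.
rewrite [LHS](sum_split2 _ iW jW ni) [RHS](sum_split2 _ iW jW ni).
congr (_ + _); last first.
  by apply: eq_bigr => x /andP[/eqP x1 /eqP x2]; rewrite !gterm_removal.
have E1 := gterm_removal_left H zK zi n1 n2; have E2 := gterm_removal_right H zK zi n1 n2.
by rewrite [LHS]addrACA -opprD E1 E2 [RHS]addrACA -opprD.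
Qed.

(** The covers through i and through i+1 are compared only in sum, which is why the two ends of an
    arc are treated together. *)
Lemma Top_removal_in : z i = (i + 1)%Zs ->
  Top W (Dop i H) z i + Top W (Dop i H) z (i + 1) = Top W H (strip z i) i + Top W H (strip z i) (i + 1).
Proof.
move=> zi; rewrite strip_removal // /Top -!big_split /=.
have ni : (i + 1)%Zs != i by apply/eqP; lia.
have zj : z (i + 1)%Zs = i by rewrite -zi zK.
rewrite [LHS](sum_split2 _ iW jW ni) [RHS](sum_split2 _ iW jW ni).
congr (_ + _); last first.
  apply: eq_bigr => x /andP[/eqP x1 /eqP x2].
  have E1 := gterm_removal_left H zK zi x1 x2; have E2 := gterm_removal_right H zK zi x1 x2.
  by rewrite [LHS]addrACA -opprD E1 E2 [RHS]addrACA -opprD.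
have nr u x : ~ rect u x x by move=> [lt _ _]; lia.
have nij : ~ rect z i (i + 1) by move=> [_ lt _]; lia.
have nji : ~ rect z (i + 1) i by move=> [lt _ _]; lia.
rewrite !(gtermN _ (nr _ _)) (gtermN _ nij) (gtermN _ nji).
by rewrite !subr0 !addr0 !add0r addrA subrK subrr.
Qed.

(* The error terms [H z] come from the pairs exchanged by [s_i]; they telescope
   when a whole increasing sequence of letters is applied. *)
Lemma Top_pair r r' : paired z r r' ->
  Top W (Dop i H) z r + Top W (Dop i H) z r' + H z *+ ((r == (i + 1)%Zs) + (r' == (i + 1)%Zs)).*2 =
  (if (z (i + 1)%Zs <? z i)%Zs then Top W H (strip z i) (s r) + Top W H (strip z i) (s r') else 0)
   + H z *+ ((r == i) + (r' == i)).*2.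
Proof.
move=> p.
have pE c : (((r == c) + (z r == c)) + ((r' == c) + (z r' == c)) = ((r == c) + (r' == c)).*2)%N.
  by case: p => [<-|[-> ->]]; rewrite ?zK; lia.
case: Z.ltb_spec => [d|a]; last first.
  have asc : (z i < z (i + 1))%Zs.
    suff : z i <> z (i + 1)%Zs by lia.
    by move=> /(inv_eq zK); lia.
  by rewrite -!pE !mulrnDr [LHS]addrACA add0r -!mulrnDr !Top_asc // mulrnDr.
have [zi|ni] := Z.eqb_spec (z i) (i + 1).
  have zj : z (i + 1)%Zs = i by rewrite -zi zK.
  have [[e1 e2]|[[e1 e2]|[[n1 n2] [n3 n4]]]] : (r = i /\ r' = (i + 1)%Zs) \/ (r = (i + 1)%Zs /\ r' = i) \/
     ((r <> i /\ r <> (i + 1)%Zs) /\ (r' <> i /\ r' <> (i + 1)%Zs)).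
  - case: p => [e|[e e']].
      have [e1|n1] := Z.eqb_spec r i; first by left; rewrite -e e1.
      have [e1|n2] := Z.eqb_spec r (i + 1); first by right; left; rewrite -e e1.
      by do 2!right; split=> //; rewrite -e; split=> h; [apply: n2|apply: n1]; rewrite -[r]zK h.
    by do 2!right; split; split=> h; move: e e'; rewrite h ?zi ?zj; lia.
  - rewrite e1 e2 (Top_removal_in zi).
    have [-> ->] : s i = (i + 1)%Zs /\ s (i + 1)%Zs = i by rewrite /s /sw; split; zall.
    by rewrite !eqxx addnC [Top W H _ i + _]addrC eq_sym.
  - rewrite e1 e2 [X in X + _ = _]addrC (Top_removal_in zi).
    have [-> ->] : s i = (i + 1)%Zs /\ s (i + 1)%Zs = i by rewrite /s /sw; split; zall.
    by rewrite !eqxx addnC eq_sym.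
  rewrite !(Top_removal_out zi) //.
  have E x y : x <> y -> (x == y :> Z) = false by move/eqP/negbTE.
  by rewrite !E // /s !swN.
by rewrite -!pE !mulrnDr [LHS]addrACA -!mulrnDr !Top_conj // mulrnDr addrACA.
Qed.
End Local.
End Ops.

(** * Passes, and the transition identity after n of them *)

Fixpoint zr (a : Z) (k : nat) : seq Z := if k is k'.+1 then a :: zr (a + 1) k' else [::].

Lemma mem_zr a k x : (x \in zr a k) = ((a <=? x) && (x <? a + Z.of_nat k))%Zs.
Proof.
elim: k a => [|k IH] a; first by rewrite in_nil; apply/esym/andP => -[/Z.leb_spec0 + /Z.ltb_spec0]; lia.
rewrite in_cons IH; apply/idP/idP.
  case/orP => [/eqP ->|/andP[/Z.leb_spec0 h1 /Z.ltb_spec0 h2]]; apply/andP; split; [apply/Z.leb_spec0|apply/Z.ltb_spec0|apply/Z.leb_spec0|apply/Z.ltb_spec0]; lia.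
case/andP=> /Z.leb_spec0 h1 /Z.ltb_spec0 h2.
have [->|n] := Z.eqb_spec x a; first by rewrite eqxx.
by apply/orP; right; apply/andP; split; [apply/Z.leb_spec0|apply/Z.ltb_spec0]; lia.
Qed.

Lemma zr_uniq a k : uniq (zr a k).
Proof.
elim: k a => //= k IH a; rewrite IH andbT mem_zr; apply/negP => /andP[/Z.leb_spec0]; lia.
Qed.

(** One variable: an increasing set of letters is stripped, each with a factor X. Words are read
    from their last letter, so compatibility makes the letters that share a variable increase. *)
Fixpoint pass (R : comNzRingType) (H : (Z -> Z) -> R) (L : seq Z) (z : Z -> Z) : {poly R} :=
  if L is i :: L' then pass H L' z + 'X * Dop i (pass H L') z else (H z)%:P.

(** Iterated polynomials over the rationals, an integral domain so that integers can be cancelled.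
    The outermost variable, used by the first pass, is x_(-1). *)
Fixpoint polyn (n : nat) : idomainType :=
  if n is n'.+1 then ({poly polyn n'} : idomainType) else (rat : idomainType).

Fixpoint Fs (b0 : Z -> Z) (L : seq Z) (n : nat) : (Z -> Z) -> polyn n :=
  if n is n'.+1 return (Z -> Z) -> polyn n then pass (@Fs b0 L n') L
  else fun z => (`[<z = b0>])%:R.

Section TopLin.
Variables (R : comNzRingType) (W : seq Z).
Implicit Types (z : Z -> Z).

Lemma Top_polyC (H : (Z -> Z) -> R) z r : Top W (fun y => (H y)%:P) z r = (Top W H z r)%:P.
Proof.
rewrite /Top rmorph_sum; apply: eq_bigr => x _; rewrite /gterm rmorphB.
by do 2!case: ifP => _; rewrite ?rmorph0 ?rmorphMn.
Qed.

Lemma Top_addX (G D : (Z -> Z) -> {poly R}) z r :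
  Top W (fun y => G y + 'X * D y) z r = Top W G z r + 'X * Top W D z r.
Proof.
rewrite /Top mulr_sumr -big_split; apply: eq_bigr => x _ /=; rewrite /gterm mulrBr.
have E (b : bool) (u v : {poly R}) k : (if b then (u + 'X * v) *+ k else 0) =
   (if b then u *+ k else 0) + 'X * (if b then v *+ k else 0).
  by case: b; rewrite ?mulr0 ?addr0 // mulrnDl mulrnAr.
by rewrite !E opprD addrACA.
Qed.
End TopLin.

Section Pass.
Variables (R : comNzRingType) (H : (Z -> Z) -> R) (A : Z) (N : nat).
Let W := zr A N.+1.
Let B := (A + Z.of_nat N)%Zs.
Variable Q : (Z -> Z) -> Z -> Z -> Prop.
Hypothesis Q0 : forall z r r', Q z r r' ->
  [/\ inv z, forall x, x \in W -> z x \in W, paired z r r', (A < r < B)%Zs & (A < r' < B)%Zs].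
Hypothesis QS : forall z r r' i, Q z r r' -> dsc z i ->
  Q (strip z i) (sw i (i + 1) r) (sw i (i + 1) r').
Hypothesis QH : forall z r r', Q z r r' -> Top W H z r + Top W H z r' = 0.

(** Induction on the letters still to come: the error of [Top_pair] at a+1 cancels the one left by
    the remaining letters, so only the error at the first letter a survives. *)
Lemma Top_pass_aux k a : (a + Z.of_nat k = B)%Zs -> (A <= a)%Zs -> forall z r r', Q z r r' ->
  Top W (pass H (zr a k)) z r + Top W (pass H (zr a k)) z r' =
  ('X * pass H (zr a k) z) *+ ((r == a) + (r' == a)).*2.
Proof.
elim: k a => [|k IH] a ha hA z r r' q; have [zK zW p l1 l2] := Q0 q.
  rewrite !Top_polyC -rmorphD QH //=.
  have [e1 e2] : (r == a) = false /\ (r' == a) = false by split; apply/eqP; lia.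
  by rewrite e1 e2 mulr0n.
have aW : a \in W by rewrite mem_zr; apply/andP; split; [apply/Z.leb_spec0|apply/Z.ltb_spec0]; lia.
have a1W : (a + 1)%Zs \in W by rewrite mem_zr; apply/andP; split; [apply/Z.leb_spec0|apply/Z.ltb_spec0]; lia.
have IHk := IH (a + 1)%Zs; have {}IHk := IHk ltac:(lia) ltac:(lia).
rewrite /= -/zr; set G := pass H _.
rewrite !Top_addX addrACA -mulrDr IHk //.
have := Top_pair (zr_uniq A N.+1) G zK aW a1W zW p.
set U := Top _ _ _ _ + _; move=> E.
have EU : 'X * U = 'X * (if (z (a + 1)%Zs <? z a)%Zs then Top W G (strip z a) (sw a (a + 1) r) + Top W G (strip z a) (sw a (a + 1) r') else 0)
   + ('X * G z) *+ ((r == a) + (r' == a)).*2 - ('X * G z) *+ ((r == (a + 1)%Zs) + (r' == (a + 1)%Zs)).*2.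
  by rewrite -!mulrnAr -mulrDr -mulrBr -E addrK.
rewrite -/W -/G EU mulrDr mulrnDl /Dop.
have sE x : (sw a (a + 1) x == (a + 1)%Zs) = (x == a).
  by apply/eqP/eqP; rewrite /sw; repeat zcase; lia.
case: Z.ltb_spec => [d|_]; last first.
  by rewrite mulr0 add0r addrC subrK mulr0 mul0rn addr0.
by have IHs := IHk _ _ _ (QS q d); rewrite -/G in IHs; rewrite IHs !sE addrC subrK [LHS]addrC mulrnAr.
Qed.

Lemma Top_pass z r r' : Q z r r' ->
  Top W (pass H (zr A N)) z r + Top W (pass H (zr A N)) z r' = 0.
Proof.
move=> q; have [zK zW p l1 l2] := Q0 q; rewrite Top_pass_aux ?(QS q) //; last lia.
have [e1 e2] : (r == A) = false /\ (r' == A) = false by split; apply/eqP; lia.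
by rewrite e1 e2 mulr0n.
Qed.
End Pass.

Lemma polyn_mulrn_eq0 n (x : polyn n) k : (x *+ k.+1 == 0) = (x == 0).
Proof.
rewrite -mulr_natr mulf_eq0 orbC; suff -> : (k.+1%:R == 0 :> polyn n) = false by [].
elim: n {x} => [|n IH] /=; first by rewrite (pnatr_eq0 rat).
by rewrite -polyC_natr polyC_eq0 IH.
Qed.

Definition cut (z : Z -> Z) (c : Z) := forall x, (x < c)%Zs -> (z x < c)%Zs.

Lemma cut_ge z c x : inv z -> cut z c -> (c <= x)%Zs -> (c <= z x)%Zs.
Proof. by move=> zK zc h; have [//|/zc] := Z.le_gt_cases c (z x); rewrite zK; lia. Qed.

Lemma cut_dsc z c i : inv z -> cut z c -> dsc z i -> (i + 1)%Zs <> c.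
Proof.
move=> zK zc; rewrite /dsc => d e; have := zc i; have := cut_ge (x := c) zK zc.
by rewrite e in d; lia.
Qed.

Lemma cut_strip z c i : inv z -> cut z c -> dsc z i -> cut (strip z i) c.
Proof.
move=> zK zc d x lt; have n := cut_dsc zK zc d.
have sc y : (y < c)%Zs -> (sw i (i + 1) y < c)%Zs by rewrite /sw; repeat zcase; lia.
rewrite /strip; case: Z.eqb_spec => _; last by apply: (sc); apply: zc; apply: (sc).
by rewrite /unarc; repeat zcase; try lia; apply: zc.
Qed.

Definition Theta (x : Z) : Z := if Z.even x then (x + 1)%Zs else (x - 1)%Zs.

Lemma Theta_cases x : (Theta x = x + 1 /\ Theta (x + 1) = x)%Zs \/ (Theta x = x - 1 /\ Theta (x - 1) = x)%Zs.
Proof.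
rewrite /Theta Z.even_add Z.even_sub /=; case: (Z.even x) => /=; lia.
Qed.

Lemma ThetaK : inv Theta.
Proof. by move=> x; have [[-> ->]|[-> ->]] := Theta_cases x. Qed.

Lemma Theta_adj a b : (a < b)%Zs -> (Theta b < Theta a)%Zs -> Theta a = b /\ Theta b = a.
Proof.
have := ThetaK a.
by have [[h1 h2]|[h1 h2]] := Theta_cases a; have [[h3 h4]|[h3 h4]] := Theta_cases b; rewrite h1 h3; lia.
Qed.

Lemma tau_neq_id z a b : inv z -> rect z a b -> tau z a b <> id.
Proof.
move=> zK; move: a b; apply: canon_ind => // [a b ab|a b ab]; first by rewrite tau_sym.
have [[lt zlt _] _ _] := ab; have [[ea eb ->]|[l1 l2 ->]|[l1 l2 ->]] := tau_canon zK ab => e.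
- by have := congr1 (fun f => f a) e; rewrite /addarc Z.eqb_refl; lia.
- have := congr1 (fun f => f b) e; rewrite /addarc Z.eqb_refl.
  by case: Z.eqb_spec => h; lia.
have zE : z = id by rewrite -(cjK z (swK a b)) e; apply: functional_extensionality => x; rewrite /cj swK.
by move: l1; rewrite zE; lia.
Qed.

Lemma tau_eq_Theta z a b : inv z -> rect z a b -> tau z a b = Theta -> z a = a /\ z b = b.
Proof.
move=> zK; move: a b; apply: canon_ind => // [a b ab|a b ab].
  by rewrite tau_sym // !zK => h /h[] *.
have [[lt zlt _] _ _] := ab; have [[ea eb ->]|[l1 l2 ->]|[l1 l2 ->]] := tau_canon zK ab => e //.
  have := congr1 (fun f => f a) e; rewrite /addarc /unarc Z.eqb_refl !eqbF; try lia.
  by have [[]|[]] := Theta_cases a; lia.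
have zE : z = cj (sw a b) Theta by rewrite -e cjK //; apply: swK.
have za : z a = sw a b (Theta b) by rewrite zE /cj; congr (sw _ _ (Theta _)); rewrite /sw; zall.
have zb : z b = sw a b (Theta a) by rewrite zE /cj; congr (sw _ _ (Theta _)); rewrite /sw; zall.
have [h1 h2] : Theta a <> a /\ Theta b <> b by split; [have := Theta_cases a|have := Theta_cases b]; lia.
exfalso; have [e1|n1] := Z.eqb_spec (Theta a) b.
  have e2 : Theta b = a by rewrite -e1 ThetaK.
  by move: zlt; rewrite za zb e1 e2 /sw; zall.
have n2 : Theta b <> a by move=> h; apply: n1; rewrite -h ThetaK.
rewrite !swN // in za zb; rewrite za zb in zlt.
by case: n1; case: (Theta_adj lt zlt).
Qed.

(** The cuts at [lo] and [hi] confine r during the strips, away from the first and last points of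
    the window; the boundary term of the telescoping sits at the first one. *)
Record dom (z : Z -> Z) (A : Z) (N : nat) (lo hi : Z) : Prop := Dom {
  dom_inv : inv z; dom_A : cut z A; dom_B : cut z (A + Z.of_nat N + 1);
  dom_lo : cut z lo; dom_hi : cut z hi;
  dom_ltA : (A < lo)%Zs; dom_ltB : (hi <= A + Z.of_nat N)%Zs }.

Lemma dom_strip z A N lo hi i : dom z A N lo hi -> dsc z i -> dom (strip z i) A N lo hi.
Proof. by case=> *; split=> //; [apply: strip_inv|apply: cut_strip|apply: cut_strip|apply: cut_strip|apply: cut_strip]. Qed.

Lemma dom_window z A N lo hi x : dom z A N lo hi -> x \in zr A N.+1 -> z x \in zr A N.+1.
Proof.
case=> zK hA hB _ _ _ _; rewrite !mem_zr => /andP[/Z.leb_spec0 h1 /Z.ltb_spec0 h2].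
have := hB x; have := cut_ge zK hA h1.
by move=> k1 k2; apply/andP; split; [apply/Z.leb_spec0|apply/Z.ltb_spec0]; lia.
Qed.

Lemma dom_sw z A N lo hi i r : dom z A N lo hi -> dsc z i -> (lo <= r < hi)%Zs ->
  (lo <= sw i (i + 1) r < hi)%Zs.
Proof.
case=> zK _ _ hl hh _ _ d; have := cut_dsc zK hl d; have := cut_dsc zK hh d.
by rewrite /sw; repeat zcase; lia.
Qed.

Lemma paired_strip z i r r' : inv z -> dsc z i -> paired z r r' -> 
  paired (strip z i) (sw i (i + 1) r) (sw i (i + 1) r').
Proof.
move=> zK d p; rewrite /paired /strip; case: Z.eqb_spec => zi; last first.
  by rewrite /cj !swK; case: p => [->|[-> ->]]; [left|right].
have zj : z (i + 1)%Zs = i by rewrite -zi zK.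
case: p => [e|[e1 e2]]; last first.
  have n x : z x = x -> x <> i /\ x <> (i + 1)%Zs by move=> e; split=> h; move: e; rewrite h ?zi ?zj; lia.
  have [n1 n2] := n _ e1; have [n3 n4] := n _ e2.
  by right; rewrite !swN // /unarc !eqbF.
have [e1|n1] := Z.eqb_spec r i; first by right; rewrite -e e1 zi /unarc /sw; split; zall.
have [e1|n2] := Z.eqb_spec r (i + 1); first by right; rewrite -e e1 zj /unarc /sw; split; zall.
have n3 : r' <> i by rewrite -e => h; apply: n2; rewrite -[r]zK h.
have n4 : r' <> (i + 1)%Zs by rewrite -e => h; apply: n1; rewrite -[r]zK h.
by left; rewrite !swN // /unarc !eqbF.
Qed.

Section Sums.
Variables (V : zmodType) (W : seq Z) (H : (Z -> Z) -> V) (z : Z -> Z).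
Hypotheses (uW : uniq W) (zK : inv z) (zW : forall x, x \in W -> z x \in W).

Lemma Top_sym r : Top W H z (z r) = Top W H z r.
Proof.
rewrite /Top; have pW : perm_eq (map z W) W.
  apply: uniq_perm => //; first by rewrite map_inj_uniq // => x y; apply: inv_eq.
  move=> x; apply/mapP/idP => [[y yW ->]|xW]; first exact: zW.
  by exists (z x); rewrite ?zK ?zW.
rewrite -(perm_big _ pW) big_map /=.
by apply: eq_bigr => x _; rewrite !gterm_sym.
Qed.
End Sums.

Section Trans.
Variables (A : Z) (N : nat) (lo hi : Z).
Let W := zr A N.+1.

Lemma Fs_pair b0 (P : Z -> Z -> Prop) :
  (forall i r r', P r r' -> P (sw i (i + 1) r) (sw i (i + 1) r')) ->
  (forall z r r', dom z A N lo hi -> (lo <= r < hi)%Zs -> (lo <= r' < hi)%Zs -> paired z r r' -> P r r' ->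
     Top W (@Fs b0 (zr A N) 0) z r + Top W (@Fs b0 (zr A N) 0) z r' = 0) ->
  forall n z r r', dom z A N lo hi -> (lo <= r < hi)%Zs -> (lo <= r' < hi)%Zs -> paired z r r' -> P r r' ->
     Top W (@Fs b0 (zr A N) n) z r + Top W (@Fs b0 (zr A N) n) z r' = 0.
Proof.
move=> PS P0; elim=> [//|n IH] z r r' dz hr hr' p Pr.
pose Q z r r' := [/\ dom z A N lo hi, (lo <= r < hi)%Zs, (lo <= r' < hi)%Zs, paired z r r' & P r r'].
apply: (@Top_pass _ _ A N Q) => //.
- move=> {z r r' dz hr hr' p Pr} z r r' [dz hr hr' p _]; have [zK _ _ _ _ l1 l2] := dz; split=> //; try lia.
  by move=> x; apply: dom_window dz.
- move=> {z r r' dz hr hr' p Pr} z r r' i [dz hr hr' p Pr] d; split; [exact: dom_strip|exact: dom_sw dz d hr|exact: dom_sw dz d hr'| |exact: PS].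
  by apply: paired_strip => //; case: dz.
- by move=> {z r r' dz hr hr' p Pr} z r r' [dz hr hr' p Pr]; apply: IH.
Qed.

Lemma Fs0_gterm b0 z a b : (rect z a b -> tau z a b <> b0) -> gterm z a b (@Fs b0 (zr A N) 0) = 0.
Proof.
move=> h; have [r|n] := pselect (rect z a b); last by rewrite gtermN.
by rewrite gtermT //= asboolF ?mul0rn //; apply: h.
Qed.

(** By symmetry the sum of the identities at r and z r is twice the one at r. In zero variables
    every term vanishes, since no cover is the identity. *)
Theorem Fs_trans_O n z r : dom z A N lo hi -> (lo <= r < hi)%Zs -> Top W (@Fs id (zr A N) n) z r = 0.
Proof.
move=> dz hr; have zK := dom_inv dz.
apply/eqP; rewrite -(polyn_mulrn_eq0 _ 1) mulr2n -{2}(Top_sym _ (zr_uniq _ _) zK) => [|x]; last exact: dom_window dz.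
apply/eqP; apply: (@Fs_pair id (fun _ _ => True)) => //; last by left.
  move=> {z r dz hr zK} z r r' dz _ _ _ _; have zK := dom_inv dz.
  by rewrite /Top !big1 ?addr0 // => x _; rewrite !Fs0_gterm ?subrr // => h; apply: tau_neq_id.
case: dz => _ _ _ h1 h2 _ _; split; first by apply: cut_ge => //; lia.
by apply: h2; lia.
Qed.

(** In zero variables a cover equals [Theta] only when it joins the last two fixed points. These
    must then be r and r', and the covers of this pair enter with opposite signs at r and at r'; the
    condition that r and r' differ is carried through the passes for this. *)
Theorem Fs_trans_Sp n z r : dom z A N lo hi -> (lo <= r < hi)%Zs -> z r <> r -> Top W (@Fs Theta (zr A N) n) z r = 0.
Proof.
move=> dz hr nr; have zK := dom_inv dz.
apply/eqP; rewrite -(polyn_mulrn_eq0 _ 1) mulr2n -{2}(Top_sym _ (zr_uniq _ _) zK) => [|x]; last exact: dom_window dz.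
have hzr : (lo <= z r < hi)%Zs.
  case: dz => _ _ _ h1 h2 _ _; split; first by apply: cut_ge => //; lia.
  by apply: h2; lia.
apply/eqP; apply: (@Fs_pair Theta (fun r r' => r <> r') _ _ n z r (z r) dz hr hzr (or_introl erefl) (not_eq_sym nr)).
  by move=> i x y n1 /sw_inj.
move=> {z r dz hr zK nr hzr} z r r' dz hr hr' p nr; have zK := dom_inv dz.
have g0 a b : (z a = a -> z b = b -> rect z a b -> tau z a b = Theta -> False) -> gterm z a b (@Fs Theta (zr A N) 0) = 0.
  move=> h; apply: Fs0_gterm => R e; have [e1 e2] := tau_eq_Theta zK R e; exact: h.
case: p => [e|[e1 e2]].
  have n1 : z r <> r by rewrite e; apply: not_eq_sym.
  have n2 : z r' <> r' by rewrite -e zK e.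
  by rewrite /Top !big1 ?addr0 // => x _; rewrite !g0 ?subrr.
have inW x : (lo <= x < hi)%Zs -> x \in W.
  by case: dz => _ _ _ _ _ l1 l2 hx; rewrite mem_zr; apply/andP; split; [apply/Z.leb_spec0|apply/Z.ltb_spec0]; lia.
have g1 a b x : rect z a b -> tau z a b = Theta -> z a = a -> z b = b -> z x = x -> x <> a -> x <> b -> False.
  move=> R e h1 h2 hx n1 n2; have := congr1 (fun f => f x) e.
  by rewrite /tau h1 h2 !Z.eqb_refl /addarc !eqbF // hx; have := Theta_cases x; lia.
rewrite /Top (bigD1_seq r') ?zr_uniq ?inW //= big1 => [|x /eqP nx]; last first.
  have [->|nxr] := Z.eqb_spec x r; first by rewrite subrr.
  rewrite !g0 ?subrr // => h1 h2 R e; [apply: (g1 _ _ r' R e); congruence | apply: (g1 _ _ r' R e); congruence].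
rewrite (bigD1_seq r) ?zr_uniq ?inW //= big1 => [|x /eqP nx]; last first.
  have [->|nxr] := Z.eqb_spec x r'; first by rewrite subrr.
  rewrite !g0 ?subrr // => h1 h2 R e; [apply: (g1 _ _ r R e); congruence | apply: (g1 _ _ r R e); congruence].
by rewrite !addr0 addrC addrA subrK subrr.
Qed.
End Trans.

(** * Independence of the window *)

Definition base (sp : bool) : Z -> Z := if sp then Theta else id.

(** Windows end at even numbers so that no arc of [Theta] crosses their boundary. *)
Definition ev (k : nat) : Z := (2 * Z.of_nat k)%Zs.

Record supp (sp : bool) (z : Z -> Z) (k : nat) : Prop := Supp {
  supp_inv : inv z;
  supp_out : forall x, (x < - ev k \/ ev k <= x)%Zs -> z x = base sp x }.

Definition letters (k : nat) : seq Z := zr (- ev k) (4 * k).-1.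
Definition window (k : nat) : seq Z := zr (- ev k) (4 * k).

Lemma Theta_cut k x : ((x < ev k) <-> (Theta x < ev k))%Zs /\ ((x < - ev k) <-> (Theta x < - ev k))%Zs.
Proof.
rewrite /Theta /ev; case E: (Z.even x).
  have [m ->] : exists m, x = (2 * m)%Zs by apply/Z.even_spec; rewrite E.
  by lia.
have [m ->] : exists m, x = (2 * m + 1)%Zs by apply/Z.odd_spec; rewrite -Z.negb_even E.
by lia.
Qed.

Lemma base_cut sp k x : ((x < ev k) <-> (base sp x < ev k))%Zs /\ ((x < - ev k) <-> (base sp x < - ev k))%Zs.
Proof. by case: sp => /=; [exact: Theta_cut|]. Qed.

Lemma supp_mono sp z k K : supp sp z k -> (k <= K)%N -> supp sp z K.
Proof. by move=> [zK h] le; split=> // x hx; apply: h; rewrite /ev in hx *; lia. Qed.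

Lemma supp_cut sp z k : supp sp z k -> cut z (- ev k) /\ cut z (ev k).
Proof.
move=> [zK h]; have b x := base_cut sp k x; split=> x hx.
  by rewrite h; [apply/(b x).2|left].
have [//|le] := Z.lt_ge_cases (z x) (ev k).
have := h (z x) (or_intror le); rewrite zK => e.
by have [[_ b1] _] := b (z x); move: b1; rewrite -e => /(_ hx); lia.
Qed.

Lemma mem_window k x : (x \in window k) = ((- ev k <=? x) && (x <? ev k))%Zs.
Proof. by rewrite mem_zr; congr (_ && Z.ltb _ _); rewrite /ev; lia. Qed.

Lemma letters_window k : (0 < k)%N -> window k = zr (- ev k) (4 * k).-1.+1.
Proof. by move=> k0; rewrite prednK //; lia. Qed.

Lemma zr_cat a k l : zr a (k + l) = zr a k ++ zr (a + Z.of_nat k)%Zs l.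
Proof.
elim: k a => [|k IH] a /=; first by rewrite Z.add_0_r.
by rewrite IH; congr (_ :: (_ ++ zr _ _)); lia.
Qed.

Lemma strip_fixed z i x : inv z -> z x = x -> exists x', strip z i x' = x'.
Proof.
move=> zK zx; rewrite /strip; case: Z.eqb_spec => _; first by exists i; rewrite /unarc Z.eqb_refl.
by exists (sw i (i + 1) x); rewrite /cj swK zx.
Qed.

(** A strip moves a fixed point or creates new ones but never removes the last, while [Theta] has
    none. This is what discards covers with fixed points in the fixed-point-free case. *)
Lemma Fs_dead L n z x : inv z -> z x = x -> @Fs Theta L n z = 0.
Proof.
elim: n z x => [|n IH] z x zK zx /=.
  by rewrite asboolF // => e; move: zx; rewrite e; have := Theta_cases x; lia.
elim: {2}L z x zK zx => [|i L' IHL] z x zK zx /=; first by rewrite (IH z x).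
rewrite (IHL z x) // add0r /Dop; case: ifP => _; last by rewrite mulr0.
by have [x' hx'] := strip_fixed i zK zx; rewrite (IHL _ x') ?mulr0 //; apply: strip_inv.
Qed.

Section Stable.
Variables (sp : bool) (k : nat).
Let b0 := base sp.

Definition inner (i : Z) := (- ev k <= i < ev k - 1)%Zs.

Lemma supp_strip z i : supp sp z k -> dsc z i -> inner i -> supp sp (strip z i) k.
Proof.
move=> [zK h] d hi; split; first exact: strip_inv.
move=> x hx; have [n1 n2] : x <> i /\ x <> (i + 1)%Zs by rewrite /inner in hi; lia.
have zn y : y = i \/ y = (i + 1)%Zs -> z x <> y.
  move=> hy e; have := supp_cut (Supp zK h); have := h x hx; have := base_cut sp k x.
  by rewrite /inner /ev in hi hx *; rewrite e => -[b1 b2] hb; rewrite -hb in b1 b2; case: hy => hy; lia.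
have m1 := zn i (or_introl erefl); have m2 := zn _ (or_intror erefl).
rewrite /strip; case: ifP => _; first by rewrite /unarc !eqbF // h.
by rewrite /cj (swN n1) // swN // h.
Qed.

(** Outside the window z is the base involution, whose only descents are arcs (i, i+1) of [Theta].
    Cutting one creates fixed points, so letters outside the window contribute nothing. *)
Lemma outer_dead i z : supp sp z k -> ~ inner i -> dsc z i ->
  exists x, sp /\ strip z i x = x.
Proof.
move=> sz ni d; have [zK h] := sz; have [c1 c2] := supp_cut sz.
have n1 := cut_dsc zK c1 d; have n2 := cut_dsc zK c2 d.
have [h1 h2] : z i = b0 i /\ z (i + 1)%Zs = b0 (i + 1)%Zs.
  by rewrite /inner in ni; split; apply: h; lia.
move: d; rewrite /dsc h1 h2 /b0 /base; case E: sp => d; last by lia.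
exists i; split=> //.
have zi : z i = (i + 1)%Zs by rewrite h1 /b0 /base E; have [] := @Theta_adj i (i + 1)%Zs ltac:(lia) d.
by rewrite /strip zi Z.eqb_refl /unarc Z.eqb_refl.
Qed.

Lemma Dop_outer L1 L n i z : supp sp z k -> ~ inner i -> Dop i (pass (@Fs b0 L n) L1) z = 0.
Proof.
move=> sz ni; rewrite /Dop; case: Z.ltb_spec => // d.
have [x [hsp hx]] := outer_dead sz ni d.
have zK : inv (strip z i) by apply: strip_inv; case: sz.
have H w y : inv w -> w y = y -> @Fs b0 L n w = 0.
  by rewrite /b0 /base hsp => wK wy; apply: Fs_dead wK wy.
elim: L1 (strip z i) x hx zK => [|j L' IHL] w y wy wK /=; first by rewrite (H w y).
rewrite (IHL w y) // add0r /Dop; case: ifP => _; last by rewrite mulr0.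
by have [y' hy'] := strip_fixed j wK wy; rewrite (IHL _ y') ?mulr0 //; apply: strip_inv.
Qed.

Lemma pass_outer L1 L2 L n z : supp sp z k -> (forall i, i \in L1 -> ~ inner i) ->
  pass (@Fs b0 L n) (L1 ++ L2) z = pass (@Fs b0 L n) L2 z.
Proof.
move=> sz; elim: L1 => //= i L1 IH h; rewrite Dop_outer //; last by apply: h; rewrite mem_head.
by rewrite mulr0 addr0 IH // => j hj; apply: h; rewrite in_cons hj orbT.
Qed.

Lemma pass_inner (R : comNzRingType) (H H' : (Z -> Z) -> R) L L3 z :
  (forall z, supp sp z k -> pass H L3 z = (H' z)%:P) -> supp sp z k -> (forall i, i \in L -> inner i) ->
  pass H (L ++ L3) z = pass H' L z.
Proof.
move=> h; elim: L z => [|i L IH] z sz hL /=; first exact: h.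
have hL' j : j \in L -> inner j by move=> hj; apply: hL; rewrite in_cons hj orbT.
rewrite IH //; congr (_ + 'X * _); rewrite /Dop; case: Z.ltb_spec => // d.
by rewrite IH //; apply: supp_strip => //; apply: hL; rewrite mem_head.
Qed.

Lemma Fs_stable K n z : (0 < k <= K)%N -> supp sp z k ->
  @Fs b0 (letters K) n z = @Fs b0 (letters k) n z.
Proof.
move=> kK; elim: n z => //= n IH z sz.
have E : letters K = zr (- ev K) (2 * (K - k)) ++ letters k ++ zr (ev k - 1)%Zs (2 * (K - k)).
  rewrite /letters; have -> : (4 * K).-1 = (2 * (K - k) + ((4 * k).-1 + 2 * (K - k)))%N by lia.
  rewrite (zr_cat _ (2 * (K - k)) _) (zr_cat _ (4 * k).-1 _).
  by congr (_ ++ (zr _ _ ++ zr _ _)); rewrite /ev; lia.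
rewrite [X in pass _ X _ = _]E pass_outer // => [|i].
  apply: pass_inner => // [w sw|i]; last first.
    by rewrite mem_zr /inner => /andP[/Z.leb_spec0 h1 /Z.ltb_spec0]; rewrite /ev in h1 *; lia.
  rewrite -[X in pass _ X]cats0 pass_outer //= ?IH // => i.
  by rewrite mem_zr /inner => /andP[/Z.leb_spec0 h1 /Z.ltb_spec0]; rewrite /ev in h1 *; lia.
by rewrite mem_zr /inner => /andP[/Z.leb_spec0 h1 /Z.ltb_spec0]; rewrite /ev in h1 *; lia.
Qed.
End Stable.

(* any large enough window computes the same value *)
Definition Fn (sp : bool) (n : nat) (z : Z -> Z) : polyn n :=
  if pselect (exists k, (0 < k)%N /\ supp sp z k) is left h then
    @Fs (base sp) (letters (projT1 (cid h))) n z else 0.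

Lemma FnE sp n z k : (0 < k)%N -> supp sp z k -> Fn sp n z = @Fs (base sp) (letters k) n z.
Proof.
move=> k0 sz; rewrite /Fn; case: pselect => [h|[]]; last by exists k.
case: (cid h) => /= k' [k0' sz'].
case: (leqP k k') => le; first by rewrite (Fs_stable n _ sz) // k0.
by rewrite -(Fs_stable n (K := k) _ sz') // k0' ltnW.
Qed.

Definition fin sp z := exists k, supp sp z k.

Lemma fin_inv sp z : fin sp z -> inv z.
Proof. by case=> k []. Qed.

Lemma finP sp z k0 : fin sp z -> exists k, [/\ (0 < k)%N, (k0 <= k)%N & supp sp z k].
Proof.
case=> k sz; exists (maxn 1 (maxn k k0)); split; [lia|lia|].
by apply: supp_mono sz _; lia.
Qed.

Lemma supp_tau sp z k a b : supp sp z k -> rect z a b -> (- ev k <= a < ev k)%Zs ->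
  (- ev k <= b < ev k)%Zs -> supp sp (tau z a b) k.
Proof.
move=> sz r ha hb; have [zK h] := sz; have [c1 c2] := supp_cut sz.
split; first exact: tau_inv.
have inz y : (- ev k <= y < ev k)%Zs -> (- ev k <= z y < ev k)%Zs.
  by move=> hy; split; [apply: cut_ge zK c1 _; lia | apply: c2; lia].
move=> x hx; rewrite tau_out ?h //.
have := inz _ ha; have := inz _ hb; have hz : ~ (- ev k <= z x < ev k)%Zs.
  by move=> /inz; rewrite zK; lia.
by move=> h1 h2; split; move=> e; move: hx hz; rewrite ?e; lia.
Qed.

Theorem Fn_trans sp n z k r : supp sp z k -> (- ev k <= r < ev k)%Zs -> (sp -> z r <> r) ->
  Top (window k.+1) (Fn sp n) z r = 0.
Proof.
move=> sz hr nr; have [zK h] := sz; have sz1 := supp_mono sz (leqnSn k).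
have [c1 c2] := supp_cut sz; have [d1 d2] := supp_cut sz1.
(* The window is one step wider than the support, which provides the margin that [dom] asks for. *)
have D : dom z (- ev k.+1) (4 * k.+1).-1 (- ev k) (ev k).
  split=> //; try (rewrite /ev; lia).
  by have -> : (- ev k.+1 + Z.of_nat (4 * k.+1).-1 + 1)%Zs = ev k.+1 by rewrite /ev; lia.
have E : Top (window k.+1) (Fn sp n) z r = Top (window k.+1) (@Fs (base sp) (letters k.+1) n) z r.
  rewrite /Top; apply: eq_big_seq => x; rewrite mem_window => /andP[/Z.leb_spec0 h1 /Z.ltb_spec0 h2].
  have hr' : (- ev k.+1 <= r < ev k.+1)%Zs by rewrite /ev in hr *; lia.
  have G a b : (- ev k.+1 <= a < ev k.+1)%Zs -> (- ev k.+1 <= b < ev k.+1)%Zs ->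
      gterm z a b (Fn sp n) = gterm z a b (@Fs (base sp) (letters k.+1) n).
    move=> ha hb; have [R|nR] := pselect (rect z a b); last by rewrite !gtermN.
    by rewrite !gtermT // (FnE n _ (supp_tau sz1 R ha hb)).
  by rewrite !G.
rewrite E letters_window //; move: nr; rewrite /base; case: (sp) => nr.
  by apply: Fs_trans_Sp D hr (nr isT).
exact: Fs_trans_O D hr.
Qed.

End TransitionEquations.

(** * Grassmannian involutions *)

Section GrassmannianInvolutions.
Local Open Scope Z_scope.

(** Without fixed points the left ends are shifted by one, so that the arc of a padding part 0
    starts at -1. *)
Definition off (sp : bool) : Z := if sp then -1 else 0.
(** In the fixed-point-free case the number of arcs over the gap must be even, since the points
    right of them are matched as in [Theta]. *)
Definition pad (sp : bool) (l : seq nat) : seq nat := if sp && odd (size l) then rcons l 0%N else l.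
Definition tail (sp : bool) (m x : Z) : Z := if sp then (if Z.even (x - m) then x + 1 else x - 1) else x.

(* right ends of the arcs over the gap between -1 and 0 are 0, 1, 2, ... and
   their left ends encode the parts *)
Record grass (sp : bool) (l : seq nat) (z : Z -> Z) : Prop := Grass {
  gr_fin : fin sp z;
  gr_fpf : sp -> forall x, z x <> x;
  gr_pre : prefix sp z;
  gr_right : forall j, (j < size l)%N -> z (Z.of_nat j) = off sp - Z.of_nat (nth 0%N l j);
  gr_tail : forall x, Z.of_nat (size l) <= x -> z x = tail sp (Z.of_nat (size l)) x }.

Lemma tail_ge sp m x : m <= x -> m <= tail sp m x.
Proof.
rewrite /tail; case: sp => // h; case E: (Z.even (x - m)); first by lia.
have : x - m <> 0 by move=> e; rewrite e in E.
by lia.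
Qed.

(** The nonnegative points are prescribed, hence so are the negative points matched with them. On
    the remaining negative points [prefix] leaves no choice, which is shown by induction from the
    far left, where both involutions are the base. *)
Lemma grass_uniq sp l z z' : grass sp l z -> grass sp l z' -> z = z'.
Proof.
move=> g g'; have zK := fin_inv (gr_fin g); have zK' := fin_inv (gr_fin g').
apply: functional_extensionality.
have nonneg x : 0 <= x -> z x = z' x.
  move=> hx; have [l1|l1] := Z.lt_ge_cases x (Z.of_nat (size l)).
    have -> : x = Z.of_nat (Z.to_nat x) by lia.
    by rewrite (gr_right g) ?(gr_right g') //; lia.
  by rewrite (gr_tail g) // (gr_tail g').
have back w w' x : inv w -> inv w' -> (forall x, 0 <= x -> w x = w' x) -> 0 <= w x -> w x = w' x.
  by move=> wK wK' h hx; have := h _ hx; rewrite wK => e; rewrite [in RHS]e wK'.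
have [k [k0 _ sz]] := finP 1 (gr_fin g); have [k' [k0' _ sz']] := finP k (gr_fin g').
have neg n x : x < - ev (maxn k k') + Z.of_nat n -> x < 0 -> z x = z' x.
  elim: n x => [|n IH] x hx h0.
    rewrite (supp_out sz) ?(supp_out sz') //; left; rewrite /ev in hx *; lia.
  have [l1|l1] := Z.lt_ge_cases x (- ev (maxn k k') + Z.of_nat n); first exact: IH.
  have [l2|l2] := Z.le_gt_cases 0 (z x); first exact: back.
  have [l3|l3] := Z.le_gt_cases 0 (z' x); first by apply/esym/back => // y hy; rewrite nonneg.
  have b w w' : inv w -> inv w' -> (forall y, y < - ev (maxn k k') + Z.of_nat n -> y < 0 -> w y = w' y) ->
     w x < x -> w x < 0 -> w x = w' x.
    by move=> wK wK' h h1 h2; have := h (w x); rewrite wK => h3; rewrite [in RHS]h3 ?wK' //; lia.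
  have [l4|l4] := Z.lt_ge_cases (z x) x; first exact: b IH l4 l2.
  have [l5|l5] := Z.lt_ge_cases (z' x) x.
    by apply/esym/(b _ _ zK' zK) => // y *; rewrite IH.
  have := gr_pre g; have := gr_pre g'; have := gr_fpf g; have := gr_fpf g'.
  rewrite /prefix; case: (sp) => f1 f2 p1 p2; last first.
    have := p2 (z x) l2; have := p1 (z' x) l3; rewrite zK zK'; lia.
  have n1 := f2 isT x; have n2 := f1 isT x.
  have [//|[l6|l6]] : z x = z' x \/ z x < z' x \/ z' x < z x by lia.
    have h := p1 x (z x); have e := back z' z (z x) zK' zK (fun y hy => esym (nonneg y hy)).
    have {}h : 0 <= z' (z x) by apply: h; lia.
    by have := e h; rewrite zK => e'; move: h; rewrite e'; lia.
  have h := p2 x (z' x); have e := back z z' (z' x) zK zK' nonneg.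
  have {}h : 0 <= z (z' x) by apply: h; lia.
  by have := e h; rewrite zK' => e'; move: h; rewrite e'; lia.
move=> x; have [l1|l1] := Z.le_gt_cases 0 x; first exact: nonneg.
by apply: (neg (Z.to_nat (ev (maxn k k')))) => //; lia.
Qed.

(** The function f_l in n variables. For strict partitions [grass_ex] provides the involution, so
    the default 0 does not occur there. *)
Definition fam (sp : bool) (l : seq nat) (n : nat) : polyn n :=
  if pselect (exists z, grass sp (pad sp l) z) is left h then Fn sp n (projT1 (cid h)) else 0%R.

Lemma famE sp l n z : grass sp (pad sp l) z -> fam sp l n = Fn sp n z.
Proof.
move=> g; rewrite /fam; case: pselect => [h|[]]; last by exists z.
by case: (cid h) => z' g' /=; rewrite (grass_uniq g g').
Qed.

(** * Leaves of the recursion are Grassmannian *)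

Definition leaf sp z := [/\ fin sp z, sp -> (forall x, z x <> x), prefix sp z &
  forall i j, vis sp z i j -> i < 0].

Section Leaf.
Variables (sp : bool) (z : Z -> Z).
Hypothesis lz : leaf sp z.
Let zK : inv z. Proof. by apply: (@fin_inv sp); case: lz. Qed.

(** A failure would make (i, j) visible. Consequently the nonnegative points with a negative partner
    form an initial segment and their partners increase, so the parts strictly decrease. *)
Lemma leaf_below i j : 0 <= i -> i < j -> z j < 0 -> z i < z j.
Proof.
move=> h1 h2 h3; have [_ _ _ nv] := lz; have := nv i j.
have : z i <> z j by move/(inv_eq zK); lia.
have [//|] := Z.lt_ge_cases (z i) (z j).
by rewrite /vis; case: (sp); lia.
Qed.

Lemma leaf_right : exists m : nat, (forall i, 0 <= i -> (z i < 0 <-> i < Z.of_nat m)).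
Proof.
have [k [_ _ sz]] := finP 0 (let: And4 f _ _ _ := lz in f).
have ex : exists n, ~~ (z (Z.of_nat n) <? 0).
  exists (2 * k)%N; apply/negP => /Z.ltb_spec0.
  have [_ c2] := supp_cut sz; have := cut_ge (x := Z.of_nat (2 * k)) zK c2; rewrite /ev; lia.
case: (ex_minnP ex) => m hm mn; exists m => i hi; split=> h.
  have [//|le] := Z.lt_ge_cases i (Z.of_nat m); exfalso.
  have nm : ~ z (Z.of_nat m) < 0 by move/Z.ltb_spec0; apply/negP.
  have [e|lt] : i = Z.of_nat m \/ Z.of_nat m < i by lia.
    by apply: nm; rewrite -e.
  by have := leaf_below (i := Z.of_nat m) (j := i); lia.
have [//|le] := Z.lt_ge_cases (z i) 0; exfalso.
have := mn (Z.to_nat i); have -> : Z.of_nat (Z.to_nat i) = i by lia.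
by have -> : (z i <? 0) = false by [apply/Z.ltb_spec0; lia]; move=> /(_ isT); lia.
Qed.

Lemma leaf_tail (m : nat) : (forall i, 0 <= i -> (z i < 0 <-> i < Z.of_nat m)) ->
  forall x, Z.of_nat m <= x -> z x = tail sp (Z.of_nat m) x.
Proof.
move=> hm; have [_ f pre nv] := lz.
have ge x : Z.of_nat m <= x -> Z.of_nat m <= z x.
  move=> h; have h1 := hm x; have h2 := hm (z x); rewrite zK in h2; lia.
rewrite /tail; case E : (sp) => x hx; last first.
  rewrite E in nv; have := nv x (z x); have := nv (z x) x; have := ge _ hx; rewrite /vis zK; lia.
rewrite E in nv f; have {}f := f isT.
(* From m on the points are matched in consecutive pairs: were the partner of a beyond a+1, then
   (a+1, z a) would be visible. *)
have st (t : nat) : z (Z.of_nat m + 2 * Z.of_nat t) = Z.of_nat m + 2 * Z.of_nat t + 1.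
  elim/ltn_ind: t => t IH; set a := Z.of_nat m + 2 * Z.of_nat t.
  have old y : Z.of_nat m <= y < a -> Z.of_nat m <= z y < a.
    move=> hy; have [s [hs|hs]] : exists s : nat, y = Z.of_nat m + 2 * Z.of_nat s \/ y = Z.of_nat m + 2 * Z.of_nat s + 1.
      have [s [hs|hs]] : exists s, y - Z.of_nat m = 2 * s \/ y - Z.of_nat m = 2 * s + 1.
        by have [[s hs]|[s hs]] := Z.Even_or_Odd (y - Z.of_nat m); exists s; [left|right]; lia.
      by exists (Z.to_nat s); left; lia.
      by exists (Z.to_nat s); right; lia.
    - by have := IH s; rewrite -hs; lia.
    have := IH s; rewrite -hs => e; have -> : z y = Z.of_nat m + 2 * Z.of_nat s by rewrite -e ?zK; lia.
    by lia.
  have new y : a <= y -> a <= z y.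
    by move=> hy; have := old (z y); rewrite zK; have := ge y; lia.
  have h1 := new a; have h2 := f a; have h3 := new (a + 1).
  have [//|l] : z a = a + 1 \/ a + 1 < z a by lia.
  have n : z (a + 1) <> a by move=> e; have := zK (a + 1); rewrite e; lia.
  by have := nv (a + 1) (z a); rewrite /vis zK; lia.
case Ev : (Z.even (x - Z.of_nat m)).
  have [s hs] : exists s, x - Z.of_nat m = 2 * s by apply/Z.even_spec; rewrite Ev.
  by have := st (Z.to_nat s); have -> : Z.of_nat m + 2 * Z.of_nat (Z.to_nat s) = x by lia.
have [s hs] : exists s, x - Z.of_nat m = 2 * s + 1 by apply/Z.odd_spec; rewrite -Z.negb_even Ev.
have := st (Z.to_nat s); have -> : Z.of_nat m + 2 * Z.of_nat (Z.to_nat s) = x - 1 by lia.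
by have -> : x - 1 + 1 = x by [lia]; move=> e; rewrite -[LHS]/(z x) -[x in LHS]e zK.
Qed.

Lemma leaf_grass : exists2 l, strict_partition l & grass sp (pad sp l) z.
Proof.
have [m hm] := leaf_right; have [fz f pre nv] := lz.
pose l := [seq Z.to_nat (off sp - z (Z.of_nat j)) | j <- iota 0 m].
have sl : size l = m by rewrite size_map size_iota.
have nl j : (j < m)%N -> Z.of_nat (nth 0%N l j) = off sp - z (Z.of_nat j).
  move=> hj; rewrite (nth_map 0%N) ?size_iota // nth_iota // add0n.
  have := hm (Z.of_nat j); rewrite /off; case: (sp); lia.
have G : grass sp l z.
  split=> // [j hj|x hx]; last by rewrite sl in hx *; apply: leaf_tail.
  by rewrite sl in hj; rewrite nl //; lia.
have sd i j : (i < j < m)%N -> (nth 0 l j < nth 0 l i)%N.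
  move=> hij; have := nl i; have := nl j; have := @leaf_below (Z.of_nat i) (Z.of_nat j).
  have := hm (Z.of_nat j); lia.
have sorted_l : sorted gtn l.
  apply/(sortedP 0%N) => i hi; rewrite sl in hi; apply: sd; lia.
(* Far to the right z is both [Theta] and the tail that starts at m, which forces m to be even. *)
have evm : sp -> ~~ odd m.
  move=> hsp; have [k [_ km sz]] := finP m fz.
  have t : z (ev k) = tail true (Z.of_nat m) (ev k).
    by rewrite (gr_tail G) ?sl ?hsp // /ev; lia.
  have t' : z (ev k) = Theta (ev k) by rewrite (supp_out sz) /base ?hsp //; right; lia.
  rewrite t' /tail in t.
  move: t; rewrite /Theta; have -> : Z.even (ev k) by rewrite /ev Z.even_mul.
  case Ev : (Z.even _); last by lia.
  have [s hs] : exists s, ev k - Z.of_nat m = 2 * s by apply/Z.even_spec; rewrite Ev.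
  by move=> _; rewrite /ev in hs; lia.
(* A part 0 comes from an arc starting at -1 and occurs only without fixed points. As the smallest
   part it stands last, and it is exactly the padding. *)
case: (boolP (0%N \in l)) => z0; last first.
  have pl : pad sp l = l by rewrite /pad sl; case: (sp) evm => //= h; rewrite (negbTE (h isT)).
  exists l; last by rewrite pl.
  by rewrite /strict_partition sorted_l; apply/allP => x xl; rewrite lt0n; apply: contraNneq z0 => <-.
have hsp : sp.
  case E : (sp) => //; case/mapP: z0 => j; rewrite mem_iota add0n => /andP[_ hj] e.
  have := hm (Z.of_nat j); rewrite /off E in e; lia.
have [j hj e] : exists2 j, (j < m)%N & nth 0%N l j = 0%N.
  by case/(nthP 0%N): z0 => j; rewrite sl => hj e; exists j.
have mj : m = j.+1.
  have [//|lt] : m = j.+1 \/ (j.+1 < m)%N by lia.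
  by have := sd j j.+1; lia.
have el : l = rcons (take j l) 0%N.
  by rewrite -e -take_nth ?sl // -mj -sl take_size.
have szt : size (take j l) = j by rewrite size_take sl hj.
exists (take j l).
  rewrite /strict_partition (subseq_sorted _ (take_subseq _ _) sorted_l) => [|a b c /=]; last by lia.
  apply/(all_nthP 0%N) => i; rewrite szt => hi; rewrite nth_take //.
  by have := sd i j; lia.
have oj : odd j by have := evm hsp; rewrite mj /= negbK.
have pl : pad sp (take j l) = l by rewrite /pad hsp szt oj /= -el.
by rewrite pl.
Qed.
End Leaf.

(** * Counting arcs and bounding rows at the leaves *)

Definition nfix (z : Z -> Z) (S : seq Z) := uniq S /\ forall x, (x \in S) = (z x != x).

Definition narc (z : Z -> Z) : nat :=
  if pselect (exists S, nfix z S) is left h then (size (projT1 (cid h)))./2 else 0%N.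

Lemma narcE z S : nfix z S -> narc z = (size S)./2.
Proof.
move=> [u h]; rewrite /narc; case: pselect => [h'|[]]; last by exists S.
case: (cid h') => S' [u' hS'] /=; congr (_./2).
by apply/perm_size/uniq_perm => // x; rewrite hS' h.
Qed.

Lemma fin_nfix z : fin false z -> exists S, nfix z S.
Proof.
case=> k [zK h]; exists [seq x <- window k | z x != x]; split.
  by rewrite filter_uniq // zr_uniq.
move=> x; rewrite mem_filter mem_window; case: eqP => //= n.
apply/andP; split; [apply/Z.leb_spec0|apply/Z.ltb_spec0].
  by have [//|l] := Z.le_gt_cases (- ev k) x; case: n; apply: h; left.
by have [//|l] := Z.lt_ge_cases x (ev k); case: n; apply: h; right.
Qed.

Lemma narc_cj z a b : fin false z -> narc (cj (sw a b) z) = narc z.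
Proof.
move=> /fin_nfix[S [u h]]; rewrite (@narcE z S) // (@narcE _ (map (sw a b) S)) ?size_map //.
split; first by rewrite map_inj_uniq //; apply: sw_inj.
move=> x; rewrite -[x in LHS](swK a b) mem_map; last exact: sw_inj.
by rewrite h /cj (can2_eq (swK a b) (swK a b)).
Qed.

Lemma narc_addarc z a b : fin false z -> z a = a -> z b = b -> a <> b ->
  narc (addarc z a b) = (narc z).+1.
Proof.
move=> /fin_nfix[S [u h]] ha hb n; rewrite (@narcE z S) // (@narcE _ [:: a, b & S]) //.
split; first by rewrite /= in_cons !h ha hb !eqxx orbF /= u andbT; apply/eqP.
move=> x; rewrite !in_cons h /addarc.
have [->|n1] := Z.eqb_spec x a; first by rewrite eqxx /=; apply/esym/eqP; lia.
have [->|n2] := Z.eqb_spec x b; first by rewrite eqxx orbT /=; apply/esym/eqP; lia.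
by rewrite (introF eqP n1) (introF eqP n2).
Qed.

Lemma supp_unarc z k a b : supp false z k -> z a = b -> supp false (unarc z a b) k.
Proof.
move=> [zK h] e; split; first exact: unarc_inv.
by move=> x hx; rewrite /unarc; repeat zcase; rewrite ?h //= ; subst.
Qed.

Lemma narc_unarc z a b : fin false z -> z a = b -> a <> b -> narc z = (narc (unarc z a b)).+1.
Proof.
move=> [k sz] e n; have zK := supp_inv sz.
have f : fin false (unarc z a b) by exists k; apply: supp_unarc.
rewrite -(narc_addarc f (a := a) (b := b)) //; last 2 first.
- by rewrite /unarc Z.eqb_refl.
- by rewrite /unarc Z.eqb_refl; case: Z.eqb_spec.
congr narc; apply: functional_extensionality => x; rewrite /addarc /unarc.
have eb : z b = a by rewrite -e zK.
by zall.
Qed.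

Lemma supp_cj_sw sp z k a b : supp sp z k -> (- ev k <= a < ev k) -> (- ev k <= b < ev k) ->
  supp sp (cj (sw a b) z) k.
Proof.
move=> sz ha hb; have [zK h] := sz; have [c1 c2] := supp_cut sz.
split; first by apply: cj_inv => //; apply: swK.
have hs y : (- ev k <= y < ev k) -> (- ev k <= z y < ev k).
  by move=> hy; split; [apply: cut_ge zK c1 _; lia | apply: c2; lia].
move=> x hx; rewrite /cj (@swN a b x) ?h //; try lia.
have hz : ~ (- ev k <= z x < ev k) by move=> /hs; rewrite zK; lia.
by rewrite -h // swN // => e; apply: hz; rewrite e.
Qed.

Lemma finE sp z a b : fin sp z -> exists k, [/\ (0 < k)%N, supp sp z k, - ev k <= a < ev k & - ev k <= b < ev k].
Proof.
move=> /(finP (Z.to_nat (Z.abs a) + Z.to_nat (Z.abs b) + 1)%N)[k [k0 h sz]].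
by exists k; split=> //; rewrite /ev; lia.
Qed.

Lemma fin_cj_sw sp z a b : fin sp z -> fin sp (cj (sw a b) z).
Proof. by move=> /(finE a b)[k [_ sz ha hb]]; exists k; apply: supp_cj_sw. Qed.

Lemma fin_tau sp z a b : fin sp z -> rect z a b -> fin sp (tau z a b).
Proof. by move=> /(finE a b)[k [_ sz ha hb]] r; exists k; apply: supp_tau. Qed.

Lemma fin_unarc z a b : fin false z -> z a = b -> fin false (unarc z a b).
Proof. by case=> k sz e; exists k; apply: supp_unarc. Qed.

Lemma Fn_dead n z x : fin true z -> z x = x -> Fn true n z = 0%R.
Proof.
move=> f e; have [k [k0 _ sz]] := finP 1 f; rewrite (FnE n k0 sz).
by apply: Fs_dead e; case: sz.
Qed.

Lemma grass_narc l z : grass false l z -> sorted gtn l -> all (fun a => 0 < a)%N l -> narc z = size l.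
Proof.
move=> g sl pl; have zK := fin_inv (gr_fin g); set m := size l.
have zr' j : (j < m)%N -> z (Z.of_nat j) = - Z.of_nat (nth 0%N l j).
  by move=> hj; rewrite (gr_right g) //= ; lia.
have pos j : (j < m)%N -> (0 < nth 0%N l j)%N by move=> hj; exact: (all_nthP 0%N pl).
pose S := [seq Z.of_nat j | j <- iota 0 m] ++ [seq z (Z.of_nat j) | j <- iota 0 m].
have inS x : x \in S <-> exists2 j, (j < m)%N & x = Z.of_nat j \/ x = z (Z.of_nat j).
  rewrite mem_cat; split.
    case/orP=> /mapP[j]; rewrite mem_iota add0n => /andP[_ hj] ->; exists j => //; [by left|by right].
  by case=> j hj [->|->]; apply/orP; [left|right]; apply/mapP; exists j; rewrite // mem_iota.
rewrite (@narcE z S); first by rewrite size_cat !size_map size_iota addnn doubleK.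
split.
  rewrite cat_uniq !map_inj_uniq ?iota_uniq ?andbT //=; try (by move=> i j; lia); try (by move=> i j /(inv_eq zK); lia).
  apply/hasPn => x /mapP[j]; rewrite mem_iota add0n => /andP[_ hj] ->.
  by apply/mapP => -[i _]; rewrite zr' //; have := pos _ hj; lia.
move=> x; apply/idP/idP.
  case/inS => j hj [->|->]; apply/eqP; rewrite ?zK zr' //; have := pos _ hj; lia.
move=> /eqP n; apply/inS.
have tl y : Z.of_nat m <= y -> z y = y by move=> hy; rewrite (gr_tail g).
have h1 := gr_pre g; rewrite /= in h1.
have [l1|l1] := Z.lt_ge_cases x 0.
  have [l2|l2] := Z.lt_ge_cases (z x) 0.
    by have := h1 _ l1; have := h1 _ l2; rewrite zK; lia.
  have [l3|l3] := Z.lt_ge_cases (z x) (Z.of_nat m).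
    by exists (Z.to_nat (z x)); [lia|right; rewrite Z2Nat.id ?zK].
  by have := tl _ l3; rewrite zK; lia.
have [l3|l3] := Z.lt_ge_cases x (Z.of_nat m); last by have := tl _ l3.
by exists (Z.to_nat x); [lia|left; rewrite Z2Nat.id].
Qed.

Lemma InE (x : Z) (s : seq Z) : List.In x s <-> x \in s.
Proof.
elim: s => //= y s [IH1 IH2]; rewrite in_cons; split.
  by case=> [->|/IH1 ->]; rewrite ?eqxx ?orbT.
by case/orP=> [/eqP ->|/IH2]; [left|right].
Qed.

(** The arcs of the parts all cross the gap before 0, so at most one of them is kept. Odd length has
    the padding arc in addition; for even length the arc at -1 takes its place, because a kept arc
    over the gap spans -1 and excludes it. Either way [size l] arcs are deleted. *)
Lemma grass_rows l z d : grass true (pad true l) z -> strict_partition l -> rows z d -> (size l <= d)%N.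
Proof.
move=> g /andP[sl pl] [E [[cl co] [S [hS szS]]]].
set l' := pad true l in g; have zK := fin_inv (gr_fin g); set m := size l'.
have fp := gr_fpf g isT.
have zr' j : (j < m)%N -> z (Z.of_nat j) = -1 - Z.of_nat (nth 0%N l' j).
  by move=> hj; rewrite (gr_right g).
have cross : forall i j, (i < m)%N -> (j < m)%N -> E (Z.of_nat i) -> E (Z.of_nat j) -> i = j.
  have aux i j : (i < m)%N -> (j < m)%N -> E (Z.of_nat i) -> E (Z.of_nat j) -> z (Z.of_nat i) < z (Z.of_nat j) -> False.
    move=> hi hj ei ej lt; apply: (co (z (Z.of_nat i)) (z (Z.of_nat j))); [exact: cl|rewrite zK; have := zr' j hj; lia|exact: cl].
  move=> i j hi hj ei ej; have := aux i j hi hj ei ej; have := aux j i hj hi ej ei.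
  have [//|[]] : z (Z.of_nat i) = z (Z.of_nat j) \/ z (Z.of_nat i) < z (Z.of_nat j) \/ z (Z.of_nat j) < z (Z.of_nat i) by lia.
    by move/(inv_eq zK); lia.
  by move=> lt _ /(_ lt). by move=> lt /(_ lt).
pose U0 := [seq Z.of_nat j | j <- iota 0 m] ++ [seq z (Z.of_nat j) | j <- iota 0 m].
have inU x : x \in U0 <-> exists2 j, (j < m)%N & x = Z.of_nat j \/ x = z (Z.of_nat j).
  rewrite mem_cat; split.
    case/orP=> /mapP[j]; rewrite mem_iota add0n => /andP[_ hj] ->; exists j => //; [by left|by right].
  by case=> j hj [->|->]; apply/orP; [left|right]; apply/mapP; exists j; rewrite // mem_iota.
have uU : uniq U0.
  rewrite cat_uniq !map_inj_uniq ?iota_uniq ?andbT //=; try (by move=> i j; lia); try (by move=> i j /(inv_eq zK); lia).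
  apply/hasPn => x /mapP[j]; rewrite mem_iota add0n => /andP[_ hj] ->.
  by apply/mapP => -[i _]; rewrite zr' //; lia.
have szU : size U0 = (2 * m)%N by rewrite size_cat !size_map size_iota; lia.
have clE x : E (z x) = E x by apply/idP/idP => [/cl|/cl]; rewrite ?zK.
have Ucount U : uniq U -> (size U <= 2 * d + count E U)%N.
  move=> u; rewrite -(count_predC E U) addnC leq_add2r -size_filter.
  have h1 : (size S <= 2 * d)%N by apply/ssrnat.leP; exact: szS.
  apply: leq_trans h1; apply: uniq_leq_size; first by rewrite filter_uniq.
  by move=> x; rewrite mem_filter => /andP[/= /negbTE hx _]; apply/InE/hS.
have c2 U (a b : Z) : uniq U -> (forall x, x \in U -> E x -> x = a \/ x = b) -> (count E U <= 2)%N.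
  move=> u h; rewrite -size_filter; apply: (@uniq_leq_size _ _ [:: a; b]); first by rewrite filter_uniq.
  by move=> x; rewrite mem_filter => /andP[ex xU]; have [->|->] := h _ xU ex; rewrite !in_cons eqxx ?orbT.
have Udich : (exists2 j0, (j0 < m)%N & E (Z.of_nat j0)) \/ (forall j, (j < m)%N -> E (Z.of_nat j) = false).
  have [h|h] := pselect (exists2 j0, (j0 < m)%N & E (Z.of_nat j0)); [by left|right].
  by move=> j hj; apply/negP => ej; apply: h; exists j.
have EU j0 x : (j0 < m)%N -> E (Z.of_nat j0) -> x \in U0 -> E x -> x = Z.of_nat j0 \/ x = z (Z.of_nat j0).
  move=> h0 e0 /inU[j hj [->|->]]; rewrite ?clE => ej; rewrite (cross _ _ hj h0 ej e0); [by left|by right].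
have EU0 x : (forall j, (j < m)%N -> E (Z.of_nat j) = false) -> x \in U0 -> E x = false.
  by move=> h /inU[j hj [->|->]]; rewrite ?clE h.
case: (boolP (odd (size l))) => od.
  have sm : m = (size l).+1 by rewrite /m /l' /pad od size_rcons.
  have := Ucount _ uU; rewrite szU; suff : (count E U0 <= 2)%N by lia.
  case: Udich => [[j0 h0 e0]|h]; first by apply: (c2 _ (Z.of_nat j0) (z (Z.of_nat j0))) => // x; apply: EU.
  by apply: (c2 _ 0 0) => // x hx; rewrite (EU0 x).
have ll : l' = l by rewrite /l' /pad (negbTE od).
have sm : m = size l by rewrite /m ll.
have pos j : (j < m)%N -> (0 < nth 0%N l' j)%N by rewrite ll sm => hj; exact: (all_nthP 0%N pl).
have n1 : z (-1) < 0.
  have [//|h] := Z.lt_ge_cases (z (-1)) 0; exfalso.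
  have [h'|h'] := Z.lt_ge_cases (z (-1)) (Z.of_nat m).
    have := @zr' (Z.to_nat (z (-1))); have := @pos (Z.to_nat (z (-1))).
    by rewrite Z2Nat.id // zK; lia.
  have := gr_tail g h'; rewrite zK; have := tail_ge (sp := true) h'; rewrite -/m; lia.
have n1' : z (-1) <> -1 by apply: fp.
pose U := [:: -1, z (-1) & U0].
have nin x : x < 0 -> z x < 0 -> x \notin U0.
  move=> h1 h2; apply/negP => /inU[j hj [e|e]]; first by rewrite e in h1; lia.
  by move: h2; rewrite e zK; lia.
have uU' : uniq U.
  rewrite /U /= in_cons uU andbT !negb_or !nin ?zK //.
  by rewrite andbT; apply/andP; split=> //; apply/eqP => /esym.
have := Ucount _ uU'; rewrite /= szU; suff : (count E U <= 2)%N by rewrite /=; lia.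
case: Udich => [[j0 h0 e0]|h]; last first.
  apply: (c2 _ (-1) (z (-1))) => // x; rewrite !in_cons => /orP[/eqP|/orP[/eqP|]]; [by left|by right|].
  by move=> hx; rewrite EU0.
apply: (c2 _ (Z.of_nat j0) (z (Z.of_nat j0))) => // x.
have e1 : E (-1) = false.
  apply/negP => e1; apply: (co (z (Z.of_nat j0)) (-1)) => //; first exact: cl.
  by rewrite zK zr' //; have := pos _ h0; lia.
rewrite !in_cons => /orP[/eqP ->|/orP[/eqP ->|]]; rewrite ?clE ?e1 //; exact: EU.
Qed.

(** * The recursion and the expansions it yields *)

Definition arcw (sp : bool) (z : Z -> Z) : nat := if sp then 0%N else narc z.
Definition bound (sp : bool) (z : Z -> Z) (d : nat) : Prop := if sp then rows z d else (narc z <= d)%N.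
Definition sizew (sp : bool) (l : seq nat) : nat := if sp then 0%N else size l.

(** Repetitions in [ls] act as coefficients, and one list serves every number n of variables. The
    bound on the lengths is carried along for products of the q's. *)
Definition expands sp z := exists ls : seq (seq nat),
  [/\ all strict_partition ls, (forall d, bound sp z d -> all (fun l => size l <= d)%N ls) &
   forall n, Fn sp n z *+ (2 ^ arcw sp z) = \sum_(l <- ls) fam sp l n *+ (2 ^ sizew sp l)]%R.

Lemma leaf_expands sp z : leaf sp z -> expands sp z.
Proof.
move=> lz; have [l sl g] := leaf_grass lz; exists [:: l]; split.
- by rewrite /= sl.
- move=> d; rewrite /bound /= andbT; case E : (sp) g => g; first exact: grass_rows g sl.
  by have /andP[s1 s2] := sl; rewrite (grass_narc g s1 s2).
move=> n; rewrite big_seq1 (famE n g); congr (_ *+ _)%R.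
rewrite /arcw /sizew; case E : (sp) g => g //.
by have /andP[s1 s2] := sl; rewrite (grass_narc g s1 s2).
Qed.

(** The transition comes multiplied by a common weight [c.+1], which is cancelled; the factors
    [2 ^ e x] become repetitions in the list. *)
Lemma expands_sum (sp : bool) (I : eqType) (xs : seq I) (w : I -> (Z -> Z)) (e : I -> nat) z c :
  (forall x, x \in xs -> expands sp (w x)) ->
  (forall d x, bound sp z d -> x \in xs -> bound sp (w x) d) ->
  (forall n, Fn sp n z *+ (2 ^ arcw sp z) *+ c.+1 =
     \sum_(x <- xs) Fn sp n (w x) *+ (2 ^ arcw sp (w x)) *+ (2 ^ e x) *+ c.+1)%R ->
  expands sp z.
Proof.
move=> hx hb hn; suff [ls [h1 h2 h3]] : exists ls : seq (seq nat),
    [/\ all strict_partition ls, (forall d, bound sp z d -> all (fun l => size l <= d)%N ls) &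
     forall n, \sum_(x <- xs) Fn sp n (w x) *+ (2 ^ arcw sp (w x)) *+ (2 ^ e x) =
      \sum_(l <- ls) fam sp l n *+ (2 ^ sizew sp l)]%R.
  exists ls; split=> // n; rewrite -h3; apply/eqP; rewrite -subr_eq0 -(polyn_mulrn_eq0 _ c).
  by rewrite mulrnBl hn sumrMnl subrr.
elim: xs hx hb {hn} => [|x xs IH] hx hb.
  by exists [::]; split=> // n; rewrite !big_nil.
have [|d y|ls [h1 h2 h3]] := IH.
- by move=> y hy; apply: hx; rewrite in_cons hy orbT.
- by move=> h hy; apply: hb => //; rewrite in_cons hy orbT.
have [lx [k1 k2 k3]] := hx x (mem_head _ _).
exists (flatten (nseq (2 ^ e x) lx) ++ ls); split.
- by rewrite all_cat h1 andbT; apply/allP => l /flattenP[t /nseqP[-> _]]; exact: (allP k1).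
- move=> d hd; rewrite all_cat h2 // andbT; apply/allP => l /flattenP[t /nseqP[-> _]]; exact: (allP (k2 d (hb d x hd (mem_head _ _)))).
move=> n; rewrite big_cat big_cons h3; congr (_ + _)%R; rewrite k3.
elim: (2 ^ e x)%N => [|m IHm]; first by rewrite mulr0n big_nil.
by rewrite /= big_cat /= -IHm mulrS.
Qed.

Section Step.
Variables (sp : bool) (z : Z -> Z) (q r : Z).
Hypotheses (fz : fin sp z) (fpf : sp -> forall x, z x <> x) (pz : prefix sp z).
Hypotheses (vqr : vis sp z q r) (maxr : forall j, vis sp z q j -> j <= r)
           (maxq : forall i j, vis sp z i j -> i <= q).
Hypothesis (q0 : 0 <= q).
Let zK : inv z. Proof. exact: fin_inv fz. Qed.
Let y := parent z q r.

Let yK : inv y. Proof. exact: parent_inv. Qed.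

Lemma fin_parent : fin sp y.
Proof.
rewrite /y /parent; case: Z.eqb_spec => e; last exact: fin_cj_sw.
have [lt C] := step_cases zK fpf vqr maxr maxq.
move: fz; case: C => [[-> _ _]|[_ h _]|h|[_ _ h]]; try lia.
by move=> f; apply: fin_unarc.
Qed.

(** For ordinary involutions weight 2 goes with one more arc, and fusing two arcs loses one. After
    normalisation by 2 to the number of arcs each child thus carries a nonnegative power of 2, and
    no child has more arcs than z. Without fixed points all weights are 1 and the bound is
    [child_rows]. *)
Lemma parent_weight x : x < q -> rect y x q -> (sp -> forall e, tau y x q e <> e) ->
  exists e, (wt y x q * 2 ^ arcw sp z = wt y q r * (2 ^ arcw sp (tau y x q) * 2 ^ e))%N /\
    (forall d, bound sp z d -> bound sp (tau y x q) d).
Proof.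
move=> xq rx wf; have [lt C] := step_cases zK fpf vqr maxr maxq.
have yq : y q = z r := parent_q zK fpf vqr maxr maxq.
have yr := parent_r zK fpf vqr maxr maxq; rewrite -/y in yr.
have w1 : z q <> r -> wt y q r = 1%N.
  move=> n; rewrite /wt yq yr; case: ifP => // /andP[/eqP h1 /eqP h2].
  by exfalso; apply: n; rewrite -h1 zK.
case E : (sp).
  exists 0%N; split=> [|d]; last first.
    rewrite /= => h; move: fpf vqr maxr maxq wf; rewrite E => f v m1 m2 wf'.
    by apply: (child_rows zK (f isT) v m1 m2) => //; apply: wf'.
  rewrite /arcw !expn0 !muln1 w1; last by case: C => [[]|[]||[]]; rewrite ?E; lia.
  rewrite /wt; case: ifP => // /andP[_ /eqP h2].
  by case: C => [[]|[]||[]]; rewrite ?E; move: h2; rewrite yq; lia.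
have fyO := fin_parent; rewrite E in fyO.
have fzO := fz; rewrite E in fzO.
have F := child_form zK fpf vqr maxr maxq rx; rewrite -/y in F.
have cw : [\/ wt y x q = 2%N /\ narc (tau y x q) = (narc y).+1,
   wt y x q = 1%N /\ narc (tau y x q) = narc y | [/\ wt y x q = 1%N, y q <> q & (narc (tau y x q)).+1 = narc y]].
  have yp : y (z r) = q by rewrite -yq yK.
  case: F => [[[f1 f2 f4]|[f1 f2 f4]]|[f1 f2 f4]|[f1 f2 f4]|[f1 f2 f3 f4]]; rewrite f4.
  - apply: Or31; have e : y q = q by rewrite yq.
    rewrite narc_addarc //; last lia.
    by rewrite /wt f1 e !eqxx.
  - apply: Or32; rewrite narc_cj //; split=> //; apply: wt1; rewrite yq; lia.
  - by apply: Or32; rewrite narc_cj //; split=> //; apply: wt1l.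
  - apply: Or33; split; [by apply: wt1; rewrite yq; lia|by rewrite yq; lia|].
    have yyx : y (y x) = x by rewrite yK.
    set i := y x in f1 f4 yyx *; set p := z r in f1 f2 f4 yp yq *.
    pose y1 := unarc y i x; pose y2 := unarc y1 p q.
    have F1 : fin false y1 by apply: fin_unarc.
    have y1p : y1 p = q by rewrite /y1 /unarc !eqbF //; lia.
    have F2 : fin false y2 by apply: fin_unarc.
    have -> : addarc (unarc y x p) i q = addarc y2 i q.
      apply: functional_extensionality => u; rewrite /addarc /y2 /y1 /unarc.
      by repeat zcase; try lia; congruence.
    rewrite narc_addarc //; last lia.
    + by rewrite (narc_unarc fyO yyx) ?(narc_unarc F1 y1p) //; lia.
    + by rewrite /y2 /y1 /unarc; repeat zcase; lia.
    + by rewrite /y2 /y1 /unarc; repeat zcase; lia.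
  - by apply: Or32; rewrite narc_cj //; split=> //; apply: wt1l.
have yz : (z q = r /\ wt y q r = 2%N /\ narc z = (narc y).+1 /\ y q = q) \/ (wt y q r = 1%N /\ narc z = narc y).
  have [e|n] := Z.eqb_spec (z q) r.
    left; split=> //; rewrite {2}/y /parent e Z.eqb_refl -(narc_unarc fzO e); last lia.
    have zr' : z r = q by rewrite -e zK.
    by rewrite /wt yq yr zr' e (eqbF (x := r)) ?eqxx //; lia.
  by right; rewrite w1 // /y /parent (eqbF n) narc_cj.
rewrite /arcw /bound; case: yz => [[e1 [e2 [e3 e4]]]|[e2 e3]]; rewrite e2 e3; case: cw => [[k1 k2]|[k1 k2]|[k1 k3 k2]]; rewrite ?k1.
- by exists 0%N; rewrite k2 expnS; split=> //; lia.
- by exists 0%N; rewrite k2 expnS; split=> [|d]; lia.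
- by [].
- exfalso; move: k1; rewrite /wt; case: ifP => // /andP[_ /eqP h] _.
  have [e|n] := Z.eqb_spec (z q) r; last first.
    by apply: n; rewrite -h yq zK.
  by move: e2; rewrite /wt h yr (eqbF (x := z q) (y := q)) ?e ?eqxx //; lia.
- by exists 0%N; rewrite k2; split=> //; lia.
- by exists 1%N; rewrite -k2 expnS; split=> [|d]; lia.
Qed.

(** The transition for the parent at q: its positive side is z, its negative side consists of the
    children. Without fixed points, children that have one are left out, their functions being
    zero. *)
Lemma step_expands :
  (forall x, x < q -> rect y x q -> (sp -> forall e, tau y x q e <> e) -> expands sp (tau y x q)) ->
  expands sp z.
Proof.
move=> IH; have [k [k0 sy hq hr]] := finE q r fin_parent.
have yq : y q = z r := parent_q zK fpf vqr maxr maxq.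
have [lt C] := step_cases zK fpf vqr maxr maxq.
pose good x := `[< rect y x q >] && `[< sp -> forall e, tau y x q e <> e >].
pose kids := [seq x <- window k.+1 | good x].
have kidP x : x \in kids -> [/\ x < q, rect y x q & sp -> forall e, tau y x q e <> e].
  by rewrite mem_filter => /andP[/andP[/asboolP h1 /asboolP h2] _]; split=> //; case: h1.
have ex x : exists e, x \in kids -> (wt y x q * 2 ^ arcw sp z = wt y q r * (2 ^ arcw sp (tau y x q) * 2 ^ e))%N.
  have [xk|_] := boolP (x \in kids); last by exists 0%N.
  by have [h1 h2 h3] := kidP _ xk; have [e [he _]] := parent_weight h1 h2 h3; exists e.
have [e he] := choice ex.
have wtS : exists c, wt y q r = c.+1 by exists (wt y q r).-1; rewrite /wt; case: ifP.
have [c hc] := wtS.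
have main n : (Fn sp n z *+ wt y q r = \sum_(x <- kids) Fn sp n (tau y x q) *+ wt y x q)%R.
  have nf : sp -> y q <> q.
    by move=> hsp; rewrite yq; case: C hsp => [[->]|[->]||[]] //; lia.
  have := Fn_trans n sy hq nf; rewrite /Top sumrB => /subr0_eq.
  have -> : (\sum_(x <- window k.+1) gterm y q x (Fn sp n) = Fn sp n z *+ wt y q r)%R.
    have rW : r \in window k.+1.
      by rewrite mem_window; apply/andP; rewrite /ev in hr *; split; [apply/Z.leb_spec0|apply/Z.ltb_spec0]; lia.
    rewrite (bigD1_seq r) ?zr_uniq //= big1 ?addr0 => [|x /eqP xr].
      rewrite gtermT; last exact: parent_rect zK fpf vqr maxr maxq.
      by rewrite (parent_tau zK fpf vqr maxr maxq).
    have [rx|/gtermN->//] := pselect (rect y q x).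
    have [//|[hsp hx hk]] := parent_pos zK fpf vqr maxr maxq rx.
    rewrite gtermT //; have ff := fin_tau fin_parent rx.
    have := parent_pos_fixed zK fpf vqr maxr maxq hsp hk; rewrite -/y -hx => dd.
    by move: ff; rewrite {1 2}hsp => ff; rewrite (Fn_dead n ff dd) mul0rn.
  move=> ->; rewrite big_filter [RHS]big_mkcond; apply: eq_bigr => x _; rewrite /good.
  have [rx|nx] := pselect (rect y x q); last by rewrite gtermN // asboolF.
  rewrite gtermT // asboolT //=; case: asboolP => // nf'.
  have ff := fin_tau fin_parent rx.
  have [hsp|hsp] := boolP sp; last by case: nf' => h; rewrite h in hsp.
  have [u hu] : exists u, tau y x q u = u.
    by apply: contrapT => no; apply: nf' => _ u hu; apply: no; exists u.
  by move: ff; rewrite hsp => ff; rewrite (Fn_dead n ff hu) mul0rn.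
apply: (@expands_sum sp _ kids (fun x => tau y x q) e z c).
- by move=> x /kidP[h1 h2 h3]; apply: IH.
- by move=> d x hd /kidP[h1 h2 h3]; have [e' [_ hb]] := parent_weight h1 h2 h3; apply: hb.
move=> n; rewrite -hc mulrnAC main -sumrMnl; apply: eq_big_seq => x xk.
by rewrite -!mulrnA he // mulnC mulnA.
Qed.
End Step.

Lemma vis_fin sp z : fin sp z -> exists K : nat, forall i j, 0 <= i -> vis sp z i j -> i < Z.of_nat K /\ j < Z.of_nat K.
Proof.
case=> k [zK h]; exists (2 * k)%N => i j hi v.
have : j < Z.of_nat (2 * k); last by case: v; lia.
have [//|le] := Z.lt_ge_cases j (Z.of_nat (2 * k)); exfalso.
move: v; rewrite /vis h; last by right; rewrite /ev; lia.
by rewrite /base; case: sp {h} => /=; have := Theta_cases j; lia.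
Qed.

(** Lexicographic induction: Q bounds the left points of visible pairs, and R bounds the distance to
    the right point for those at the largest admissible left point. *)
Theorem tree sp z : fin sp z -> (sp -> forall x, z x <> x) -> prefix sp z -> expands sp z.
Proof.
move=> fz; have [K hK] := vis_fin fz.
have : (forall i j, vis sp z i j -> i < Z.of_nat K).
  by move=> i j v; have [l|l] := Z.lt_ge_cases i 0; [lia|case: (hK _ _ l v)].
move: (K) => Q {K hK}; elim: Q z fz => [|Q IHQ] z fz hQ f pz.
  by apply: leaf_expands; split=> // i j /hQ.
have [K hK] := vis_fin fz.
have : (forall j, vis sp z (Z.of_nat Q) j -> j <= Z.of_nat Q + Z.of_nat K).
  by move=> j v; have := hK _ _ (Zle_0_nat Q) v; lia.
move: (K) => R {K hK}; elim: R z fz hQ f pz => [|R IHR] z fz hQ f pz hR.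
  apply: IHQ => // i j v; have := hQ _ _ v.
  have [e|n] := Z.eqb_spec i (Z.of_nat Q); last by lia.
  by rewrite e in v; have := hR _ v; case: v; lia.
have [v|nv] := pselect (vis sp z (Z.of_nat Q) (Z.of_nat Q + Z.of_nat R.+1)); last first.
  apply: IHR => // j vj; have := hR _ vj.
  have : j <> Z.of_nat Q + Z.of_nat R.+1 by move=> e; apply: nv; rewrite -e.
  by lia.
have mq i j : vis sp z i j -> i <= Z.of_nat Q by move/hQ; lia.
have zK := fin_inv fz.
apply: (step_expands fz f pz v hR mq) => x xq rx wf.
have fw : fin sp (tau (parent z (Z.of_nat Q) (Z.of_nat Q + Z.of_nat R.+1)) x (Z.of_nat Q)).
  by apply: fin_tau => //; apply: fin_parent.
apply: IHR => //.
- by move=> i j vi; have := child_maxq zK f v hR mq xq rx vi; lia.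
- by apply: (child_prefix zK f v hR mq) => //; lia.
- by move=> j vj; have := child_maxr zK f v hR mq xq rx vj; lia.
Qed.

Lemma pass_dead (sp : bool) n L L1 z x : inv z -> sp -> z x = x -> pass (@Fs (base sp) L n) L1 z = 0%R.
Proof.
move=> zK hsp zx; rewrite /base hsp.
elim: L1 z x zK zx => [|j L' IHL] w y wK wy /=; first by rewrite (Fs_dead _ _ wK wy).
rewrite (IHL w y) // add0r /Dop; case: ifP => _; last by rewrite mulr0.
by have [y' hy'] := strip_fixed j wK wy; rewrite (IHL _ y') ?mulr0 //; apply: strip_inv.
Qed.

(** A descent at an arc (i, i+1) strips to an involution with fixed points, on which every pass
    vanishes when [sp] holds; for ordinary involutions the hypothesis excludes descents at i. *)
Lemma Dop_base (sp : bool) n L L1 i z : inv z ->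
  (dsc z i -> z i = i + 1 /\ sp) -> Dop i (pass (@Fs (base sp) L n) L1) z = 0%R.
Proof.
move=> zK h; rewrite /Dop; case: Z.ltb_spec => // /h[e hsp].
apply: (@pass_dead _ _ _ _ _ i) => //; first exact: strip_inv.
by rewrite /strip e Z.eqb_refl /unarc Z.eqb_refl.
Qed.

Lemma base_dsc (sp : bool) i : base sp (i + 1) < base sp i -> base sp i = i + 1 /\ sp.
Proof. by case: sp => /=; [move=> d; have [] := @Theta_adj i (i + 1) ltac:(lia) d | lia]. Qed.

(** * Products of involutions on the two sides of a cut *)

Section Product.
Variables (sp : bool) (c : Z).

Record lside (z : Z -> Z) : Prop := Lside { ls_inv : inv z; ls_cut : cut z c; ls_base : forall x, c <= x -> z x = base sp x }.
Record rside (z : Z -> Z) : Prop := Rside { rs_inv : inv z; rs_cut : cut z c; rs_base : forall x, x < c -> z x = base sp x }.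

Definition jn (z1 z2 : Z -> Z) (x : Z) : Z := if x <? c then z1 x else z2 x.

Lemma lside_strip z i : lside z -> dsc z i -> i < c -> lside (strip z i).
Proof.
move=> [zK zc zb] d ic; have n := cut_dsc zK zc d; split; [exact: strip_inv|exact: cut_strip|].
move=> x hx; have h := cut_ge zK zc hx; rewrite /strip; case: Z.eqb_spec => e.
  by rewrite /unarc !eqbF; try lia; apply: zb; lia.
by rewrite /cj (@swN i (i + 1) x); try lia; rewrite swN; try lia; apply: zb; lia.
Qed.

Lemma rside_strip z i : rside z -> dsc z i -> c <= i -> rside (strip z i).
Proof.
move=> [zK zc zb] d ic; split; [exact: strip_inv|exact: cut_strip|].
move=> x hx; have h := zc _ hx; rewrite /strip; case: Z.eqb_spec => e.
  by rewrite /unarc !eqbF; try lia; apply: zb; lia.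
by rewrite /cj (@swN i (i + 1) x); try lia; rewrite swN; try lia; apply: zb; lia.
Qed.

Lemma jn_strip_l z1 z2 i : lside z1 -> rside z2 -> i + 1 < c ->
  strip (jn z1 z2) i = jn (strip z1 i) z2.
Proof.
move=> [K1 c1 b1] [K2 c2 b2] hi; rewrite /strip /jn.
have -> : (i <? c) = true by apply/Z.ltb_spec0; lia.
case: Z.eqb_spec => e; apply: functional_extensionality => x.
  rewrite /unarc; case: (Z.ltb_spec x c) => h //.
  by rewrite !eqbF //; lia.
rewrite /cj; case: (Z.ltb_spec x c) => h.
  have -> : (sw i (i + 1) x <? c) = true by apply/Z.ltb_spec0; rewrite /sw; zall.
  by [].
have h' := cut_ge K2 c2 h; rewrite (@swN i (i + 1) x); try lia.
by case: (Z.ltb_spec x c) => h2; [lia | rewrite swN //; lia].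
Qed.

Lemma jn_strip_r z1 z2 i : lside z1 -> rside z2 -> c <= i ->
  strip (jn z1 z2) i = jn z1 (strip z2 i).
Proof.
move=> [K1 c1 b1] [K2 c2 b2] hi; rewrite /strip /jn.
have -> : (i <? c) = false by apply/Z.ltb_spec0; lia.
case: Z.eqb_spec => e; apply: functional_extensionality => x.
  rewrite /unarc; case: (Z.ltb_spec x c) => h //.
  by rewrite !eqbF //; lia.
rewrite /cj; case: (Z.ltb_spec x c) => h; last first.
  by have -> : (sw i (i + 1) x <? c) = false by apply/Z.ltb_spec0; rewrite /sw; zall.
have h' := c1 _ h; rewrite (@swN i (i + 1) x); try lia.
by case: (Z.ltb_spec x c) => h2; [rewrite swN //; lia | lia].
Qed.

(** Each letter acts on one side only: on the other it meets the base involution, where [Dop] is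
    zero. The letter straddling the cut is never a descent. *)
Lemma pass_mul L n (H := @Fs (base sp) L n) L1 :
  (forall z1 z2, lside z1 -> rside z2 -> H (jn z1 z2) = (H z1 * H z2)%R) ->
  forall z1 z2, lside z1 -> rside z2 -> pass H L1 (jn z1 z2) = (pass H L1 z1 * pass H L1 z2)%R.
Proof.
move=> h; elim: L1 => [|i L1 IH] z1 z2 s1 s2 /=; first by rewrite h // rmorphM.
have [K1 c1 b1] := s1; have [K2 c2 b2] := s2.
rewrite IH //; have [l|[e|l]] : i + 1 < c \/ i + 1 = c \/ c <= i by lia.
- rewrite [Dop i _ z2]Dop_base //; last by rewrite /dsc !b2; [apply: base_dsc|lia|lia].
  rewrite mulr0 addr0 mulrDl -mulrA; congr (_ + 'X * _)%R.
  have E : (jn z1 z2 (i + 1) <? jn z1 z2 i) = (z1 (i + 1) <? z1 i).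
    by rewrite /jn; case: (Z.ltb_spec (i + 1) c); case: (Z.ltb_spec i c); lia.
  rewrite /Dop E; case: Z.ltb_spec => d; last by rewrite mul0r.
  rewrite jn_strip_l // IH //; apply: lside_strip => //; lia.
- have nd w : inv w -> cut w c -> Dop i (pass H L1) w = 0%R.
    move=> wK wc; rewrite /Dop; case: Z.ltb_spec => // d.
    by case: (cut_dsc wK wc d).
  rewrite !nd ?mulr0 ?addr0 //.
    by move=> x; rewrite /jn; have := c1 x; have := c2 x; case: (Z.ltb_spec x c) => hx h1 h2; case: Z.ltb_spec; rewrite ?K1 ?K2 //; have := cut_ge (x := x) K2 c2; lia.
  by move=> x hx; rewrite /jn; case: Z.ltb_spec; [move=> _; exact: c1|lia].
rewrite [Dop i _ z1]Dop_base //; last by rewrite /dsc !b1; [apply: base_dsc|lia|lia].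
rewrite mulr0 addr0 mulrDr mulrCA; congr (_ + 'X * _)%R.
have E : (jn z1 z2 (i + 1) <? jn z1 z2 i) = (z2 (i + 1) <? z2 i).
  by rewrite /jn; case: (Z.ltb_spec (i + 1) c); case: (Z.ltb_spec i c); lia.
rewrite /Dop E; case: Z.ltb_spec => d; last by rewrite mulr0.
by rewrite jn_strip_r // IH //; apply: rside_strip.
Qed.

Lemma Fs_mul L n z1 z2 : lside z1 -> rside z2 ->
  @Fs (base sp) L n (jn z1 z2) = (@Fs (base sp) L n z1 * @Fs (base sp) L n z2)%R.
Proof.
elim: n z1 z2 => [|n IH] z1 z2 s1 s2 /=; last exact: pass_mul.
rewrite -natrM mulnb; congr (_%:R)%R; congr (nat_of_bool _).
have [K1 c1 b1] := s1; have [K2 c2 b2] := s2.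
apply/asboolP/andP => [e|[/asboolP e1 /asboolP e2]].
  have e' x : jn z1 z2 x = base sp x by rewrite e.
  split; apply/asboolP/functional_extensionality => x; have := e' x; rewrite /jn; case: Z.ltb_spec => // h _; [exact: b1|exact: b2].
by apply: functional_extensionality => x; rewrite /jn e1 e2; case: ifP.
Qed.

Lemma fin_jn z1 z2 : fin sp z1 -> fin sp z2 -> cut z1 c -> cut z2 c -> fin sp (jn z1 z2).
Proof.
move=> f1 [k2 h2] c1 c2; have [k [k0 kk s1]] := finP k2 f1; have s2 := supp_mono h2 kk.
have [K1 o1] := s1; have [K2 o2] := s2; exists k; split.
  by move=> x; rewrite /jn; have := c1 x; have := c2 x; case: (Z.ltb_spec x c) => hx h1 h3; case: Z.ltb_spec; rewrite ?K1 ?K2 //; have := cut_ge (x := x) K2 c2; lia.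
by move=> x hx; rewrite /jn; case: ifP => _; [apply: o1|apply: o2].
Qed.

Lemma Fn_mul n z1 z2 : fin sp z1 -> fin sp z2 -> lside z1 -> rside z2 ->
  Fn sp n (jn z1 z2) = (Fn sp n z1 * Fn sp n z2)%R.
Proof.
move=> f1 f2 s1 s2; have [k3 h3] := fin_jn f1 f2 (ls_cut s1) (rs_cut s2).
have [k1 h1] := f1; have [k2 h2] := f2; pose k := (k1 + k2 + k3 + 1)%N.
have k0 : (0 < k)%N by rewrite /k; lia.
rewrite (@FnE sp n _ k) //; last by apply: supp_mono h3 _; rewrite /k; lia.
rewrite (@FnE sp n z1 k) //; last by apply: supp_mono h1 _; rewrite /k; lia.
rewrite (@FnE sp n z2 k) //; last by apply: supp_mono h2 _; rewrite /k; lia.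
exact: Fs_mul.
Qed.
End Product.

(** * A single arc and the functions q_d *)

Definition unrk (a b y : Z) : Z := if y <? a then y else if y <? b - 1 then y + 1 else y + 2.
(** The order isomorphism from the complement of {a, b} to the integers that fixes every point left
    of a; [unrk] is its inverse. *)
Definition rk (a b x : Z) : Z := if x <? a then x else if x <? b then x - 1 else x - 2.

(* the arc (a, b), inserted in the base involution on the remaining points *)
Definition ar (sp : bool) (a b x : Z) : Z :=
  if x =? a then b else if x =? b then a else unrk a b (base sp (rk a b x)).

Lemma base_cases (sp : bool) x : (sp = false /\ base sp x = x) \/
  (sp /\ ((base sp x = x + 1 /\ base sp (x + 1) = x) \/ (base sp x = x - 1 /\ base sp (x - 1) = x))).
Proof. by case: sp => /=; [right; split=> //; exact: Theta_cases|left]. Qed.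

Lemma rkK a b x : a < b -> x <> a -> x <> b -> unrk a b (rk a b x) = x.
Proof. by rewrite /unrk /rk; repeat zcase; lia. Qed.

Lemma unrkK a b y : a < b -> rk a b (unrk a b y) = y /\ unrk a b y <> a /\ unrk a b y <> b.
Proof. by rewrite /unrk /rk; repeat zcase; lia. Qed.

Lemma baseK sp : inv (base sp).
Proof. by case: sp => //; exact: ThetaK. Qed.

Lemma ar_inv sp a b : a < b -> inv (ar sp a b).
Proof.
move=> ab x; rewrite {2}/ar; case: (Z.eqb_spec x a) => [->|na]; first by rewrite /ar eqbF ?Z.eqb_refl //; lia.
case: (Z.eqb_spec x b) => [->|nb]; first by rewrite /ar Z.eqb_refl.
have [e [n1 n2]] := unrkK (base sp (rk a b x)) ab.
by rewrite /ar !eqbF // e baseK rkK.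
Qed.

Lemma ar_fin sp a b : a < b -> fin sp (ar sp a b).
Proof.
move=> ab; exists (Z.to_nat (Z.abs a) + Z.to_nat (Z.abs b) + 2)%N; split; first exact: ar_inv.
move=> x hx; have := base_cases sp x; have := base_cases sp (x - 2).
rewrite /ev in hx; rewrite /ar !eqbF; try lia.
have E y : Theta (y - 2) = Theta y - 2 by rewrite /Theta Z.even_sub /=; case: (Z.even y) => /=; lia.
move=> h1 h2; rewrite /rk; have [l|l] : x < Z.min a b - 2 \/ Z.max a b + 2 < x by lia.
  have -> : (x <? a) = true by apply/Z.ltb_spec0; lia.
  by rewrite /unrk; have -> : (base sp x <? a) = true by apply/Z.ltb_spec0; lia.
have -> : (x <? a) = false by apply/Z.ltb_spec0; lia.
have -> : (x <? b) = false by apply/Z.ltb_spec0; lia.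
have e : base sp (x - 2) = base sp x - 2 by rewrite /base; case: (sp).
rewrite /unrk; have -> : (base sp (x - 2) <? a) = false by apply/Z.ltb_spec0; lia.
have -> : (base sp (x - 2) <? b - 1) = false by apply/Z.ltb_spec0; lia.
by lia.
Qed.

(** The length of the arc whose function is q_1 / 2. An arc of length 1 may belong to [Theta], so
    lengths start at 2 in the fixed-point-free case. *)
Definition gap (sp : bool) : Z := if sp then 2 else 1.

(** A further variable X multiplies the generating function of the q_d by (1 + X t)/(1 - X t), which
    gives this recursion. *)
Fixpoint qn (n : nat) : nat -> polyn n :=
  if n is n'.+1 return nat -> polyn n then
    fix g (D : nat) : polyn n'.+1 :=
      if D is D'.+1 then ((qn n' D)%:P + 'X * (qn n' D')%:P + 'X * g D')%R
      else ((qn n' 0%N)%:P)%R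
  else fun D => ((D == 0%N)%:R)%R.

Lemma qn0 n : qn n 0 = 1%R.
Proof. by elim: n => //= n ->. Qed.

Lemma qnS n D : qn n.+1 D.+1 = ((qn n D.+1)%:P + 'X * (qn n D)%:P + 'X * qn n.+1 D)%R.
Proof. by []. Qed.

Section Ar.
Variables (sp : bool) (a b : Z).
Hypothesis ab : a + gap sp <= b.

Let lt_ab : a < b. Proof. by move: ab; rewrite /gap; case: (sp); lia. Qed.
Let zK := ar_inv sp lt_ab.
Let za : ar sp a b a = b. Proof. by rewrite /ar Z.eqb_refl. Qed.
Let zb : ar sp a b b = a. Proof. by rewrite /ar eqbF ?Z.eqb_refl //; lia. Qed.
Let zg x : x <> a -> x <> b -> ar sp a b x = unrk a b (base sp (rk a b x)).
Proof. by move=> n1 n2; rewrite /ar !eqbF. Qed.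

Lemma ar_dsc_other i : i <> a -> i <> b - 1 -> dsc (ar sp a b) i -> ar sp a b i = i + 1 /\ sp.
Proof.
move=> n1 n2; rewrite /dsc => d.
have [e|n3] := Z.eqb_spec i b.
  exfalso; move: d; rewrite e zb zg; try lia.
  have := base_cases sp (b - 1); rewrite /rk; have -> : (b + 1 <? a) = false by apply/Z.ltb_spec0; lia.
  have -> : (b + 1 <? b) = false by apply/Z.ltb_spec0; lia.
  have -> : b + 1 - 2 = b - 1 by lia.
  move: ab; rewrite /gap /unrk; case: (sp) => h1 h2; repeat zcase; lia.
have [e|n4] := Z.eqb_spec (i + 1) a.
  exfalso; move: d; rewrite e za zg; try lia.
  have := base_cases sp i; rewrite /rk; have -> : (i <? a) = true by apply/Z.ltb_spec0; lia.
  by move: ab; rewrite /gap /unrk; case: (sp) => h1 h2; repeat zcase; lia.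
have n5 : i + 1 <> b by lia.
rewrite !zg // in d *.
have rS : rk a b (i + 1) = rk a b i + 1 by rewrite /rk; repeat zcase; lia.
rewrite rS in d; have mono u v : u <= v -> unrk a b u <= unrk a b v by rewrite /unrk; repeat zcase; lia.
have [] := @base_dsc sp (rk a b i).
  have [l|//] := Z.le_gt_cases (base sp (rk a b i)) (base sp (rk a b i + 1)).
  by have := mono _ _ l; lia.
by move=> -> hsp; rewrite -rS rkK.
Qed.

Lemma ar_step_l : dsc (ar sp a b) a -> a + 1 < b -> strip (ar sp a b) a = ar sp (a + 1) b.
Proof.
move=> d l; rewrite /strip za eqbF; last lia.
apply: functional_extensionality => x; rewrite /cj.
have [->|n1] := Z.eqb_spec x a.
  rewrite swL zg; try lia.
  rewrite /ar !eqbF; try lia.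
  have -> : rk a b (a + 1) = rk (a + 1) b a by rewrite /rk; repeat zcase; lia.
  by set y := base _ _; rewrite /unrk /sw; repeat zcase; lia.
have [->|n2] := Z.eqb_spec x (a + 1).
  by rewrite swR za /ar Z.eqb_refl swN; lia.
rewrite (swN n1 n2); have [->|n3] := Z.eqb_spec x b.
  by rewrite zb swL /ar eqbF ?Z.eqb_refl //; lia.
rewrite zg // /ar !eqbF //.
have -> : rk a b x = rk (a + 1) b x by rewrite /rk; repeat zcase; lia.
by set y := base _ _; rewrite /unrk /sw; repeat zcase; lia.
Qed.

Lemma ar_step_r : dsc (ar sp a b) (b - 1) -> a + 1 < b -> strip (ar sp a b) (b - 1) = ar sp a (b - 1).
Proof.
move=> d l; have e1 : b - 1 + 1 = b by lia.
rewrite /strip e1; have nz : ar sp a b (b - 1) <> b.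
  by move=> e; have := zK (b - 1); rewrite e zb; lia.
rewrite eqbF //; apply: functional_extensionality => x; rewrite /cj.
have [->|n1] := Z.eqb_spec x b.
  rewrite swR zg; try lia.
  rewrite /ar !eqbF; try lia.
  have -> : rk a b (b - 1) = rk a (b - 1) b by rewrite /rk; repeat zcase; lia.
  by set y := base _ _; rewrite /unrk /sw; repeat zcase; lia.
have [->|n2] := Z.eqb_spec x (b - 1).
  rewrite swL zb /ar (eqbF (x := b - 1) (y := a)) ?Z.eqb_refl; try lia.
  by rewrite swN; lia.
rewrite (swN n2 n1); have [->|n3] := Z.eqb_spec x a.
  by rewrite za swR /ar Z.eqb_refl.
rewrite zg // /ar !eqbF //.
have -> : rk a b x = rk a (b - 1) x by rewrite /rk; repeat zcase; lia.
by set y := base _ _; rewrite /unrk /sw; repeat zcase; lia.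
Qed.

(** For the shortest arc without fixed points the parity of a decides at which of its two ends the
    descent lies; [ar_dsc_r] is the complementary case. *)
Lemma ar_dsc_l : dsc (ar sp a b) a <-> (sp = false \/ a + 2 < b \/ Z.even a = false).
Proof.
rewrite /dsc za; have [e|n] := Z.eqb_spec (a + 1) b.
  by rewrite e zb; move: ab; rewrite /gap; case: (sp); [lia|split=> _; [left|lia]].
rewrite zg; try lia.
have -> : rk a b (a + 1) = a by rewrite /rk; repeat zcase; lia.
rewrite /base; case: (sp); last first.
  by rewrite /unrk; repeat zcase; split=> // h; try lia; left.
rewrite /Theta; case: (Z.even a); rewrite /unrk; repeat zcase; split=> h; try lia; try (exfalso; lia); try (by right; left; lia); try (by right; right); try (by case: h => [|[|]] //; lia).
Qed.

Lemma ar_dsc_r : dsc (ar sp a b) (b - 1) <-> (sp = false \/ a + 2 < b \/ Z.even a = true).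
Proof.
rewrite /dsc; have -> : b - 1 + 1 = b by lia.
rewrite zb; have [e|n] := Z.eqb_spec (b - 1) a.
  by rewrite e za; move: ab; rewrite /gap; case: (sp); [lia|split=> _; [left|lia]].
rewrite zg; try lia.
have -> : rk a b (b - 1) = b - 2 by rewrite /rk; repeat zcase; lia.
have [l|l] : a + 2 < b \/ b = a + 2 by lia.
  split=> _; first by right; left.
  by have := base_cases sp (b - 2); rewrite /unrk; repeat zcase; lia.
have -> : b - 2 = a by lia.
rewrite /base; case: (sp); last first.
  by rewrite /unrk; repeat zcase; split=> // h; try lia; left.
rewrite /Theta; case: (Z.even a); rewrite /unrk; repeat zcase; split=> h; try lia; try (exfalso; lia); try (by right; left; lia); try (by right; right); try (by case: h => [|[|]] //; lia).
Qed.
End Ar.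

Lemma ar_base a : Z.even a = true -> ar true a (a + 1) = Theta.
Proof.
move=> ev_a; apply: functional_extensionality => x; rewrite /ar.
have ta : Theta a = a + 1 by rewrite /Theta ev_a.
have [->|n1] := Z.eqb_spec x a; first by rewrite ta.
have [->|n2] := Z.eqb_spec x (a + 1); first by rewrite -ta ThetaK.
have n3 : Theta x <> a by move=> e; have := ThetaK x; rewrite e ta; lia.
have n4 : Theta x <> a + 1 by move=> e; have := ThetaK x; rewrite e -ta ThetaK; lia.
rewrite /rk; have [l|l] := Z.ltb_spec x a.
  by rewrite /unrk /=; have [] := Theta_cases x; repeat zcase; lia.
have -> : (x <? a + 1) = false by apply/Z.ltb_spec0; lia.
have E : Theta (x - 2) = Theta x - 2 by rewrite /Theta Z.even_sub /=; case: (Z.even x) => /=; lia.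
by rewrite /= E /unrk; have [] := Theta_cases x; repeat zcase; lia.
Qed.

Section Row.
Variables (sp : bool) (L : seq Z) (n : nat).
Let H : (Z -> Z) -> polyn n := @Fs (base sp) L n.

Lemma pass_base L1 : pass H L1 (base sp) = ((H (base sp))%:P)%R.
Proof.
elim: L1 => //= i L1 ->; rewrite Dop_base ?mulr0 ?addr0 //; first exact: baseK.
exact: base_dsc.
Qed.

Lemma pass_ar_dead a b L1 : a + gap sp <= b -> a \notin L1 -> (b - 1) \notin L1 ->
  pass H L1 (ar sp a b) = ((H (ar sp a b))%:P)%R.
Proof.
move=> ab; elim: L1 => //= i L1 IH; rewrite !in_cons !negb_or => /andP[/eqP n1 h1] /andP[/eqP n2 h2].
rewrite IH // Dop_base ?mulr0 ?addr0 //; first by apply: ar_inv; move: ab; rewrite /gap; case: (sp); lia.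
by apply: ar_dsc_other => //; apply: not_eq_sym.
Qed.

Hypothesis H0 : H (base sp) = 1%R.
Variables lo hi : Z.
Hypothesis H1 : forall a b (D : nat), b = a + gap sp + Z.of_nat D -> lo <= a -> b <= hi -> (H (ar sp a b) *+ 2 = qn n D.+1)%R.

(** Once the letter a has been passed, only the right end can still be shortened, and only once. *)
Lemma pass_ar_right a b (D : nat) i k : b = a + gap sp + Z.of_nat D.+1 -> lo <= a -> b <= hi -> a < i < b -> b <= i + Z.of_nat k ->
  (pass H (zr i k) (ar sp a b) *+ 2 = (qn n D.+2)%:P + 'X * (qn n D.+1)%:P)%R.
Proof.
move=> e hl hh; elim: k i => [|k IH] i hi' hk; first by lia.
have g1 : 1 <= gap sp by rewrite /gap; case: (sp).
have ab : a + gap sp <= b by lia.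
rewrite /= -/zr; have [ei|ni] := Z.eqb_spec i (b - 1); last first.
  rewrite Dop_base; [|by apply: ar_inv; lia|by apply: ar_dsc_other; lia].
  by rewrite mulr0 addr0 IH //; lia.
have d : dsc (ar sp a b) (b - 1) by apply/ar_dsc_r => //; move: e; rewrite /gap; case: (sp); [right; left; lia|left].
rewrite {2}ei DopT // ar_step_r //; try lia.
rewrite !pass_ar_dead //; try lia; try (by rewrite mem_zr; apply/negP => /andP[/Z.leb_spec0]; lia).
by rewrite mulrnDl -mulrnAr -!rmorphMn (H1 e) ?(@H1 _ _ D) //; lia.
Qed.

(** At the letter a the left end either stays, which leads to [pass_ar_right], or moves to a+1,
    where the same situation recurs with a shorter arc. The two contributions are those of the
    recursion [qnS]. *)
Lemma pass_ar_left a b (D : nat) i k : b = a + gap sp + Z.of_nat D -> lo <= a -> b <= hi -> i <= a -> b <= i + Z.of_nat k ->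
  (pass H (zr i k) (ar sp a b) *+ 2 = qn n.+1 D.+1)%R.
Proof.
elim: k i a D => [|k IH] i a D e hl hh hi' hk.
  by move: e; rewrite /gap; case: (sp); lia.
have g1 : 1 <= gap sp by rewrite /gap; case: (sp).
have ab : a + gap sp <= b by lia.
rewrite /= -/zr; have [ei|ni] := Z.eqb_spec i a; last first.
  rewrite Dop_base; [|by apply: ar_inv; lia|by apply: ar_dsc_other; lia].
  by rewrite mulr0 addr0 (IH _ a D) //; lia.
rewrite ei in hi' hk *; rewrite -/qn -/(qn n.+1 D.+1).
case: D e => [|D] e; last first.
  have d : dsc (ar sp a b) a by apply/ar_dsc_l => //; move: e; rewrite /gap; case: (sp); [right; left; lia|left].
  rewrite DopT // ar_step_l //; try lia.
  rewrite mulrnDl (@pass_ar_right _ _ D) //; try lia.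
  by rewrite -mulrnAr (IH _ (a + 1) D) //; lia.
have qn1 : (qn n.+1 1 = (H (ar sp a b))%:P *+ 2 + 'X *+ 2)%R.
  by rewrite qnS !qn0 !mulr1 -addrA -mulr2n -rmorphMn (H1 e).
rewrite -/(qn n.+1 1) qn1 -mulrnDl; congr (_ *+ _)%R.
have dead L1 : a \notin L1 -> b - 1 \notin L1 -> pass H L1 (ar sp a b) = ((H (ar sp a b))%:P)%R.
  by move=> *; apply: pass_ar_dead.
have notin c i' k' : c < i' -> c \notin zr i' k'.
  by move=> hc; rewrite mem_zr; apply/negP => /andP[/Z.leb_spec0]; lia.
have [E|E] : sp = false \/ sp = true by case: (sp); [right|left].
  have eb : b = a + 1 by rewrite /gap E in e; lia.
  have d : dsc (ar sp a b) a by apply/ar_dsc_l => //; left.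
  rewrite DopT // /strip.
  have za : ar sp a b a = a + 1 by rewrite /ar Z.eqb_refl.
  rewrite za Z.eqb_refl; have -> : unarc (ar sp a b) a (a + 1) = base sp.
    apply: functional_extensionality => x; rewrite /unarc /ar.
    have [->|n1] := Z.eqb_spec x a; first by rewrite E.
    have [->|n2] := Z.eqb_spec x (a + 1); first by rewrite E.
    by rewrite eb (eqbF n2) E [base false _]/= rkK //; lia.
  by rewrite dead ?notin ?pass_base ?H0 ?mulr1 //; lia.
rewrite /gap E in e; have k2 : exists k', k = k'.+1 by exists k.-1; lia.
case: k2 => k' ek; case Ev : (Z.even a).
  have nd : ~ dsc (ar sp a b) a by move/(ar_dsc_l ab); rewrite E Ev => -[|[|]] //; lia.
  rewrite DopN // mulr0 addr0 ek /=.
  have d : dsc (ar sp a b) (b - 1) by apply/(ar_dsc_r ab); rewrite Ev; right; right.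
  have eb : a + 1 = b - 1 by lia.
  rewrite eb DopT // ar_step_r //; try lia.
  have -> : ar sp a (b - 1) = base sp by rewrite -eb E ar_base.
  by rewrite pass_base H0 mulr1 dead ?notin //; lia.
have d : dsc (ar sp a b) a by apply/(ar_dsc_l ab); right; right.
rewrite DopT // ar_step_l //; try lia.
have ev1 : Z.even (a + 1) = true by rewrite Z.even_add Ev.
have -> : ar sp (a + 1) b = base sp.
  by have -> : b = a + 1 + 1 by [lia]; rewrite E ar_base.
rewrite pass_base H0 mulr1; congr (_ + _)%R.
rewrite ek /= Dop_base; first by rewrite mulr0 addr0 dead ?notin //; lia.
  by apply: ar_inv; lia.
move=> dd; exfalso; have [h1 _] := ar_dsc_r ab; move: h1; have -> : b - 1 = a + 1 by lia.
by move=> /(_ dd); rewrite E Ev => -[|[|]] //; lia.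
Qed.
End Row.

Lemma Fs_base sp L n : @Fs (base sp) L n (base sp) = 1%R.
Proof.
elim: n => [|n IH] /=; first by rewrite asboolT.
by rewrite pass_base IH.
Qed.

Lemma Fs_row sp A N n a b (D : nat) : b = a + gap sp + Z.of_nat D -> A <= a -> b <= A + Z.of_nat N ->
  (@Fs (base sp) (zr A N) n (ar sp a b) *+ 2 = qn n D.+1)%R.
Proof.
elim: n a b D => [|n IH] a b D e h1 h2.
  rewrite [LHS]/= asboolF //= => h; have := congr1 (fun f => f a) h.
  rewrite /ar Z.eqb_refl; have := base_cases sp a; move: e; rewrite /gap; case: (sp); lia.
rewrite [Fs _ _ _]/=; apply: (@pass_ar_left _ _ _ _ A (A + Z.of_nat N)) => //; first exact: Fs_base.
Qed.

Lemma Fn_row sp n a b (D : nat) : b = a + gap sp + Z.of_nat D -> (Fn sp n (ar sp a b) *+ 2 = qn n D.+1)%R.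
Proof.
move=> e; have ab : a < b by move: e; rewrite /gap; case: (sp); lia.
have [k [k0 s ha hb]] := finE a b (ar_fin sp ab).
rewrite (FnE n k0 s) /letters; apply: Fs_row => //; rewrite /ev in ha hb *; lia.
Qed.

Definition bump_part (l : seq nat) (j : nat) : seq nat := set_nth 0%N l j (nth 0%N l j).+1.

(** * Covers of Grassmannian involutions *)

Section Grass.
Variables (sp : bool) (l : seq nat) (z : Z -> Z).
Hypothesis g : grass sp l z.
Hypothesis evl : sp -> ~~ odd (size l).
Hypothesis sl : sorted gtn l.
Hypothesis pl : sp = false -> all (fun a => 0 < a)%N l.
Let m := Z.of_nat (size l).
Let zK : inv z. Proof. exact: fin_inv (gr_fin g). Qed.

(** The ends of the arcs over the gap together with the first block of the tail. Summing the
    transitions over this set leaves the covers that enter or leave it: those leaving give the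
    product with q_1, those entering add a box. *)
Definition inM (x : Z) : bool :=
  ((0 <=? x) && (x <? m + gap sp)) || ((x <? 0) && (0 <=? z x)).

Lemma inMP x : reflect (0 <= x < m + gap sp \/ (x < 0 /\ 0 <= z x)) (inM x).
Proof.
apply: (iffP orP) => -[].
- by move=> /andP[/Z.leb_spec0 h1 /Z.ltb_spec0 h2]; left.
- by move=> /andP[/Z.ltb_spec0 h1 /Z.leb_spec0 h2]; right.
- by move=> [h1 h2]; left; apply/andP; split; [apply/Z.leb_spec0|apply/Z.ltb_spec0].
- by move=> [h1 h2]; right; apply/andP; split; [apply/Z.ltb_spec0|apply/Z.leb_spec0].
Qed.

Lemma gr_rightZ x : 0 <= x < m -> z x < 0.
Proof.
move=> h; have -> : x = Z.of_nat (Z.to_nat x) by lia.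
have hx : (Z.to_nat x < size l)%N by rewrite /m in h; lia.
rewrite (gr_right g) // /off; case E : (sp); first lia.
by have := all_nthP 0%N (pl E) _ hx; lia.
Qed.

Lemma gr_tailZ x : m <= x -> z x = tail sp m x.
Proof. exact: gr_tail. Qed.

Lemma gr_tail_ge c x : m <= c <= x -> (sp -> Z.even (c - m)) -> c <= z x.
Proof.
move=> h hc; rewrite gr_tailZ /tail; last lia.
case E : (sp) hc => hc; last lia.
case Ev : (Z.even _); first by lia.
have : x <> c by move=> e; move: (hc isT); rewrite -e Ev.
by lia.
Qed.

Lemma gr_neg x : x < 0 -> z x < m.
Proof.
move=> h; have [//|le] := Z.lt_ge_cases (z x) m.
have h2 : m <= z (z x) by apply: gr_tail_ge; [lia | rewrite Z.sub_diag].
by rewrite zK in h2; lia.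
Qed.

Lemma gr_top : z m = (if sp then m + 1 else m) /\ (sp -> z (m + 1) = m).
Proof.
rewrite !gr_tailZ /tail; try lia; have -> : m - m = 0 by lia.
by case: (sp); split=> // _; have -> : m + 1 - m = 1 by [lia]; rewrite /=; lia.
Qed.

Lemma gr_filler_fix x : sp = false -> x < 0 -> z x < 0 -> z x = x.
Proof.
move=> e h1 h2; have := gr_pre g; rewrite e /= => p.
by have := p _ h1; have := p _ h2; rewrite zK; lia.
Qed.

Lemma inM_z x : inM (z x) = inM x.
Proof.
have aux y : inM y -> inM (z y).
  move=> /inMP[h|[h1 h2]]; apply/inMP; last first.
    by left; have := gr_neg h1; have : 0 < gap sp by [rewrite /gap; case: (sp)]; lia.
  have [l1|l1] : y < m \/ m <= y by lia.
    by right; split; [apply: gr_rightZ; lia | rewrite zK; lia].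
  left; have [h1 h2] := gr_top; move: h h1 h2; rewrite /gap; case: (sp) => h h1 h2.
    have [->|->] : y = m \/ y = m + 1 by lia.
      by rewrite h1; lia.
    by rewrite h2 //; lia.
  by have -> : y = m by [lia]; lia.
by apply/idP/idP => /aux; rewrite ?zK.
Qed.

Lemma out_pairs y x : inM y -> inM x = false -> rect z y x ->
  if sp then (m <= y <= m + 1 /\ m + 2 <= x <= m + 3) else (y = m /\ x = m + 1).
Proof.
move=> /inMP My /inMP Mx [lt zlt h]; have m0 : 0 <= m by lia.
have [t1 t2] := gr_top.
have [xn|xp] := Z.lt_ge_cases x 0.
  have zx : z x < 0 by have [|] := Z.lt_ge_cases (z x) 0; [|move=> ?; case: Mx; right].
  by exfalso; case: My => My; lia.
have xM : m + gap sp <= x by have [|//] := Z.lt_ge_cases x (m + gap sp); move=> ?; case: Mx; left.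
have zx : m + gap sp <= z x.
  apply: gr_tail_ge; first by move: xM; rewrite /gap; case: (sp); lia.
  by rewrite /gap; case: (sp) => // _; have -> : m + 2 - m = 2 by lia.
have yt : m <= y.
  have [l1|//] := Z.lt_ge_cases y m; exfalso; have hm := h m.
  have zy : z y < m.
    case: My => [My|[My _]]; last exact: gr_neg.
    by have := @gr_rightZ y; lia.
  by move: t1 hm xM zx; rewrite /gap; case: (sp) => t1; lia.
case: My => My; last by exfalso; lia.
have S2 : sp -> z (m + 2) = m + 3.
  by move=> hs; rewrite gr_tailZ /tail ?hs; [have -> : m + 2 - m = 2 by [lia]; rewrite /=; lia | lia].
have S1 : sp = false -> z (m + 1) = m + 1 by move=> hs; rewrite gr_tailZ /tail ?hs //; lia.
have h1 := h (m + 1); have h2 := h (m + 2).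
move: My xM zx t1 t2 S1 S2; rewrite /gap; case E : (sp) => My xM zx t1 t2 S1 S2.
  split; first by lia.
  have t2' := t2 isT; have S2' := S2 isT; have [l1|l1] : x <= m + 3 \/ m + 4 <= x by lia.
    by lia.
  exfalso; have : m + 4 <= z x.
    apply: gr_tail_ge; first by lia.
    by move=> _; have -> : m + 4 - m = 4 by lia.
  have : z y <= m + 1 by (have [e|e] : y = m \/ y = m + 1 by lia); rewrite e; lia.
  by lia.
have S1' := S1 erefl; have ey : y = m by lia.
have n : z x = m + 1 -> x = m + 1 by move=> e; apply: (inv_eq zK); rewrite e S1'.
by rewrite ey in h1 zlt lt *; split=> //; lia.
Qed.

Lemma phi_mono i j : (i < size l)%N -> (j < size l)%N -> (nth 0%N l j < nth 0%N l i)%N = (i < j)%N.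
Proof.
have gt_tr : transitive gtn by move=> a b c /=; lia.
have st a b : (a < b < size l)%N -> (nth 0%N l b < nth 0%N l a)%N.
  by move=> /andP[ab bs]; apply: (sorted_ltn_nth gt_tr 0%N sl) => //; rewrite inE; lia.
move=> hi hj; apply/idP/idP => h; last by apply: st; rewrite h.
have [e|[lt|//]] : i = j \/ (j < i)%N \/ (i < j)%N by lia.
  by rewrite e ltnn in h.
by have := st j i; lia.
Qed.

Section Phi.
Variable j : nat.
Hypothesis hj : (j < size l)%N.
Let f := z (Z.of_nat j).
Let zf : z f = Z.of_nat j. Proof. by rewrite /f zK. Qed.
Let fneg : f < 0. Proof. by apply: gr_rightZ; rewrite /m; lia. Qed.

(** From outside the set a left end is reached only from its left neighbour, which adds a box to its
    row. Without fixed points a second cover may exist, but it has a fixed point. *)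
Lemma in_phi x : inM x = false -> rect z x f ->
  (x = f - 1) \/ (sp /\ exists u, tau z x f u = u).
Proof.
move=> /inMP Mx [lt zlt h]; rewrite zf in zlt h.
have xn : x < 0 by lia.
have zx : z x < 0 by have [|] := Z.lt_ge_cases (z x) 0; [|move=> ?; case: Mx; right].
have [e|n] := Z.eqb_spec x (f - 1); first by left.
have hc := h (f - 1); have zc : z (f - 1) < 0.
  have [//|le] := Z.lt_ge_cases (z (f - 1)) 0; exfalso.
  have lt' := @gr_neg (f - 1); have [i hi] : exists i, z (f - 1) = Z.of_nat i by exists (Z.to_nat (z (f - 1))); lia.
  have im : (i < size l)%N by rewrite /m in lt'; lia.
  have e1 : f - 1 = off sp - Z.of_nat (nth 0%N l i) by rewrite -(gr_right g im) -hi zK.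
  have e2 : f = off sp - Z.of_nat (nth 0%N l j) by rewrite -(gr_right g hj).
  have : (i < j)%N by rewrite -(phi_mono im hj); lia.
  by lia.
right; have n1 : z x <> z (f - 1) by move/(inv_eq zK).
have l1 : z (f - 1) < z x by lia.
case E : (sp); last first.
  exfalso; have := @gr_filler_fix x E xn zx; have := @gr_filler_fix (f - 1) E; lia.
have p := gr_pre g; rewrite E /= in p.
have fp : forall x, z x <> x by apply: (gr_fpf g); rewrite E.
have [e|n2] := Z.eqb_spec x (z (f - 1)); last first.
  exfalso; have [l2|l2] : f - 1 < z (f - 1) \/ z (f - 1) < f - 1 by have := fp (f - 1); lia.
    by have := p x (f - 1); lia.
  have [l3|l3] : x < z (f - 1) \/ z (f - 1) < x by lia.
    by have := p x (z (f - 1)); rewrite zK; lia.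
  by have := p (z (f - 1)) x; rewrite zK; lia.
split=> //; exists (f - 1).
have zx' : z x = f - 1 by rewrite e zK.
rewrite /tau zf zx' !eqbF; try lia.
have -> : (Z.max x (f - 1) <? Z.min f (Z.of_nat j)) = true by apply/Z.ltb_spec0; lia.
have -> : (x <? f - 1) = true by apply/Z.ltb_spec0; lia.
have -> : (f <? Z.of_nat j) = true by apply/Z.ltb_spec0; lia.
by rewrite /= /addarc /unarc; zall.
Qed.

Hypothesis free : z (f - 1) < 0.
Let c := f - 1.
Let s := sw c f.

Let sN u : 0 <= u -> s u = u.
Proof. by move=> hu; rewrite /s swN // /c; lia. Qed.
Let zcn : z c <> c -> z c <> f.
Proof. by move=> _ e; have := zK c; rewrite e zf; rewrite /c; lia. Qed.

Lemma phi_step : rect z c f /\ tau z c f = cj s z.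
Proof.
have zcf : z c <> f by move=> e; have := zK c; rewrite e zf; rewrite /c; lia.
split; first by split; [rewrite /c; lia|rewrite zf /c; lia|rewrite /c; lia].
rewrite /tau zf.
case: Z.eqb_spec => e1.
  rewrite eqbF; last lia.
  by rewrite Z.min_l; last lia.
rewrite eqbF; last lia.
have [l1|l1] := Z.lt_ge_cases (z c) c.
  case: Z.ltb_spec => // _.
  have -> : (c <? z c) = false by apply/Z.ltb_spec0; lia.
  by have -> : (f <? Z.of_nat j) = true by apply/Z.ltb_spec0; lia.
by have -> : (Z.max c (z c) <? Z.min f (Z.of_nat j)) = false by apply/Z.ltb_spec0; rewrite /c in zcf l1 e1 *; lia.
Qed.

(** Moving the left end of the j-th arc one step to the left lengthens the part by one; [free] says
    that no other arc over the gap starts there. *)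
Lemma grass_bump : grass sp (bump_part l j) (cj s z).
Proof.
have zcf : z c <> f by move=> e; have := zK c; rewrite e zf; rewrite /c; lia.
have sK : involutive s := swK c f.
have szb : size (bump_part l j) = size l by rewrite size_set_nth; lia.
have vs x : cj s z (s x) = s (z x) by rewrite /cj sK.
split.
- exact: fin_cj_sw (gr_fin g).
- move=> hs x; rewrite -[x]sK vs => /(inv_inj sK); exact: (gr_fpf g hs).
- have p := gr_pre g; rewrite /prefix in p *; case E : (sp) p => p; last first.
    move=> e he; rewrite /cj.
    have [->|n1] := Z.eqb_spec e c.
      by rewrite /s swL zf swN; rewrite /c; lia.
    have cc : z c = c by apply: (gr_filler_fix E) => //; rewrite /c; lia.
    have [->|n2] := Z.eqb_spec e f.
      by rewrite /s swR cc swL; lia.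
    have n3 : z e <> c by move=> h; apply: n1; apply: (inv_eq zK); rewrite h cc.
    have n4 : z e <> f by move=> h; have := zK e; rewrite h zf; lia.
    by rewrite /s (@swN c f e) // swN //; apply: p.
  have fp : forall x, z x <> x by apply: (gr_fpf g); rewrite E.
  move=> e u l1 l2 l3; rewrite /cj in l1 l2 l3 *.
  have snn x : s x < 0 -> x < 0 by rewrite /s /c /sw; repeat zcase; lia.
  have goalR : 0 <= z (s u) -> 0 <= s (z (s u)) by move=> h; rewrite sN.
  apply: goalR.
  have z1 : z (s e) < 0 by apply: snn.
  have nf : s e <> f by move=> h; move: z1; rewrite h zf; lia.
  have nf2 : z (s e) <> f by move=> h; have := zK (s e); rewrite h zf => h'; move: nf z1; rewrite -h'; have : e = Z.of_nat j by [rewrite -[e]sK -h' sN //; lia]; lia.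
  have es : e = s (s e) by rewrite sK.
  have [k1|k1] := Z.eqb_spec (s e) c.
    have ef : e = f by rewrite es k1 /s swL.
    rewrite k1 in l1 l2 l3 z1.
    have szc : s (z c) = z c by rewrite /s swN //; exact: fp.
    rewrite szc ef in l1 l2 l3; have -> : s u = u by rewrite /s swN; rewrite /c; lia.
    by apply: (p c u); rewrite /c in l1 l2 l3 *; lia.
  have e0 : s e = e by have h := swN k1 nf; rewrite -/(s (s e)) sK in h.
  rewrite e0 in l1 l2 l3 z1 nf nf2 k1.
  have [k2|k2] := Z.eqb_spec (z e) c.
    have sc : s (z e) = f by rewrite k2 /s swL.
    rewrite sc in l1 l2 l3.
    have [->|n1] := Z.eqb_spec u c; first by rewrite /s swL zf; lia.
    have -> : s u = u by rewrite /s swN; lia.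
    by apply: (p e u); rewrite k2 /c in n1 *; lia.
  have sz : s (z e) = z e by rewrite /s swN.
  rewrite sz in l1 l2 l3.
  have [->|n1] := Z.eqb_spec u c; first by rewrite /s swL zf; lia.
  have [e2|n2] := Z.eqb_spec u f; last by rewrite /s swN //; apply: (p e u); lia.
  by rewrite e2 /s swR; apply: (p e c); rewrite /c in k1 *; lia.
- move=> i; rewrite szb => hi; rewrite /cj (@sN (Z.of_nat i)); last lia.
  rewrite /bump_part nth_set_nth /=; case: eqP => [->|ne].
    by rewrite -/f /s swR /c /f (gr_right g hj); lia.
  rewrite /s swN ?(gr_right g) //.
    by rewrite -(gr_right g hi) => h; have := free; rewrite -/c -h zK; lia.
  by move=> h; apply: ne; move: h; rewrite -(gr_right g hi) /f => /(inv_eq zK); lia.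
move=> x; rewrite szb => hx; rewrite /cj (@sN x); last lia.
by rewrite (gr_tail g) // sN //; have := tail_ge (sp := sp) hx; lia.
Qed.
End Phi.
End Grass.

Section Grass.
Variables (sp : bool) (l : seq nat) (z : Z -> Z).
Hypothesis g : grass sp l z.
Hypothesis evl : sp -> ~~ odd (size l).
Hypothesis sl : sorted gtn l.
Hypothesis pl : sp = false -> all (fun a => 0 < a)%N l.
Let m := Z.of_nat (size l).
Let zK : inv z. Proof. exact: fin_inv (gr_fin g). Qed.
Let top : z m = (if sp then m + 1 else m) /\ (sp -> z (m + 1) = m).
Proof. exact: (gr_top g evl sl pl). Qed.
Let rightZ x : 0 <= x < m -> z x < 0.
Proof. exact: (gr_rightZ g evl sl pl). Qed.
Let fillO x : sp = false -> x < 0 -> z x < 0 -> z x = x.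
Proof. exact: (gr_filler_fix g evl sl pl). Qed.
Let neg x : x < 0 -> z x < m.
Proof. exact: (gr_neg g evl sl pl). Qed.
Let m0 : 0 <= m. Proof. rewrite /m; lia. Qed.

Lemma z_minus2 : sp -> z (-1) < 0 -> z (-2) < 0 -> z (-1) = -2 /\ z (-2) = -1.
Proof.
move=> hs h1 h2; have p := gr_pre g; rewrite hs /= in p; have f := gr_fpf g hs.
have n := f (-1); have [e|n2] := Z.eqb_spec (z (-1)) (-2); first by rewrite -e zK.
by have := p (z (-1)) (-2); rewrite zK; lia.
Qed.

(** A new row opens from -1. The alternative -2 of the fixed-point-free case is disposed of by
    [top_fixed]. *)
Lemma in_top x : inM sp l z x = false -> rect z x m -> z (-1) < 0 /\
  if sp then z (-2) < 0 /\ (x = -1 \/ x = -2) else x = -1.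
Proof.
move=> /(inMP sp l z) Mx [lt zlt h].
have xm : x < 0 by have [|] := Z.lt_ge_cases x 0; [|move=> ?; case: Mx; left; rewrite /gap -/m; case: (sp); lia].
have zx : z x < 0 by have [|] := Z.lt_ge_cases (z x) 0; [|move=> ?; case: Mx; right].
have [t1 t2] := top; have h1 := h (-1).
have z1 : z (-1) < 0.
  have [//|le] := Z.lt_ge_cases (z (-1)) 0; exfalso.
  have n := neg (x := -1); have : x <> -1 by move=> e; rewrite e in zx; lia.
  by rewrite -/m in n; move: t1 zlt; case: (sp); lia.
split=> //; case E : (sp) t1 => t1; last first.
  have e1 : z (-1) = -1 by apply: fillO.
  have e2 : z x = x by apply: fillO.
  have [//|n] := Z.eqb_spec x (-1).
  by have := h (-1); rewrite e1 e2 t1; lia.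
have p := gr_pre g; rewrite E /= in p; have f : forall x, z x <> x by apply: (gr_fpf g); rewrite E.
have xd : x = -1 \/ x = z (-1).
  have [|n] := Z.eqb_spec x (-1); first by left.
  right; have n2 : z x <> z (-1) by move/(inv_eq zK).
  have l1 : z (-1) < z x by lia.
  have n3 := f (-1); have [e|n4] := Z.eqb_spec (z x) (-1); first by have := zK x; rewrite e => <-.
  by exfalso; have := p (z (-1)) (z x); rewrite !zK; lia.
have z2 : z (-2) < 0.
  have [//|le] := Z.lt_ge_cases (z (-2)) 0; exfalso.
  have n := neg (x := -2); rewrite -/m in n.
  have n3 := f (-1); have n5 : z (-1) <> -2 by move=> e; move: le; rewrite -e zK; lia.
  case: xd => e; rewrite e in lt zlt h.
    by have := h (z (-2)); rewrite zK; lia.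
  by have := h (-2); rewrite zK; lia.
by split=> //; have [<- _] := z_minus2 E z1 z2.
Qed.

Lemma top_fixed : sp -> z (-1) < 0 -> z (-2) < 0 -> exists u, tau z (-2) m u = u.
Proof.
move=> hs h1 h2; have [e1 e2] := z_minus2 hs h1 h2; have [t1 t2] := top; rewrite hs in t1.
exists (-1); rewrite /tau e2 t1 !eqbF; try lia.
have -> : (Z.max (-2) (-1) <? Z.min m (m + 1)) = true by apply/Z.ltb_spec0; lia.
have -> : (m <? m + 1) = true by apply/Z.ltb_spec0; lia.
by rewrite /= /addarc /unarc; repeat zcase; lia.
Qed.

Lemma top_step : z (-1) < 0 -> (sp -> z (-2) < 0) -> rect z (-1) m /\
  tau z (-1) m = if sp then cj (sw (-1) m) z else addarc z (-1) m.
Proof.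
move=> h1 h2; have [t1 t2] := top.
have zm : z (-1) < z m by rewrite t1; case: (sp); lia.
split.
  split=> // [|e he]; first by lia.
  have [e1|l1] : e = -1 \/ 0 <= e by lia.
    by lia.
  have ze := rightZ (x := e); rewrite -/m in ze.
  have [l2|l2] : z e < z (-1) \/ z (-1) <= z e by lia.
    by lia.
  have e3 : z e = z (-1) -> e = -1 by move/(inv_eq zK).
  case E : (sp) t1 => t1; last by have : z (-1) = -1 by [apply: fillO]; lia.
  have [k1 k2] := z_minus2 E h1 (h2 E).
  have : z e <> -1 by move=> k3; have := zK e; rewrite k3; lia.
  by lia.
rewrite /tau t1; case E : (sp) t1 => t1; last first.
  by have -> : z (-1) = -1 by [apply: fillO]; rewrite !Z.eqb_refl.
have [k1 k2] := z_minus2 E h1 (h2 E).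
rewrite k1 !eqbF; try lia.
have -> : (Z.max (-1) (-2) <? Z.min m (m + 1)) = true by apply/Z.ltb_spec0; lia.
by have -> : (m <? m + 1) = true by apply/Z.ltb_spec0; lia.
Qed.

(** Without fixed points the arcs over the gap come in pairs, so a new part 1 brings its padding 0
    along. *)
Definition add_row (sp : bool) (l : seq nat) : seq nat := if sp then l ++ [:: 1%N; 0%N] else l ++ [:: 1%N].

Lemma grass_top : z (-1) < 0 -> (sp -> z (-2) < 0) -> grass sp (add_row sp l) (tau z (-1) m).
Proof.
move=> h1 h2; have [r tE] := top_step h1 h2; have [t1 t2] := top.
have rl i : (i < size l)%N -> z (Z.of_nat i) < 0 by move=> hi; apply: rightZ; rewrite /m; lia.
case E : (sp) tE t1 => tE t1; last first.
  have e1 : z (-1) = -1 by [apply: fillO]; have F := fin_tau (gr_fin g) r; rewrite E in F; rewrite tE in F *.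
  split=> //.
  - have p := gr_pre g; rewrite E /= in p *; move=> e he; rewrite /addarc.
    by zcase; [lia | zcase; [lia | exact: p]].
  - move=> i; rewrite size_cat /= addn1 ltnS => hi; rewrite /addarc nth_cat.
    case: ltnP => hi'; first by rewrite !eqbF ?(gr_right g) ?E //; rewrite ?/m; lia.
    have -> : i = size l by lia.
    by rewrite subnn /= -/m eqbF ?Z.eqb_refl //; lia.
  move=> x; rewrite size_cat /= addn1 => hx; rewrite /addarc !eqbF; try (rewrite /m; lia).
  by rewrite (gr_tail g) ?E //=; lia.
have [k1 k2] := z_minus2 E h1 (h2 E); have t2' := t2 E.
have F := fin_tau (gr_fin g) r; rewrite E in F; rewrite tE in F *.
have fp : forall x, z x <> x by apply: (gr_fpf g); rewrite E.
have p := gr_pre g; rewrite E /= in p.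
pose s := sw (-1) m; have sK : involutive s := swK _ _.
have sN x : x <> -1 -> x <> m -> s x = x by exact: swN.
have v1 : cj s z (-1) = m + 1 by rewrite /cj /s swL t1 swN; lia.
have v2 : cj s z (-2) = m by rewrite /cj (@sN (-2)) ?k2 /s ?swL; lia.
have v3 : cj s z m = -2 by rewrite /cj /s swR k1 swN; lia.
have v4 : cj s z (m + 1) = -1 by rewrite /cj (@sN (m + 1)) ?t2' /s ?swR; lia.
have v5 x : x <> -1 -> x <> -2 -> x <> m -> x <> m + 1 -> cj s z x = z x.
  move=> n1 n2 n3 n4; rewrite /cj (sN x) // sN // => e; [apply: n2 | apply: n4].
    by apply: (inv_eq zK); rewrite e k2.
  by apply: (inv_eq zK); rewrite e t2'.
split=> //.
- by move=> _ x h; apply: (fp (s x)); apply: (inv_inj sK); rewrite sK; exact: h.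
- move=> e u l1 l2 l3.
  have n1 : e <> -1 by move=> h; move: l2; rewrite h v1; lia.
  have n2 : e <> -2 by move=> h; move: l2; rewrite h v2; lia.
  have en : e < 0 by lia.
  rewrite v5 // in l1 l2 l3; try lia.
  have hu := p e u l1 l2 l3.
  have [->|m1] := Z.eqb_spec u (-1); first by rewrite v1; lia.
  have [->|m2] := Z.eqb_spec u (-2); first by rewrite v2; lia.
  by rewrite v5 //; lia.
- move=> i; rewrite size_cat /= => hi; rewrite nth_cat.
  case: ltnP => hi'.
    by rewrite v5 ?(gr_right g) ?E //; rewrite ?/m; lia.
  have [->|->] : i = size l \/ i = (size l).+1 by lia.
    by rewrite subnn -/m v3.
  have -> : Z.of_nat (size l).+1 = m + 1 by rewrite /m; lia.
  by rewrite v4 subSnn.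
move=> x; rewrite size_cat /= => hx; rewrite v5; try (rewrite /m; lia).
rewrite (gr_tail g) ?E /tail; last lia.
have -> : x - Z.of_nat (size l + 2) = x - Z.of_nat (size l) - 2 by lia.
by rewrite [in RHS]Z.even_sub /=; case: (Z.even _).
Qed.

(** The cover leaving the set puts the shortest nontrivial arc right of all the others;
    multiplicativity then turns its function into that of z times q_1 / 2. *)
Lemma out_tau : let a := if sp then m + 1 else m in
  [/\ rect z a (a + 1), wt z a (a + 1) = (if sp then 1 else 2)%N &
  tau z a (a + 1) = jn m z (ar sp m (m + gap sp))] .
Proof.
have [t1 t2] := top; rewrite /gap; case E : (sp) t1 => t1 /=.
  have t2' := t2 E; have tl x : m + 2 <= x -> z x = Theta x.
    move=> hx; rewrite (gr_tail g) -/m ?E /tail /Theta; last lia.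
    rewrite Z.even_sub; have -> : Z.even m = true by apply/Z.even_spec; exists (Z.of_nat (size l)./2); rewrite /m; have := evl E; lia.
    by case: (Z.even x).
  have evm : Z.even m = true by apply/Z.even_spec; exists (Z.of_nat (size l)./2); rewrite /m; have := evl E; lia.
  have t3 : z (m + 2) = m + 3 by rewrite tl /Theta ?Z.even_add ?evm /=; lia.
  have t4 : z (m + 3) = m + 2 by rewrite -t3 zK.
  have e2 : m + 1 + 1 = m + 2 by lia.
  rewrite e2; split.
  - by split; rewrite ?t2' ?t3; lia.
  - by rewrite wt1 // t3; lia.
  rewrite /tau t2' t3 !eqbF; try lia.
  have -> : (Z.max (m + 1) m <? Z.min (m + 2) (m + 3)) = true by apply/Z.ltb_spec0; lia.
  have -> : (m + 1 <? m) = false by apply/Z.ltb_spec0; lia.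
  have -> : (m + 2 <? m + 3) = true by apply/Z.ltb_spec0; lia.
  rewrite /=; apply: functional_extensionality => x; rewrite /jn /cj.
  have c1 : forall x, x < m -> z x < m.
    by move=> u hu; have [l1|l1] := Z.lt_ge_cases u 0; [exact: neg | have := rightZ (x := u); rewrite -/m; lia].
  case: Z.ltb_spec => hx.
    by rewrite (@swN _ _ x) ?swN //; try lia; have := c1 x hx; lia.
  have ta : Theta m = m + 1 by rewrite /Theta evm.
  have [->|n1] := Z.eqb_spec x m; first by rewrite /ar Z.eqb_refl (@swN _ _ m) ?t1 ?swL; lia.
  have [->|n2] := Z.eqb_spec x (m + 2).
    by rewrite swR t2' swN ?/ar ?(@eqbF (m + 2) m) ?Z.eqb_refl; lia.
  have [->|n3] := Z.eqb_spec x (m + 1).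
    rewrite swL t3 swN; try lia; rewrite /ar !eqbF; try lia.
    have -> : rk m (m + 2) (m + 1) = m by rewrite /rk; repeat zcase; lia.
    by rewrite /= ta /unrk; repeat zcase; lia.
  have [->|n4] := Z.eqb_spec x (m + 3).
    rewrite (@swN _ _ (m + 3)) ?t4 ?swR; try lia; rewrite /ar !eqbF; try lia.
    have -> : rk m (m + 2) (m + 3) = m + 1 by rewrite /rk; repeat zcase; lia.
    by rewrite /= -ta ThetaK /unrk; repeat zcase; lia.
  have hx4 : m + 4 <= x by lia.
  have tg : m + 4 <= z x by apply: (gr_tail_ge g evl sl pl) => //; rewrite -/m; [lia | move=> _; have -> : m + 4 - m = 4 by lia].
  rewrite (@swN _ _ x) ?swN //; try lia.
  rewrite /ar !eqbF; try lia.
  have -> : rk m (m + 2) x = x - 2 by rewrite /rk; repeat zcase; lia.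
  have E2 : Theta (x - 2) = Theta x - 2 by rewrite /Theta Z.even_sub /=; case: (Z.even x) => /=; lia.
  by rewrite /= E2 -tl; [rewrite /unrk; repeat zcase; lia | lia].
have tl x : m <= x -> z x = x by move=> hx; rewrite (gr_tail g) // E.
split.
- by split; rewrite ?tl; lia.
- by rewrite /wt !tl ?eqxx //; lia.
rewrite /tau !tl; try lia.
rewrite !Z.eqb_refl; apply: functional_extensionality => x; rewrite /jn /addarc /ar.
case: (Z.ltb_spec x m) => hx; first by rewrite !eqbF //; lia.
zcase => //; zcase => //.
by rewrite [base false _]/= rkK ?tl //; lia.
Qed.
End Grass.

(** * Vanishing in too few variables *)

Definition cross (z : Z -> Z) (g : Z) (c : nat) := exists xs : seq Z,
  [/\ uniq xs, forall x, x \in xs -> x < g /\ g <= z x & (c <= size xs)%N].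

Lemma cross_strip z i g c : inv z -> dsc z i -> i + 1 < g \/ g <= i -> cross z g c -> cross (strip z i) g c.
Proof.
move=> zK d hg [xs [u h s]]; rewrite /strip; case: Z.eqb_spec => e.
  exists xs; split=> // x /h[h1 h2]; rewrite /unarc.
  have zj : z (i + 1) = i by rewrite -e zK.
  by repeat zcase; subst; lia.
exists (map (sw i (i + 1)) xs); split; rewrite ?size_map //.
  by rewrite map_inj_uniq //; apply: sw_inj.
move=> x' /mapP[x /h[h1 h2] ->]; rewrite /cj swK; split; rewrite /sw; repeat zcase; lia.
Qed.

Lemma cross_prev z g c : cross z g c.+1 -> cross z (g - 1) c.
Proof.
case=> xs [u h s]; exists (rem (g - 1) xs); split.
- exact: rem_uniq.
- have key (x : Z) : x \in rem (g - 1) xs -> x < g - 1 /\ g - 1 <= z x.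
    rewrite mem_rem_uniq // inE => /andP[/eqP n /h[h1 h2]].
    by have {}n : x <> g - 1 := n; lia.
  exact: key.
case: (boolP (g - 1 \in xs)) => i; first by rewrite size_rem //; case: (size xs) s.
by rewrite rem_id //; lia.
Qed.

(** Letters below g - 1 do not lower the number of arcs over the gap before g. At the letter g - 1
    the count passes to the gap before g - 1, losing at most the point g - 1, and this letter and
    all later ones respect that gap. So a pass costs at most one crossing. *)
Lemma pass_cross (R : comNzRingType) (H : (Z -> Z) -> R) c g :
  (forall w, inv w -> cross w (g - 1) c -> H w = 0%R) ->
  forall k i z, inv z -> cross z g c.+1 -> i <= g - 1 -> pass H (zr i k) z = 0%R.
Proof.
move=> h; have h0 w : inv w -> cross w g c.+1 -> H w = 0%R.
  by move=> wK /cross_prev; apply: h.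
have late k : forall i z, inv z -> cross z (g - 1) c -> g - 1 <= i -> pass H (zr i k) z = 0%R.
  elim: k => [|k IH] i z zK hz hi /=; first by rewrite h.
  rewrite IH // ?add0r; last lia.
  rewrite /Dop; case: Z.ltb_spec => [d|_]; last by rewrite mulr0.
  rewrite IH ?mulr0 //; [exact: strip_inv | apply: cross_strip => //; lia | lia].
elim=> [|k IH] i z zK hz hi /=; first by rewrite h0.
have [e|n] := Z.eqb_spec i (g - 1).
  by apply: (late k.+1 i) => //; [exact: cross_prev | lia].
rewrite IH // ?add0r; last lia.
rewrite /Dop; case: Z.ltb_spec => [d|_]; last by rewrite mulr0.
by rewrite IH ?mulr0 //; [exact: strip_inv | apply: cross_strip => //; lia | lia].
Qed.

(** The summand [sp] stands for the one arc of [Theta] that can cross a gap. *)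
Lemma Fs_cross (sp : bool) n A N g z : inv z -> A <= g - Z.of_nat n ->
  cross z g (n + sp).+1 -> @Fs (base sp) (zr A N) n z = 0%R.
Proof.
elim: n g z => [|n IH] g z zK hA hz.
  rewrite [LHS]/= asboolF // => e; have [xs [u h s]] := hz.
  move: u h s; rewrite e; case: (sp) => u h s /=.
    pose L1 : seq Z := [:: g - 1].
    have key (x : Z) : x \in xs -> x \in L1.
      by move=> /h[h1 h2]; rewrite inE; apply/eqP; have := Theta_cases x; rewrite /= in h2; lia.
    by have := leq_trans s (uniq_leq_size u key).
  by case: xs h s {u} => // x xs /(_ x (mem_head _ _)) /=; lia.
apply: (@pass_cross _ _ (n + sp).+1 g) => //; last by lia.
by move=> w wK hw; apply: (IH (g - 1)) => //; lia.
Qed.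

Lemma Fn_cross (sp : bool) n g z : fin sp z -> cross z g (n + sp).+1 -> Fn sp n z = 0%R.
Proof.
move=> f h; have [k [k0 s h1 h2]] := finE (g - Z.of_nat n) 0 f.
by rewrite (FnE n k0 s); apply: Fs_cross h => //; [case: s | lia].
Qed.

Lemma strict_pos l : strict_partition l -> all (fun a => 0 < a)%N l. Proof. by case/andP. Qed.

Lemma pad_even (sp : bool) l : sp -> ~~ odd (size (pad sp l)).
Proof. by move=> hs; rewrite /pad hs /=; case: (boolP (odd (size l))) => //=; rewrite size_rcons /= negbK. Qed.

Lemma rcons_sorted (l : seq nat) a : sorted gtn (rcons l a) = sorted gtn l && (all (fun b => a < b)%N l).
Proof.
have gt_tr : transitive gtn by move=> x y w /=; lia.
by rewrite -cats1 (sorted_pairwise gt_tr) (sorted_pairwise gt_tr) pairwise_cat allrel1r /= andbT andbC.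
Qed.

Lemma pad_sorted (sp : bool) l : strict_partition l -> sorted gtn (pad sp l).
Proof.
move=> /andP[h1 h2]; rewrite /pad; case: ifP => // _.
by rewrite rcons_sorted h1.
Qed.

Lemma pad_pos (sp : bool) l : strict_partition l -> sp = false -> all (fun a => 0 < a)%N (pad sp l).
Proof. by move=> /andP[h1 h2] e; rewrite /pad e. Qed.

(** The arcs of the parts cross the gap before 0. Without fixed points one more crossing is needed:
    for odd length the padding arc supplies it, for even length the arc at -1 does, at the gap
    before -1. *)
Lemma fam_vanish (sp : bool) l n : strict_partition l -> (n < size l)%N -> fam sp l n = 0%R.
Proof.
move=> sl hn; have [[z g]|no] := pselect (exists z, grass sp (pad sp l) z); last first.
  by rewrite /fam; case: pselect => [h|//]; case: no.
rewrite (famE n g); have zK := fin_inv (gr_fin g).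
set l' := pad sp l in g; set m := size l'.
have rZ := gr_rightZ g (@pad_even sp l) (pad_sorted sp sl) (pad_pos sl).
have mk (xs : seq Z) c gp : uniq xs -> (forall x, x \in xs -> x < gp /\ gp <= z x) -> (c <= size xs)%N -> cross z gp c.
  by exists xs.
pose P := [seq z (Z.of_nat j) | j <- iota 0 m].
have inP x : x \in P -> exists2 j, (j < m)%N & x = z (Z.of_nat j).
  by move=> /mapP[j]; rewrite mem_iota add0n => /andP[_ hj] ->; exists j.
have uP : uniq P by rewrite map_inj_uniq ?iota_uniq // => i j /(inv_eq zK); lia.
have szP : size P = m by rewrite size_map size_iota.
have prop : (n + sp < m)%N -> Fn sp n z = 0%R.
  move=> h; apply: (@Fn_cross sp n 0 z (gr_fin g)); apply: (mk P); rewrite ?szP //.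
  by move=> x /inP[j hj ->]; split; [apply: rZ; rewrite -/l' -/m; lia | rewrite zK; lia].
have [h|h] := ssrnat.ltnP (n + sp) m; first exact: prop.
have hs : sp by move: h; rewrite /m /l' /pad; case: (sp) => //=; lia.
have el : l' = l by move: h; rewrite /m /l' /pad hs /=; case: ifP => // _; rewrite size_rcons; lia.
have em : m = size l by rewrite /m el.
have f := gr_fpf g hs.
have r1 j : (j < m)%N -> z (Z.of_nat j) < -1.
  move=> hj; rewrite (gr_right g) // /off hs; have := all_nthP 0%N (strict_pos sl) j; rewrite -em el => /(_ hj); lia.
have zm1 : z (-1) < -1.
  have n1 := f (-1); have [l1|l1] := Z.lt_ge_cases (z (-1)) 0; first by lia.
  have ng := gr_neg g (@pad_even sp l) (pad_sorted sp sl) (pad_pos sl) (x := -1).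
  have := r1 (Z.to_nat (z (-1))); rewrite Z2Nat.id // zK; rewrite -/l' -/m in ng; lia.
apply: (@Fn_cross sp n (-1) z (gr_fin g)); apply: (mk (z (-1) :: P)); rewrite /= ?szP.
- rewrite uP andbT; apply/negP => /inP[j hj /(inv_eq zK)]; lia.
- move=> x; rewrite in_cons => /orP[/eqP ->|/inP[j hj ->]]; rewrite zK; first by lia.
  by have := r1 _ hj; lia.
by rewrite hs em; lia.
Qed.

Lemma grass_nil (sp : bool) : grass sp (pad sp [::]) (base sp).
Proof.
have p0 : pad sp [::] = [::] by rewrite /pad andbF.
rewrite p0; split.
- by exists 0%N; split=> //; exact: baseK.
- by move=> hs x; rewrite /base hs; have := Theta_cases x; lia.
- rewrite /prefix /base; case: (sp) => [e u|e]; last by lia.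
  by have := Theta_cases e; lia.
- by [].
by move=> x _; rewrite /tail /base Z.sub_0_r; case: (sp).
Qed.

Lemma fam_nil (sp : bool) n : fam sp [::] n = 1%R.
Proof.
rewrite (famE n (grass_nil sp)) (@FnE sp n _ 1) //; first exact: Fs_base.
by split=> //; exact: baseK.
Qed.

Lemma big_single (V : zmodType) (T : eqType) (s : seq T) (P : pred T) (F : T -> V) (a : T) :
  uniq s -> a \in s -> P a -> (forall x, P x -> x <> a -> F x = 0%R) ->
  (\sum_(x <- s | P x) F x = F a)%R.
Proof.
move=> us as_ Pa h; rewrite -big_filter (bigD1_seq a) ?mem_filter ?Pa ?filter_uniq //= big1_seq ?addr0 // => x /andP[/eqP nx].
by rewrite mem_filter => /andP[Px _]; exact: h.
Qed.

Lemma big_double (V : zmodType) (T : eqType) (s : seq T) (P : pred T) (F : T -> V) (a b : T) :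
  uniq s -> a \in s -> P a -> b \in s -> P b -> a <> b -> (forall x, P x -> x <> a -> x <> b -> F x = 0%R) ->
  (\sum_(x <- s | P x) F x = F a + F b)%R.
Proof.
move=> us as_ Pa bs Pb ab h; rewrite -big_filter (bigD1_seq a) ?mem_filter ?Pa ?filter_uniq //=; congr (_ + _)%R.
rewrite -big_filter (bigD1_seq b) ?mem_filter ?Pb ?filter_uniq //=; last first.
  by rewrite bs !andbT; apply/eqP => e; apply: ab.
rewrite big1_seq ?addr0 // => x /andP[/eqP n1]; rewrite !mem_filter => /and3P[/eqP n2 Px _]; exact: h.
Qed.

(** * The Pieri rule for Grassmannian involutions *)

Section Pieri.
Variables (sp : bool) (l : seq nat) (z : Z -> Z) (n : nat).
Hypothesis g : grass sp l z.
Hypothesis evl : sp -> ~~ odd (size l).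
Hypothesis sl : sorted gtn l.
Hypothesis pl : sp = false -> all (fun a => 0 < a)%N l.
Let m := Z.of_nat (size l).
Let zK : inv z. Proof. exact: fin_inv (gr_fin g). Qed.
Let f := gr_fin g.
Let H := Fn sp n.
Let M := inM sp l z.
Let phi (j : nat) : Z := z (Z.of_nat j).
Let tops : seq Z := if sp then [:: m; m + 1] else [:: m].
Let Ms : seq Z := [seq phi j | j <- iota 0 (size l)] ++ [seq Z.of_nat j | j <- iota 0 (size l)] ++ tops.
Let rightZ x : 0 <= x < m -> z x < 0.
Proof. exact: (gr_rightZ g evl sl pl). Qed.
Let neg x : x < 0 -> z x < m.
Proof. exact: (gr_neg g evl sl pl). Qed.
Let m0 : 0 <= m. Proof. rewrite /m; lia. Qed.
Let top : z m = (if sp then m + 1 else m) /\ (sp -> z (m + 1) = m).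
Proof. exact: (gr_top g evl sl pl). Qed.

Lemma Ms_in (x : Z) : (x \in Ms) = M x.
Proof.
apply/idP/(inMP sp l z x).
  rewrite !mem_cat => /or3P[/mapP[j]|/mapP[j]|].
  - rewrite mem_iota => /andP[_ hj] ->; right; rewrite /phi zK; split; last by lia.
    by apply: rightZ; rewrite /m; lia.
  - by rewrite mem_iota => /andP[_ hj] ->; left; rewrite /gap -/m; case: (sp); rewrite /m; lia.
  by rewrite /tops /gap -/m; case: (sp); rewrite !inE => h; left;
    [case/orP: h => /eqP ->|move/eqP: h => ->]; lia.
rewrite -/m !mem_cat => -[h|[h1 h2]].
  have [l1|l1] := Z.lt_ge_cases x m.
    apply/or3P/Or32; apply/mapP; exists (Z.to_nat x); [rewrite mem_iota; lia|lia].
  apply/or3P/Or33; rewrite /tops; move: h; rewrite /gap; case: (sp) => h; rewrite !inE.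
    have [->|->] : x = m \/ x = m + 1 by lia.
      by rewrite eqxx.
    by rewrite eqxx orbT.
  by apply/eqP; lia.
apply/or3P/Or31; apply/mapP; exists (Z.to_nat (z x)); last by rewrite /phi Z2Nat.id // zK.
by rewrite mem_iota; have := neg h1; rewrite /m; lia.
Qed.

Lemma Ms_uniq : uniq Ms.
Proof.
rewrite !cat_uniq; apply/and3P; split.
- by rewrite map_inj_uniq ?iota_uniq // => i j /(inv_eq zK); lia.
- apply/hasPn => x hx; apply/negP => /mapP[j]; rewrite mem_iota => /andP[_ hj] e.
  have : x < 0 by rewrite e; apply: rightZ; rewrite /m; lia.
  move: hx; rewrite mem_cat => /orP[/mapP[i _ ->]|]; first by lia.
  by rewrite /tops; case: (sp); rewrite !inE => h; [case/orP: h => /eqP ->|move/eqP: h => ->]; lia.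
apply/and3P; split.
- by rewrite map_inj_uniq ?iota_uniq // => i j; lia.
- apply/hasPn => x hx; apply/negP => /mapP[j]; rewrite mem_iota => /andP[_ hj] e.
  by move: hx; rewrite e /tops; case: (sp); rewrite !inE => h; [case/orP: h => /eqP|move/eqP: h]; rewrite /m; lia.
by rewrite /tops; case: (sp) => //=; rewrite inE andbT; apply/eqP; lia.
Qed.

(** The transitions at all points of the set are added. A cover inside the set enters once with each
    sign, so the covers leaving the set balance those entering it. *)
Lemma pieri_balance : exists k, [/\ forall x, M x -> x \in window k.+1,
  - ev k.+1 <= -(m + 4 + Z.abs (phi 0)) /\ m + 4 < ev k.+1, forall x, x \in window k.+1 -> z x \in window k.+1,
  forall j, (j < size l)%N -> phi j - 1 \in window k.+1 &
  (\sum_(y <- window k.+1 | M y) \sum_(x <- window k.+1 | ~~ M x) gterm z y x H =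
  \sum_(y <- window k.+1 | M y) \sum_(x <- window k.+1 | ~~ M x) gterm z x y H)%R].
Proof.
have [k [k0 s h1 h2]] := finE (m + 4) (-(m + 4 + Z.abs (phi 0))) f.
have [c1 c2] := supp_cut s; have s1 := supp_mono s (leqnSn k); have [d1 d2] := supp_cut s1.
have evS : ev k.+1 = ev k + 2 by rewrite /ev; lia.
have Mk (x : Z) : M x -> - ev k <= x < ev k.
  move=> /(inMP sp l z)[h|[h3 h4]]; first by move: h; rewrite -/m /gap; case: (sp); lia.
  by have [l1|l1] := Z.lt_ge_cases x (- ev k); [have := c1 x l1 |]; lia.
have inW (x : Z) : - ev k.+1 <= x < ev k.+1 -> x \in window k.+1.
  by move=> h; rewrite mem_window; apply/andP; split; [apply/Z.leb_spec0|apply/Z.ltb_spec0]; lia.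
exists k; split.
- by move=> x /Mk h; apply: inW; lia.
- by lia.
- move=> x; rewrite mem_window => /andP[/Z.leb_spec0 h3 /Z.ltb_spec0 h4]; apply: inW; split.
    by apply: cut_ge zK d1 _.
  by apply: d2; lia.
- move=> j hj; have h : M (phi j).
    by apply/(inMP sp l z); right; rewrite /phi zK; split; [apply: rightZ; rewrite /m|]; lia.
  by have := Mk _ h; have : phi j < 0 by [apply: rightZ; rewrite /m; lia]; move=> *; apply: inW; lia.
have T : (\sum_(y <- window k.+1 | M y) Top (window k.+1) H z y = 0)%R.
  apply: big1 => y My; apply: (Fn_trans n s); first exact: Mk.
  by move=> hs; apply: (gr_fpf g).
apply/eqP; rewrite -subr_eq0 -sumrB; apply/eqP; rewrite -[RHS]T.
rewrite /Top; under [RHS]eq_bigr do rewrite (bigID M) /=.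
rewrite [RHS]big_split /= [X in _ = (X + _)%R](_ : _ = 0%R).
  by rewrite add0r; apply: eq_bigr => y _; rewrite sumrB.
under eq_bigr do rewrite sumrB.
by rewrite sumrB [X in (_ - X)%R]exchange_big /= subrr.
Qed.

Lemma pieri_out k : (forall x, M x -> x \in window k.+1) -> m + 4 < ev k.+1 -> - ev k.+1 <= 0 ->
  (\sum_(y <- window k.+1 | M y) \sum_(x <- window k.+1 | ~~ M x) gterm z y x H = H z * qn n 1)%R.
Proof.
move=> hM hk hk'; have [t1 t2] := top; have [r w te] := out_tau g evl sl pl.
have inW (x : Z) : 0 <= x < m + 4 -> x \in window k.+1.
  by move=> h; rewrite mem_window; apply/andP; split; [apply/Z.leb_spec0|apply/Z.ltb_spec0]; lia.
have op : forall y x : Z, M y -> M x = false -> rect z y x ->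
    if sp then (m <= y <= m + 1 /\ m + 2 <= x <= m + 3) else (y = m /\ x = m + 1).
  exact: (out_pairs g evl sl pl).
have uW : uniq (window k.+1) by exact: zr_uniq.
have Min (x : Z) : 0 <= x -> M x = (x <? m + gap sp).
  move=> hx; apply/(inMP sp l z)/Z.ltb_spec0; rewrite -/m; first by lia.
  by move=> ?; left.
have val : (H (jn m z (ar sp m (m + gap sp))) *+ 2 = H z * qn n 1)%R.
  have ab : m < m + gap sp by rewrite /gap; case: (sp); lia.
  have evm : sp -> Z.even m = true.
    by move=> hs; apply/Z.even_spec; exists (Z.of_nat (size l)./2); rewrite /m; have := evl hs; lia.
  have bm x : m <= x -> m <= base sp x.
    move=> hx; rewrite /base; case E: (sp) => //; rewrite /Theta; case Ex : (Z.even x); first by lia.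
    by have := evm E; have : x = m \/ m < x by [lia]; case=> [<-|?]; [rewrite Ex | lia].
  have bl x : x < m -> base sp x < m.
    by move=> hx; have [//|/bm] := Z.lt_ge_cases (base sp x) m; rewrite baseK; lia.
  rewrite /H (@Fn_mul sp m) // -?mulrnAr ?(@Fn_row sp n m _ 0) //; try lia.
  - exact: ar_fin.
  - split=> //.
      by move=> x hx; have [l1|l1] := Z.lt_ge_cases x 0; [exact: neg | have := rightZ (x := x); lia].
    move=> x hx; rewrite (gr_tail g) // -/m /tail /base; case E: (sp) => //.
    by rewrite Z.even_sub (evm E) /Theta; case: (Z.even x).
  have rs x : x < m -> ar sp m (m + gap sp) x = base sp x.
    move=> hx; rewrite /ar !eqbF; try lia.
    have e : rk m (m + gap sp) x = x by rewrite /rk; repeat zcase; lia.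
    by rewrite e /unrk; have := bl x hx; repeat zcase; lia.
  split=> //; first exact: ar_inv.
  by move=> x hx; rewrite rs //; exact: bl.
rewrite -val; case E : (sp) op r w te t1 t2 => op r w te t1 t2; last first.
  rewrite E /gap in Min te.
  have Mm : M m by rewrite Min; [apply/Z.ltb_spec0|]; lia.
  have Mm1 : M (m + 1) = false by rewrite Min; [apply/Z.ltb_spec0|]; lia.
  rewrite (big_single (a := m)) //; [|by apply: inW; lia|]; last first.
    move=> y My n1; apply: big1 => x /negbTE Mx; apply: gtermN => ry.
    by have := op y x My Mx ry; lia.
  rewrite (big_single (a := m + 1)) ?Mm1 //; [|by apply: inW; lia|]; last first.
    move=> x /negbTE Mx n1; apply: gtermN => ry.
    by have := op m x Mm Mx ry; lia.
  by rewrite gtermT // w te ?E.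
rewrite E /gap in Min te.
have t2' := t2 isT.
have tl x : m <= x -> z x = tail true m x by move=> hx; rewrite (gr_tail g) // E.
have t3 : z (m + 2) = m + 3.
  by rewrite tl; last lia; rewrite /tail; have -> : m + 2 - m = 2 by [lia]; rewrite /=; lia.
have t4 : z (m + 3) = m + 2 by rewrite -t3 zK.
have e2 : m + 1 + 1 = m + 2 by lia.
have v12 : (gterm z (m + 1) (m + 2) H = H (jn m z (ar true m (m + 2))))%R.
  by rewrite e2 in r w te; rewrite gtermT // w te ?E.
have v03 : (gterm z m (m + 3) H = H (jn m z (ar true m (m + 2))))%R.
  by rewrite -gterm_sym // t1 t4.
have v02 : (gterm z m (m + 2) H = 0)%R.
  have [rr|/gtermN //] := pselect (rect z m (m + 2)).
  rewrite gtermT // (_ : H _ = 0%R) ?mul0rn // /H E (@Fn_dead _ _ (m + 1)) //.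
    by have := fin_tau f rr; rewrite E.
  rewrite /tau t1 t3 !eqbF; try lia.
  have -> : (Z.max m (m + 1) <? Z.min (m + 2) (m + 3)) = true by apply/Z.ltb_spec0; lia.
  have -> : (m <? m + 1) = true by apply/Z.ltb_spec0; lia.
  have -> : (m + 2 <? m + 3) = true by apply/Z.ltb_spec0; lia.
  by rewrite /= /addarc /unarc; repeat zcase; lia.
have v13 : (gterm z (m + 1) (m + 3) H = 0)%R by rewrite -gterm_sym // t2' t4.
have Mm : M m by rewrite Min; [apply/Z.ltb_spec0|]; lia.
have Mm1 : M (m + 1) by rewrite Min; [apply/Z.ltb_spec0|]; lia.
have Mm2 : M (m + 2) = false by rewrite Min; [apply/Z.ltb_spec0|]; lia.
have Mm3 : M (m + 3) = false by rewrite Min; [apply/Z.ltb_spec0|]; lia.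
rewrite (big_double (a := m) (b := m + 1)) //; [|by apply: inW; lia|by apply: inW; lia|by lia|]; last first.
  move=> y My n1 n2; apply: big1 => x /negbTE Mx; apply: gtermN => ry.
  by have := op y x My Mx ry; lia.
rewrite [X in (X + _)%R](big_single (a := m + 3)) ?Mm3 //; [|by apply: inW; lia|]; last first.
  move=> x /negbTE Mx n1; have [->|n2] := Z.eqb_spec x (m + 2); first exact: v02.
  by apply: gtermN => ry; have := op m x Mm Mx ry; lia.
rewrite [X in (_ + X)%R](big_single (a := m + 2)) ?Mm2 //; [|by apply: inW; lia|]; last first.
  move=> x /negbTE Mx n1; have [->|n2] := Z.eqb_spec x (m + 3); first exact: v13.
  by apply: gtermN => ry; have := op (m + 1) x Mm1 Mx ry; lia.
by rewrite v12 v03 mulr2n ?E.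
Qed.

(** The two ends of an arc both lie in the set and contribute equally by symmetry, whence the factor
    2. *)
Lemma pieri_in k : (forall x, M x -> x \in window k.+1) -> - ev k.+1 <= -2 -> 0 < ev k.+1 ->
  (forall x, x \in window k.+1 -> z x \in window k.+1) ->
  (forall j, (j < size l)%N -> phi j - 1 \in window k.+1) ->
  (\sum_(y <- window k.+1 | M y) \sum_(x <- window k.+1 | ~~ M x) gterm z x y H =
  (\sum_(j <- iota 0 (size l)) (if z (phi j - 1) <? 0 then H (cj (sw (phi j - 1) (phi j)) z) else 0) +
   (if (z (-1) <? 0) && (sp ==> (z (-2) <? 0)) then H (tau z (-1) m) else 0)) *+ 2)%R.
Proof.
move=> hM hk hk' hz hphi; have [t1 t2] := top.
have uW : uniq (window k.+1) by exact: zr_uniq.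
pose G y := (\sum_(x <- window k.+1 | ~~ M x) gterm z x y H)%R.
have Gz y : G (z y) = G y.
  have P : perm_eq (window k.+1) (map z (window k.+1)).
    apply: uniq_perm => //; first by rewrite map_inj_uniq // => u v; exact: inv_eq.
    by move=> x; apply/idP/mapP => [h|[x' h ->]]; [exists (z x); [exact: hz | rewrite zK] | exact: hz].
  transitivity (\sum_(x <- map z (window k.+1) | ~~ M x) gterm z x (z y) H)%R; first exact: perm_big.
  rewrite big_map; apply: eq_big => x; first by rewrite /M (inM_z g evl sl pl).
  by move=> _; exact: gterm_sym.
have Gphi j : (j < size l)%N -> G (phi j) = (if z (phi j - 1) <? 0 then H (cj (sw (phi j - 1) (phi j)) z) else 0)%R.
  move=> hj; have fneg : phi j < 0 by apply: rightZ; rewrite /m; lia.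
  have zf : z (phi j) = Z.of_nat j by rewrite /phi zK.
  have off1 x : ~~ M x -> x <> phi j - 1 -> gterm z x (phi j) H = 0%R.
    move=> /negbTE Mx n1; have [rr|/gtermN //] := pselect (rect z x (phi j)).
    have [e|[hs [u hu]]] := in_phi g evl sl pl hj Mx rr; first by case: n1.
    rewrite gtermT // (_ : H _ = 0%R) ?mul0rn //; have := fin_tau f rr; move: hs hu; rewrite /H.
    by case: (sp) => // _ hu hf; apply: Fn_dead hf hu.
  case: Z.ltb_spec => hfree.
    have [rr te] := phi_step g evl sl pl hj hfree; have -> : G (phi j) = gterm z (phi j - 1) (phi j) H.
      apply: (big_single uW (hphi j hj)) => [|x Mx n1]; last exact: off1.
      by case Mx: (M _) => //; move/(inMP sp l z): Mx; lia.
    by rewrite gtermT // wt1 ?te // zf; lia.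
  apply: big1 => x Mx; apply: off1 => // e; case/negP: Mx; apply/(inMP sp l z); right; rewrite e; lia.
have Gm : G m = (if (z (-1) <? 0) && (sp ==> (z (-2) <? 0)) then H (tau z (-1) m) *+ (if sp then 1 else 2)%N else 0)%R.
  have it := in_top g evl sl pl.
  have off1 x : ~~ M x -> x <> -1 -> gterm z x m H = 0%R.
    move=> /negbTE Mx n1; have [rr|/gtermN //] := pselect (rect z x m).
    have [h1 h2] := it x Mx rr; move: h2; case E : (sp) => // -[h2 [//|e]].
    have [u hu] := top_fixed g evl sl pl E h1 h2; rewrite e in rr *.
    rewrite gtermT // (_ : H _ = 0%R) ?mul0rn //; have := fin_tau f rr; rewrite /H E => hf.
    exact: Fn_dead hf hu.
  case: ifP => [/andP[/Z.ltb_spec0 h1 h2]|h].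
    have h2' : sp -> z (-2) < 0 by move=> hs; move: h2; rewrite hs /= => /Z.ltb_spec0.
    have [rr te] := top_step g evl sl pl h1 h2'; have -> : G m = gterm z (-1) m H.
      apply: (big_single uW) => [||x Mx n1]; last exact: off1.
      - by rewrite mem_window; apply/andP; split; [apply/Z.leb_spec0|apply/Z.ltb_spec0]; lia.
      by case Mx: (M _) => //; move/(inMP sp l z): Mx; lia.
    rewrite gtermT //; case E : (sp) t1 => t1; first by rewrite wt1 // t1; lia.
    have e : z (-1) = -1 by apply: (gr_filler_fix g evl sl pl E).
    by rewrite /wt e t1 !eqxx.
  apply: big1 => x Mx; have [e|n1] := Z.eqb_spec x (-1); last exact: off1.
  rewrite e in Mx *; apply: gtermN => rr.
  have [h1 h2] := it _ (negbTE Mx) rr; move/negP: h; apply; apply/andP; split; first by apply/Z.ltb_spec0.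
  by move: h2; case: (sp) => //= -[h2 _]; apply/Z.ltb_spec0.
have P : perm_eq [seq x <- window k.+1 | M x] Ms.
  apply: uniq_perm; [exact: filter_uniq | exact: Ms_uniq|].
  by move=> x; rewrite mem_filter Ms_in; case Mx: (M x) => //=; exact: hM.
rewrite -[LHS]big_filter (perm_big _ P) /Ms !big_cat !big_map /=.
rewrite -[X in (_ + (X + _))%R](eq_bigr _ (fun j _ => Gz (Z.of_nat j))) -/phi.
have -> : (\sum_(j <- tops) G j = (if (z (-1) <? 0) && (sp ==> (z (-2) <? 0)) then H (tau z (-1) m) else 0) *+ 2)%R.
  rewrite /tops; case E : (sp) t1 t2 Gm => t1 t2 Gm; rewrite !big_cons big_nil ?addr0.
    by have := Gz m; rewrite t1 => ->; rewrite Gm mulr2n ?E /=; case: ifP => _; rewrite ?mulr1n.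
  by rewrite Gm ?E /=; case: ifP => _; rewrite ?mul0rn.
rewrite mulrnDl addrA; congr (_ + _)%R; rewrite mulr2n.
have S : (\sum_(j <- iota 0 (size l)) G (phi j) = \sum_(j <- iota 0 (size l)) (if z (phi j - 1) <? 0 then H (cj (sw (phi j - 1) (phi j)) z) else 0))%R.
  by apply: eq_big_seq => j; rewrite mem_iota => /andP[_ hj]; exact: Gphi.
by congr (_ + _)%R; exact: S.
Qed.

Lemma pieri_raw : (H z * qn n 1 =
  (\sum_(j <- iota 0 (size l)) (if z (phi j - 1) <? 0 then H (cj (sw (phi j - 1) (phi j)) z) else 0) +
   (if (z (-1) <? 0) && (sp ==> (z (-2) <? 0)) then H (tau z (-1) m) else 0)) *+ 2)%R.
Proof.
have [k [h1 [h2 h2'] h3 h4 h5]] := pieri_balance.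
rewrite -(@pieri_in k h1 _ _ h3 h4); [|lia|lia].
by rewrite -h5 (@pieri_out k h1); [|lia|lia].
Qed.
End Pieri.

Lemma gtn_tr : transitive gtn. Proof. by move=> a b c /=; lia. Qed.

Lemma strict_bump k j : strict_partition k -> (j < size k)%N ->
  strict_partition (bump_part k j) = ((nth 0 k j).+1 \notin k)%N.
Proof.
move=> /andP[sk pk] hj.
have st (s : seq nat) a b : sorted gtn s -> (a < b < size s)%N -> (nth 0%N s b < nth 0%N s a)%N.
  by move=> ss /andP[ab bs]; apply: (sorted_ltn_nth gtn_tr 0%N ss) => //; rewrite inE; lia.
have sb : size (bump_part k j) = size k by rewrite size_set_nth; lia.
have nb i : nth 0%N (bump_part k j) i = if i == j then (nth 0%N k j).+1 else nth 0%N k i by rewrite nth_set_nth.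
apply/idP/idP => [/andP[hb _]|hn].
  apply/negP => /(nthP 0%N)[i hi e].
  have [l1|l1|l1] := ltngtP i j.
  - by have := st _ i j hb; rewrite sb l1 hj !nb eqxx ltn_eqF // => /(_ isT); rewrite e ltnn.
  - by have := st _ j i sk; rewrite l1 hi => /(_ isT); rewrite e ltnNge leqnSn.
  by move: e; rewrite l1 => /n_Sn.
apply/andP; split.
  apply/(sortedP 0%N) => i; rewrite sb !nb => hi; have h1 := st _ i i.+1 sk; rewrite leqnn hi in h1.
  have {}h1 := h1 isT; rewrite /=; case: (eqVneq i.+1 j) => [e|n1].
    case: eqP => [e'|_]; first by lia.
    have : nth 0%N k i != (nth 0%N k j).+1.
      by apply: contraNneq hn => <-; apply: mem_nth; exact: ltnW.
    by rewrite e in h1; lia.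
  by case: eqP => [<-|_] //; apply: ltnW.
apply/(all_nthP 0%N) => i; rewrite sb nb => hi; case: eqP => // _; exact: (all_nthP 0%N pk).
Qed.

Lemma strict_rcons1 k : strict_partition k -> strict_partition (rcons k 1%N) = (1%N \notin k).
Proof.
move=> /andP[sk pk]; rewrite /strict_partition rcons_sorted sk all_rcons pk /= andbT.
apply/allP/idP => [h|h x xk]; first by apply/negP => /h.
by have := allP pk x xk; have : x != 1%N by [apply: contraNneq h => <-]; lia.
Qed.

Section Fam.
Variables (sp : bool) (k : seq nat) (z : Z -> Z) (n : nat).
Hypothesis sk : strict_partition k.
Hypothesis g : grass sp (pad sp k) z.
Let l := pad sp k.
Let evl : sp -> ~~ odd (size l). Proof. exact: pad_even. Qed.
Let sl : sorted gtn l. Proof. exact: pad_sorted. Qed.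
Let pl : sp = false -> all (fun a => 0 < a)%N l. Proof. exact: pad_pos. Qed.
Let zK : inv z. Proof. exact: fin_inv (gr_fin g). Qed.
Let H := Fn sp n.

Lemma freeP (a : nat) : off sp - Z.of_nat a < 0 -> (z (off sp - Z.of_nat a) <? 0) = (a \notin l).
Proof.
move=> ha; apply/Z.ltb_spec0/idP => [h|h].
  apply/negP => /(nthP 0%N)[i hi e].
  by move: h; rewrite -e -(gr_right g) // zK; lia.
have [//|h1] := Z.lt_ge_cases (z (off sp - Z.of_nat a)) 0; case/negP: h.
have h2 := gr_neg g evl sl pl ha; rewrite -/l in h2.
have e := gr_right g (j := Z.to_nat (z (off sp - Z.of_nat a))).
rewrite Z2Nat.id // zK -/l in e.
have hlt : (Z.to_nat (z (off sp - Z.of_nat a)) < size l)%N by lia.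
have {}e := e hlt.
have e2 : nth 0%N l (Z.to_nat (z (off sp - Z.of_nat a))) = a by lia.
by apply/(nthP 0%N); exists (Z.to_nat (z (off sp - Z.of_nat a))).
Qed.

Let padded : (sp && odd (size k) /\ l = rcons k 0%N) \/ (sp && odd (size k) = false /\ l = k).
Proof. by rewrite /l /pad; case: ifP => h; [left|right]. Qed.

Let nthl j : (j < size k)%N -> nth 0%N l j = nth 0%N k j.
Proof. by case: padded => -[_ ->] // hj; rewrite nth_rcons hj. Qed.

Let szl : (size k <= size l)%N.
Proof. by case: padded => -[_ ->]; rewrite ?size_rcons. Qed.

Let inl a : (a.+1 \in l) = (a.+1 \in k).
Proof. by case: padded => -[_ ->] //; rewrite mem_rcons inE. Qed.

Lemma pad_bump j : (j < size k)%N -> pad sp (bump_part k j) = bump_part l j.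
Proof.
move=> hj; have sb : size (bump_part k j) = size k by rewrite size_set_nth; lia.
rewrite /pad sb; case: padded => -[-> ->] //; rewrite /bump_part.
apply: (@eq_from_nth _ 0%N); first by rewrite size_rcons !size_set_nth size_rcons; lia.
move=> i; rewrite size_rcons size_set_nth => hi.
rewrite nth_rcons !nth_set_nth /= !nth_rcons hj size_set_nth.
have -> : maxn j.+1 (size k) = size k by lia.
by case: eqP => [->|_]; rewrite ?hj.
Qed.

Let phiE j : (j < size l)%N -> z (Z.of_nat j) - 1 = off sp - Z.of_nat (nth 0%N l j).+1.
Proof. by move=> hj; rewrite (gr_right g) // -/l; lia. Qed.

Let offS a : off sp - Z.of_nat a.+1 < 0.
Proof. by rewrite /off; case: (sp); lia. Qed.

Lemma free_bump j : (j < size k)%N ->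
  (z (z (Z.of_nat j) - 1) <? 0) = strict_partition (bump_part k j).
Proof. by move=> hj; rewrite phiE ?freeP ?inl ?nthl ?strict_bump //; lia. Qed.

Lemma grass_bump_part j : (j < size k)%N -> strict_partition (bump_part k j) ->
  grass sp (pad sp (bump_part k j)) (cj (sw (z (Z.of_nat j) - 1) (z (Z.of_nat j))) z).
Proof.
move=> hj hs; rewrite pad_bump //; apply: (grass_bump g evl sl pl); first by rewrite -/l; lia.
by apply/Z.ltb_spec0; rewrite free_bump.
Qed.

Lemma grass_rcons1 : strict_partition (rcons k 1%N) -> exists w, grass sp (pad sp (rcons k 1%N)) w /\
  if sp && odd (size k) then w = cj (sw (z (Z.of_nat (size k)) - 1) (z (Z.of_nat (size k)))) z
  else w = tau z (-1) (Z.of_nat (size l)).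
Proof.
rewrite strict_rcons1 // -inl => h1; case: padded => -[hp el].
  exists (cj (sw (z (Z.of_nat (size k)) - 1) (z (Z.of_nat (size k)))) z); rewrite hp; split=> //.
  have hj : (size k < size l)%N by rewrite el size_rcons.
  have -> : pad sp (rcons k 1%N) = bump_part l (size k).
    case/andP: hp => hs ho; rewrite /pad size_rcons /= ho andbF el /bump_part nth_rcons ltnn eqxx.
    apply: (@eq_from_nth _ 0%N); first by rewrite size_set_nth !size_rcons; lia.
    move=> i; rewrite nth_set_nth /= !nth_rcons size_rcons => hi.
    by case: (ltngtP i (size k)) => //; lia.
  apply: (grass_bump g evl sl pl) => //; apply/Z.ltb_spec0; rewrite phiE // freeP //.
  by rewrite el nth_rcons ltnn eqxx -el.
exists (tau z (-1) (Z.of_nat (size l))); rewrite hp; split=> //.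
have h : (z (-1) < 0) /\ (sp -> z (-2) < 0).
  case E : (sp) freeP => fr.
    have f0 := fr 0%N; have f1 := fr 1%N.
    split=> [|_]; apply/Z.ltb_spec0; [rewrite f0 // el|by rewrite f1].
    by apply/negP => h; have := allP (strict_pos sk) _ h.
  by split=> //; apply/Z.ltb_spec0; have := fr 1%N => ->.
have -> : pad sp (rcons k 1%N) = add_row sp l.
  rewrite /pad size_rcons /add_row el /=; move: hp; case: (sp) => /= [->|_] /=; last by rewrite cats1.
  by rewrite -!cats1 -catA.
by case: h => h h'; apply: (grass_top g evl sl pl).
Qed.

Lemma fam_pieri : (fam sp k n * qn n 1 =
  (\sum_(j <- iota 0 (size k)) (if strict_partition (bump_part k j) then fam sp (bump_part k j) n else 0) +
   (if strict_partition (rcons k 1%N) then fam sp (rcons k 1%N) n else 0)) *+ 2)%R.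
Proof.
rewrite (famE n g) (pieri_raw n g evl sl pl) -/H -/l; congr (_ *+ _)%R.
have S : (\sum_(j <- iota 0 (size k)) (if z (z (Z.of_nat j) - 1) <? 0 then
     H (cj (sw (z (Z.of_nat j) - 1) (z (Z.of_nat j))) z) else 0) =
  \sum_(j <- iota 0 (size k)) (if strict_partition (bump_part k j) then fam sp (bump_part k j) n else 0))%R.
  apply: eq_big_seq => j; rewrite mem_iota => /andP[_ hj]; rewrite free_bump //.
  by case: ifP => // hs; rewrite (famE n (grass_bump_part hj hs)).
case: padded => -[hp el].
  (* When a padding part is present, the new row is this part raised from 0 to 1; the place -1 is
     occupied, so the term with [tau] is absent. *)
  rewrite {1}el size_rcons -addn1 iotaD big_cat big_seq1 add0n -addrA; congr (_ + _)%R; first exact: S.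
  have hs : sp by case/andP: hp.
  have -> : (z (-1) <? 0) = false.
    have := @freeP 0; rewrite /off hs /= => -> //.
    by rewrite el mem_rcons mem_head.
  have hj : (size k < size l)%N by rewrite el size_rcons.
  have F : (z (z (Z.of_nat (size k)) - 1) <? 0) = strict_partition (rcons k 1%N).
    by rewrite phiE // freeP // {1}el nth_rcons ltnn eqxx inl strict_rcons1.
  rewrite /= addr0 F; case: ifP => // h; have [w [gw]] := grass_rcons1 h; rewrite hp => ew.
  by rewrite (famE n gw) ew.
rewrite {1}el; congr (_ + _)%R; first exact: S.
have -> : (z (-1) <? 0) && (sp ==> (z (-2) <? 0)) = strict_partition (rcons k 1%N).
  rewrite strict_rcons1 // -inl.
  case E : (sp) freeP => fr.
    have f0 := fr 0%N; have f1 := fr 1%N.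
    rewrite f0 // f1 // el /=; have -> // : (0%N \notin k) by apply/negP => h; have := allP (strict_pos sk) _ h.
  by rewrite /= andbT; have := fr 1%N => ->.
by case: ifP => // h; have [w [gw]] := grass_rcons1 h; rewrite hp => ew; rewrite (famE n gw) ew.
Qed.
End Fam.

Lemma last_box k x : strict_partition (rcons k x) ->
  (x = 1%N /\ strict_partition k) \/
  (exists y, [/\ x = y.+1, strict_partition (rcons k y) & bump_part (rcons k y) (size k) = rcons k x]).
Proof.
move=> /andP[]; rewrite rcons_sorted all_rcons => /andP[h1 h2] /andP[h3 h4].
case: x h2 h3 => [|[|y]] // h2 _; first by left; split=> //; apply/andP.
right; exists y.+1; split=> //.
  apply/andP; split; last by rewrite all_rcons.
  by rewrite rcons_sorted h1; apply: sub_all h2 => a; lia.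
apply: (@eq_from_nth _ 0%N); first by rewrite size_set_nth !size_rcons; lia.
move=> i; rewrite size_set_nth !size_rcons => hi; rewrite nth_set_nth /= !nth_rcons ltnn eqxx.
by case: (ltngtP i (size k)) => //; lia.
Qed.

(** Built up one box at a time in the last row, using the involutions that the Pieri rule
    produces. *)
Lemma grass_ex (sp : bool) k : strict_partition k -> exists z, grass sp (pad sp k) z.
Proof.
move: {2}(sumn k) (leqnn (sumn k)) => N; elim: N k => [|N IH] k.
  case: k => [|[|a] k] //; last by move=> _ /andP[_] /=.
  by move=> _ _; exists (base sp); exact: grass_nil.
case/lastP: k => [|k x] hN sk; first by exists (base sp); exact: grass_nil.
rewrite sumn_rcons in hN.
have [[ex sk']|[y [ex sk' e]]] := last_box sk.
  have [z g] := IH k ltac:(lia) sk'; rewrite ex in sk *.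
  by have [w [gw _]] := grass_rcons1 sk' g sk; exists w.
have [z g] := IH (rcons k y) ltac:(rewrite sumn_rcons; lia) sk'.
have := grass_bump_part sk' g (j := size k); rewrite size_rcons e => /(_ (leqnn _) sk) gw.
by eexists; exact: gw.
Qed.

End GrassmannianInvolutions.

(** * Pfaffians and Q-functions in finitely many variables *)

Section QFunctions.
Local Open Scope ring_scope.

(** * Signed contractions and alternating functions of sequences *)

Section Contraction.
Variable R : comNzRingType.
Implicit Types (f g : nat -> R) (h : seq nat -> R) (l s : seq nat).

(** The exterior product of the one-form f with h: the alternating sum of f at one entry times h at
    the remaining ones, as in a row expansion. *)
Fixpoint ctr f h l : R :=
  if l is a :: l' then f a * h l' - ctr f (fun s => h (a :: s)) l' else 0.

Fixpoint bump_sum h l : R :=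
  if l is a :: l' then h (a.+1 :: l') + bump_sum (fun s => h (a :: s)) l' else 0.

Lemma ctr_ext f f' h h' l : {in l, f =1 f'} ->
  (forall s, {subset s <= l} -> (size s).+1 = size l -> h s = h' s) -> ctr f h l = ctr f' h' l.
Proof.
elim: l h h' => //= a l IH h h' hf hh; rewrite hf ?mem_head // hh //; last first.
  by move=> x; rewrite in_cons orbC => ->.
congr (_ - _); apply: IH => [x hx|s sl ss]; first by rewrite hf // in_cons hx orbT.
apply: hh => /=; last by rewrite ss.
by move=> x; rewrite !in_cons => /orP[->//|/sl ->]; rewrite orbT.
Qed.

Lemma ctr_lin c f h h' l : ctr f (fun s => c * h s + h' s) l = c * ctr f h l + ctr f h' l.
Proof.
elim: l h h' => [|a l IH] h h' /=; first by rewrite mulr0 addr0.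
by rewrite (IH (fun s => h (a :: s)) (fun s => h' (a :: s))); ring.
Qed.

Lemma ctr_linf c f f' h l : ctr (fun a => c * f a + f' a) h l = c * ctr f h l + ctr f' h l.
Proof.
elim: l h => [|a l IH] h /=; first by rewrite mulr0 addr0.
by rewrite IH; ring.
Qed.

Lemma ctr_add f h h' l : ctr f (fun s => h s + h' s) l = ctr f h l + ctr f h' l.
Proof. by rewrite -[ctr f h l]mul1r -ctr_lin; apply: ctr_ext => // s _ _; rewrite mul1r. Qed.

Lemma ctr_addf f f' h l : ctr (fun a => f a + f' a) h l = ctr f h l + ctr f' h l.
Proof. by rewrite -[ctr f h l]mul1r -ctr_linf; apply: ctr_ext => // a _; rewrite mul1r. Qed.

Lemma ctr_subf c d f f' h l :
  ctr (fun a => c * f a - d * f' a) h l = c * ctr f h l - d * ctr f' h l.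
Proof.
elim: l h => [|a l IH] h /=; first by rewrite !mulr0 subrr.
by rewrite IH; ring.
Qed.

Lemma ctr0 f l : ctr f (fun=> 0) l = 0.
Proof. by elim: l => //= a l ->; rewrite mulr0 subrr. Qed.

Lemma ctr0f h l : ctr (fun=> 0) h l = 0.
Proof. by elim: l h => //= a l IH h; rewrite IH mul0r subrr. Qed.

Lemma ctr_sub c f h h' l : ctr f (fun s => c * h s - h' s) l = c * ctr f h l - ctr f h' l.
Proof.
elim: l h h' => [|a l IH] h h' /=; first by rewrite mulr0 subrr.
by rewrite (IH (fun s => h (a :: s)) (fun s => h' (a :: s))); ring.
Qed.

Lemma ctr_opp f h l : ctr f (fun s => - h s) l = - ctr f h l.
Proof.
rewrite -[RHS]add0r -[X in _ = X + _](mul0r (ctr f h l)) -ctr_sub.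
by apply: ctr_ext => // s _ _; rewrite mul0r sub0r.
Qed.

Lemma ctr_anti f g h l : ctr f (ctr g h) l = - ctr g (ctr f h) l.
Proof.
elim: l h => [|a l IH] h /=; first by rewrite oppr0.
rewrite (ctr_sub (g a) f h (ctr g (fun s => h (a :: s)))) (ctr_sub (f a) g h (ctr f (fun s => h (a :: s)))) IH.
ring.
Qed.

Lemma ctr_nil2 f h l : ctr f (ctr f h) l = 0.
Proof.
elim: l h => [|a l IH] h //=.
by rewrite (ctr_sub (f a) f h (ctr f (fun s => h (a :: s)))) IH subr0 subrr.
Qed.

Lemma ctr_rcons f h l x :
  ctr f h (rcons l x) = ctr f (fun s => h (rcons s x)) l + (-1) ^+ size l * (f x * h l).
Proof.
elim: l h => [|a l IH] h /=; first by rewrite expr0 mul1r subr0 add0r.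
by rewrite IH exprS; ring.
Qed.

Lemma bump_sum_ext h h' l : (forall s, size s = size l -> h s = h' s) -> bump_sum h l = bump_sum h' l.
Proof.
elim: l h h' => //= a l IH h h' hh; rewrite hh //; congr (_ + _).
by apply: IH => s e; apply: hh; rewrite /= e.
Qed.

Lemma bump_sum_sub c h h' l : bump_sum (fun s => c * h s - h' s) l = c * bump_sum h l - bump_sum h' l.
Proof.
elim: l h h' => [|a l IH] h h' /=; first by rewrite mulr0 subrr.
by rewrite (IH (fun s => h (a :: s)) (fun s => h' (a :: s))); ring.
Qed.

Lemma bump_sum_add h h' l : bump_sum (fun s => h s + h' s) l = bump_sum h l + bump_sum h' l.
Proof.
elim: l h h' => [|a l IH] h h' /=; first by rewrite addr0.
by rewrite (IH (fun s => h (a :: s)) (fun s => h' (a :: s))) addrACA.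
Qed.

(** The Leibniz rule: raising one entry at a time is a derivation of exterior products. *)
Lemma bump_sum_ctr f h l :
  bump_sum (ctr f h) l = ctr (fun a => f a.+1) h l + ctr f (bump_sum h) l.
Proof.
elim: l h => [|a l IH] h /=; first by rewrite addr0.
rewrite (bump_sum_sub (f a) h (ctr f (fun s => h (a :: s)))) IH.
have -> : ctr f (fun s => h (a.+1 :: s) + bump_sum (fun s0 => h (a :: s0)) s) l =
    ctr f (fun s => h (a.+1 :: s)) l + ctr f (bump_sum (fun s => h (a :: s))) l.
  exact: ctr_add.
ring.
Qed.

(** Alternation is asked only up to length N, so that it can be proved by induction on the
    length. *)
Definition altn N h := forall l1 x y l2, ((size l1 + size l2).+2 <= N)%N ->
  h (l1 ++ x :: y :: l2) = - h (l1 ++ y :: x :: l2).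

Lemma ctr_alt f N h : altn N h -> altn N.+1 (ctr f h).
Proof.
move=> + l1 x y l2; elim: l1 h N => [|a l1 IH] h N ha /= hs.
  have -> : ctr f (fun s => h [:: x, y & s]) l2 = - ctr f (fun s => h [:: y, x & s]) l2.
    by rewrite -ctr_opp; apply: ctr_ext => // s _ ss; apply: (ha [::]) => /=; lia.
  ring.
rewrite ha ?(IH (fun s => h (a :: s)) N.-1); try (simpl in *; lia).
  by ring.
by move=> k1 u v k2 hk; apply: (ha (a :: k1)) => /=; lia.
Qed.

Lemma altn_cons N h a : altn N.+1 h -> altn N (fun s => h (a :: s)).
Proof. by move=> ha k1 u v k2 hk; apply: (ha (a :: k1)) => /=; lia. Qed.

Definition alt h := forall N, altn N h.

Lemma alt_cons h a : alt h -> alt (fun s => h (a :: s)).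
Proof. by move=> ha N; apply: altn_cons. Qed.

Lemma alt_move h l1 x l2 l3 : alt h ->
  h (l1 ++ x :: l2 ++ l3) = (-1) ^+ size l2 * h (l1 ++ l2 ++ x :: l3).
Proof.
move=> ha; elim: l2 l1 => [|y l2 IH] l1 /=; first by rewrite mul1r.
rewrite (ha _ _ _ _ _ (leqnn _)) -[l1 ++ y :: x :: _]/(l1 ++ [:: y] ++ x :: _) catA IH -catA /= exprS.
ring.
Qed.

Lemma alt_dup h l1 x l2 l3 : (forall u : R, u *+ 2 = 0 -> u = 0) -> alt h ->
  h (l1 ++ x :: l2 ++ x :: l3) = 0.
Proof.
move=> tf ha; rewrite alt_move // [X in _ * X]tf ?mulr0 // mulr2n.
by rewrite catA [X in X + _](ha _ _ _ _ _ (leqnn _)) addNr.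
Qed.
End Contraction.

(** * Pfaffians of lists and the Pieri rule for Q-functions *)

Section Pfaffian.
Variables (R : comNzRingType) (q : nat -> R).

(* the values of [Q_(a,b)] for [(a,b) <> (0,0)], through
   [Q_(a,b+1) + Q_(a+1,b) = q_a q_(b+1) - q_(a+1) q_b] *)
Fixpoint wq (a b : nat) : R :=
  if b is b'.+1 then q a * q b - q a.+1 * q b' - wq a.+1 b' else if a is 0 then 0 else q a.

(** The Pfaffian by expansion along the first row, with k as fuel. *)
Fixpoint pfr k l : R := if k is k'.+1 then if l is a :: l' then ctr (wq a) (pfr k') l' else 1 else 1.
Definition pfs l := pfr (size l) l.

Lemma pfr_size k l : (size l <= k)%N -> pfr k l = pfs l.
Proof.
suff H k1 : forall k2 l, (size l <= k1)%N -> (size l <= k2)%N -> pfr k1 l = pfr k2 l.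
  by move=> h; apply: H.
elim: k1 => [|k1 IH] [|k2] [|a l'] //= h1 h2.
by apply: ctr_ext => // s _ ss; apply: IH; lia.
Qed.

Lemma pfs_cons a l : pfs (a :: l) = ctr (wq a) pfs l.
Proof.
rewrite {1}/pfs /=; apply: (@ctr_ext _ _ _ (pfr (size l))) => // s _ ss.
by apply: pfr_size; rewrite -ss.
Qed.

Lemma pfs_odd l : odd (size l) -> pfs l = 0.
Proof.
move: {2}(size l) (leqnn (size l)) => N; elim: N l => [|N IH] [|a l] //= h o.
rewrite pfs_cons -(ctr0 (wq a) l); apply: ctr_ext => // s _ ss; apply: IH; lia.
Qed.

Lemma pfs_sign l : (-1) ^+ size l * pfs l = pfs l.
Proof.
have [o|e] := boolP (odd (size l)); first by rewrite pfs_odd ?mulr0.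
by rewrite -signr_odd (negPf e) mul1r.
Qed.

(** Expansion along the last column. It follows from the one along the first row because
    contractions anticommute; the sign disappears since Pfaffians of odd length vanish. *)
Lemma pfs_rcons l x : pfs (rcons l x) = ctr (fun a => wq a x) pfs l.
Proof.
move: {2}(size l) (leqnn (size l)) => N; elim: N l => [|N IH] [|a l] //= h.
rewrite pfs_cons ctr_rcons.
have -> : ctr (fun b => wq b x) (fun s => pfs (a :: s)) l = - ctr (wq a) (ctr (fun b => wq b x) pfs) l.
  by rewrite -ctr_anti; apply: ctr_ext => // s _ _; rewrite pfs_cons.
rewrite opprK addrC mulrCA pfs_sign; congr (_ + _).
by apply: ctr_ext => // s _ ss; apply: IH; lia.
Qed.

(* for [l] of odd length the first summand vanishes and the second is the
   Pfaffian with a final [0] appended; for [l] of even length conversely *)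
Definition Qs l : R := pfs l + ctr q pfs l.

Lemma Qs_nil : Qs [::] = 1.
Proof. by rewrite /Qs /= addr0. Qed.

Hypothesis tf : forall u : R, u *+ 2 = 0 -> u = 0.
Hypothesis q0 : q 0 = 1.
(** Given [q0], this amounts to the vanishing of the alternating sum of q_p q_(n-p) for n > 0; it
    makes [wq] skew-symmetric. *)
Hypothesis wq0 : forall b, wq 0 b.+1 = - q b.+1.

Lemma wq_skew a b : wq a b = - wq b a.
Proof.
suff H : wq a b + wq b a = 0 by apply/eqP; rewrite -addr_eq0 H.
elim: b a => [|b IH] a; first by case: a => [|a]; rewrite ?wq0 /= ?addr0 // addrN.
have := IH a.+1; rewrite [wq b a.+1]/= [wq a b.+1]/= => e.
by rewrite -[RHS]oppr0 -e; ring.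
Qed.

Lemma pfs_alt : alt pfs.
Proof.
elim=> [|N IH] l1 x y l2 //= hs; case: l1 hs => [|a l1] /= hs; last first.
  by rewrite !pfs_cons (@ctr_alt _ (wq a) N) //; lia.
rewrite !pfs_cons /= wq_skew.
have E u v : ctr (wq u) (fun s => pfs (v :: s)) l2 = ctr (wq u) (ctr (wq v) pfs) l2.
  by apply: ctr_ext => // s _ _; rewrite pfs_cons.
by rewrite !E ctr_anti; ring.
Qed.

Lemma Qs_alt : alt Qs.
Proof.
move=> N l1 x y l2 h; have aN := pfs_alt; have a1 := aN N l1 x y l2 h; have a2 := ctr_alt q (aN N); rewrite /Qs a1 (a2 l1 x y l2) ?opprD //; lia.
Qed.

Lemma Qs_rcons0 l : all (fun a => 0 < a)%N l -> Qs (rcons l 0%N) = Qs l.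
Proof.
move=> /allP hl; rewrite /Qs pfs_rcons ctr_rcons q0 mul1r pfs_sign.
have E s : {subset s <= l} -> ctr (fun a => wq a 0) pfs s = ctr q pfs s.
  by move=> hs; apply: ctr_ext => // -[|a] // /hs/hl.
have Z : ctr q (fun s => pfs (rcons s 0%N)) l = 0.
  rewrite -(ctr_nil2 q pfs l); apply: ctr_ext => // s hs _.
  by rewrite pfs_rcons E.
by rewrite E // Z add0r addrC.
Qed.

(** The derivation sends the form with entries [wq a b] to the decomposable form q_a q_(b+1) -
    q_(a+1) q_b. Its exterior product with the Pfaffian is the right side. *)
Lemma bump_pfs l : bump_sum pfs l = - ctr (fun a => q a.+1) (ctr q pfs) l.
Proof.
move: {2}(size l) (leqnn (size l)) => N; elim: N l => [|N IH] [|a l] //= h; rewrite ?oppr0 //.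
rewrite pfs_cons (bump_sum_ext (h' := ctr (wq a) pfs)); last by move=> s _; rewrite pfs_cons.
rewrite bump_sum_ctr addrA.
have -> : ctr (wq a.+1) pfs l + ctr (fun b => wq a b.+1) pfs l =
    q a * ctr (fun b => q b.+1) pfs l - q a.+1 * ctr q pfs l.
  rewrite -ctr_addf -ctr_subf.
  by apply: ctr_ext => // b _; rewrite /=; ring.
have -> : ctr (wq a) (bump_sum pfs) l = - ctr (fun b => q b.+1) (ctr q (ctr (wq a) pfs)) l.
  rewrite (@ctr_ext _ _ (wq a) _ (fun s => - ctr (fun b => q b.+1) (ctr q pfs) s)) //; last first.
    by move=> s _ ss; apply: IH; lia.
  rewrite ctr_opp ctr_anti opprK -ctr_opp; apply: ctr_ext => // s _ _.
  by rewrite ctr_anti.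
rewrite (ctr_sub (q a) _ pfs (ctr q (fun s => pfs (a :: s)))).
have -> : ctr (fun b => q b.+1) (ctr q (fun s => pfs (a :: s))) l =
    ctr (fun b => q b.+1) (ctr q (ctr (wq a) pfs)) l.
  by apply: ctr_ext => // s _ _; apply: ctr_ext => // s' _ _; rewrite pfs_cons.
ring.
Qed.

(** The column of an appended part 1 has the entries q_1 q_a - 2 q_(a+1). The first summand produces
    the product with q_1, the second the sum over bumps. *)
Lemma Qs_pieri l : all (fun a => 0 < a)%N l ->
  q 1 * Qs l = bump_sum Qs l *+ 2 + Qs (rcons l 1%N).
Proof.
move=> /allP hl.
have w1 a : (0 < a)%N -> wq a 1 = q 1 * q a - 2%:R * q a.+1 by case: a => //= a _; rewrite q0; ring.
have W s : {subset s <= l} -> ctr (fun a => wq a 1) pfs s = q 1 * ctr q pfs s - 2%:R * ctr (fun a => q a.+1) pfs s.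
  by move=> hs; rewrite -ctr_subf; apply: ctr_ext => // a /hs/hl; exact: w1.
rewrite /Qs bump_sum_add bump_sum_ctr bump_pfs pfs_rcons ctr_rcons mulrCA pfs_sign.
rewrite W // (@ctr_ext _ q q (bump_sum pfs) (fun s => - ctr (fun a => q a.+1) (ctr q pfs) s)) //; last first.
  by move=> s _ _; rewrite bump_pfs.
have -> : ctr q (fun s => pfs (rcons s 1%N)) l =
    ctr q (fun s => q 1%N * ctr q pfs s - 2%:R * ctr (fun a => q a.+1) pfs s) l.
  by apply: ctr_ext => // s hs _; rewrite pfs_rcons W.
have A : ctr q (ctr (fun a => q a.+1) (ctr q pfs)) l = 0.
  rewrite ctr_anti -[RHS]oppr0 -(ctr0 (fun a => q a.+1) l); congr (- _).
  by apply: ctr_ext => // s _ _; exact: ctr_nil2.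
have B : ctr q (fun s => 2%:R * ctr (fun a => q a.+1) pfs s) l = 2%:R * ctr q (ctr (fun a => q a.+1) pfs) l.
  by rewrite -[RHS]addr0 -(ctr0 q l) -ctr_lin; apply: ctr_ext => // s _ _; rewrite addr0.
rewrite ctr_opp A (ctr_sub (q 1%N) q (ctr q pfs) (fun s => 2%:R * ctr (fun a => q a.+1) pfs s)) ctr_nil2 B.
rewrite (ctr_anti (fun a => q a.+1) q); ring.
Qed.
End Pfaffian.

(** * Branching: the effect of one more variable *)

Section Branch.
Variable R : comNzRingType.
Implicit Types (f : nat -> R) (h : seq nat -> R) (l s : seq nat).

(** The coefficients of (1 + X t)/(1 - X t), the factor that a new variable X contributes. *)
Definition cf (i : nat) : {poly R} := if i is 0 then 1 else 'X^i *+ 2.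

Definition br1 (g : nat -> {poly R}) a : {poly R} := \sum_(i < a.+1) cf i * g (a - i)%N.

Definition brf f a : {poly R} := br1 (fun x => (f x)%:P) a.

(** Every row loses boxes independently, so h is evaluated at arbitrary sequences; alternation takes
    care of those that are not strictly decreasing. *)
Fixpoint br h l : {poly R} :=
  if l is a :: l' then br1 (fun x => br (fun s => h (x :: s)) l') a else (h [::])%:P.

Lemma br1_ext g g' a : (forall x, (x <= a)%N -> g x = g' x) -> br1 g a = br1 g' a.
Proof. by move=> h; apply: eq_bigr => i _; rewrite h // leq_subr. Qed.

Lemma br1_lin c g g' a : br1 (fun x => c * g x - g' x) a = c * br1 g a - br1 g' a.
Proof.
rewrite /br1 mulr_sumr -sumrB; apply: eq_bigr => i _.
by rewrite mulrBr mulrCA.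
Qed.

Lemma br1S g a : br1 g a.+1 = br1 (fun x => g x.+1) a + cf a.+1 * g 0%N.
Proof.
rewrite /br1 big_ord_recr /= subnn; congr (_ + _); apply: eq_bigr => i _.
by rewrite subSn // -ltnS.
Qed.

Lemma br1_0 g : br1 g 0 = g 0%N.
Proof. by rewrite /br1 big_ord1 mul1r. Qed.

Lemma br_ext h h' l : (forall s, size s = size l -> h s = h' s) -> br h l = br h' l.
Proof.
elim: l h h' => [|a l IH] h h' hh /=; first by rewrite hh.
by apply: br1_ext => x _; apply: IH => s ss; apply: hh; rewrite /= ss.
Qed.

Lemma br_lin c h h' l : br (fun s => c * h s - h' s) l = c%:P * br h l - br h' l.
Proof.
elim: l h h' => [|a l IH] h h' /=; first by rewrite rmorphB rmorphM.
by rewrite -br1_lin; apply: br1_ext => x _; rewrite (IH (fun s => h (x :: s))).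
Qed.

Lemma br0 l : br (fun=> 0) l = 0.
Proof. elim: l => //= a l IH; rewrite IH /br1; apply: big1 => i _; exact: mulr0. Qed.

Lemma br_add h h' l : br (fun s => h s + h' s) l = br h l + br h' l.
Proof.
elim: l h h' => [|a l IH] h h' /=; first by rewrite rmorphD.
rewrite /br1 -big_split /=; apply: eq_bigr => i _.
by rewrite -mulrDr (IH (fun s => h (_ :: s))).
Qed.

Lemma ctr_br1 (F : nat -> nat -> {poly R}) H a l :
  ctr (fun b => br1 (F^~ b) a) H l = br1 (fun x => ctr (F x) H l) a.
Proof.
elim: l H => [|b l IH] H /=; first by rewrite /br1 big1 // => i _; rewrite mulr0.
rewrite IH /br1 mulr_suml -sumrB; apply: eq_bigr => i _; ring.
Qed.

Lemma ctr_br1h f (G : nat -> seq nat -> {poly R}) a l :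
  ctr (brf f) (fun s => br1 (G^~ s) a) l = br1 (fun x => ctr (brf f) (G x) l) a.
Proof.
elim: l G => [|b l IH] G /=; first by rewrite /br1 big1 // => i _; rewrite mulr0.
rewrite (IH (fun x s => G x (b :: s))) /br1 mulr_sumr -sumrB; apply: eq_bigr => i _; ring.
Qed.

Lemma br_ctr f h l : ctr (brf f) (br h) l = br (ctr f h) l.
Proof.
elim: l h => [|a l IH] h /=; first by [].
rewrite (ctr_br1h f (fun x s => br (fun s => h (x :: s)) s)) /brf.
rewrite /br1 mulr_suml -sumrB; apply: eq_bigr => i _.
rewrite -/(brf f) IH (br_lin (f (a - i)%N) h (ctr f (fun s => h ((a - i)%N :: s)))); ring.
Qed.

Lemma br_eq0 h l : (forall s, size s = size l -> h s = 0) -> br h l = 0.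
Proof. by move=> hh; rewrite (br_ext (h' := fun=> 0)) ?br0. Qed.

Hypothesis tf : forall u : R, u *+ 2 = 0 -> u = 0.

Lemma tfp (u : {poly R}) : u *+ 2 = 0 -> u = 0.
Proof. by move=> e; apply/polyP => i; rewrite coef0; apply: tf; rewrite -coefMn e coef0. Qed.

(** Exchanging the amounts taken from two equal rows changes the sign of each term. *)
Lemma br_dup h b l : alt h -> br h [:: b, b & l] = 0.
Proof.
move=> ha; apply: tfp; rewrite mulr2n /= /br1.
under eq_bigr do rewrite mulr_sumr; rewrite [X in X + _]exchange_big -big_split /=.
apply: big1 => i _; rewrite -big_split /=; apply: big1 => j _.
have -> : br (fun s => h [:: (b - j)%N, (b - i)%N & s]) l = - br (fun s => h [:: (b - i)%N, (b - j)%N & s]) l.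
  rewrite -[RHS]add0r -[X in X + _](mul0r (br (fun=> 0) l)) -(polyC0 R) -br_lin.
  by apply: br_ext => s _; rewrite mul0r sub0r; apply: (ha _ [::] _ _ _ (leqnn _)).
ring.
Qed.

(* the generic row [a] may be cleared against the row [b] below it *)
Lemma br_clear h a b l : (b < a)%N -> alt h -> br h [:: a, b & l] =
  \sum_(i < a - b) cf i * br (fun s => h ((a - i)%N :: s)) (b :: l) +
  'X^(a - b) * br (fun s => h (b :: s)) (b :: l).
Proof.
move=> lt ha; set G := fun x => br (fun s => h (x :: s)) (b :: l).
have D : br1 G b = 0 by exact: br_dup.
change (br1 G a = \sum_(i < a - b) cf i * G (a - i)%N + 'X^(a - b) * G b).
clearbody G; rewrite {1}/br1.
have -> : a.+1 = ((a - b) + b.+1)%N by lia.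
rewrite big_split_ord /=; congr (_ + _).
have cfp i : cf (a - b + i) = 'X^(a - b + i) *+ 2.
  by case E: (a - b)%N => [|k]; [lia | rewrite addSn].
transitivity ('X^(a - b) * (G b + br1 G b)); last by rewrite D addr0.
rewrite /br1 [in RHS]big_ord_recl [in LHS]big_ord_recl /= subn0 cfp addn0 mul1r.
have -> : (a - (a - b))%N = b by lia.
rewrite addrA -mulr2n mulrDr big_distrr /=. rewrite mulrnAl mulrnAr; congr (_ + _).
apply: eq_bigr => i _; rewrite /= /bump /= cfp.
have -> : (a - (a - b + (1 + i)))%N = (b - (1 + i))%N by lia.
by rewrite exprD add1n mulrnAl mulrnAl mulrnAr mulrA.
Qed.

(** Once each row is cleared against the next, degree a is reached only if every row shrinks to the
    length of the following one and the last to 0. The factor 2 is that of [cf] in the last row. *)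
Lemma br_lead h a l : sorted gtn (a :: l) -> all (fun x => 0 < x)%N (a :: l) -> alt h ->
  (size (br h (a :: l)) <= a.+1)%N /\ (br h (a :: l))`_a = h (rcons l 0%N) *+ 2.
Proof.
have szc i (p : {poly R}) n : (size p <= n)%N -> (size (cf i * p)%R <= i + n)%N.
  case: i => [|i] hp /=; first by rewrite mul1r.
  rewrite mulrnAl -scaler_nat; apply: leq_trans (size_scale_leq _ _) _ => //.
  rewrite mulrC; apply: leq_trans (size_polyMleq _ _) _; rewrite size_polyXn; lia.
elim: l a h => [|b l IH] a h.
  move=> _ /= /andP[a0 _] ha; split.
    apply: (big_ind (fun p : {poly R} => size p <= a.+1)%N); first by rewrite size_poly0.
      by move=> p r hp hr; apply: leq_trans (size_polyD _ _) _; rewrite geq_max hp.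
    move=> i _; apply: leq_trans (szc i _ 1%N _) _; [exact: size_polyC_leq1 | have := ltn_ord i; lia].
  rewrite /br1 big_ord_recr /= coefD coef_sum big1 ?add0r; last first.
    move=> i _; rewrite nth_default //; apply: leq_trans (szc i _ 1%N _) _; [exact: size_polyC_leq1 | have := ltn_ord i; lia].
  rewrite subnn; case: a a0 => //= a _.
  by rewrite mulrnAl coefMn mulrC coefCM coefXn eqxx mulr1.
move=> /andP[lt hs] /andP[a0 /andP[b0 hp]] ha.
have B x := IH b (fun s => h (x :: s)) hs ltac:(by rewrite /= b0) (alt_cons x ha).
rewrite br_clear // ; split.
  apply: leq_trans (size_polyD _ _) _; rewrite geq_max; apply/andP; split.
    apply: (big_ind (fun p : {poly R} => size p <= a.+1)%N); first by rewrite size_poly0.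
      by move=> p r hp' hr; apply: leq_trans (size_polyD _ _) _; rewrite geq_max hp'.
    by move=> i _; apply: leq_trans (szc i _ _ (B _).1) _; have := ltn_ord i; lia.
  rewrite mulrC; apply: leq_trans (size_polyMleq _ _) _; rewrite size_polyXn; have := (B b).1; lia.
rewrite coefD coef_sum big1 ?add0r; last first.
  by move=> i _; rewrite nth_default //; apply: leq_trans (szc i _ _ (B _).1) _; have := ltn_ord i; lia.
by rewrite coefXnM; case: ltnP => [|_]; [lia | rewrite subKn ?(B b).2 //; lia].
Qed.
End Branch.

(** * Q-functions under branching: vanishing and independence *)

Section Step.
Variables (R : comNzRingType) (q : nat -> R) (q' : nat -> {poly R}).
Hypothesis tf : forall u : R, u *+ 2 = 0 -> u = 0.
Hypothesis q0 : q 0 = 1.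
Hypothesis wq0 : forall b, wq q 0 b.+1 = - q b.+1.
Hypothesis qE : forall a, q' a = brf q a.

Let E2 a b := br1 (fun x => brf (wq q x) b) a.

Let corr (a b : nat) : {poly R} :=
  match a, b with S _, 0 => cf R a | 0, S _ => - cf R b | _, _ => 0 end.

(** The double branching of [wq] satisfies the recursion of [wq] up to boundary terms, which [corr]
    collects. They vanish for positive indices, so Pfaffians of positive parts branch row by row. *)
Lemma wq_corr a b : wq q' a b = E2 a b + corr a b.
Proof.
elim: b a => [|b IH] a.
  have -> : E2 a 0 = br1 (fun x => (wq q x 0)%:P) a by apply: br1_ext => x _; rewrite /brf br1_0.
  case: a => [|a]; first by rewrite br1_0 addr0.
  rewrite [wq _ _ _]/= qE /brf !br1S /= q0 mulr0 mulr1 addr0; congr (_ + _).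
have E00 : q' 0%N = 1 by rewrite qE /brf br1_0 q0.
rewrite [LHS]/= IH !qE.
have A x : brf (wq q x) b.+1 = br1 (fun y => (wq q x y.+1)%:P) b + cf R b.+1 * (wq q x 0)%:P by rewrite /brf br1S.
have -> : E2 a.+1 b = br1 (fun x => brf (wq q x.+1) b) a + cf R a.+1 * brf (wq q 0%N) b by rewrite /E2 br1S.
have -> : E2 a b.+1 = br1 (fun x => br1 (fun y => (wq q x y.+1)%:P) b) a + cf R b.+1 * br1 (fun x => (wq q x 0)%:P) a.
  rewrite /E2 {1}/br1 /br1 mulr_sumr -big_split /=; apply: eq_bigr => i _.
  by rewrite A mulrDr; congr (_ + _); exact: mulrCA.
have -> : br1 (fun x => (wq q x 0)%:P) a = brf q a - cf R a.
  case: a {IH} => [|a]; first by rewrite /brf !br1_0 q0 subrr.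
  by rewrite /brf !br1S /= q0 mulr0 addr0 mulr1 addrK.
have -> : brf (wq q 0) b = - brf q b + cf R b.
  have N c : br1 (fun x => - (q x.+1)%:P) c = - br1 (fun x => (q x.+1)%:P) c.
    by rewrite /br1 -sumrN; apply: eq_bigr => i _; rewrite mulrN.
  case: b {IH A} => [|b]; first by rewrite /brf !br1_0 q0 addNr.
  rewrite /brf !br1S q0 mulr1 opprD subrK [wq q 0 0]/= mulr0 addr0 -N.
  by apply: br1_ext => x _; rewrite wq0 rmorphN.
have -> : br1 (fun x => br1 (fun y => (wq q x y.+1)%:P) b) a =
    br1 (fun x => (q x)%:P) a * br1 (fun y => (q y.+1)%:P) b -
    br1 (fun x => (q x.+1)%:P) a * br1 (fun y => (q y)%:P) b -
    br1 (fun x => brf (wq q x.+1) b) a.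
  rewrite /brf /br1 !mulr_suml -!sumrB; apply: eq_bigr => i _.
  rewrite -!mulrA -!mulrBr; congr (_ * _); rewrite !mulr_sumr -!sumrB; apply: eq_bigr => j _.
  by rewrite /= !rmorphB !rmorphM; ring.
have -> : br1 (fun x => (q x.+1)%:P) a = brf q a.+1 - cf R a.+1 by rewrite /brf br1S q0 mulr1 addrK.
have -> : br1 (fun x => (q x.+1)%:P) b = brf q b.+1 - cf R b.+1 by rewrite /brf br1S q0 mulr1 addrK.
rewrite -/(brf q a) -/(brf q b).
have X n : cf R n.+1 = 'X^(n.+1) *+ 2 by [].
case: a {IH} => [|a]; case: b {A} => [|b]; rewrite /corr !X ?[cf R 0]/=; try ring.
all: rewrite !exprS; ring.
Qed.

Lemma wq_step0 b : wq q' 0 b.+1 = - q' b.+1.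
Proof.
have N : br1 (fun x => (wq q 0 x.+1)%:P) b = - br1 (fun x => (q x.+1)%:P) b.
  by rewrite /br1 -sumrN; apply: eq_bigr => i _; rewrite wq0 rmorphN mulrN.
rewrite wq_corr /E2 br1_0 qE /brf !br1S q0 mulr1 [wq q 0 0]/= mulr0 addr0 N.
by rewrite [RHS]opprD.
Qed.

Lemma pfs_step l : all (fun a => 0 < a)%N l -> pfs q' l = br (pfs q) l.
Proof.
move: {2}(size l) (leqnn (size l)) => N; elim: N l => [|N IH] [|a l] //= h /andP[a0 /allP hl].
rewrite pfs_cons (@ctr_ext _ _ (fun b => br1 (fun x => brf (wq q x) b) a) _ (br (pfs q))); last first.
- by move=> s hs ss; apply: IH; [lia | apply/allP => x /hs/hl].
- by move=> b /hl b0; rewrite wq_corr /corr; case: a a0 {h} b b0 => // a _ [|b] // _; rewrite addr0.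
rewrite (ctr_br1 (fun x => brf (wq q x))); apply: br1_ext => x _.
by rewrite br_ctr; apply: br_ext => s _; rewrite pfs_cons.
Qed.

Lemma Qs_step l : all (fun a => 0 < a)%N l -> Qs q' l = br (Qs q) l.
Proof.
move=> hl; rewrite /Qs br_add pfs_step //; congr (_ + _).
rewrite -br_ctr; apply: ctr_ext => // s hs _; apply: pfs_step.
by apply/allP => x /hs; move/allP: hl => /[apply].
Qed.

(** A term of the branching without zeros vanishes by hypothesis. A single zero is moved to the end
    and dropped, which leaves a list that is still too long; two zeros cancel by alternation. *)
Lemma Qs_vanish n : (forall l, all (fun a => 0 < a)%N l -> (n < size l)%N -> Qs q l = 0) ->
  forall l, all (fun a => 0 < a)%N l -> (n.+1 < size l)%N -> Qs q' l = 0.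
Proof.
move=> hv l hl hs; rewrite Qs_step //; apply: br_eq0 => s ss.
have aQ := Qs_alt wq0.
have [hp|] := boolP (all (fun a => 0 < a)%N s); first by apply: hv => //; lia.
rewrite -has_predC => /hasP[x xs /= x0]; have {x0} ex : x = 0%N by lia.
rewrite ex in xs; case/splitPr: xs ss => l1 l2 ss.
have [hin|hout] := boolP (0%N \in l1 ++ l2); last first.
  have A : all (fun a => 0 < a)%N (l1 ++ l2) by apply/allP => y hy; case: y hy hout => // ->.
  have B : (n < size (l1 ++ l2))%N by move: ss; rewrite !size_cat /=; lia.
  by rewrite -[l2]cats0 (alt_move _ _ _ _ aQ) catA cats1 Qs_rcons0 // hv ?mulr0.
move: hin ss; rewrite mem_cat => /orP[] /splitPr[l3 l4] _.
  by rewrite -catA; apply: (alt_dup l3 0%N l4 l2 tf aQ).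
exact: (alt_dup l1 0%N l3 l4 tf aQ).
Qed.
End Step.

Lemma polyn_tf n (u : polyn n) : u *+ 2 = 0 -> u = 0.
Proof. by move/eqP; rewrite polyn_mulrn_eq0 => /eqP. Qed.

Lemma br1_stepX (R : comNzRingType) (g : nat -> {poly R}) D :
  br1 g D.+1 = g D.+1 + 'X * g D + 'X * br1 g D.
Proof.
rewrite /br1 big_ord_recl /= mul1r subn0 -addrA; congr (_ + _).
rewrite mulr_sumr [LHS]big_ord_recl [in RHS]big_ord_recl /= addrA; congr (_ + _).
  by rewrite mul1r subSS subn0 expr1 mulrnAl mulr2n.
apply: eq_bigr => i _; rewrite /bump /= !add1n !subSS. by rewrite [RHS]mulrA mulrnAr -exprS.
Qed.

Lemma qn_brf n a : qn n.+1 a = brf (qn n) a.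
Proof.
elim: a => [|a IH]; first by rewrite /brf br1_0 !qn0.
by rewrite qnS IH /brf br1_stepX.
Qed.

Lemma qn_wq0 n b : wq (qn n) 0 b.+1 = - qn n b.+1.
Proof.
elim: n b => [|n IH] b; last first.
  by apply: (wq_step0 (q := qn n)) => //; [exact: qn0|exact: qn_brf].
have z : forall a b, wq (qn 0) a.+1 b = 0.
  by move=> a {}b; elim: b a => [|b IHb] a //=; rewrite IHb !mul0r !subrr.
have z0 c : qn 0 c.+1 = 0 by [].
have -> : wq (qn 0) 0 b.+1 = qn 0 0 * qn 0 b.+1 - qn 0 1 * qn 0 b - wq (qn 0) 1 b by [].
by rewrite z !z0 mulr0 mul0r !subr0 oppr0.
Qed.

Definition QQ n l : polyn n := Qs (qn n) l.

Lemma strict_all l : strict_partition l -> all (fun a => 0 < a)%N l. Proof. by case/andP. Qed.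

Lemma QQ_vanish n l : all (fun a => 0 < a)%N l -> (n < size l)%N -> QQ n l = 0.
Proof.
elim: n l => [|n IH] l hl hs; last first.
  by apply: (Qs_vanish (@polyn_tf n) (qn0 n) (@qn_wq0 n) (@qn_brf n) IH hl).
have w0 a b : wq (qn 0) a.+1 b = 0 by elim: b a => [|b IHb] a //=; rewrite IHb !mul0r !subrr.
case: l hl hs => [|[|a] l] // /andP[_ hl] _; rewrite /QQ /Qs pfs_cons.
have c0 f h s : {in s, forall x, f x = 0} -> ctr f h s = 0 :> polyn 0.
  by move=> hf; rewrite -(ctr0f h s); apply: ctr_ext.
rewrite c0 => [|x _]; last exact: w0.
rewrite c0 ?addr0 // => x; rewrite in_cons => /orP[/eqP -> //|/(allP hl)].
by case: x.
Qed.

Lemma QQ_lead n a l : strict_partition (a :: l) ->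
  (size (QQ n.+1 (a :: l) : {poly polyn n}) <= a.+1)%N /\ (QQ n.+1 (a :: l) : {poly polyn n})`_a = QQ n l *+ 2.
Proof.
move=> /andP[hs hp]; have E : QQ n.+1 (a :: l) = br (Qs (qn n)) (a :: l).
  by apply: (Qs_step (qn0 n) (@qn_wq0 n) (@qn_brf n)).
have [h1 h2] := br_lead (@polyn_tf n) hs hp (Qs_alt (@qn_wq0 n)).
rewrite E h2 /QQ; split=> //; rewrite Qs_rcons0 //; first exact: qn0.
by case/andP: hp.
Qed.

Lemma polyn_one_intz n (c : int) : (1 : polyn n) *~ c = 0 -> c = 0.
Proof.
case: c => [[|k]|k] //; rewrite ?NegzE ?mulrNz => /eqP; rewrite ?oppr_eq0 -pmulrn polyn_mulrn_eq0.
  by rewrite oner_eq0.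
by rewrite oner_eq0.
Qed.

Lemma coef_intz (R : idomainType) (S : seq (seq nat)) (F : seq nat -> {poly R}) (c : seq nat -> int) K :
  \sum_(l <- S) F l *~ c l = 0 -> \sum_(l <- S) (F l)`_K *~ c l = 0.
Proof.
move/(congr1 (fun p : {poly R} => p`_K)); rewrite coef0 coef_sum => h; rewrite -[RHS]h.
by apply: eq_bigr => l _; rewrite coefMrz.
Qed.

Lemma mulrz2 (V : zmodType) (x : V) (m : int) : x *~ m *+ 2 = x *+ 2 *~ m.
Proof. by rewrite !pmulrn mulrzAC. Qed.

(** Double induction, on the number of variables and on a bound for the first parts. By [QQ_lead]
    the coefficient at the top degree isolates the partitions with largest first part and removes
    that part together with one variable. *)
Lemma QQ_free r (S : seq (seq nat)) (c : seq nat -> int) : uniq S ->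
  (forall l, l \in S -> strict_partition l /\ (size l <= r)%N) ->
  \sum_(l <- S) QQ r l *~ c l = 0 -> forall l, l \in S -> c l = 0.
Proof.
elim: r S c => [|r IH] S c uS hS.
  move=> e l lS; have hn k : k \in S -> k = [::] by move/hS => -[_]; case: k.
  move: e; rewrite (bigD1_seq l) //= big1_seq ?addr0 => [|k /andP[/eqP n kS]].
    by rewrite (hn l lS) /QQ Qs_nil => /(@polyn_one_intz 0).
  by case: n; rewrite (hn k kS) (hn l lS).
suff H K : forall S, uniq S -> (forall l, l \in S -> strict_partition l /\ (size l <= r.+1)%N) ->
    (forall l, l \in S -> head 0%N l <= K)%N ->
    \sum_(l <- S) QQ r.+1 l *~ c l = 0 -> forall l, l \in S -> c l = 0.
  move=> e; apply: (H (\max_(l <- S) head 0%N l)%N) => // l lS.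
  by rewrite (big_rem l) //= leq_maxl.
elim: K => [|K IHK] {uS hS}S uS hS hK e.
  have hn k : k \in S -> k = [::].
    move=> kS; have := hK k kS; have [/andP[_ hp] _] := hS k kS.
    by case: (k) hp => //= a k' /andP[a0 _]; lia.
  move=> l lS; move: e; rewrite (bigD1_seq l) //= big1_seq ?addr0 => [|k /andP[/eqP n kS]].
    by rewrite (hn l lS) /QQ Qs_nil => /(@polyn_one_intz r.+1).
  by case: n; rewrite (hn k kS) (hn l lS).
pose S1 := [seq l <- S | head 0%N l == K.+1].
have inS1 l : l \in S1 -> exists2 l', l = K.+1 :: l' & l \in S.
  by rewrite mem_filter => /andP[]; case: l => // a l' /eqP /= -> h; exists l'.
have c1 l : l \in S1 -> c l = 0.
  move=> lS; have [l' el _] := inS1 l lS.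
  have := IH [seq behead l | l <- S1] (fun k => c (K.+1 :: k)).
  rewrite el; apply.
  - rewrite map_inj_in_uniq ?filter_uniq // => u v /inS1[u' -> _] /inS1[v' -> _] /= -> //.
  - move=> k /mapP[u /inS1[u' -> /hS[/andP[h1 h2] h3]] ->] /=; split; last exact: h3.
    by apply/andP; split; [apply: path_sorted h1 | case/andP: h2].
  - rewrite big_map; apply: polyn_tf.
    have := @coef_intz (polyn r) S (QQ r.+1) c K.+1 e => h1; rewrite -[RHS]h1.
    rewrite -sumrMnl [RHS](bigID (fun l => head 0%N l == K.+1)) /= [X in _ = _ + X]big1_seq ?addr0.
      rewrite -[RHS]big_filter; apply: eq_big_seq => u /inS1[u' -> /hS[hu _]] /=.
      by rewrite mulrz2; congr (_ *~ _); rewrite (QQ_lead _ hu).2.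
    move=> u /andP[n uS'].
    suff h : (QQ r.+1 u : {poly polyn r})`_K.+1 = 0 by rewrite [X in X *~ _]h mul0rz.
    have := hK u uS'; have [hu _] := hS u uS'; case: (u) n hu => [|a u'] /= n hu ha.
      by rewrite /QQ Qs_nil coef1.
    by rewrite nth_default //; apply: leq_trans (QQ_lead _ hu).1 _; rewrite ltn_neqAle n.
  by apply/mapP; exists l => //; rewrite el.
move=> l lS; have [h|h] := boolP (head 0%N l == K.+1); first by apply: c1; rewrite mem_filter h.
apply: (IHK [seq l <- S | head 0%N l != K.+1]); rewrite ?filter_uniq ?mem_filter ?h //.
- by move=> k; rewrite mem_filter => /andP[_]; exact: hS.
- by move=> k; rewrite mem_filter => /andP[n /hK]; lia.
have := e; rewrite (bigID (fun l => head 0%N l == K.+1)) /= [X in X + _ = _]big1_seq; last first.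
  by move=> k /andP[hk kS]; rewrite c1 ?mulr0z // mem_filter hk.
by rewrite add0r -big_filter => h1; exact: h1.
Qed.

End QFunctions.

(** * Comparison of Grassmannian involutions with Q-functions *)

Section ArcProducts.
Local Open Scope Z_scope.

Lemma base_even sp c x : Z.even c -> (c <= x <-> c <= base sp x).
Proof.
move=> ec; have H y : c <= y -> c <= base sp y.
  move=> hy; rewrite /base; case: (sp) => //; rewrite /Theta; case Ex : (Z.even y); first by lia.
  by have [e|n] := Z.eqb_spec y c; [rewrite e ec in Ex | lia].
by split=> [/H//|/H]; rewrite baseK.
Qed.

(** One arc for each entry of mu, side by side right of c, with the base pattern on the remaining
    points; S consists of the ends of these arcs. [bl_next] says that deleting S leaves disjoint
    arcs, which gives the row bound. *)
Record blocks (sp : bool) (mu : seq nat) (c : Z) (z : Z -> Z) (S : seq Z) : Prop := Blocks {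
  bl_fin : fin sp z;
  bl_rside : rside sp c z;
  bl_size : size S = (2 * size mu)%N;
  bl_uniq : uniq S;
  bl_ge : forall x, x \in S -> c <= x;
  bl_mv : forall x, x \in S -> z x \in S /\ z x <> x;
  bl_mv' : forall x, x \notin S -> z x \notin S;
  bl_next : forall x u, x \notin S -> x < u < z x -> u \in S;
  bl_fix : forall x, x \notin S -> if sp then z x <> x else z x = x;
  bl_Fn : forall n, (Fn sp n z *+ 2 ^ size mu = \prod_(d <- mu) qn n d)%R }.

Lemma blocks_ex sp mu c : Z.even c -> all (fun d => 0 < d)%N mu -> exists z S, blocks sp mu c z S.
Proof.
elim: mu c => [|[|D] mu IH] c ec //= hmu.
  exists (base sp), [::]; split=> //.
  - by exists 0%N; split=> //; exact: baseK.
  - split=> //; first exact: baseK.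
    by move=> x hx; have := (base_even sp x ec).2; lia.
  - by move=> x u _; rewrite /base; have := Theta_cases x; case: (sp); lia.
  - by move=> x _; rewrite /base; have := Theta_cases x; case: (sp); lia.
  move=> n; rewrite big_nil expn0 mulr1n (@FnE sp n _ 1) //; first exact: Fs_base.
  by split=> //; exact: baseK.
(* The next cut [c'] is even, so that [Theta] respects it, and far enough right of b that the
   inserted arc does not affect the points beyond. *)
set b := c + gap sp + Z.of_nat D; set c' := c + 2 * Z.of_nat D + 6.
have ec' : Z.even c' by rewrite /c' !Z.even_add ec Z.even_mul.
have [w [S bw]] := IH c' ec' hmu.
have gp : 1 <= gap sp <= 2 by rewrite /gap; case: (sp).
have cb : c < b /\ b + 3 <= c' by rewrite /b /c'; lia.
set A := ar sp c b; have AK : inv A by apply: ar_inv; lia.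
have Ain x : x <> c -> x <> b -> A x = unrk c b (base sp (rk c b x)) by move=> h1 h2; rewrite /A /ar !eqbF.
have [Ac Ab] : A c = b /\ A b = c by rewrite /A /ar !Z.eqb_refl eqbF //; lia.
have Ahi x : c' <= x -> A x = base sp x.
  move=> hx; rewrite Ain; try lia.
  have -> : rk c b x = x - 2 by rewrite /rk; repeat zcase; lia.
  have -> : base sp (x - 2) = base sp x - 2 by rewrite /base; case: (sp) => //; rewrite /Theta Z.even_sub /=; case: (Z.even x) => /=; lia.
  have := (base_even sp x ec').1 hx; rewrite /unrk; repeat zcase; lia.
have Alo x : x < c -> A x = base sp x.
  move=> hx; rewrite Ain; try lia.
  have -> : rk c b x = x by rewrite /rk; repeat zcase; lia.
  have := (base_even sp x ec).2; rewrite /unrk; repeat zcase; lia.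
have Acut : cut A c'.
  move=> x hx; have [//|h] := Z.lt_ge_cases (A x) c'.
  have := Ahi _ h; rewrite AK => e; have := (base_even sp (A x) ec').1; lia.
have Acut2 : cut A c.
  by move=> x hx; rewrite Alo //; have := (base_even sp x ec).2; lia.
have fA : fin sp A by apply: ar_fin; lia.
have lA : lside sp c' A by split.
have [rw rc rb] := bl_rside bw.
have Sge := bl_ge bw.
have Sno x : x < c' -> x \notin S by move=> h; apply/negP => /Sge; lia.
pose z := jn c' A w; have zlo x : x < c' -> z x = A x by move=> h; rewrite /z /jn; zcase; lia.
have zhi x : c' <= x -> z x = w x by move=> h; rewrite /z /jn; zcase; lia.
have inS x : (x \in [:: c, b & S]) = [|| x =? c, x =? b | x \in S] by rewrite !in_cons -!eqZE.
have nS x : x \notin [:: c, b & S] <-> [/\ x <> c, x <> b & x \notin S].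
  rewrite inS !negb_or; split; first by case/and3P=> /Z.eqb_spec ? /Z.eqb_spec.
  by case=> h1 h2 ->; rewrite !eqbF.
have An x : x <> c -> x <> b -> [/\ A x <> c, A x <> b & rk c b (A x) = base sp (rk c b x)].
  move=> h1 h2; rewrite Ain //; have [e [n1 n2]] := @unrkK c b (base sp (rk c b x)) cb.1; by [].
have rkm u v : u < v -> u <> c -> v <> b -> v <> c -> u <> b -> rk c b u < rk c b v by rewrite /rk; repeat zcase; lia.
exists z, [:: c, b & S]; split.
- by apply: fin_jn => //; [exact: bl_fin bw].
- have hh x : x < c -> z x = base sp x by move=> hx; rewrite zlo ?Alo //; lia.
  split=> //; last by move=> x hx; rewrite hh //; have := (base_even sp x ec).2; lia.
  move=> x; have [h|h] := Z.lt_ge_cases x c'; first by rewrite (zlo x) // zlo ?AK //; exact: Acut.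
  by rewrite (zhi x) // zhi ?rw //; exact: cut_ge rw rc h.
- by rewrite /= (bl_size bw); lia.
- rewrite cons_uniq cons_uniq (bl_uniq bw) andbT inE negb_or !Sno ?andbT; try lia.
  by rewrite eqZE; apply/negP => /Z.eqb_spec; lia.
- by move=> x; rewrite inS => /or3P[/Z.eqb_spec|/Z.eqb_spec|/Sge]; lia.
- move=> x; rewrite inS => /or3P[/Z.eqb_spec ->|/Z.eqb_spec ->|hx].
  + by rewrite zlo ?Ac ?inS ?Z.eqb_refl ?orbT; lia.
  + by rewrite zlo ?Ab ?inS ?Z.eqb_refl ?orbT; lia.
  by have [h1 h2] := bl_mv bw hx; rewrite zhi ?inS ?h1 ?orbT //; exact: Sge.
- move=> x /nS[h1 h2 h3]; apply/nS; have [h|h] := Z.lt_ge_cases x c'.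
    by rewrite zlo //; have [k1 k2 _] := An x h1 h2; split=> //; apply: Sno; exact: Acut.
  have hw := cut_ge rw rc h; rewrite zhi //; split; [lia|lia|exact: (bl_mv' bw)].
- move=> x u /nS[h1 h2 h3] hu; rewrite inS; have [h|h] := Z.lt_ge_cases x c'; last first.
    by rewrite zhi // in hu; rewrite (bl_next bw h3 hu) !orbT.
  rewrite zlo // in hu; have [k1 k2 k3] := An x h1 h2.
  case: (Z.eqb_spec u c) => // n1; case: (Z.eqb_spec u b) => // n2; exfalso.
  have l1 := @rkm x u ltac:(lia) h1 n2 n1 h2; have l2 := @rkm u (A x) ltac:(lia) n1 k2 k1 n2.
  rewrite k3 in l2; have := base_cases sp (rk c b x); lia.
- move=> x /nS[h1 h2 h3]; have [h|h] := Z.lt_ge_cases x c'; last by rewrite zhi //; exact: (bl_fix bw).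
  rewrite zlo //; have [k1 k2 k3] := An x h1 h2; case E : (sp).
    by move=> e; rewrite e in k3; have := base_cases sp (rk c b x); rewrite E in k3 *; lia.
  by rewrite Ain // E /base rkK //; lia.
move=> n; rewrite (Fn_mul n fA (bl_fin bw) lA (bl_rside bw)) big_cons /= expnS.
have /= r := @Fn_row sp n c b D erefl; rewrite -/A in r.
by rewrite -(bl_Fn bw) -r mulrnA mulrnAr mulrnAl.
Qed.

(** The recursion applied to side-by-side arcs. There are [size mu] of them and deleting them leaves
    disjoint arcs, so their number bounds the rows in both cases. *)
Lemma prod_expand sp mu : all (fun d => 0 < d)%N mu -> exists ls : seq (seq nat),
  [/\ all strict_partition ls, all (fun l => size l <= size mu)%N ls &
  forall n, (\prod_(d <- mu) qn n d = \sum_(l <- ls) fam sp l n *+ 2 ^ (if sp then size mu else size l))%R].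
Proof.
move=> hmu; have [z [S bz]] := @blocks_ex sp mu 0 isT hmu.
have [zK zc zb] := bl_rside bz.
have fp : sp -> forall x, z x <> x.
  move=> hs x; have [xS|nS] := boolP (x \in S); first by case: (bl_mv bz xS).
  by have := bl_fix bz nS; rewrite hs.
have pz : prefix sp z.
  rewrite /prefix; case E : (sp) zb => zb.
    move=> e u h1 h2 h3; exfalso; have he : e < 0 by lia.
    by have := zb e he; rewrite /base; have := Theta_cases e; lia.
  by move=> e he; rewrite zb // /base; lia.
have [ls [sls bls els]] := tree (bl_fin bz) fp pz; exists ls.
have narcS : sp = false -> narc z = size mu.
  move=> E; rewrite (@narcE z S); first by rewrite (bl_size bz); lia.
  split; first exact: bl_uniq bz.
  move=> x; have [xS|nS] := boolP (x \in S); first by have [_ /eqP ->] := bl_mv bz xS.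
  by have := bl_fix bz nS; rewrite E => ->; rewrite eqxx.
split=> //.
  apply: bls; rewrite /bound; case E : (sp); last by rewrite narcS.
  exists (fun x => x \notin S); split; first split.
  - by move=> x; exact: (bl_mv' bz).
  - by move=> x u h1 h2; rewrite (bl_next bz h1 h2).
  exists S; split; last by apply/ssrnat.leP; rewrite -[length S]/(size S) (bl_size bz).
  by move=> x /negbFE h; apply/InE.
move=> n; rewrite -(bl_Fn bz) /arcw /sizew in els *; have := els n; case E : (sp) => h.
  rewrite expn0 mulr1n in h; rewrite h -sumrMnl; apply: eq_bigr => l _.
  by rewrite ?expn0 ?mulr1n.
by rewrite -h narcS.
Qed.

End ArcProducts.

(** * Identification of f_l with the Q-functions *)

Section Comparison.
Local Open Scope ring_scope.

Definition comb (V : zmodType) (F : seq nat -> V) (L : seq (seq nat * int)) : V :=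
  \sum_(p <- L) F p.1 *~ p.2.

Section Lc.
Implicit Types (P : seq nat -> Prop) (F : forall n, seq nat -> polyn n) (X Y : forall n, polyn n).

(** Integer combinations whose coefficients do not depend on the number n of variables; this
    uniformity carries a relation from r variables to all n. *)
Definition lc P F X := exists L : seq (seq nat * int),
  (forall p, p \in L -> P p.1) /\ forall n, X n = comb (F n) L.

Lemma lc_ext P F X Y : (forall n, X n = Y n) -> lc P F X -> lc P F Y.
Proof. by move=> e [L [h1 h2]]; exists L; split=> // n; rewrite -e. Qed.

Lemma lc0 P F : lc P F (fun n => 0).
Proof. by exists [::]; split=> // n; rewrite /comb big_nil. Qed.

Lemma lc_gen P F l : P l -> lc P F (fun n => F n l).
Proof.
move=> h; exists [:: (l, 1)]; split=> [p|n]; first by rewrite inE => /eqP ->.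
by rewrite /comb big_seq1.
Qed.

Lemma lc_add P F X Y : lc P F X -> lc P F Y -> lc P F (fun n => X n + Y n).
Proof.
move=> [L [h1 h2]] [K [k1 k2]]; exists (L ++ K); split=> [p|n].
  by rewrite mem_cat => /orP[/h1|/k1].
by rewrite h2 k2 /comb big_cat.
Qed.

Lemma lc_mulz P F X (c : int) : lc P F X -> lc P F (fun n => X n *~ c).
Proof.
move=> [L [h1 h2]]; exists [seq (p.1, p.2 * c) | p <- L]; split=> [p|n].
  by case/mapP=> p' /h1 h ->.
rewrite h2 /comb big_map mulrz_suml; by apply: eq_bigr => p _; rewrite mulrzA.
Qed.

Lemma lc_sub P F X Y : lc P F X -> lc P F Y -> lc P F (fun n => X n - Y n).
Proof.
move=> hX hY; apply: lc_ext (lc_add hX (lc_mulz (-1) hY)) => n.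
by rewrite mulrN1z.
Qed.

Lemma lc_bind P P' F F' X : (forall l, P l -> lc P' F' (fun n => F n l)) -> lc P F X -> lc P' F' X.
Proof.
move=> h [L [h1 h2]]; apply: lc_ext (fun n => esym (h2 n)) _.
elim: L h1 {h2} => [|p L IH] h1; first by apply: lc_ext (lc0 P' F') => n; rewrite /comb big_nil.
have hL q : q \in L -> P q.1 by move=> hq; apply: h1; rewrite in_cons hq orbT.
by apply: lc_ext (lc_add (lc_mulz p.2 (h p.1 (h1 p (mem_head _ _)))) (IH hL)) => n; rewrite /comb big_cons.
Qed.
End Lc.

Definition qprod n (l : seq nat) : polyn n := \prod_(d <- l) qn n d.
Definition Pr r (l : seq nat) : Prop := all (fun d => 0 < d)%N l /\ (size l <= r)%N.
Definition inprod r := lc (Pr r) qprod.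

Lemma inprod_mul r s X Y : inprod r X -> inprod s Y -> inprod (r + s) (fun n => X n * Y n).
Proof.
move=> hX [K [k1 k2]]; apply: (@lc_ext _ _ (fun n => \sum_(p <- K) (X n * qprod n p.1) *~ p.2)).
  by move=> n; rewrite k2 /comb mulr_sumr; apply: eq_bigr => p _; rewrite mulrzAr.
elim: K k1 {k2} => [|p K IH] k1; first by apply: lc_ext (lc0 _ _) => n; rewrite big_nil.
apply: (@lc_ext _ _ (fun n => (X n * qprod n p.1) *~ p.2 + \sum_(p <- K) (X n * qprod n p.1) *~ p.2)).
  by move=> n; rewrite big_cons.
apply: lc_add; last by apply: IH => q hq; apply: k1; rewrite in_cons hq orbT.
apply: lc_mulz; have [hp1 hp2] := k1 p (mem_head _ _).
case: hX => L [h1 h2]; exists [seq (q.1 ++ p.1, q.2) | q <- L]; split.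
  move=> q /mapP[q' /h1[h3 h4] ->] /=; split; first by rewrite all_cat h3.
  by rewrite size_cat leq_add.
move=> n; rewrite h2 /comb big_map mulr_suml; apply: eq_bigr => q _.
by rewrite /= /qprod big_cat /= mulrzAl.
Qed.

Lemma inprod_le r s X : (r <= s)%N -> inprod r X -> inprod s X.
Proof. by move=> h; apply: lc_bind => l [h1 h2]; apply: lc_gen; split=> //; apply: leq_trans h. Qed.

Lemma inprod_q a : inprod 1 (fun n => qn n a).
Proof.
case: a => [|a].
  have := lc_gen qprod (P := Pr 1) (l := [::]) => h; apply: lc_ext (h _) => // n.
  by rewrite /qprod big_nil qn0.
have := lc_gen qprod (P := Pr 1) (l := [:: a.+1]) => h; apply: lc_ext (h _) => // n.
by rewrite /qprod big_seq1.
Qed.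

Lemma inprod_wq a b : inprod 2 (fun n => wq (qn n) a b).
Proof.
elim: b a => [|b IH] [|a] /=; try exact: lc0.
- by apply: (@inprod_le 1) => //; exact: inprod_q.
- by apply: lc_sub (IH _); apply: lc_sub; apply: (@inprod_mul 1 1); exact: inprod_q.
- by apply: lc_sub (IH _); apply: lc_sub; apply: (@inprod_mul 1 1); exact: inprod_q.
Qed.

Lemma inprod_ctr r s (f : forall n, nat -> polyn n) (h : forall n, seq nat -> polyn n) l :
  (forall a, inprod r (fun n => f n a)) ->
  (forall k, (size k).+1 = size l -> inprod s (fun n => h n k)) ->
  inprod (r + s) (fun n => ctr (f n) (h n) l).
Proof.
move=> hf; elim: l h => [|a l IH] h hh /=; first exact: lc0.
apply: lc_sub; first by apply: inprod_mul => //; apply: hh.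
by apply: (IH (fun n k => h n (a :: k))) => k e; apply: hh; rewrite /= e.
Qed.

(** The entries [wq] are at most quadratic in the q's, so the number of factors does not exceed the
    length of the list. *)
Lemma inprod_pfs l : inprod (size l) (fun n => pfs (qn n) l).
Proof.
move: {2}(size l) (leqnn (size l)) => N; elim: N l => [|N IH] [|a l] //= hN.
- have := lc_gen qprod (P := Pr 0) (l := [::]) => h; apply: lc_ext (h _) => // n.
  by rewrite /qprod big_nil.
- have := lc_gen qprod (P := Pr 0) (l := [::]) => h; apply: lc_ext (h _) => // n.
  by rewrite /qprod big_nil.
apply: (@lc_ext _ _ (fun n => ctr (wq (qn n) a) (pfs (qn n)) l)) => [n|]; first by rewrite pfs_cons.
case: l hN => [|b l] hN; first exact: lc0.
have -> : size (b :: l) = (1 + size l)%N by [].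
apply: (@inprod_ctr 2 (size l)) => [c|k [e]]; first exact: inprod_wq.
by rewrite -e; apply: IH; rewrite /= in hN; lia.
Qed.

Lemma inprod_QQ l : inprod (size l) (fun n => QQ n l).
Proof.
apply: lc_add; first exact: inprod_pfs.
case: l => [|b l]; first exact: lc0.
apply: (@inprod_ctr 1 (size l)) => [c|k [e]]; first exact: inprod_q.
by rewrite -e; exact: inprod_pfs.
Qed.

Definition St r (l : seq nat) : Prop := strict_partition l /\ (size l <= r)%N.
Definition inspan sp r := lc (St r) (fun n l => fam sp l n).

Lemma inprod_inspan sp r X : inprod r X -> inspan sp r X.
Proof.
apply: lc_bind => mu [m1 m2]; have [ls [h1 h2 h3]] := prod_expand sp m1.
exists [seq (l, (2 ^ (if sp then size mu else size l))%N%:Z) | l <- ls]; split.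
  by move=> p /mapP[l hl ->]; split; [exact: (allP h1) | apply: leq_trans m2; exact: (allP h2)].
by move=> n; rewrite /comb big_map /qprod h3; apply: eq_bigr => l _; rewrite -pmulrn.
Qed.

(** Independence in r variables kills the collected coefficients themselves, so the same combination
    of any other family is zero. *)
Lemma free_comb r (L : seq (seq nat * int)) (V : zmodType) (F : seq nat -> V) :
  (forall p, p \in L -> St r p.1) -> comb (QQ r) L = 0 -> comb F L = 0.
Proof.
move=> hL; pose U := undup (map fst L); pose c l : int := \sum_(p <- L | p.1 == l) p.2.
have E (W : zmodType) (G : seq nat -> W) : comb G L = \sum_(l <- U) G l *~ c l.
  rewrite /comb /c; transitivity (\sum_(p <- L) \sum_(l <- U | p.1 == l) G l *~ p.2).
    apply: eq_big_seq => p pL; rewrite -big_filter (@perm_big _ _ _ _ _ [:: p.1]) ?big_seq1 //.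
    apply: uniq_perm; rewrite ?filter_uniq ?undup_uniq // => l; rewrite mem_filter inE mem_undup eq_sym.
    by case: eqP => //= ->; apply/mapP; exists p.
  rewrite (exchange_big_dep xpredT) //=; apply: eq_bigr => l _.
  by elim: (L) => [|p K IH]; rewrite ?big_nil ?mulr0z // !big_cons; case: ifP => _; rewrite ?mulrzDr ?IH.
rewrite !E => /QQ_free h; rewrite big1_seq // => l /andP[_ lU]; rewrite h ?mulr0z ?undup_uniq //.
by move=> k; rewrite mem_undup => /mapP[p /hL h1 ->].
Qed.

(** Rows weighted by their position. A box added to the last row raises the moment more than a box
    added to any earlier row; this orders the induction in [fam_QQ]. *)
Fixpoint mom i (l : seq nat) : nat := if l is a :: l' then (i * a + mom i.+1 l')%N else 0%N.

Lemma mom_bump i l j : (j < size l)%N -> mom i (bump_part l j) = (mom i l + i + j)%N.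
Proof.
elim: l i j => //= a l IH i [|j] hj; first by rewrite /bump_part /=; lia.
by rewrite -[bump_part (a :: l) j.+1]/(a :: bump_part l j) /= IH //; lia.
Qed.

Lemma bump_sumE (R : comNzRingType) (h : seq nat -> R) l :
  bump_sum h l = \sum_(j <- iota 0 (size l)) h (bump_part l j).
Proof.
elim: l h => [|a l IH] h /=; first by rewrite big_nil.
rewrite big_cons IH -[1%N]/(1 + 0)%N iotaDl big_map; congr (_ + _).
Qed.

Lemma alt_uniq n h l : alt (R := polyn n) h -> ~~ uniq l -> h l = 0.
Proof.
move=> ha; suff H : forall l1, ~~ uniq l -> h (l1 ++ l) = 0 by exact: (H [::]).
elim: l => //= a l IH l1; rewrite negb_and negbK => /orP[|/(IH (rcons l1 a))]; last by rewrite cat_rcons.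
by case/splitPr=> l2 l3; exact: (alt_dup l1 a l2 l3 (@polyn_tf n) ha).
Qed.

Lemma QQ_bump n k j : strict_partition k -> (j < size k)%N -> ~~ strict_partition (bump_part k j) ->
  QQ n (bump_part k j) = 0.
Proof.
move=> sk hj; rewrite strict_bump // negbK => /(nthP 0%N)[i hi e].
apply: (alt_uniq (Qs_alt (@qn_wq0 n))); apply/negP => u.
have sb : size (bump_part k j) = size k by rewrite size_set_nth; lia.
have ij : (i == j) = false by apply/eqP => e2; move: e; rewrite e2 => /n_Sn.
have := nth_uniq 0%N (i := i) (j := j) _ _ u; rewrite sb => /(_ hi hj).
by rewrite !nth_set_nth /= ij eqxx e eqxx.
Qed.

Definition pierieq n (h : seq nat -> polyn n) k : Prop :=
  h k * qn n 1 = (\sum_(j <- iota 0 (size k) | strict_partition (bump_part k j)) h (bump_part k j)) *+ 2 +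
     (if strict_partition (rcons k 1%N) then h (rcons k 1%N) else 0).

Lemma QQ_pieri n k : strict_partition k -> pierieq (QQ n) k.
Proof.
move=> sk; rewrite /pierieq mulrC (Qs_pieri (qn0 n) (strict_all sk)) bump_sumE.
congr (_ *+ 2 + _).
  rewrite [RHS]big_mkcond; apply: eq_big_seq => j; rewrite mem_iota => /andP[_ hj].
  by case: ifP => // /negbT h; exact: QQ_bump.
case: ifP => // /negbT; rewrite strict_rcons1 // negbK => h.
apply: (alt_uniq (Qs_alt (@qn_wq0 n))).
by rewrite rcons_uniq h.
Qed.

Definition Ff sp n l : polyn n := fam sp l n *+ 2 ^ size l.

Lemma Ff_pieri sp n k : strict_partition k -> pierieq (Ff sp n) k.
Proof.
move=> sk; have [z g] := grass_ex sp sk; rewrite /pierieq /Ff mulrnAl (fam_pieri n sk g).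
rewrite -mulrnA mulnC mulrnA mulrnDl mulrnDl; congr (_ + _).
  congr (_ *+ 2); rewrite -sumrMnl [RHS]big_mkcond /=.
  apply: eq_big_seq => j; rewrite mem_iota => /andP[_ hj].
  by case: ifP => _; rewrite ?mul0rn // size_set_nth; congr (_ *+ 2 ^ _); lia.
by case: ifP => _; rewrite ?mul0rn // size_rcons expnSr mulrnA.
Qed.

Theorem fam_QQ sp l n : strict_partition l -> QQ n l = fam sp l n *+ 2 ^ size l.
Proof.
pose Df n l := QQ n l - Ff sp n l.
have Dp m k : strict_partition k -> pierieq (Df m) k.
  move=> sk; rewrite /pierieq /Df mulrBl QQ_pieri // Ff_pieri // sumrB mulrnBl.
  by case: ifP => _; rewrite ?addr0 // opprD addrACA.
suff H r : forall l, strict_partition l -> (size l <= r)%N -> forall n, Df n l = 0.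
  by move=> sl; apply/eqP; rewrite -subr_eq0; apply/eqP; exact: (H (size l)).
elim: r => [|r IH] {}l sl hl {}n.
  by case: l hl sl => // _ _; rewrite /Df /Ff fam_nil /QQ Qs_nil subrr.
have [|hr] := leqP (size l) r; first by move=> h; apply: IH.
(* In exactly [r.+1] variables, by induction on the moment. In the Pieri rule for the partition
   without its last box only one unknown term remains: a bump of an earlier row has smaller moment,
   and a row beyond [r.+1] vanishes. *)
have St1 k : strict_partition k -> (size k <= r.+1)%N -> Df r.+1 k = 0.
  move: {2}(mom 1 k) (leqnn (mom 1 k)) => N; elim: N k => [|N IHN] k.
    by case: k => [|[|a] k] //; [move=> _ sk _; apply: IH | move=> _ /andP[_]].
  case/lastP: k => [|k x] hN sk hk; first by apply: IH.
  have [|hr'] := leqP (size (rcons k x)) r; first by move=> h; apply: IH.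
  rewrite size_rcons in hk hr'.
  have [[ex sk']|[y [ex sk' e]]] := last_box sk.
    have := Dp r.+1 k sk'; rewrite /pierieq -ex sk IH // mul0r big1_seq ?mul0rn ?add0r // => j /andP[hs].
    by rewrite mem_iota => /andP[_ hj]; apply: IH => //; rewrite size_set_nth; lia.
  have sx : size (rcons k y) = r.+1 by rewrite size_rcons; lia.
  have hy : (size k < size (rcons k y))%N by rewrite size_rcons.
  have me := mom_bump 1 hy; rewrite e in me.
  have := Dp r.+1 _ sk'; rewrite /pierieq IHN ?sx //; last by lia.
  rewrite mul0r.
  have -> : (if strict_partition (rcons (rcons k y) 1%N) then Df r.+1 (rcons (rcons k y) 1%N) else 0) = 0.
    case: ifP => // h; rewrite /Df /Ff QQ_vanish ?fam_vanish ?mul0rn ?subrr ?size_rcons ?sx //; first exact: strict_all.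
  have -> : iota 0 r.+1 = iota 0 (size k) ++ [:: size k] by rewrite -sx size_rcons -addn1 iotaD.
  rewrite addr0 big_cat /= big_cons big_nil e sk addr0 big1_seq ?add0r; last first.
    move=> j /andP[hs]; rewrite mem_iota => /andP[_ hj].
    have hj' : (j < size (rcons k y))%N by rewrite size_rcons; lia.
    apply: IHN => //; last by rewrite size_set_nth sx; lia.
    by rewrite mom_bump //; lia.
  by move=> /esym h; apply: (@polyn_tf r.+1); move: h; rewrite ?add0r ?addr0.
(* In every number of variables the difference is the same integer combination of the [fam] with at
   most [r.+1] rows. *)
have sp1 : inspan sp r.+1 (fun n => Df n l).
  apply: lc_sub; first by apply: inprod_inspan; apply: inprod_le hl _; exact: inprod_QQ.
  apply: (@lc_ext _ _ (fun n => fam sp l n *~ (2 ^ size l)%N%:Z)) => [m|]; first by rewrite -pmulrn.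
  by apply: lc_mulz; apply: (lc_gen (fun n l => fam sp l n)).
case: sp1 => L [hL eL].
(* After multiplication by [2 ^ r.+1] the combination can be written in terms of [Ff] with integer
   coefficients. *)
pose L' := [seq (p.1, p.2 * (2 ^ (r.+1 - size p.1))%N%:Z) | p <- L].
have hL' p : p \in L' -> St r.+1 p.1 by case/mapP=> q /hL h ->.
have E m : comb (Ff sp m) L' = Df m l *+ 2 ^ r.+1.
  rewrite eL /comb big_map -sumrMnl; apply: eq_big_seq => p /hL[_ hp].
  rewrite /Ff /= !pmulrn -!mulrzA; congr (_ *~ _).
  by rewrite mulrCA -PoszM -expnD subnKC.
(* In [r.+1] variables [Ff] agrees with [QQ] and the combination is zero by [St1]. Independence
   makes its coefficients vanish, hence also its value in n variables. *)
have Z : comb (Ff sp n) L' = 0.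
  apply: (@free_comb r.+1) => //; rewrite -[RHS](mul0rn _ (2 ^ r.+1)) -[X in X *+ _](St1 l sl hl) -E.
  apply: eq_big_seq => p /hL'[h1 h2]; congr (_ *~ _).
  by apply/eqP; rewrite -subr_eq0; apply/eqP; exact: St1.
move: Z; rewrite E => /eqP; have : (0 < 2 ^ r.+1)%N by rewrite expn_gt0.
by case: (2 ^ r.+1)%N => // m _; rewrite polyn_mulrn_eq0 => /eqP.
Qed.

End Comparison.

(** * From power series to finitely many variables *)

Section PowerSeries.
Local Open Scope ring_scope.

(** * The Pfaffian over matchings, expanded along its first row *)

Section PfaffianRow.
Variables (R : comNzRingType) (k : nat).

Lemma lift0_even (i : 'I_k) : lift ord0 (lift ord0 (even_slot i)) = even_slot (lift ord0 i) :> 'I_(k.+1.*2).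
Proof. by apply/val_inj. Qed.

Lemma lift0_odd (i : 'I_k) : lift ord0 (lift ord0 (odd_slot i)) = odd_slot (lift ord0 i) :> 'I_(k.+1.*2).
Proof. by apply/val_inj. Qed.

(** The permutations whose first block is {0, j+1}, with s arranging the other points. The sign is
    that of s times (-1)^j. *)
Definition row_perm1 (j : 'I_(k.*2.+1)) (s : 'S_(k.*2)) : 'S_(k.+1.*2) :=
  lift_perm ord0 ord0 (lift_perm ord0 j s).

Let e0 : even_slot (ord0 : 'I_k.+1) = ord0 :> 'I_(k.+1.*2). Proof. exact/val_inj. Qed.
Let o0 : odd_slot (ord0 : 'I_k.+1) = lift ord0 ord0 :> 'I_(k.+1.*2). Proof. exact/val_inj. Qed.

Lemma row_perm1_even j s (i : 'I_k) :
  row_perm1 j s (even_slot (lift ord0 i)) = lift ord0 (lift j (s (even_slot i))).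
Proof. by rewrite -lift0_even /row_perm1 !lift_perm_lift. Qed.

Lemma row_perm1_odd j s (i : 'I_k) :
  row_perm1 j s (odd_slot (lift ord0 i)) = lift ord0 (lift j (s (odd_slot i))).
Proof. by rewrite -lift0_odd /row_perm1 !lift_perm_lift. Qed.

Lemma row_perm1_0 j s : row_perm1 j s (even_slot ord0) = ord0.
Proof. by rewrite e0 /row_perm1 lift_perm_id. Qed.

Lemma row_perm1_1 j s : row_perm1 j s (odd_slot ord0) = lift ord0 j.
Proof. by rewrite o0 /row_perm1 lift_perm_lift lift_perm_id. Qed.

Lemma lift_lt n (h : 'I_n.+1) (x y : 'I_n) : (lift h x < lift h y)%N = (x < y)%N.
Proof. by rewrite /= /bump; do 2!case: leqP => /= ?; apply/idP/idP; lia. Qed.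

Lemma matching_row j s : is_matching (k := k.+1) (row_perm1 j s) = is_matching s.
Proof.
rewrite /is_matching; congr (_ && _).
  apply/forallP/forallP => h i.
    by have := h (lift ord0 i); rewrite row_perm1_even row_perm1_odd !lift_lt.
  have [->|[i' ->]] : i = ord0 \/ exists i', i = lift ord0 i'.
    by case: (unliftP ord0 i) => [i' ->|->]; [right; exists i'|left].
  - by rewrite row_perm1_0 row_perm1_1.
  by rewrite row_perm1_even row_perm1_odd !lift_lt.
apply/forallP/forallP => h i; apply/forallP => i2; apply/implyP => lt.
  have := h (lift ord0 i) => /forallP/(_ (lift ord0 i2))/implyP.
  by rewrite !row_perm1_even !lift_lt; apply.
case: (unliftP ord0 i2) lt => [i2' ->|->] //.
case: (unliftP ord0 i) => [i' ->|->]; last by rewrite row_perm1_0 row_perm1_even.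
rewrite !row_perm1_even !lift_lt => lt.
by have := h i' => /forallP/(_ i2')/implyP; apply.
Qed.

Lemma matching_0 (s : 'S_(k.+1.*2)) : is_matching (k := k.+1) s -> s ord0 = ord0.
Proof.
move=> /andP[/forallP h1 /forallP h2]; set x := (s^-1 ord0)%g.
have sx : s x = ord0 by rewrite /x permKV.
have inc (i : 'I_k.+1) : (s (even_slot ord0) <= s (even_slot i))%N.
  case: (unliftP ord0 i) => [i' ->|-> //].
  by apply: ltnW; have /forallP/(_ (lift ord0 i'))/implyP := h2 ord0; apply.
have hx : (x./2 < k.+1)%N by have := ltn_ord x; rewrite ltn_half_double.
pose i := Ordinal hx; have Ex := odd_double_half x.
suff : (s (even_slot ord0) <= s x)%N by rewrite sx leqn0 e0 => /eqP h; apply/val_inj.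
apply: leq_trans (inc i) _; case: (boolP (odd x)) => ox.
  have -> : x = odd_slot i by apply/val_inj; rewrite /= -[LHS]Ex ox.
  exact: ltnW.
by have -> : x = even_slot i by apply/val_inj; rewrite /= -[LHS]Ex (negPf ox).
Qed.

Lemma row_permP (s : 'S_(k.+1.*2)) : s ord0 = ord0 -> exists p, s = row_perm1 p.1 p.2.
Proof.
have lp n (t : 'S_n.+1) (j : 'I_n.+1) : t ord0 = j -> exists t' : 'S_n, t = lift_perm ord0 j t'.
  move=> tj; pose f (x : 'I_n) := odflt x (unlift j (t (lift ord0 x))).
  have h x : t (lift ord0 x) = lift j (f x).
    rewrite /f; case: (unliftP j (t (lift ord0 x))) => [y -> //|e].
    by exfalso; have /perm_inj/eqP := etrans e (esym tj); rewrite eq_sym (negPf (neq_lift _ _)).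
  have inj : injective f.
    by move=> x y e; apply: (@lift_inj _ ord0); apply: (@perm_inj _ t); rewrite !h e.
  exists (perm inj); apply/permP => x; case: (unliftP ord0 x) => [y ->|->].
    by rewrite lift_perm_lift permE h.
  by rewrite lift_perm_id.
move=> s0; have [t ->] := lp _ _ _ s0; have [t' ->] := lp _ t _ erefl.
by exists (t ord0, t').
Qed.

Lemma row_perm1_inj : injective (fun p => row_perm1 p.1 p.2).
Proof.
move=> [j s] [j' s'] /= e; have ej : j = j'.
  by have := congr1 (fun t : 'S_(k.+1.*2) => t (odd_slot ord0)) e; rewrite !row_perm1_1 => /lift_inj.
rewrite ej in e *; congr (_, _); apply/permP => x.
have := congr1 (fun t : 'S_(k.+1.*2) => t (lift ord0 (lift ord0 x))) e.
by rewrite /row_perm1 !lift_perm_lift => /lift_inj/lift_inj.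
Qed.

Lemma pfaffian_row (A : 'M[R]_(k.+1.*2)) :
  pfaffian A = \sum_(j < k.*2.+1) (-1) ^+ j * A ord0 (lift ord0 j) *
    pfaffian (k := k) (\matrix_(a, b) A (lift ord0 (lift j a)) (lift ord0 (lift j b))).
Proof.
rewrite {1}/pfaffian.
transitivity (\sum_(p : 'I_(k.*2.+1) * 'S_(k.*2) | is_matching p.2)
  (-1) ^+ (row_perm1 p.1 p.2) * \prod_(i < k.+1) A (row_perm1 p.1 p.2 (even_slot i)) (row_perm1 p.1 p.2 (odd_slot i))).
  rewrite (reindex_onto (fun p => row_perm1 p.1 p.2)
    (fun s => odflt (ord0, 1%g) [pick p | row_perm1 p.1 p.2 == s])) /=; last first.
    move=> s /matching_0/row_permP[p ->]; case: pickP => [p' /eqP -> //|/(_ p)].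
    by rewrite eqxx.
  apply: eq_bigl => p; rewrite matching_row andbC.
  case: pickP => [p' /eqP/row_perm1_inj -> |/(_ p)]; last by rewrite eqxx.
  by rewrite eqxx.
rewrite -(pair_big_dep xpredT (fun _ s => is_matching s) (fun j s =>
  (-1) ^+ (row_perm1 j s) * \prod_(i < k.+1) A (row_perm1 j s (even_slot i)) (row_perm1 j s (odd_slot i)))) /=.
apply: eq_bigr => j _; rewrite /pfaffian mulr_sumr; apply: eq_bigr => s _.
rewrite big_ord_recl row_perm1_0 row_perm1_1 /row_perm1 !odd_lift_perm /= ?addFb ?addbF signr_addb.
rewrite signr_odd mulrACA; congr (_ * (_ * _)).
by apply: eq_bigr => i _; rewrite !mxE -/(row_perm1 j s) row_perm1_even row_perm1_odd.
Qed.
End PfaffianRow.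

Section PfaffianList.
Variable R : comNzRingType.

Definition drop_nth (l : seq nat) j := take j l ++ drop j.+1 l.

Lemma ctr_sum (f : nat -> R) h l :
  ctr f h l = \sum_(j < size l) (-1) ^+ j * f (nth 0%N l j) * h (drop_nth l j).
Proof.
elim: l h => [|a l IH] h /=; first by rewrite big_ord0.
rewrite big_ord_recl /= mul1r /drop_nth /= drop0 IH; congr (_ + _).
rewrite -sumrN; apply: eq_bigr => j _; rewrite /bump /= add1n exprS; ring.
Qed.

Lemma nth_drop_nth l (j : 'I_(size l)) n (e : size l = n.+1) (a : 'I_n) :
  nth 0%N (drop_nth l j) a = nth 0%N l (lift (cast_ord e j) a).
Proof.
rewrite /drop_nth nth_cat size_take ltn_ord /= /bump.
by case: ltnP => h; [rewrite nth_take // ?leqNgt ?h | rewrite nth_drop ?h; congr nth; rewrite /=; lia].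
Qed.

Lemma pfaffian_pfs (q : nat -> R) k l : size l = k.*2 ->
  pfaffian (\matrix_(i < k.*2, j < k.*2) wq q (nth 0%N l i) (nth 0%N l j)) = pfs q l.
Proof.
elim: k l => [|k IH] l sl.
  rewrite (size0nil sl) /pfs /= /pfaffian (big_pred1 1%g) ?big_ord0 ?mulr1 ?odd_perm1 // => s.
  transitivity true; last by apply/esym/eqP/permP => -[].
  by apply/andP; split; apply/forallP => -[].
case: l sl => // a l [sl]; rewrite pfaffian_row pfs_cons ctr_sum.
have e : size l = k.*2.+1 by [].
rewrite (reindex (cast_ord e)) /=; last by exists (cast_ord (esym e)) => j _; rewrite ?cast_ordK ?cast_ordKV.
apply: eq_bigr => j _; rewrite !mxE /=; congr (_ * _).
have sd : size (drop_nth l j) = k.*2 by rewrite /drop_nth size_cat size_take size_drop ltn_ord; have := ltn_ord j; lia.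
rewrite -(IH (drop_nth l j) sd); congr pfaffian; apply/matrixP => x y; rewrite !mxE.
by rewrite !(@nth_drop_nth l j _ e).
Qed.

Lemma wqE (q : nat -> R) a b : q 0%N = 1 -> (a != 0)%N || (b != 0)%N ->
  wq q a b = q a * q b + (\sum_(1 <= p < b.+1) (-1) ^+ p * q (a + p)%N * q (b - p)%N) *+ 2.
Proof.
move=> q0; elim: b a => [|b IH] a.
  by rewrite big_nil mul0rn addr0 q0 mulr1; case: a.
move=> _; rewrite /= IH // [in RHS]big_ltn // [in RHS]big_add1 /=.
have -> : \sum_(1 <= i < b.+1) (-1) ^+ i.+1 * q (a + i.+1)%N * q (b.+1 - i.+1)%N =
    - \sum_(1 <= i < b.+1) (-1) ^+ i * q (a.+1 + i)%N * q (b - i)%N.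
  by rewrite -sumrN; apply: eq_bigr => i _; rewrite exprS !mulNr !mul1r subSS addSnnS.
by rewrite addn1 subn1 expr1 /=; ring.
Qed.
End PfaffianList.

(* the coefficient of the monomial with exponent [nth 0 e j] on [x_(-j-1)] *)
Fixpoint cfn n : polyn n -> seq nat -> rat :=
  if n is n'.+1 return polyn n -> seq nat -> rat then
    fun p e => if e is k :: e' then cfn (p : {poly polyn n'})`_k e' else 0
  else fun p _ => p.

Lemma cfnD n (p q : polyn n) e : cfn (p + q) e = cfn p e + cfn q e.
Proof. by elim: n p q e => //= n IH p q [|k e]; rewrite ?addr0 // -IH -coefD. Qed.

Lemma cfn0 n e : cfn (0 : polyn n) e = 0.
Proof. by elim: n e => //= n IH [|k e] //; rewrite coef0 IH. Qed.

Lemma cfnN n (p : polyn n) e : cfn (- p) e = - cfn p e.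
Proof. by apply/eqP; rewrite -addr_eq0 -cfnD addNr cfn0. Qed.

Lemma cfn_sum n (I : Type) (r : seq I) P (F : I -> polyn n) e :
  cfn (\sum_(i <- r | P i) F i) e = \sum_(i <- r | P i) cfn (F i) e.
Proof. by apply: (big_morph (fun p : polyn n => cfn p e)) => [p q|]; [exact: cfnD | exact: cfn0]. Qed.

Lemma cfnMn n (p : polyn n) e k : cfn (p *+ k) e = cfn p e *+ k.
Proof. by elim: k => [|k IH]; rewrite ?mulr0n ?cfn0 // !mulrS cfnD IH. Qed.

(** * Monomials as exponent vectors, and restriction to finitely many variables *)

Definition vj (j : nat) : var := exist (fun i : int => i < 0) (Negz j) isT.

Lemma vj_inj : injective vj. Proof. by move=> i j /(congr1 val) /= []. Qed.

Lemma var_surj (x : var) : exists j, x = vj j.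
Proof. by case: x => -[i|j] h //; exists j; apply/val_inj. Qed.

Fixpoint mons j (e : seq nat) : seq var :=
  if e is k :: e' then nseq k (vj j) ++ mons j.+1 e' else [::].

Definition mon e : monomial := seq_mset (mons 0 e).

Lemma count_mons j e i : count_mem (vj i) (mons j e) = if (j <= i)%N then nth 0%N e (i - j) else 0%N.
Proof.
elim: e j => [|k e IH] j /=; first by rewrite nth_nil if_same.
rewrite count_cat count_nseq IH /= (inj_eq vj_inj).
case: (ltngtP j i) => [lt|gt|->]; rewrite ?mul0n ?add0n //; last by rewrite mul1n subnn addn0.
by have -> : (i - j = (i - j.+1).+1)%N by lia.
Qed.

Lemma mon_nth e i : mon e (vj i) = nth 0%N e i.
Proof. by rewrite mset_seqE count_mons subn0. Qed.

Lemma mon_eq (a : monomial) e : (forall i, a (vj i) = nth 0%N e i) -> a = mon e.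
Proof. by move=> h; apply/msetP => x; have [j ->] := var_surj x; rewrite h mon_nth. Qed.

Lemma mon_inj e e' : size e = size e' -> mon e = mon e' -> e = e'.
Proof. by move=> s h; apply: (@eq_from_nth _ 0%N) => // i _; rewrite -!mon_nth h. Qed.

Lemma mon_surj (m : monomial) : exists e, m = mon e.
Proof.
pose N := (\max_(x <- enum_mset m) absz (val x)).+1.
exists (mkseq (fun j => m (vj j)) N); apply: mon_eq => i.
have [lt|le] := ltnP i N; first by rewrite nth_mkseq.
rewrite nth_default ?size_mkseq //; apply/eqP; rewrite mset_eq0.
apply/negP => h; have : (absz (val (vj i)) <= \max_(x <- enum_mset m) absz (val x))%N.
  by rewrite (big_rem (vj i)) //= leq_maxl.
by rewrite /N /= in le *; lia.
Qed.

Lemma size_mons j e : size (mons j e) = sumn e.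
Proof. by elim: e j => //= k e IH j; rewrite size_cat size_nseq IH. Qed.

Lemma size_mon e : size (enum_mset (mon e)) = sumn e.
Proof. by rewrite (perm_size (perm_eq_seq_mset _)) size_mons. Qed.

Lemma uniq_mon e : uniq (enum_mset (mon e)) = all (fun k => k <= 1)%N e.
Proof.
rewrite (perm_uniq (perm_eq_seq_mset _)); suff H j : uniq (mons j e) = all (fun k => k <= 1)%N e by exact: H.
elim: e j => //= k e IH j.
rewrite cat_uniq IH; have -> : has (mem (nseq k (vj j))) (mons j.+1 e) = false.
  apply/negbTE/hasPn => x hx; rewrite -[mem _ x]/(x \in nseq k (vj j)) mem_nseq negb_and; apply/orP; right; apply: contraL hx => /eqP ->.
  by rewrite -has_pred1 has_count count_mons ltnn.
by case: k => [|[|k]] //=; rewrite in_cons eqxx.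
Qed.

Fixpoint subs (e : seq nat) : seq (seq nat) :=
  if e is k :: e' then [seq i :: s | i <- iota 0 k.+1, s <- subs e'] else [:: [::]].

Fixpoint subl (e s : seq nat) : seq nat :=
  match e, s with k :: e', i :: s' => (k - i)%N :: subl e' s' | _, _ => [::] end.

Lemma subs_uniq e : uniq (subs e).
Proof.
elim: e => //= k e IH; apply: (allpairs_uniq (iota_uniq 0 k.+1) IH).
by move=> [a b] [c d] _ _ /= [-> ->].
Qed.

Lemma mem_subs e s : reflect (size s = size e /\ forall i, (nth 0 s i <= nth 0 e i)%N) (s \in subs e).
Proof.
elim: e s => [|k e IH] s.
  rewrite inE; apply: (iffP eqP) => [->|[]]; first by split=> // i; rewrite nth_nil.
  by case: s.
rewrite -[subs (k :: e)]/([seq i :: s | i <- iota 0 k.+1, s <- subs e]).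
apply: (iffP idP) => [/allpairsPdep[a [b [ha /IH[hb1 hb2] ->]]]|[]].
  by rewrite mem_iota in ha; split=> [|[|i]] /=; rewrite ?hb1 //; lia.
case: s => // a s [hs] h; apply/allpairsPdep; exists a, s; split=> //.
  by rewrite mem_iota; have := h 0%N; rewrite /=; lia.
by apply/IH; split=> // i; exact: (h i.+1).
Qed.

Lemma subl_nth e s : s \in subs e -> size (subl e s) = size e /\ forall i, (nth 0 (subl e s) i = nth 0 e i - nth 0 s i)%N.
Proof.
elim: e s => [|k e IH] s; first by rewrite inE => /eqP ->; split=> // i; rewrite !nth_nil.
rewrite -[subs (k :: e)]/([seq i :: s | i <- iota 0 k.+1, s <- subs e]).
by move=> /allpairsPdep[a [b [_ /IH[h1 h2] ->]]] /=; rewrite h1; split=> // -[|i] //=.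
Qed.

Lemma cfn_mul n (p q : polyn n) e : size e = n ->
  cfn (p * q) e = \sum_(s <- subs e) cfn p s * cfn q (subl e s).
Proof.
elim: n p q e => [|n IH] p q [|k e] // se; first by rewrite big_seq1.
rewrite -[subs (k :: e)]/([seq i :: s | i <- iota 0 k.+1, s <- subs e]) big_allpairs_dep.
case: se => se; rewrite -[LHS]/(cfn ((p : {poly polyn n}) * (q : {poly polyn n}))`_k e) coefM cfn_sum.
rewrite -(big_mkord xpredT (fun j => cfn ((p : {poly polyn n})`_j * (q : {poly polyn n})`_(k - j)) e)).
by rewrite /index_iota subn0; apply: eq_bigr => i _; exact: IH.
Qed.

(** X n is f with all variables except x_(-1), ..., x_(-n) set to zero. As a monomial involves
    finitely many variables, these restrictions determine f. *)
Definition rel (f : series) (X : forall n, polyn n) := forall n e, size e = n -> f (mon e) = cfn (X n) e.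

Lemma rel_eq f g X : rel f X -> rel g X -> f = g.
Proof. by move=> hf hg; apply: seriesP => m; have [e ->] := mon_surj m; rewrite (hf _ e erefl) (hg _ e erefl). Qed.

Lemma rel_ext f X Y : (forall n, X n = Y n) -> rel f X -> rel f Y.
Proof. by move=> h hf n e se; rewrite -h; exact: hf. Qed.

Lemma rel0 : rel 0 (fun n => 0).
Proof. by move=> n e _; rewrite cfn0. Qed.

Lemma rel_add f g X Y : rel f X -> rel g Y -> rel (f + g) (fun n => X n + Y n).
Proof. by move=> hf hg n e se; rewrite cfnD -(hf n e se) -(hg n e se). Qed.

Lemma rel_opp f X : rel f X -> rel (- f) (fun n => - X n).
Proof. by move=> hf n e se; rewrite cfnN -(hf n e se). Qed.

Lemma rel_sub f g X Y : rel f X -> rel g Y -> rel (f - g) (fun n => X n - Y n).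
Proof. by move=> hf hg; apply: rel_add => //; exact: rel_opp. Qed.

Lemma rel_sum (I : Type) (r : seq I) (F : I -> series) (G : I -> forall n, polyn n) :
  (forall i, rel (F i) (G i)) -> rel (\sum_(i <- r) F i) (fun n => \sum_(i <- r) G i n).
Proof.
move=> h; elim: r => [|i r IH].
  by rewrite big_nil; apply: rel_ext rel0 => n; rewrite big_nil.
by rewrite big_cons; apply: rel_ext (rel_add (h i) IH) => n; rewrite big_cons.
Qed.

Lemma rel_mul f g X Y : rel f X -> rel g Y -> rel (f * g) (fun n => X n * Y n).
Proof.
move=> hf hg n e se; rewrite cfn_mul // -[(f * g) (mon e)]/(series_mul f g (mon e)) /series_mul.
rewrite (@perm_big _ _ _ _ _ (map mon (subs e))); last first.
  apply: uniq_perm; first exact: undup_uniq.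
    rewrite map_inj_in_uniq ?subs_uniq // => s t /mem_subs[hs _] /mem_subs[ht _].
    by apply: mon_inj; rewrite hs ht.
  move=> a; rewrite mem_mono_divisors; apply/msubsetP/mapP => [h|[s /mem_subs[hs1 hs2] -> x]]; last first.
    by have [j ->] := var_surj x; rewrite !mon_nth.
  exists (mkseq (fun j => a (vj j)) (size e)).
    apply/mem_subs; rewrite size_mkseq; split=> // i; have := h (vj i); rewrite mon_nth.
    by have [lt|le] := ltnP i (size e); [rewrite nth_mkseq | rewrite !nth_default ?size_mkseq].
  apply: mon_eq => i; have := h (vj i); rewrite mon_nth.
  have [lt|le] := ltnP i (size e); first by rewrite nth_mkseq.
  by rewrite (nth_default 0%N (s := e)) // leqn0 => /eqP ->; rewrite nth_default ?size_mkseq.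
rewrite big_map; apply: eq_big_seq => s hs; have [h1 h2] := mem_subs _ _ hs.
have [k1 k2] := subl_nth hs.
have -> : (mon e `\` mon s)%mset = mon (subl e s).
  by apply: mon_eq => i; rewrite msetE2 !mon_nth k2.
by rewrite (hf n s) ?h1 // (hg n (subl e s)) // k1.
Qed.

Fixpoint hp (n : nat) : nat -> polyn n :=
  if n is n'.+1 return nat -> polyn n then
    fix g (D : nat) : polyn n'.+1 := if D is D'.+1 then (hp n' D)%:P + 'X * g D' else (hp n' 0%N)%:P
  else fun D => (D == 0%N)%:R.

Fixpoint ep (n : nat) (D : nat) : polyn n :=
  if n is n'.+1 return polyn n then
    (ep n' D)%:P + 'X * (if D is D'.+1 then (ep n' D')%:P else 0)
  else (D == 0%N)%:R.

Lemma hpS n D : hp n.+1 D.+1 = (hp n D.+1)%:P + 'X * hp n.+1 D. Proof. by []. Qed.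

Lemma hp_coef n D k : (hp n.+1 D : {poly polyn n})`_k = if (k <= D)%N then hp n (D - k) else 0.
Proof.
elim: D k => [|D IH] k; first by rewrite coefC; case: k.
rewrite hpS coefD coefC coefXM; case: k => [|k] /=; first by rewrite addr0.
by rewrite add0r IH.
Qed.

Lemma rel_hp d : rel (complete_sym d) (fun n => hp n d).
Proof.
move=> n e se; rewrite /complete_sym size_mon; elim: n e d se => [|n IH] [|k e] d //= se; first by rewrite eq_sym.
case: se => se; have h := hp_coef n d k; rewrite [X in cfn X e]h; case: leqP => hk.
  by rewrite -IH //; congr (nat_of_bool _)%:R; apply/eqP/eqP; lia.
by rewrite cfn0; case: eqP => //; lia.
Qed.

Lemma rel_ep d : rel (elementary_sym d) (fun n => ep n d).
Proof.
move=> n e se; rewrite /elementary_sym size_mon uniq_mon; elim: n e d se => [|n IH] [|k e] d //= se.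
  by rewrite andbT eq_sym.
case: se => se; rewrite coefD coefC coefXM; case: k => [|[|k]] /=; last first.
- by rewrite andbF; case: d => [|d]; rewrite ?coef0 ?coefC /= ?addr0 cfn0.
- case: d => [|d]; rewrite add0r ?coef0 ?coefC /=; first by rewrite cfn0.
  by rewrite -IH // add1n eqSS.
by rewrite addr0 -IH.
Qed.

(** The generating functions of [hp] and [ep] gain the factors 1/(1 - X t) and 1 + X t for a new
    variable X; their product is the factor behind [qn]. *)
Lemma hp_ep n d : \sum_(a < d.+1) hp n a * ep n (d - a) = qn n d.
Proof.
elim: n d => [|n IH] d.
  rewrite big_ord_recl /= mul1r subn0 big1 ?addr0 // => i _; exact: mul0r.
have h0 m : hp m 0 = 1 by elim: m => //= m ->.
have e0 m : ep m 0 = 1 by elim: m => //= m ->; rewrite mulr0 addr0.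
elim: d => [|d IHd]; first by rewrite big_ord1 h0 e0 mulr1 qn0.
rewrite qnS -IHd.
pose C m := \sum_(a < m.+1) (hp n a)%:P * ep n.+1 (m - a).
have CE m : C m.+1 = (qn n m.+1)%:P + 'X * (qn n m)%:P.
  have E1 : ep n.+1 0 = 1 := e0 n.+1.
  have M0 k : (k - @ord_max k)%N = 0%N by rewrite /= subnn.
  have -> : qn n m.+1 = \sum_(a < m.+1) hp n a * ep n (m.+1 - a) + hp n m.+1.
    by rewrite -IH big_ord_recr M0 e0 mulr1.
  have -> : C m.+1 = \sum_(a < m.+1) (hp n a)%:P * ep n.+1 (m.+1 - a) + (hp n m.+1)%:P.
    by rewrite /C big_ord_recr M0 E1 mulr1.
  rewrite -IH !rmorphD !rmorph_sum mulr_sumr addrAC; congr (_ + _).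
  rewrite -big_split; apply: eq_bigr => i _; rewrite subSn; last by rewrite -ltnS.
  rewrite -[ep n.+1 _]/((ep n (m - i).+1)%:P + 'X * (ep n (m - i))%:P) !rmorphM /=; ring.
rewrite -CE /C big_ord_recl [in RHS]big_ord_recl /= !subn0 !h0 -addrA; congr (_ + _).
rewrite mulr_sumr -big_split /=; apply: eq_bigr => i _; rewrite /bump /= !add1n subSS.
by rewrite mulrDl -[X in _ + X]mulrA.
Qed.

Lemma rel_Qone d : rel (Qone d) (fun n => qn n d).
Proof.
apply: (@rel_ext _ (fun n => \sum_(a < d.+1) hp n a * ep n (d - a))) => [n|]; first exact: hp_ep.
by apply: rel_sum => a; apply: rel_mul; [exact: rel_hp | exact: rel_ep].
Qed.

Lemma rel_one : rel 1 (fun n => 1).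
Proof.
have := rel_hp 0; have -> : complete_sym 0 = 1 by apply: seriesP => m; rewrite /complete_sym size_mset_eq0.
by apply: rel_ext => n; elim: n => //= n ->.
Qed.

Lemma Qone0 : Qone 0 = 1.
Proof. by apply: rel_eq (rel_Qone 0) _; apply: rel_ext rel_one => n; rewrite qn0. Qed.

Lemma rel_wq a b : rel (wq Qone a b) (fun n => wq (qn n) a b).
Proof.
elim: b a => [|b IH] [|a] /=; try exact: rel0; try exact: rel_Qone;
  by apply: rel_sub (IH _); apply: rel_sub; apply: rel_mul; exact: rel_Qone.
Qed.

Lemma rel_ctr f f' h h' l : (forall a, rel (f a) (fun n => f' n a)) ->
  (forall k, (size k < size l)%N -> rel (h k) (fun n => h' n k)) ->
  rel (ctr f h l) (fun n => ctr (f' n) (h' n) l).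
Proof.
move=> hf; elim: l h h' => [|a l IH] h h' hh /=; first exact: rel0.
apply: rel_sub; first by apply: rel_mul; [exact: hf | exact: hh].
by apply: (IH (fun k => h (a :: k)) (fun n k => h' n (a :: k))) => k e; apply: hh.
Qed.

Lemma rel_pfs l : rel (pfs Qone l) (fun n => pfs (qn n) l).
Proof.
move: {2}(size l) (leqnn (size l)) => N; elim: N l => [|N IH] [|a l] //= h; try exact: rel_one.
rewrite pfs_cons; apply: (@rel_ext _ (fun n => ctr (wq (qn n) a) (pfs (qn n)) l)) => [n|]; first by rewrite pfs_cons.
apply: rel_ctr => [b|k hk]; [exact: rel_wq | apply: IH; lia].
Qed.

Lemma ctr_pfs_even (R : comNzRingType) (q f : nat -> R) l : ~~ odd (size l) -> ctr f (pfs q) l = 0.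
Proof.
move=> ev; rewrite -(ctr0 f l); apply: ctr_ext => // s _ ss; apply: pfs_odd.
by rewrite -ss /= negbK in ev.
Qed.

Lemma Qtwo_wq a b : Qtwo a b = wq Qone a b.
Proof.
rewrite /Qtwo; case: ifP => [/andP[/eqP -> /eqP ->] //|/negbT h].
by rewrite wqE ?Qone0 // -negb_and.
Qed.

(** For odd length the padding 0 is expanded along the last column, whose entries [wq a 0] are q_a
    for positive a; this is the second summand of [Qs]. *)
Lemma schurQ_Qs l : strict_partition l -> schurQ l = Qs Qone l.
Proof.
move=> /andP[_ hp]; rewrite /schurQ /Qs.
have E k l' : (forall i, nth 0%N l i = nth 0%N l' i) -> size l' = k.*2 ->
    pfaffian (\matrix_(i < k.*2, j < k.*2) Qtwo (nth 0%N l i) (nth 0%N l j)) = pfs Qone l'.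
  move=> h sl; rewrite -(pfaffian_pfs Qone sl); congr pfaffian; apply/matrixP => i j.
  by rewrite !mxE Qtwo_wq !h.
have [o|ev] := boolP (odd (size l)).
  rewrite (pfs_odd _ o) add0r (E _ (rcons l 0%N)).
  - rewrite pfs_rcons; apply: ctr_ext => // a al.
    by have := allP hp a al; case: a {al}.
  - by move=> i; rewrite nth_rcons; case: ltnP => h //; rewrite nth_default // if_same.
  by rewrite size_rcons uphalf_half o add1n doubleS; have := odd_double_half (size l); rewrite o; lia.
rewrite ctr_pfs_even // addr0 (E _ l) //.
by rewrite uphalf_half (negPf ev) add0n even_halfK.
Qed.

Lemma rel_schurQ l : strict_partition l -> rel (schurQ l) (fun n => QQ n l).
Proof.
move=> sl; rewrite schurQ_Qs //; apply: rel_add; first exact: rel_pfs.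
by apply: rel_ctr => [a|k _]; [exact: rel_Qone | exact: rel_pfs].
Qed.

End PowerSeries.

(** * Involution words *)

Section HatWords.
Import GroupScope.

Section Hat.
Variable n : nat.
Implicit Types (w z : 'S_n) (i : 'I_n.-1) (x y : 'I_n) (a b : seq 'I_n.-1).

Definition dcf w i := demazure (demazure (simple_refl i) w) (simple_refl i).

Definition invol w := w * w = 1.

Definition strS z i : 'S_n :=
  if z (ord_lo i) == ord_hi i then z * simple_refl i else simple_refl i * z * simple_refl i.

Lemma involK w : invol w -> involutive w.
Proof. by move=> h x; rewrite -permM h perm1. Qed.

Lemma involV w : invol w -> w^-1 = w.
Proof. by move=> h; apply/eqP; rewrite eq_invg_mul h. Qed.

Lemma srK i : simple_refl i * simple_refl i = 1.
Proof. exact: tperm2. Qed.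

Lemma sr_lo i : simple_refl i (ord_lo i) = ord_hi i. Proof. exact: tpermL. Qed.
Lemma sr_hi i : simple_refl i (ord_hi i) = ord_lo i. Proof. exact: tpermR. Qed.
Lemma srKx i x : simple_refl i (simple_refl i x) = x. Proof. exact: tpermK. Qed.

Lemma ascentN w i : ~~ ascent w i = (w (ord_hi i) < w (ord_lo i))%N.
Proof.
rewrite /ascent -leqNgt leq_eqVlt; case: eqP => // /val_inj/perm_inj e.
by have := ord_lo_neq_hi i; rewrite e eqxx.
Qed.

Lemma invol_conj w i : invol w -> invol (simple_refl i * w * simple_refl i).
Proof.
rewrite /invol => h; rewrite !mulgA -[_ * simple_refl i * simple_refl i]mulgA srK mulg1.
by rewrite -[_ * w * w]mulgA h mulg1 srK.
Qed.

Lemma fix_comm w i : w (ord_lo i) = ord_lo i -> w (ord_hi i) = ord_hi i ->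
  w * simple_refl i = simple_refl i * w.
Proof.
move=> h1 h2; rewrite /simple_refl -{1}h1 -{1}h2 -(tpermJ (ord_lo i) (ord_hi i) w) conjgE.
by rewrite mulKVg.
Qed.

Lemma demazure_demL w i : demazure (simple_refl i) w = demL w i.
Proof.
have [b Ew ->] := demazure_word w.
have -> : simple_refl i = demL 1 i by rewrite demLE invg1 /ascent !perm1 /= ltnSn mul1g.
by rewrite -demL_foldl -Ew.
Qed.

Lemma asc_mulr w i : ascent w i ->
  ascent (w * simple_refl i) i = ~~ ((w (ord_lo i) == ord_lo i) && (w (ord_hi i) == ord_hi i)).
Proof.
move=> asc; rewrite /ascent !permM; case: (boolP (_ && _)) => [/andP[/eqP -> /eqP ->]|h].
  by rewrite sr_lo sr_hi /= ltnNge leqnSn.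
rewrite simple_refl_lt //; apply/negP; rewrite xpair_eqE => /andP[/eqP h1 /eqP h2].
by move: asc; rewrite /ascent h1 h2 /= ltnNge leqnSn.
Qed.

Lemma dcfE w i : invol w -> dcf w i = if ascent w i then
    (if (w (ord_lo i) == ord_lo i) && (w (ord_hi i) == ord_hi i) then w * simple_refl i
     else simple_refl i * w * simple_refl i) else w.
Proof.
move=> iw; rewrite /dcf demazure_demL demazure_simple -/(demazureR (demL w i) i) demazureRE demLE involV //.
case asc: (ascent w i) => /=; last by rewrite asc.
by rewrite asc_mulr //; case: (_ && _) => //=; rewrite /mulR mulgA.
Qed.

Lemma dcf_strS w i : invol w -> ascent w i ->
  [/\ invol (dcf w i), ~~ ascent (dcf w i) i & strS (dcf w i) i = w].
Proof.
move=> iw asc; rewrite dcfE // asc; case: (boolP (_ && _)) => [/andP[/eqP h1 /eqP h2]|h].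
  split.
  - rewrite /invol {2}fix_comm // -mulgA [_ * (_ * w)]mulgA srK mul1g; exact: iw.
  - by rewrite /ascent !permM h1 h2 sr_lo sr_hi /= ltnNge leqnSn.
  by rewrite /strS permM h1 sr_lo eqxx -mulgA srK mulg1.
have asc2 : ascent (w * simple_refl i) i by rewrite asc_mulr.
split; first exact: invol_conj.
  by rewrite -mulgA -/(mulR (w * simple_refl i) i) ascent_mulR asc2.
have ne : (simple_refl i * w * simple_refl i) (ord_lo i) == ord_hi i = false.
  apply/eqP; rewrite !permM sr_lo => /(congr1 (simple_refl i)); rewrite srKx sr_hi => e.
  by move: asc; rewrite /ascent e -{1}e involK // /= ltnNge leqnSn.
by rewrite /strS ne !mulgA srK mul1g -mulgA srK mulg1.
Qed.

Lemma strS_dcf z i : invol z -> ~~ ascent z i ->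
  [/\ invol (strS z i), ascent (strS z i) i & dcf (strS z i) i = z].
Proof.
move=> iz; rewrite ascentN => de.
suff [h1 h2 h3] : [/\ invol (strS z i), ascent (strS z i) i &
    (if (strS z i (ord_lo i) == ord_lo i) && (strS z i (ord_hi i) == ord_hi i) then strS z i * simple_refl i
     else simple_refl i * strS z i * simple_refl i) = z].
  by split=> //; rewrite dcfE // h2.
rewrite /strS; case: eqP => [e|ne].
  have e' : z (ord_hi i) = ord_lo i by rewrite -e involK.
  have c : z * simple_refl i = simple_refl i * z.
    by rewrite /simple_refl -{1}e -{1}e' tpermC -(tpermJ (ord_lo i) (ord_hi i) z) conjgE mulKVg tpermC.
  rewrite !permM e e' sr_lo sr_hi !eqxx /=; split.
  - rewrite /invol {2}c -mulgA [_ * (_ * z)]mulgA srK mul1g; exact: iz.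
  - by rewrite /ascent !permM e e' sr_lo sr_hi /= ltnSn.
  by rewrite -mulgA srK mulg1.
have h1 : ~ (z (ord_hi i) = ord_hi i /\ z (ord_lo i) = ord_lo i).
  by case=> e1 e2; move: de; rewrite e1 e2 /= ltnNge leqnSn.
split; first exact: invol_conj.
  rewrite /ascent !permM sr_lo sr_hi simple_refl_lt //; apply/eqP => -[e1 e2]; [exact: ne|exact: h1].
rewrite !permM sr_lo sr_hi; case: ifP => [/andP[/eqP e1 /eqP e2]|_].
  by case: h1; split; apply: (can_inj (srKx i)); rewrite ?e1 ?e2 ?sr_lo ?sr_hi.
by rewrite !mulgA srK mul1g -mulgA srK mulg1.
Qed.

Lemma inversionsV w : inversions w^-1 = inversions w.
Proof.
pose f (p : 'I_n * 'I_n) := (w p.2, w p.1).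
have fI : injective f by move=> [a b] [c d] [/perm_inj -> /perm_inj ->].
rewrite /inversions -[RHS](card_imset _ fI); apply: eq_card => -[x y].
apply/idP/imsetP => [|[[a b]]]; rewrite inE /= => /andP[h1 h2].
  by exists (w^-1 y, w^-1 x); rewrite ?inE /f /= ?permKV ?h1 ?h2.
by move=> [-> ->]; rewrite inE /= !permK h1 h2.
Qed.

Lemma inversions_mulR w i : ascent w i -> inversions (mulR w i) = (inversions w).+1.
Proof.
move=> asc; pose sw (p : 'I_n * 'I_n) := (simple_refl i p.1, simple_refl i p.2).
have swK : cancel sw sw by move=> [x y]; rewrite /sw /= !srKx.
set A := [set p : 'I_n * 'I_n | (p.1 < p.2)%N && (w p.2 < w p.1)%N].
have mA p : (p \in sw @: A) = (sw p \in A) by rewrite -{1}[p]swK mem_imset //; exact: can_inj swK.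
have E : [set p : 'I_n * 'I_n | (p.1 < p.2)%N && (mulR w i p.2 < mulR w i p.1)%N] = (ord_lo i, ord_hi i) |: (sw @: A).
  apply/setP => -[x y]; rewrite !inE mA inE /= /mulR !permM.
  have [/eqP[-> ->]|n1] := boolP ((x, y) == (ord_lo i, ord_hi i)); first by rewrite sr_lo sr_hi /= ltnSn.
  have [/eqP[-> ->]|n2] := boolP ((x, y) == (ord_hi i, ord_lo i)).
    have a1 : (w (ord_hi i) < w (ord_lo i))%N = false by apply/negbTE; rewrite -ascentN negbK.
    by rewrite !sr_lo !sr_hi a1 !andbF.
  by rewrite simple_refl_lt.
rewrite /inversions E cardsU1 (card_imset _ (can_inj swK)) mA inE /= sr_lo sr_hi /=.
by rewrite [(i.+1 < i)%N]ltnNge leqnSn.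
Qed.

Definition moved w : {set 'I_n} := [set x | w x != x].

(** A length adapted to Demazure conjugation: each step at an ascent raises it by exactly 4, through
    two more inversions or through one more inversion and two more moved points. It shows which
    words are shortest. *)
Definition rho w := (2 * inversions w + #|moved w|)%N.

Lemma rho_step w i : invol w -> ascent w i -> rho (dcf w i) = (rho w + 4)%N.
Proof.
move=> iw asc; rewrite dcfE // asc; case: (boolP (_ && _)) => [/andP[/eqP h1 /eqP h2]|h].
  have E : moved (w * simple_refl i) = ord_lo i |: (ord_hi i |: moved w).
    apply/setP => x; rewrite !inE permM.
    have [->|n1] := eqVneq x (ord_lo i); first by rewrite h1 sr_lo eq_sym ord_lo_neq_hi.
    have [->|n2] := eqVneq x (ord_hi i); first by rewrite h2 sr_hi ord_lo_neq_hi.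
    by rewrite /simple_refl tpermD // eq_sym; [rewrite -h1 | rewrite -h2]; rewrite (inj_eq perm_inj).
  rewrite /rho E !cardsU1 !inE h1 h2 !eqxx (negPf (ord_lo_neq_hi i)) fix_comm // -/(mulR w i) inversions_mulR //=.
  by lia.
have asc2 : ascent (w * simple_refl i) i by rewrite asc_mulr.
have E : moved (simple_refl i * w * simple_refl i) = simple_refl i @: moved w.
  apply/setP => x; rewrite -{2}[x](srKx i) mem_imset ?inE; last exact: perm_inj.
  by rewrite !permM -{2}[x](srKx i) (inj_eq perm_inj).
rewrite /rho E card_imset; last exact: perm_inj.
rewrite -mulgA -/(mulR (w * simple_refl i) i) inversions_mulR //.
rewrite -[inversions (w * _)]inversionsV invMg (involV iw) [(simple_refl i)^-1]tpermV -/(simple_refl i) -/(mulR w i) inversions_mulR //.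
by lia.
Qed.

Variable one : 'S_n.
Hypothesis ione : invol one.

Lemma fold_rho a : invol (foldl dcf one a) /\ (rho (foldl dcf one a) <= rho one + 4 * size a)%N.
Proof.
elim/last_ind: a => [|a i [IH1 IH2]] /=; first by rewrite muln0 addn0.
rewrite foldl_rcons size_rcons; case asc: (ascent (foldl dcf one a) i).
  by have [h _ _] := dcf_strS IH1 asc; rewrite rho_step //; split=> //; lia.
by rewrite dcfE // asc; split=> //; lia.
Qed.

Fixpoint chn z b : bool := if b is i :: b' then ~~ ascent z i && chn (strS z i) b' else z == one.

Lemma chn_fold z b : invol z -> chn z b ->
  foldl dcf one (rev b) = z /\ rho z = (rho one + 4 * size b)%N.
Proof.
elim: b z => [|i b IH] z iz /=; first by move/eqP ->; rewrite muln0 addn0.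
case/andP=> de /(IH _ _) h; have [h1 h2 h3] := strS_dcf iz de; have [e1 e2] := h h1.
by rewrite rev_cons foldl_rcons e1 h3; split=> //; rewrite -{1}h3 rho_step // e2; lia.
Qed.

Lemma fold_chn z a : (forall b, foldl dcf one b = z -> (size a <= size b)%N) ->
  foldl dcf one a = z -> chn z (rev a).
Proof.
elim/last_ind: a z => [|a i IH] z hmin; first by move=> /= ->.
rewrite foldl_rcons rev_rcons /= => ez; have [iw _] := fold_rho a.
case asc: (ascent (foldl dcf one a) i); last first.
  by have := hmin a; rewrite -ez dcfE // asc size_rcons ltnn => /(_ erefl).
have [h1 h2 h3] := dcf_strS iw asc; rewrite -ez h2 h3 /=; apply: IH => // b eb.
by have := hmin (rcons b i); rewrite foldl_rcons eb ez !size_rcons ltnS; apply.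
Qed.

(** A shortest word contains no letter without effect, so its reversal strips descents from z down
    to [one]. Conversely [rho] forces the length of such a chain and bounds every other word from
    below. *)
Lemma hat_wordE z a : invol z -> is_hat_word one z a = chn z (rev a).
Proof.
move=> iz; apply/andP/idP => [[/eqP e /forallP h]|h].
  apply: fold_chn => // b eb; rewrite leqNgt; apply/negP => lt.
  by have /forallP/(_ (in_tuple b)) := h (Ordinal lt); rewrite /is_hat_factorization /= -/dcf eb eqxx.
have [e1 e2] := chn_fold iz h; rewrite revK in e1; rewrite size_rev in e2; split.
  by rewrite /is_hat_factorization -e1.
apply/forallP => k; apply/forallP => b; apply/negP => /eqP eb.
have [_] := fold_rho b; rewrite -[foldl dcf one b]eb e2 size_tuple; have := ltn_ord k; lia.
Qed.
End Hat.

End HatWords.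

(** * Extending involutions of a finite set to the integers *)

Section Extension.
Local Open Scope Z_scope.

Section Ext.
Variables (sp : bool) (n : nat).
Hypothesis evn : sp -> ~~ odd n.
Implicit Types (z w : 'S_n) (i : 'I_n.-1) (u : 'I_n).

Definition ext z (x : Z) : Z :=
  if (0 <=? x) then (if insub (Z.to_nat x) is Some u then Z.of_nat (z (u : 'I_n)) else base sp x) else base sp x.

Lemma ext_ord z u : ext z (Z.of_nat u) = Z.of_nat (z u).
Proof.
clear evn; rewrite /ext; have -> : (0 <=? Z.of_nat u) = true by apply/Z.leb_spec0; lia.
by rewrite Nat2Z.id valK.
Qed.

Lemma ext_out z x : x < 0 \/ Z.of_nat n <= x -> ext z x = base sp x.
Proof.
clear evn; rewrite /ext; case: Z.leb_spec => // h [|h2]; first by lia.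
by rewrite insubF //; apply/negP => h3; lia.
Qed.

Lemma ord_cases (x : Z) : (exists u, x = Z.of_nat u) \/ (x < 0 \/ Z.of_nat n <= x).
Proof.
clear evn; have [h|h] : (0 <= x < Z.of_nat n) \/ (x < 0 \/ Z.of_nat n <= x) by lia.
  have hx : (Z.to_nat x < n)%N by lia.
  by left; exists (Ordinal hx) => /=; lia.
by right.
Qed.

Lemma base_out x : (x < 0 \/ Z.of_nat n <= x) -> (base sp x < 0 \/ Z.of_nat n <= base sp x).
Proof.
have b0 := @base_even sp 0 x isT; case E : (sp) b0 evn => b0 ev; last by rewrite /base.
have en : Z.even (Z.of_nat n) by apply/Z.even_spec; exists (Z.of_nat n./2); have := ev isT; lia.
by have := @base_even true _ x en; lia.
Qed.

Lemma ext_inv z : invol z -> inv (ext z).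
Proof.
move=> iz x; have [[u ->]|h] := ord_cases x; first by rewrite !ext_ord involK.
by rewrite (ext_out z h) ext_out ?baseK //; exact: base_out.
Qed.

Lemma ext_supp z : invol z -> supp sp (ext z) n.+1.
Proof.
move=> iz; split; first exact: ext_inv.
by move=> x hx; apply: ext_out; rewrite /ev in hx; lia.
Qed.

Lemma ext_cut0 z x : x < 0 -> ext z x < 0.
Proof.
move=> hx; rewrite ext_out; last by left.
by have := @base_even sp 0 x isT; lia.
Qed.

Lemma ext_cutn z x : invol z -> x < Z.of_nat n -> ext z x < Z.of_nat n.
Proof.
move=> iz hx; have [[u ->]|h] := ord_cases x; first by rewrite ext_ord; have := ltn_ord (z u); lia.
have [//|h2] := Z.lt_ge_cases (ext z x) (Z.of_nat n).
have e : ext z (ext z x) = base sp (ext z x) by apply: ext_out; right.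
rewrite ext_inv // in e; have := base_out (or_intror h2); rewrite -e => h3.
by have h4 := ext_cut0 z (x := x); lia.
Qed.

Lemma dsc_ext z i : (ext z (Z.of_nat i + 1) <? ext z (Z.of_nat i)) = ~~ ascent z i.
Proof.
have -> : Z.of_nat i + 1 = Z.of_nat (ord_hi i) by rewrite /=; lia.
have -> : Z.of_nat i = Z.of_nat (ord_lo i) by [].
by rewrite !ext_ord ascentN; apply/Z.ltb_spec0/idP; lia.
Qed.

Lemma sr_sw i u : Z.of_nat (simple_refl i u) = sw (Z.of_nat i) (Z.of_nat i + 1) (Z.of_nat u).
Proof.
have lo : Z.of_nat (ord_lo i) = Z.of_nat i by [].
have hi : Z.of_nat (ord_hi i) = Z.of_nat i + 1 by rewrite /=; lia.
rewrite -hi /simple_refl; case: tpermP => [->|->|h1 h2].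
- by rewrite lo swL.
- by rewrite swR.
rewrite swN // => e; [apply: h1|apply: h2]; apply/val_inj; rewrite /=; rewrite /= in e; lia.
Qed.

Lemma ext_strS z i : invol z -> ~~ ascent z i -> ext (strS z i) = strip (ext z) (Z.of_nat i).
Proof.
move=> iz de; apply: functional_extensionality => x.
have hi : Z.of_nat (ord_hi i) = Z.of_nat i + 1 by rewrite /=; lia.
have lo : Z.of_nat (ord_lo i) = Z.of_nat i by [].
have bi : 0 <= Z.of_nat i /\ Z.of_nat i + 1 < Z.of_nat n by have := ltn_ord (ord_hi i); rewrite /=; lia.
have e0 : ext z (Z.of_nat i) = Z.of_nat (z (ord_lo i)) by rewrite -lo ext_ord.
rewrite /strip e0 -hi; have [[u ->]|h] := ord_cases x.
  rewrite ext_ord /strS; case: eqP => [e|ne].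
    rewrite e Z.eqb_refl /unarc permM sr_sw.
    have e' : z (ord_hi i) = ord_lo i by rewrite -e involK.
    case: Z.eqb_spec => [hu|hu].
      have -> : u = ord_lo i by apply/val_inj; rewrite /=; lia.
      by rewrite e hi swR.
    case: Z.eqb_spec => [hu2|hu2].
      have -> : u = ord_hi i by apply/val_inj; rewrite /=; lia.
      by rewrite e' lo swL hi.
    rewrite ext_ord swN //; rewrite -?hi -?lo => /Nat2Z.inj/val_inj h3.
      by apply: hu2; rewrite -(involK iz u) h3 e.
    by apply: hu; rewrite -(involK iz u) h3 e'.
  rewrite eqbF; last by move=> /Nat2Z.inj/val_inj.
  by rewrite /cj !permM hi -sr_sw ext_ord -sr_sw.
rewrite ext_out //; have [n1 n2] : x <> Z.of_nat i /\ x <> Z.of_nat (ord_hi i) by lia.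
case: Z.eqb_spec => _; first by rewrite /unarc !eqbF // ext_out.
have hb := base_out h; rewrite /cj (swN n1 n2) ext_out // swN // => e; lia.
Qed.

Section Pass.
Variables (K m : nat).
Let H := @Fs (base sp) (letters K) m.

(** The extension preserves the range, so letters across its ends are ascents, and letters outside
    meet only the base involution. *)
Lemma dead_letter z (i : Z) L1 : invol z -> ~ (0 <= i < Z.of_nat n.-1) -> Dop i (pass H L1) (ext z) = 0%R.
Proof.
move=> iz hi; apply: Dop_base; first exact: ext_inv.
rewrite /dsc => d; have [e|n1] := Z.eqb_spec i (-1).
  have := ext_cut0 z (x := i) ltac:(lia); have h0 : 0 <= ext z (i + 1).
    have [//|/ext_cut0] := Z.le_gt_cases 0 (ext z (i + 1)).
    by move=> /(_ z); rewrite ext_inv //; lia.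
  by lia.
have [e|n2] := Z.eqb_spec i (Z.of_nat n - 1).
  have [e1|n3] := Z.eqb_spec (Z.of_nat n) 0; first by lia.
  have h1 := ext_cutn iz (x := i) ltac:(lia); have h0 : Z.of_nat n <= ext z (i + 1).
    have [//|h2] := Z.le_gt_cases (Z.of_nat n) (ext z (i + 1)).
    by have := ext_cutn iz h2; rewrite ext_inv //; lia.
  by lia.
have o1 : i < 0 \/ Z.of_nat n <= i by lia.
have o2 : i + 1 < 0 \/ Z.of_nat n <= i + 1 by lia.
by move: d; rewrite !ext_out //; exact: base_dsc.
Qed.

Lemma pass_dead_prefix z (L1 L2 : seq Z) : invol z ->
  (forall j : Z, j \in L1 -> ~ (0 <= j < Z.of_nat n.-1)) -> pass H (L1 ++ L2) (ext z) = pass H L2 (ext z).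
Proof.
move=> iz; elim: L1 => //= i L1 IH h; rewrite dead_letter //; last by apply: h; rewrite mem_head.
by rewrite mulr0 addr0 IH // => j hj; apply: h; rewrite in_cons hj orbT.
Qed.

Lemma pass_dead_suffix z (L1 L3 : seq Z) : invol z ->
  (forall j : Z, j \in L1 -> 0 <= j < Z.of_nat n.-1) -> (forall j : Z, j \in L3 -> ~ (0 <= j < Z.of_nat n.-1)) ->
  pass H (L1 ++ L3) (ext z) = pass H L1 (ext z).
Proof.
move=> + h1 h3; elim: L1 h1 z => [|i L1 IH] h1 z iz.
  by rewrite cat0s -[L3]cats0 pass_dead_prefix.
have hL j : j \in L1 -> 0 <= j < Z.of_nat n.-1 by move=> hj; apply: h1; rewrite in_cons hj orbT.
rewrite /= IH //; congr (_ + 'X * _)%R; have hi : 0 <= i < Z.of_nat n.-1 := h1 i (mem_head _ _).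
have ho : (Z.to_nat i < n.-1)%N by lia.
have ei : i = Z.of_nat (Ordinal ho) by rewrite /=; lia.
rewrite /Dop; case E: (_ <? _) => //; rewrite ei dsc_ext in E; rewrite ei -ext_strS //.
by apply: IH => //; case: (strS_dcf iz E).
Qed.

(** Counts the ways to strip k increasing letters starting from [lo], weighted by h at the end; this
    is the coefficient of X^k in one pass. *)
Fixpoint cG (lo k : nat) (h : 'S_n -> nat) z : nat :=
  if k is k'.+1 then (\sum_(i < n.-1 | (lo <= i) && ~~ ascent z i) cG i.+1 k' h (strS z i))%N else h z.

Lemma pass_cG (h : 'S_n -> nat) e : (forall w, invol w -> cfn (H (ext w)) e = (h w)%:R)%R ->
  forall c lo k z, (lo + c)%N = n.-1 -> invol z ->
  (cfn (pass H (zr (Z.of_nat lo) c) (ext z))`_k e = (cG lo k h z)%:R)%R.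
Proof.
move=> hH; elim=> [|c IH] lo k z hc iz.
  rewrite coefC; case: k => [|k] /=; first exact: hH.
  by rewrite cfn0 big_pred0 // => i; apply/negP => /andP[h1 _]; have := ltn_ord i; lia.
have hlo : (lo < n.-1)%N by lia.
have S1 : Z.of_nat lo + 1 = Z.of_nat lo.+1 by lia.
rewrite /= S1 coefD coefXM cfnD IH; [|lia|by []].
case: k => [|k] /=; first by rewrite cfn0 addr0.
have de := dsc_ext z (Ordinal hlo); rewrite /= S1 in de; rewrite /Dop S1 de.
rewrite [in RHS](bigID (fun i : 'I_n.-1 => (lo.+1 <= i)%N)) /= natrD; congr (_ + _)%R.
  by congr (_%:R)%R; apply: eq_bigl => i; case: ltnP => h1; rewrite ?andbT ?andbF //= ltnW.
rewrite (eq_bigl (fun i => (i == Ordinal hlo) && ~~ ascent z i)); last first.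
  move=> i; rewrite -leqNgt -val_eqE /= eqn_leq.
  by case: (lo <= i)%N; case: (ascent z i); case: (i <= lo)%N.
rewrite big_mkcondr big_pred1_eq; case: ifP => ha; last by rewrite coef0 cfn0.
have [iw _ _] := strS_dcf iz ha; have := IH lo.+1 k (strS z (Ordinal hlo)).
by rewrite ext_strS // => -> //; rewrite addSn -addnS.
Qed.
End Pass.

Variable one : 'S_n.
Hypothesis ext_one : ext one = base sp.

Fixpoint Gc (e : seq nat) z : nat := if e is k :: e' then cG 0 k (Gc e') z else (z == one).

Lemma ext_inj z w : ext z = ext w -> z = w.
Proof.
clear evn; move=> h; apply/permP => u; have := congr1 (fun f : Z -> Z => f (Z.of_nat u)) h.
by rewrite !ext_ord => /Nat2Z.inj/val_inj.
Qed.

Lemma Fn_Gc m e z : size e = m -> invol z -> (cfn (Fn sp m (ext z)) e = (Gc e z)%:R)%R.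
Proof.
move=> se iz; rewrite (FnE m _ (ext_supp iz)) //.
elim: m e z se iz => [|m IH] [|k e] z //= se iz.
  congr (_%:R)%R; congr nat_of_bool; apply/asboolP/eqP => [h|->]; [apply: ext_inj; by rewrite ext_one | exact: ext_one].
have E : letters n.+1 = zr (- ev n.+1) (2 * n.+1) ++ zr 0 n.-1 ++ zr (Z.of_nat n.-1) (2 * n.+1 - n.-1).-1.
  rewrite /letters; have -> : (4 * n.+1).-1 = (2 * n.+1 + (n.-1 + (2 * n.+1 - n.-1).-1))%N by lia.
  rewrite (zr_cat _ (2 * n.+1)) (zr_cat _ n.-1); congr (zr _ _ ++ _); rewrite /ev.
  by congr (zr _ _ ++ zr _ _); lia.
rewrite [X in pass _ X]E pass_dead_prefix //; last first.
  by move=> i; rewrite mem_zr => /andP[/Z.leb_spec0 h1 /Z.ltb_spec0]; rewrite /ev in h1 *; lia.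
rewrite pass_dead_suffix //; first last.
- by move=> i; rewrite mem_zr => /andP[/Z.leb_spec0 h1 /Z.ltb_spec0]; lia.
- by move=> i; rewrite mem_zr => /andP[/Z.leb_spec0 h1 /Z.ltb_spec0]; lia.
apply: (@pass_cG _ _ (Gc e) e _ _ 0) => // w iw; apply: IH => //; by case: se.
Qed.
End Ext.

End Extension.

(** * Counting compatible words *)

Section Counting.
Local Open Scope nat_scope.

Lemma sum_tuple_cons (I : finType) p (F : seq I -> nat) :
  \sum_(t : p.+1.-tuple I) F t = \sum_(i : I) \sum_(t : p.-tuple I) F (i :: t).
Proof.
rewrite pair_big /= (reindex (fun x : I * p.-tuple I => cons_tuple x.1 x.2)) //=.
exists (fun t => (thead t, behead_tuple t)) => [[i t] _|t _] /=.
  by congr (_, _); apply/val_inj.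
by apply/val_inj; rewrite /= [in RHS](tuple_eta t).
Qed.

Section Count.
Variables (n : nat) (one : 'S_n).
Implicit Types (z w : 'S_n) (i : 'I_n.-1) (b : seq 'I_n.-1).

(** The predicate on words that [cG] counts: k increasing descents are stripped, and the rest of the
    word satisfies h. *)
Fixpoint Vk (lo k : nat) (h : 'S_n -> seq 'I_n.-1 -> bool) z b : bool :=
  if k is k'.+1 then
    if b is i :: b' then [&& lo <= i, ~~ ascent z i & Vk i.+1 k' h (strS z i) b'] else false
  else h z b.

Fixpoint Vt (e : seq nat) z b : bool :=
  if e is k :: e' then Vk 0 k (Vt e') z b else (z == one) && nilp b.

Lemma sum_Vk lo k m h z : \sum_(t : (k + m).-tuple 'I_n.-1) Vk lo k h z t =
  cG lo k (fun w => \sum_(t : m.-tuple 'I_n.-1) h w t) z.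
Proof.
elim: k lo z => [|k IH] lo z //.
rewrite [LHS](@sum_tuple_cons _ (k + m) (fun b => nat_of_bool (Vk lo k.+1 h z b))) /= [RHS]big_mkcond /=.
apply: eq_bigr => i _; case: ifP => [/andP[-> ->]|h0]; first by rewrite -IH.
by rewrite big1 // => t _; rewrite andbA h0.
Qed.

Lemma sum_Vt e z : \sum_(t : (sumn e).-tuple 'I_n.-1) Vt e z t = Gc one e z.
Proof.
elim: e z => [|k e IH] z /=.
  rewrite (big_pred1 [tuple]) => [|t]; first by rewrite /= andbT.
  by apply/esym/eqP; exact: tuple0.
rewrite sum_Vk; suff H lo : cG lo k (fun w => \sum_(t : (sumn e).-tuple 'I_n.-1) Vt e w t) z = cG lo k (Gc one e) z by exact: H.
elim: k lo z => [|k IHk] lo z /=; first exact: IH.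
by apply: eq_bigr => i _; exact: IHk.
Qed.

(** Compatibility read from the end of the word, the direction in which letters are stripped. *)
Definition cmp (p q : 'I_n.-1 * var) : bool :=
  (val q.2 <= val p.2)%R && ((q.1 < p.1) ==> (val q.2 < val p.2)%R).

Lemma val_vj j : val (vj j) = Negz j. Proof. by []. Qed.

(** Within one variable compatibility only forbids a decrease. A repeated letter is excluded because
    i is an ascent after it has been stripped, so the letters increase strictly. *)
Lemma path_block i j k b (tl : seq var) w : ascent w i -> chn one w b ->
  (forall v, v \in tl -> (val v < val (vj j))%R) ->
  path cmp (i, vj j) (zip b (nseq k (vj j) ++ tl)) =
  sorted cmp (zip b (nseq k (vj j) ++ tl)) && ((0 < k) ==> all (fun i2 : 'I_n.-1 => i < i2) (take 1 b)).
Proof.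
move=> aw; case: b => [|i2 b] c htl; first by rewrite /= implybT; case: (nseq k _ ++ tl).
case: k => [|k] /=.
  case: tl htl => [|v vs] htl //=.
  have h1 := htl v (mem_head _ _).
  have -> : cmp (i, vj j) (i2, v) = true.
    by apply/andP; split; [exact: ltW h1 | apply/implyP => _; exact: h1].
  by rewrite andbT.
have n1 : i != i2 by apply: contraTneq c => <- /=; rewrite negb_and negbK aw.
have -> : cmp (i, vj j) (i2, vj j) = (i < i2).
  by rewrite /cmp /= lexx ltxx implybF -leqNgt ltn_neqAle n1.
by rewrite take0 /= andbT andbC.
Qed.

Lemma Vk_block h N tl j :
  (forall v, v \in tl -> (val v < val (vj j))%R) ->
  (forall z b, invol z -> h z b = [&& chn one z b, size b == N & sorted cmp (zip b tl)]) ->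
  forall k lo z b, invol z ->
  Vk lo k h z b = [&& chn one z b, size b == k + N,
    sorted cmp (zip b (nseq k (vj j) ++ tl)) & (0 < k) ==> all (fun i : 'I_n.-1 => lo <= i) (take 1 b)].
Proof.
move=> htl hh; elim=> [|k IHk] lo z b iz; first by rewrite /= hh // andbT.
case: b => [|i b]; first by rewrite /= andbF.
have [de|as_] := boolP (ascent z i); first by rewrite /= de /= !andbF.
have [iw aw _] := strS_dcf iz as_.
rewrite /= (IHk i.+1) // as_ take0 /= !andbT addSn eqSS.
case c : (chn one (strS z i) b); rewrite ?andbF //=.
case: (size b == _); rewrite ?andbF //=.
by rewrite (path_block k aw c htl) andbC.
Qed.

Lemma VtE_from e j z b : invol z ->
  Vt e z b = [&& chn one z b, size b == sumn e & sorted cmp (zip b (mons j e))].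
Proof.
elim: e j z b => [|k e IH] j z b iz; first by case: b => [|i b] /=; rewrite ?andbT ?andbF.
rewrite [LHS]/= (@Vk_block (Vt e) (sumn e) (mons j.+1 e) j) //; last by move=> *; exact: IH.
  have -> : all (fun i : 'I_n.-1 => 0 <= i) (take 1 b) by apply/allP.
  by rewrite implybT andbT.
move=> v; have [j' ->] := var_surj v; rewrite -has_pred1 has_count count_mons.
case: ifP => // hj _; rewrite !val_vj !NegzE ltrN2 ltz_nat; lia.
Qed.

Lemma VtE e z b : invol z ->
  Vt e z b = [&& chn one z b, size b == sumn e & sorted cmp (zip b (mons 0 e))].
Proof. exact: VtE_from. Qed.

Lemma compatible_rev b (vs : seq var) : size b = size vs ->
  compatible (rev b) (rev vs) = sorted cmp (zip b vs).
Proof.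
by move=> s; rewrite /compatible !size_rev s eqxx -rev_zip // rev_sorted.
Qed.

Lemma mons_sorted j e : sorted (fun u v : var => (val v <= val u)%R) (mons j e).
Proof.
have tr : transitive (fun u v : var => (val v <= val u)%R) by move=> y x u h1 h2; apply: le_trans h2 h1.
elim: e j => //= k e IH j; rewrite (sorted_pairwise tr) pairwise_cat -!(sorted_pairwise tr) IH andbT.
apply/andP; split.
  apply/allrelP => u v; rewrite mem_nseq => /andP[_ /eqP ->]; have [j' ->] := var_surj v.
  rewrite -has_pred1 has_count count_mons; case: ifP => // h _.
  by rewrite !val_vj !NegzE lerN2 lez_nat; lia.
by elim: k => //= k; case: k => //= k; rewrite lexx.
Qed.

(** The variables increase weakly along a compatible sequence, so the sorted arrangement of the
    monomial is the only candidate. *)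
Lemma count_compatible e (a : seq 'I_n.-1) :
  count (compatible a) (permutations (enum_mset (mon e))) = compatible a (rev (mons 0 e)).
Proof.
set i0 := rev _; have i0P : i0 \in permutations (enum_mset (mon e)).
  by rewrite mem_permutations /i0 (perm_trans (_ : perm_eq _ (mons 0 e))) ?perm_rev // perm_sym perm_eq_seq_mset.
have U (s : seq var) : s \in permutations (enum_mset (mon e)) -> compatible a s -> s = i0.
  rewrite mem_permutations => hp /andP[/eqP sa hc].
  have tr : transitive (fun u v : var => (val u <= val v)%R) by move=> y x u; apply: le_trans.
  have an : antisymmetric (fun u v : var => (val u <= val v)%R).
    by move=> x y /le_anti/val_inj.
  apply: (sorted_eq tr an).
  - have -> : s = [seq p.2 | p <- zip a s] by rewrite -[LHS](@unzip2_zip _ _ a) // sa.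
    rewrite sorted_map; apply: sub_sorted hc => p q /andP[]; by [].
  - by rewrite /i0 rev_sorted; exact: mons_sorted.
  apply: (perm_trans hp); apply: (perm_trans (perm_eq_seq_mset _)).
  by rewrite perm_sym perm_rev.
rewrite (@eq_in_count _ _ (fun s : seq var => (s == i0) && compatible a i0)); last first.
  move=> s hs; apply/idP/andP => [c|[/eqP -> //]].
  by have e' := U s hs c; rewrite -e' eqxx c.
case: (compatible a i0); last by rewrite (@eq_count _ _ pred0) ?count_pred0 // => i; rewrite andbF.
rewrite (@eq_count _ _ (pred1 i0)) => [|s]; last by rewrite andbT.
by rewrite count_uniq_mem ?permutations_uniq // i0P.
Qed.

Lemma stanley_Gc e z : invol one -> invol z -> stanley one z (mon e) = (Gc one e z)%:R%R.
Proof.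
move=> ione iz; rewrite /stanley; congr (_%:R)%R.
under eq_bigr do rewrite count_compatible.
rewrite size_mon big_mkcond /= -sum_Vt.
rewrite (reindex_inj (h := @rev_tuple (sumn e) 'I_n.-1)) /=; last first.
  by move=> s t /(congr1 val) /= /(can_inj revK) h; apply/val_inj.
apply: eq_bigr => t _; rewrite VtE // hat_wordE //= revK size_tuple eqxx /=.
by rewrite compatible_rev ?size_tuple ?size_mons //; case: (chn _ _ _).
Qed.
End Count.

End Counting.

(** * Cycles, fixed points and the elements 1 of the two cases *)

Local Open Scope ring_scope.

Lemma involution_invol n (y : 'S_n) : involution y -> invol y.
Proof. by move=> /eqP; rewrite expgS expg1. Qed.

Definition up n (z : 'S_n) : {set 'I_n} := [set x : 'I_n | (x < z x)%N].

Lemma card_moved n (z : 'S_n) : invol z -> #|moved z| = (2 * #|up z|)%N.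
Proof.
move=> iz; have mI x : (x \in z @: up z) = (z x \in up z).
  by rewrite -{1}[x](involK iz) mem_imset //; exact: perm_inj.
have E : moved z = up z :|: z @: up z.
  by apply/setP => x; rewrite !inE mI !inE involK // -val_eqE neq_ltn orbC.
rewrite E cardsU (_ : _ :&: _ = set0) ?cards0 ?card_imset; [lia | exact: perm_inj |].
by apply/setP => x; rewrite !inE mI !inE involK //; case: ltngtP.
Qed.

Lemma porbit_invol n (y : 'S_n) x : invol y -> porbit y x = [set x; y x].
Proof.
move=> iy; apply/setP => u; rewrite !inE; apply/porbitP/orP => [[k ->]|[/eqP ->|/eqP ->]].
- elim: k => [|k IH]; first by rewrite expg0 perm1 eqxx; left.
  rewrite expgSr permM; case: IH => /eqP ->; first by right.
  by left; rewrite involK.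
- by exists 0%N; rewrite expg0 perm1.
by exists 1%N; rewrite expg1.
Qed.

Lemma cyc_up n (y : 'S_n) : invol y -> cyc y = #|up y|.
Proof.
move=> iy; rewrite /cyc; have inj : {in up y &, injective (porbit y)}.
  move=> u v; rewrite !inE => hu hv e.
  have : u \in porbit y v by rewrite -e porbit_id.
  rewrite porbit_invol // !inE => /orP[/eqP //|/eqP euv].
  by move: hu; rewrite euv involK // ltnNge ltnW.
rewrite -(card_in_imset inj); apply: eq_card => c; rewrite inE.
apply/andP/imsetP => [[/imsetP[x _ ->]]|[x]].
  rewrite porbit_invol // cards2 => hc; have ne : y x != x by move: hc; rewrite eqSS eqb1 eq_sym.
  have [lt|ge] := boolP (x < y x)%N; first by exists x; rewrite ?inE ?porbit_invol.
  exists (y x); last by rewrite porbit_invol // involK // setUC.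
  by rewrite inE involK // ltn_neqAle leqNgt ge andbT val_eqE.
rewrite inE => lt ->; split; first exact: imset_f.
by rewrite porbit_invol // cards2 eqSS eqb1 -val_eqE neq_ltn lt.
Qed.

Lemma narc_ext n (y : 'S_n) : invol y -> narc (ext false y) = cyc y.
Proof.
move=> iy; rewrite cyc_up // (@narcE _ [seq Z.of_nat (val u) | u <- enum (moved y)]).
  by rewrite size_map -cardE card_moved //; lia.
split; first by rewrite map_inj_uniq ?enum_uniq // => u v /Nat2Z.inj/val_inj.
move=> x; have [[u ->]|h] := ord_cases n x.
  rewrite ext_ord; apply/mapP/idP => [[v]|ne].
    rewrite mem_enum inE => hv /Nat2Z.inj/val_inj ->.
    by apply: contraNneq hv => /Nat2Z.inj/val_inj ->.
  by exists u => //; rewrite mem_enum inE; apply: contraNneq ne => ->.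
rewrite ext_out // eqxx; apply/negbTE/negP => /mapP[u _ e].
by have hu := ltn_ord u; rewrite e /= in h; lia.
Qed.

Lemma fpf_even n (z : 'S_n) : fpf_involution z -> ~~ odd n.
Proof.
move=> /andP[/involution_invol iz /forallP f]; have := card_moved iz.
have -> : moved z = [set: 'I_n] by apply/setP => x; rewrite !inE f.
by rewrite cardsT card_ord; lia.
Qed.

Lemma ext_one_O n : ext false (one_O n) = base false.
Proof.
apply: functional_extensionality => x; have [[u ->]|h] := ord_cases n x; last exact: ext_out.
by rewrite ext_ord perm1.
Qed.

(** Distinct even letters give disjoint transpositions, each of them an arc of [Theta], so a point
    is moved by at most one factor. *)
Lemma prod_flip n (l : seq 'I_n.-1) (x : 'I_n) : uniq l -> all (fun i : 'I_n.-1 => ~~ odd i) l ->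
  Z.of_nat ((\prod_(i <- l) simple_refl i)%g x) =
  if has (fun i : 'I_n.-1 => (x == i :> nat) || (x == i.+1 :> nat)) l then Theta (Z.of_nat x) else Z.of_nat x.
Proof.
elim: l x => [|i l IH] x /=; first by rewrite big_nil perm1.
move=> /andP[il ul] /andP[ei el]; rewrite big_cons permM IH //.
have evi : Z.even (Z.of_nat i) = true by apply/Z.even_spec; exists (Z.of_nat (i./2)); lia.
have [/orP hx|hx] := boolP ((x == i :> nat) || (x == i.+1 :> nat)); last first.
  have -> // : simple_refl i x = x.
  by rewrite /simple_refl tpermD // -val_eqE /= eq_sym; case/norP: hx.
have ey : (simple_refl i x = i :> nat) \/ (simple_refl i x = i.+1 :> nat).
  case: hx => /eqP hx; [right|left].
    by have e : x = ord_lo i by [apply/val_inj]; rewrite e sr_lo.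
  by have e : x = ord_hi i by [apply/val_inj]; rewrite e sr_hi.
have -> : has (fun j : 'I_n.-1 => (simple_refl i x == j :> nat) || (simple_refl i x == j.+1 :> nat)) l = false.
  apply/negbTE/hasPn => j jl; have oj := allP el j jl.
  have nj : (j != i :> nat) by apply: contraNneq il => /val_inj <-.
  by case: ey => ->; lia.
case: hx => /eqP hx.
  have ex : x = ord_lo i by apply/val_inj.
  by rewrite ex sr_lo /Theta /= evi; lia.
have ex : x = ord_hi i by apply/val_inj.
have e1 : Z.of_nat (ord_hi i) = (Z.of_nat i + 1)%Z by rewrite /=; lia.
by rewrite ex sr_hi e1 /Theta Z.even_add evi /=; lia.
Qed.

Lemma ext_one_Sp n : ~~ odd n -> ext true (one_Sp n) = base true.
Proof.
move=> en; apply: functional_extensionality => x; have [[u ->]|h] := ord_cases n x; last exact: ext_out.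
rewrite ext_ord /one_Sp -big_filter prod_flip ?filter_uniq ?index_enum_uniq ?filter_all //.
have hu := ltn_ord u; have hv : (u./2.*2 < n.-1)%N by lia.
rewrite ifT //; apply/hasP; exists (Ordinal hv); last by rewrite /=; lia.
by rewrite mem_filter mem_index_enum /= andbT odd_double.
Qed.

Lemma invol_ext (sp : bool) n (w : 'S_n) : inv (ext sp w) -> invol w.
Proof.
move=> h; apply/permP => u; rewrite permM perm1.
by have := h (Z.of_nat u); rewrite !ext_ord => /Nat2Z.inj e; exact: val_inj e.
Qed.

Lemma fin_ext (sp : bool) n (z : 'S_n) : (sp -> ~~ odd n) -> invol z -> fin sp (ext sp z).
Proof. by move=> ev iz; exists n.+1; exact: ext_supp. Qed.

Lemma prefix_ext (sp : bool) n (z : 'S_n) : prefix sp (ext sp z).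
Proof.
rewrite /prefix; case: sp => [e u h1 h2 h3|e he]; last first.
  by have -> : ext false z e = e by [rewrite ext_out //; left]; lia.
exfalso; have he : (e < 0)%Zs by lia.
by have := @ext_out true n z e (or_introl he); rewrite /base; have := Theta_cases e; lia.
Qed.

Lemma rel_schurQ_sum ls : all strict_partition ls ->
  rel (\sum_(l <- ls) 1%:R *: schurQ l) (fun m => \sum_(l <- ls) QQ m l).
Proof.
elim: ls => [_|l ls IH /= /andP[sl sls]].
  by rewrite big_nil; apply: rel_ext rel0 => m; rewrite big_nil.
rewrite big_cons scale1r; apply: rel_ext (rel_add (rel_schurQ sl) (IH sls)) => m.
by rewrite big_cons.
Qed.

Lemma rel_schurP_sum ls : all strict_partition ls ->
  rel (\sum_(l <- ls) 1%:R *: schurP l) (fun m => \sum_(l <- ls) fam true l m).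
Proof.
elim: ls => [_|l ls IH /= /andP[sl sls]].
  by rewrite big_nil; apply: rel_ext rel0 => m; rewrite big_nil.
rewrite big_cons scale1r; apply: (@rel_ext _ (fun m => fam true l m + \sum_(l <- ls) fam true l m)).
  by move=> m; rewrite big_cons.
apply: rel_add (IH sls) => m e se.
rewrite -[schurP l (mon e)]/(2%:R ^- size l * schurQ l (mon e)) (rel_schurQ sl se) (fam_QQ true m sl) cfnMn.
rewrite -[cfn _ e *+ _]mulr_natr natrX mulrC mulfK // expf_neq0 //.
Qed.

Theorem corollary5p13 (n : nat) :
  (forall y : 'S_n, involution y ->
     schurQ_positive ((2%:R : rat) ^+ cyc y *: stanley_O y)) /\
  (forall z : 'S_n, fpf_involution z -> schurP_positive (stanley_Sp z)).
Proof.
split=> [y /involution_invol iy|z fz].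
  have ev : false -> ~~ odd n by [].
  have [ls [sls _ els]] := tree (fin_ext ev iy) (fun h => False_ind _ (notF h)) (prefix_ext false y).
  exists ls, (fun=> 1%N); split=> //; apply: (rel_eq _ (rel_schurQ_sum sls)) => m e se.
  have -> : \sum_(l <- ls) QQ m l = Fn false m (ext false y) *+ 2 ^ cyc y.
    (* The factor [2 ^ cyc y] is the arc weight of the recursion, and [fam] times [2 ^ size l] is
       Q_l by [fam_QQ]. *)
    rewrite -narc_ext // (els m) big_seq [RHS]big_seq; apply: eq_bigr => l hl.
    exact: (fam_QQ false m (allP sls l hl)).
  rewrite -[LHS]/(2%:R ^+ cyc y * stanley (one_O n) y (mon e)) cfnMn.
  have io : invol (one_O n) by rewrite /invol mulg1.
  by rewrite stanley_Gc // (Fn_Gc ev (ext_one_O n) se iy) -natrX mulr_natl.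
have ev : true -> ~~ odd n by move=> _; exact: fpf_even fz.
have /andP[/involution_invol iz /forallP fp] := fz.
have fpe : true -> forall x, ext true z x <> x.
  move=> _ x; have [[u ->]|h] := ord_cases n x.
    by rewrite ext_ord => /Nat2Z.inj/val_inj/eqP; apply/negP.
  by rewrite ext_out // /base; have := Theta_cases x; lia.
have [ls [sls _ els]] := tree (fin_ext ev iz) fpe (prefix_ext true z).
exists ls, (fun=> 1%N); split=> //; apply: (rel_eq _ (rel_schurP_sum sls)) => m e se.
have -> : \sum_(l <- ls) fam true l m = Fn true m (ext true z).
  have h : Fn true m (ext true z) *+ 1 = \sum_(l <- ls) fam true l m *+ 1 := els m.
  by rewrite mulr1n in h; rewrite h; apply: eq_bigr => l _; rewrite mulr1n.
have e1 := ext_one_Sp (ev isT).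
have io : invol (one_Sp n) by apply: (@invol_ext true); rewrite e1; exact: baseK.
by rewrite /stanley_Sp stanley_Gc // (Fn_Gc ev e1 se iz).
Qed.
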